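(* Assume the Setting, Condition (SO) and Condition (MIX) described in the context, and fix $q<1$. Then there exist $\varepsilon>0$ and constants $c_1,c_2>0$ such that, with probability tending to one as $n\to\infty$, $$L_n(\boldsymbol\theta)-L_n(\boldsymbol\theta_0)\le(\boldsymbol\theta-\boldsymbol\theta_0)^\top\mathbf{S}_n(\boldsymbol\theta_0)-c_1\|\boldsymbol\theta-\boldsymbol\theta_0\|^2\quad\text{for all }\boldsymbol\theta\in\mathbb{B}_\varepsilon(\boldsymbol\theta_0),$$ and $$L_n(\boldsymbol\theta)-L_n(\boldsymbol\theta_0)\le-c_2\quad\text{for all }\boldsymbol\theta\in\Theta_n\setminus\mathbb{B}_\varepsilon(\boldsymbol\theta_0).$$
   Context: Setting: $(X_t)_{t\ge1}$ is a strictly stationary real time series with continuous stationary distribution function $F$; $Q(\tau)=\inf\{x:F(x)\ge\tau\}$ and $b(t)=Q(e^{-1/t})$, $t>1$. For $\gamma\in\mathbb{R}$, $G_\gamma(z)=\exp(-(1+\gamma z)_+^{-1/\gamma})$ ($\exp(-e^{-z})$ if $\gamma=0$), with density $g_\gamma$. $\mathcal{H}_{\gamma,\rho}(x)=\int_1^x v^{\gamma-1}\int_1^v u^{\rho-1}du\,dv$. $F$ is in the max-domain of attraction of $G_{\gamma_0}$ with $\gamma_0>-1/2$, and the series has extremal index $\theta_0\in(0,1]$: for every $x>0$ and every $u_m$ with $m(1-F(u_m))\to x$, $\mathbb{P}(\max(X_1,\dots,X_m)\le u_m)\to e^{-\theta_0x}$. Sequences $m=m_n$, $l=l_n$ satisfy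 $m\to\infty$, $l\to\infty$, $l=o(m)$, $m=o(n)$, and $k=\lfloor n/(m+l)\rfloor\to\infty$. Block maxima: $M_{i,m}=\max(X_{1+(i-1)(m+l)},\dots,X_{m+(i-1)(m+l)})$, $i=1,\dots,k$. Condition (SO): there exist a positive function $a(\cdot)$, a function $A(\cdot)$ of eventually constant sign with $A(s)\to0$, and $\rho_0\le0$ such that for all $x>0$, $\lim_{s\to\infty}A(s)^{-1}\big((b(sx)-b(s))/a(s)-\int_1^xu^{\gamma_0-1}du\big)=\mathcal{H}_{\gamma_0,\rho_0}(x)$; and $\sqrt{k}A(m)\to\lambda_0\in\mathbb{R}$. Set $a_{m,0}=a(\theta_0m)$, $b_{m,0}=b(\theta_0m)$. Condition (MIX): (i) for $\varepsilon\in(0,1]$ let $\mathcal{F}^\varepsilon_{i,j}$ be the $\sigma$-field generated by $F(X_t)\mathbf{1}(F(X_t)>1-\varepsilon)$, $i\le t\le j$, $\alpha_r^\varepsilon(l)=\sup\{|\mathbb{P}(A\cap B)-\mathbb{P}(A)\mathbb{P}(B)|:A\in\mathcal{F}^\varepsilon_{1,r},B\in\mathcal{F}^\varepsilon_{r+l,\infty}\}$, $\alpha_\varepsilon(l)=\sup_r\alpha_r^\varepsilon(l)$; then $\alpha_\varepsilon(l)\to0$; (ii) $k^2(\log k)^4\sum_{r=1}^k r\,\alpha_\varepsilon((r-1)(m+l)+l)\to0$; (iii) with $\widetilde X_i$ i.i.d. with distribution $F$, $\beta_n=\sup_{s\in[0,1]}|\mathbb{P}(\max_{1\le i\le m}F^{m\theta_0}(X_i)\le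 s)-\mathbb{P}(\max_{1\le i\le\lfloor\theta_0m\rfloor}F^{\lfloor\theta_0m\rfloor}(\widetilde X_i)\le s)|$ satisfies $k\beta_n\to0$. Likelihood: for $\boldsymbol\theta=(\gamma,\mu,\sigma)$ with $\sigma>0$, $\ell_{\boldsymbol\theta}(x)=\log\big(g_\gamma((x-\mu)/\sigma)/\sigma\big)$ if $1+\gamma(x-\mu)/\sigma>0$ and $-\infty$ otherwise. Let $\boldsymbol\theta_0=(\gamma_0,0,1)$, $\widetilde M_{i,m}=(M_{i,m}-b_{m,0})/a_{m,0}$, $L_n(\boldsymbol\theta)=k^{-1}\sum_{i=1}^k\ell_{\boldsymbol\theta}(\widetilde M_{i,m})$, $\mathbf{S}_n=\partial L_n/\partial\boldsymbol\theta$. $\Theta_n=\{(\gamma,\mu,\sigma):-1/2<\gamma<k^q,\mu\in\mathbb{R},\sigma>0\}$, and $\mathbb{B}_\varepsilon(\boldsymbol\theta_0)$ is the open Euclidean ball of radius $\varepsilon$ around $\boldsymbol\theta_0$ within $(-1/2,\infty)\times\mathbb{R}\times(0,\infty)$. *)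

(* Defs.v *)
From mathcomp Require Import all_boot all_order all_algebra.
From mathcomp Require Import all_classical all_reals all_analysis.
Set Implicit Arguments. Unset Strict Implicit. Unset Printing Implicit Defensive.
Import Order.TTheory GRing.Theory Num.Theory.
Import numFieldNormedType.Exports.
Local Open Scope classical_set_scope.
Local Open Scope ring_scope.

Section Defs.
Context {R : realType} {d : measure_display} {T : measurableType d}.
Implicit Types (P : probability T R) (X : nat -> T -> R).

(* Time indices are 1-based as in the paper: X_t = X t for t >= 1;
   X 0 is never used. *)

(* strict stationarity of (X_t)_{t>=1}: all finite-dimensional laws are
   shift invariant (tested on measurable rectangles, which generate the
   product sigma-field) *)
Definition strictly_stationary P X : Prop :=
  forall (h s : nat) (A : nat -> set R), (forall i, measurable (A i)) ->
    P [set w | forall i, (i < h)%N -> A i (X (1 + s + i)%N w)] =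
    P [set w | forall i, (i < h)%N -> A i (X (1 + i)%N w)].

Definition cdf1 P X (x : R) : R := fine (P [set w | X 1%N w <= x]).

Definition quantile (F : R -> R) (tau : R) : R := inf [set x | tau <= F x].

Definition bfun (F : R -> R) (t : R) : R := quantile F (expR (- t^-1)).

Definition GEV (g z : R) : R :=
  if g == 0 then expR (- expR (- z))
  else if 0 < 1 + g * z then expR (- powR (1 + g * z) (- g^-1))
  else if 0 < g then 0 else 1.

Definition gev_density (g z : R) : R :=
  if g == 0 then expR (- expR (- z)) * expR (- z)
  else if 0 < 1 + g * z then GEV g z * powR (1 + g * z) (- g^-1 - 1)
  else 0.

Definition in_MDA (F : R -> R) (g : R) : Prop :=
  exists an bn : nat -> R, (forall n, 0 < an n) /\
    forall x : R, (F (an n * x + bn n) ^+ n) @[n --> \oo] --> GEV g x.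

Definition has_extremal_index P X (F : R -> R) (th : R) : Prop :=
  forall x : R, 0 < x -> forall u : nat -> R,
    ((n%:R * (1 - F (u n))) @[n --> \oo] --> x) ->
    (fine (P [set w | forall i, (1 <= i <= n)%N -> X i w <= u n]))
      @[n --> \oo] --> expR (- (th * x)).

Definition oint (f : R -> R) (x : R) : R :=
  if 1 <= x then Rintegral (@lebesgue_measure R) `[1, x] f
  else - Rintegral (@lebesgue_measure R) `[x, 1] f.

Definition Hfun (g rho x : R) : R :=
  oint (fun v => powR v (g - 1) * oint (fun u => powR u (rho - 1)) v) x.

Definition kn (m l : nat -> nat) (n : nat) : nat := (n %/ (m n + l n))%N.

Definition cond_SO (b : R -> R) (g0 : R) (m k : nat -> nat)
    (a A : R -> R) (rho lam : R) : Prop :=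
  [/\ (forall s, 0 < a s),
      ((\forall s \near +oo, 0 < A s) \/ (\forall s \near +oo, A s < 0)),
      (A s @[s --> +oo] --> 0) /\ rho <= 0,
      (forall x : R, 0 < x ->
        ((A s)^-1 * ((b (s * x) - b s) / a s - oint (fun u => powR u (g0 - 1)) x))
          @[s --> +oo] --> Hfun g0 rho x)
    & (Num.sqrt (k n)%:R * A (m n)%:R) @[n --> \oo] --> lam].

Definition Yeps (F : R -> R) X (eps : R) (t : nat) (w : T) : R :=
  F (X t w) * (if 1 - eps < F (X t w) then 1 else 0).

Definition sig_of (Y : nat -> T -> R) (I : set nat) : set (set T) :=
  <<s [set A | exists t, I t /\ exists B, measurable B /\ A = Y t @^-1` B] >>.

Definition alpha_r P (Y : nat -> T -> R) (r l : nat) : R :=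
  sup [set z | exists A B,
         [/\ sig_of Y [set t | (1 <= t <= r)%N] A,
             sig_of Y [set t | (r + l <= t)%N] B &
             z = `| fine (P (A `&` B)) - fine (P A) * fine (P B) |]].

Definition alpha P (Y : nat -> T -> R) (l : nat) : R :=
  sup [set alpha_r P Y r l | r in [set r : nat | (1 <= r)%N]].

(* beta_n; the second probability, for X~_1,...,X~_N i.i.d. with law F
   (N = floor(theta0 m)), equals P(F^N(X_1) <= s)^N *)
Definition beta P X (F : R -> R) (th : R) (m : nat) : R :=
  let N := Num.truncn (th * m%:R) in
  sup [set `| fine (P [set w | forall i, (1 <= i <= m)%N ->
                                 powR (F (X i w)) (m%:R * th) <= s])
             - (fine (P [set w | F (X 1%N w) ^+ N <= s])) ^+ N |
       | s in `[0, 1]].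

Definition cond_MIX P X (F : R -> R) (th : R) (m l k : nat -> nat) : Prop :=
  exists eps : R, [/\ 0 < eps <= 1,
    alpha P (Yeps F X eps) (l n) @[n --> \oo] --> 0,
    ((k n)%:R ^+ 2 * (ln (k n)%:R) ^+ 4 *
       \sum_(1 <= r < (k n).+1)
          r%:R * alpha P (Yeps F X eps) ((r - 1) * (m n + l n) + l n)%N)
       @[n --> \oo] --> 0
  & ((k n)%:R * beta P X F th (m n)) @[n --> \oo] --> 0].

(* block maximum M_{i+1,m} (blocks numbered from 0 here) *)
Definition blockmax X (m l i : nat) (w : T) : R :=
  \big[Num.max/X (1 + i * (m + l))%N w]_(j < m) X (1 + j + i * (m + l))%N w.

Definition loglik (g mu sg x : R) : \bar R :=
  if 0 < 1 + g * ((x - mu) / sg)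
  then (ln (gev_density g ((x - mu) / sg) / sg))%:E else -oo%E.

Definition loglik_r (g mu sg x : R) : R :=
  ln (gev_density g ((x - mu) / sg) / sg).

Definition Ln X (m l k : nat) (am bm : R) (g mu sg : R) (w : T) : \bar R :=
  ((k%:R)^-1)%:E *
    (\sum_(i < k) loglik g mu sg ((blockmax X m l i w - bm) / am))%E.

Definition Ln_r X (m l k : nat) (am bm : R) (g mu sg : R) (w : T) : R :=
  (k%:R)^-1 * \sum_(i < k) loglik_r g mu sg ((blockmax X m l i w - bm) / am).

(* (theta - theta0)^T S_n(theta0), S_n = gradient of L_n at theta0 = (g0,0,1) *)
Definition score_lin X (m l k : nat) (am bm g0 : R) (g mu sg : R) (w : T) : R :=
  (g - g0) * derive1 (fun x => Ln_r X m l k am bm x 0 1 w) g0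
  + mu * derive1 (fun x => Ln_r X m l k am bm g0 x 1 w) 0
  + (sg - 1) * derive1 (fun x => Ln_r X m l k am bm g0 0 x w) 1.

Definition dist2 (g0 g mu sg : R) : R := (g - g0) ^+ 2 + mu ^+ 2 + (sg - 1) ^+ 2.

Definition in_ball (eps g0 g mu sg : R) : Prop :=
  [/\ -2^-1 < g, 0 < sg & Num.sqrt (dist2 g0 g mu sg) < eps].

Definition in_Theta (k : nat) (q g mu sg : R) : Prop :=
  -2^-1 < g /\ g < powR k%:R q /\ 0 < sg.

End Defs.

(* Main.v *)
From HB Require Import structures.
Require Import Defs.
From mathcomp Require Import all_boot all_order all_algebra.
From mathcomp Require Import all_classical all_reals all_analysis.
From mathcomp Require Import measurable_realfun.
From mathcomp Require Import ring lra zify.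
Set Implicit Arguments. Unset Strict Implicit. Unset Printing Implicit Defensive.
Import Order.TTheory GRing.Theory Num.Theory.
Import numFieldNormedType.Exports.
Local Open Scope classical_set_scope.
Local Open Scope ring_scope.

(* Put [v = ln (1 + g0 z) / g0], so that the limit law of the normalised block
   maxima [z] becomes the standard Gumbel law.  Once the empirical distribution
   function of the [v] is close to the Gumbel one and their weighted tails are
   small, both inequalities are deterministic.

   Near the true parameter, let [U] be the increasing map taking [v] to its value
   under the other parameter, [delta = U - v] and [m = ln U'].  The second-order
   remainder of the log-likelihood is an exact derivative, whose Gumbel integral
   vanishes up to the boundary, minus
   [exp (-v) (exp (-delta) - 1 + delta) + (exp m - 1 - m)], and these two
   nonnegative terms cannot both be small around two distinct points unless the
   parameters agree.  On bounded parameter sets away from the truth the loss is a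
   squared Hellinger distance; extreme scales lose by the decay of the likelihood;
   for shapes up to [k ^ q] only the points close to the sample minimum can gain,
   and there are too few of them.

   The second-order condition is iterated along a geometric grid of ratio
   [exp L], from [1 / ln k] to [k ^ (1 + dl)]; the accumulated error is of order
   [k ^ (-1/2)] up to small powers, which [g0 > -1/2] makes negligible.  The grid
   starts at infinity because [ln k = o(m)]: otherwise [A] would decay
   exponentially along a subsequence, and propagating this backwards would make a
   ratio of increments of the monotone function [b] vanish at one of its continuity
   points.  The mixing condition enters through Chebyshev's inequality for
   the numbers of block maxima below a level and through Markov's inequality in
   the tails. *)

(** * Derivatives and the deformed exponential *)

(** An additive error, as in a plain uniform law of large numbers, is useless for the first
    inequality: near the truth the loss is only of the order of the squared distance [D ^+ 2]. Every
    error there must carry that factor. So the remainder is bounded together with its Lipschitz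
    constant by multiples of [D ^+ 2], and [lln] is uniform over Lipschitz functions, with an error
    proportional to the constant. No Fisher information is computed: [ident_local] replaces its
    positive definiteness.

    Integrals against the Gumbel density never appear: an explicit antiderivative is supplied each
    time, and sample averages are compared with its increments. All the probability is condensed
    into three properties of a filter on finite samples, [gumbel_ecdf], [small_tails] and
    [near_min].

    The threshold -1/2 for the shape has two further uses: it makes [Wt g0] grow more slowly than
    [expR v], hence integrable, and it keeps the slope of the likelihood ratio bounded where [U] is
    large, through [1 + 2 * g >= 0]. *)

Section Derivatives.
Context {R : realType}.
Implicit Types (f g : R -> R) (x a b : R).

Definition has_der (x : R) (f : R -> R) (a : R) : Prop := is_derive x 1 f a.

Lemma der_eq x f a b : has_der x f a -> a = b -> has_der x f b.
Proof. by move=> ? <-. Qed.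

Lemma der_cst c x : has_der x (fun _ : R => c : R) 0.
Proof. exact: is_derive_cst. Qed.

Lemma der_id x : has_der x (fun v : R => v) 1.
Proof. exact: is_derive_id. Qed.

Lemma der_add f g a b x : has_der x f a -> has_der x g b ->
  has_der x (fun v => f v + g v) (a + b).
Proof. by move=> fa gb; exact: is_deriveD. Qed.

Lemma der_opp f a x : has_der x f a -> has_der x (fun v => - f v) (- a).
Proof. by move=> fa; exact: is_deriveN. Qed.

Lemma der_mul f g a b x : has_der x f a -> has_der x g b ->
  has_der x (fun v => f v * g v) (f x * b + a * g x).
Proof.
move=> fa gb; have := is_deriveM fa gb.
by rewrite /GRing.scale /= [g x * a]mulrC.
Qed.

Lemma der_comp h f a b x : has_der (f x) h a -> has_der x f b ->
  has_der x (fun v => h (f v)) (a * b).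
Proof. by move=> ha fb; exact: (@is_derive1_comp _ h f x a b ha fb). Qed.

Lemma der_exp f a x : has_der x f a ->
  has_der x (fun v => expR (f v)) (expR (f x) * a).
Proof. by move=> fa; apply: (der_comp (h := expR)) => //; exact: is_derive_expR. Qed.

Lemma der_ln f a x : 0 < f x -> has_der x f a ->
  has_der x (fun v => ln (f v)) ((f x)^-1 * a).
Proof. by move=> fx fa; apply: (der_comp (h := @ln R)) => //; exact: is_derive1_ln. Qed.

Lemma der_continuous f a x : has_der x f a -> {for x, continuous f}.
Proof. by rewrite /has_der => -[df _]; apply/differentiable_continuous/derivable1_diffP. Qed.

Lemma mvt (f df : R -> R) a b : a <= b ->
  (forall x, a <= x <= b -> has_der x f (df x)) ->
  exists2 c, a <= c <= b & f b - f a = df c * (b - a).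
Proof.
move=> ab dF; have [c|c|c cab e] := @MVT_segment R f df a b ab.
- rewrite in_itv /= => /andP[ac cb]; apply: dF.
  by rewrite !ltW.
- apply: continuous_in_subspaceT => z; rewrite inE /= in_itv /= => zab.
  exact: (der_continuous (dF z zab)).
by exists c => //; move: cab; rewrite in_itv.
Qed.

Lemma mvt_bound (f df : R -> R) a b K : 
  (forall x, Num.min a b <= x <= Num.max a b -> has_der x f (df x)) ->
  (forall x, Num.min a b <= x <= Num.max a b -> `|df x| <= K) ->
  `|f b - f a| <= K * `|b - a|.
Proof.
wlog ab : a b / a <= b => [hw|].
  move=> d k; case: (leP a b) => [/hw/(_ d k)//|/ltW/hw].
  by rewrite minC maxC (distrC (f a)) (distrC a) => /(_ d k).
rewrite min_l// max_r// => d k; have [c cab ->] := mvt ab d.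
by rewrite normrM ler_pM// k.
Qed.

End Derivatives.

Ltac der_step := first
  [ eassumption
  | match goal with
    | |- has_der _ (fun v => v) _ => exact: der_id
    | |- has_der _ (fun _ => ?c) _ => exact: der_cst
    | |- has_der ?x (GRing.mul ?c) ?a => change (has_der x (fun v => c * v) a)
    | |- has_der ?x (GRing.add ?c) ?a => change (has_der x (fun v => c + v) a)
    | |- has_der ?x (@GRing.opp ?V) ?a =>
        change (has_der x (fun v => @GRing.opp V v) a)
    | |- has_der ?x (@expR ?S) ?a => change (has_der x (fun v => @expR S v) a)
    | |- has_der _ (fun _ => _ + _) _ => eapply der_add
    | |- has_der _ (fun _ => - _) _ => eapply der_opp
    | |- has_der _ (fun _ => expR _) _ => eapply der_exp
    | |- has_der _ (fun _ => _ * _) _ => eapply der_mul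
    end ].
Ltac der := eapply der_eq; [repeat der_step | rewrite /=].

(** * Elementary inequalities and the map from the Gumbel scale to the observations *)

Section Elementary.
Context {R : realType}.
Implicit Types (g x y u v : R).

(** [expR x] is the square of [expR (x / 2)], which is at least [1 + x / 2]; squaring needs that
    bound to be nonnegative, hence [-2 <= x]. *)
Lemma expR_ge_sqr x : -2 <= x -> 1 + x + x ^+ 2 / 4 <= expR x.
Proof.
move=> hx; have -> : expR x = expR (x / 2) ^+ 2.
  by rewrite expr2 -expRD; congr expR; lra.
have h := expR_ge1Dx (x / 2).
have : (1 + x / 2) ^+ 2 <= expR (x / 2) ^+ 2 by rewrite lerXn2r ?nnegrE//; lra.
by apply: le_trans; nra.
Qed.

Lemma expR_le_sqr x : `|x| <= 2^-1 -> expR x <= 1 + x + 2 * x ^+ 2.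
Proof.
rewrite ler_norml => /andP[xl xu].
have := expR_ge1Dx (- x); rewrite expRN => h.
have e0 := expR_gt0 x.
have : (1 - x) * expR x <= (expR x)^-1 * expR x by rewrite ler_pM2r.
rewrite mulVf ?gt_eqF//.
nra.
Qed.

Lemma expR_sub1_bound x : `|x| <= 2^-1 -> `|expR x - 1| <= 2 * `|x|.
Proof.
move=> hx; have h1 := expR_ge1Dx x; have h2 := expR_le_sqr hx.
move: hx; rewrite !ler_norml => /andP[xl xu].
have [x0|x0] := leP 0 x.
  by rewrite ger0_norm//; apply/andP; split; nra.
by rewrite ltr0_norm//; apply/andP; split; nra.
Qed.

Lemma expR_taylor1 x : `|x| <= 2^-1 -> `|expR x - 1 - x| <= 2 * x ^+ 2.
Proof.
move=> hx; have h1 := expR_ge1Dx x; have h2 := expR_le_sqr hx.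
by rewrite ger0_norm; lra.
Qed.

Lemma ln_le_sub1 x : 0 < x -> ln x <= x - 1.
Proof.
move=> x0; have := @le_ln1Dx R (x - 1).
by have -> : 1 + (x - 1) = x by [ring]; apply; lra.
Qed.

Lemma ln_ge x : 0 < x -> 1 - x^-1 <= ln x.
Proof.
move=> x0; have := @ln_le_sub1 x^-1; rewrite invr_gt0 => /(_ x0).
by rewrite lnV ?posrE//; lra.
Qed.

Lemma ln1D_bound y : `|y| <= 2^-1 -> `|ln (1 + y) - y| <= 2 * y ^+ 2.
Proof.
rewrite ler_norml => /andP[yl yu].
have p : 0 < 1 + y by lra.
have h1 := ln_le_sub1 p; have h2 := ln_ge p.
have h3 : (1 + y)^-1 * (1 + y) = 1 by rewrite mulVf// gt_eqF.
have : 0 < (1 + y)^-1 by rewrite invr_gt0.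
set i := (1 + y)^-1 in h2 h3 * => i0.
have i2 : i <= 2 by nra.
rewrite ler_norml; apply/andP; split; last by nra.
have -> : ln (1 + y) - y = (ln (1 + y) - (1 - i)) + (1 - i - y) by ring.
have h4 : y * (i * (1 + y)) = y by rewrite h3 mulr1.
have : y ^+ 2 * i <= 2 * y ^+ 2 by rewrite mulrC ler_wpM2r// sqr_ge0.
lra.
Qed.

(* weighted AM-GM with weights l and 1 - l on the pair (a, 1) *)
Lemma ln_concave_at1 (l a : R) : 0 <= l <= 1 -> 0 < a ->
  l * ln a <= ln (1 + l * (a - 1)).
Proof.
move=> /andP[l0 l1] a0.
have b0 : 0 < 1 + l * (a - 1) by nra.
set b := 1 + _ in b0 *.
have h1 : ln (a / b) <= a / b - 1 by apply: ln_le_sub1; rewrite divr_gt0.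
have h2 : ln (b^-1) <= b^-1 - 1 by apply: ln_le_sub1; rewrite invr_gt0.
rewrite ln_div ?posrE// in h1; rewrite lnV ?posrE// in h2.
have e : l * (a / b - 1) + (1 - l) * (b^-1 - 1) = 0.
  have -> : l * (a / b - 1) + (1 - l) * (b^-1 - 1) = (1 + l * (a - 1)) / b - 1.
    by ring.
  by rewrite divff ?subrr// gt_eqF.
nra.
Qed.

(** [Dg g v] is the integral of [u ^ (g - 1)] from 1 to [e ^ v], and [ug g] is its inverse on
    [1 + g * y > 0]. As [GEV g (Dg g v)] is the Gumbel distribution function at [v], they pass from
    the Gumbel scale to the extreme value law of shape [g] and back; [g = 0] is the continuous
    limit. *)
Definition Dg g v := if g == 0 then v else (expR (g * v) - 1) / g.
Definition ug g y := if g == 0 then y else ln (1 + g * y) / g.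

Lemma Dg_exp g v : 1 + g * Dg g v = expR (g * v).
Proof.
rewrite /Dg; case: eqP => [->|/eqP g0]; first by rewrite !mul0r addr0 expR0.
by field.
Qed.

Lemma Dg_supp g v : 0 < 1 + g * Dg g v.
Proof. by rewrite Dg_exp expR_gt0. Qed.

Lemma Dg0r g : Dg g 0 = 0.
Proof. by rewrite /Dg; case: eqP => // _; rewrite mulr0 expR0 subrr mul0r. Qed.

Lemma DgK g v : ug g (Dg g v) = v.
Proof.
rewrite /ug Dg_exp expRK /Dg; case: eqP => // /eqP g0.
by field.
Qed.

Lemma ug_exp g y : 0 < 1 + g * y -> expR (g * ug g y) = 1 + g * y.
Proof.
rewrite /ug => h; case: eqP => [->|/eqP g0]; first by rewrite !mul0r addr0 expR0.
by rewrite mulrCA mulfV// mulr1 lnK.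
Qed.

Lemma ugK g y : 0 < 1 + g * y -> Dg g (ug g y) = y.
Proof.
move=> h; rewrite /Dg ug_exp//; rewrite /ug; case: eqP => // /eqP g0.
by field.
Qed.

(** The cocycle identity behind everything done later on a grid: shifting the base point by [v]
    rescales the increment by [expR (g * v)]. *)
Lemma DgD g v u : Dg g (v + u) = Dg g v + expR (g * v) * Dg g u.
Proof.
rewrite /Dg; case: eqP => [->|/eqP g0]; first by rewrite mul0r expR0 mul1r.
by rewrite mulrDr expRD; field.
Qed.

Lemma DgN g v : Dg g (- v) = - (expR (- (g * v)) * Dg g v).
Proof.
have := DgD g (- v) v; rewrite addNr Dg0r mulrN.
by move/eqP; rewrite eq_sym addr_eq0 => /eqP.
Qed.

Lemma der_Dg g v : has_der v (Dg g) (expR (g * v)).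
Proof.
case: (eqVneq g 0) => [->|g0].
  have -> : Dg 0 = (fun v => v) by apply/funext => x; rewrite /Dg eqxx.
  by rewrite mul0r expR0; exact: der_id.
have -> : Dg g = (fun v => (expR (g * v) - 1) / g).
  by apply/funext => x; rewrite /Dg (negbTE g0).
by der; field.
Qed.

Lemma der_ug g (f : R -> R) a x : 0 < 1 + g * f x -> has_der x f a ->
  has_der x (fun v => ug g (f v)) (a / (1 + g * f x)).
Proof.
move=> p fa; case: (eqVneq g 0) => [->|g0].
  have -> : (fun v => ug 0 (f v)) = f by apply/funext => y; rewrite /ug eqxx.
  by rewrite mul0r addr0 divr1.
have -> : (fun v => ug g (f v)) = (fun v => ln (1 + g * f v) / g).
  by apply/funext => y; rewrite /ug (negbTE g0).
eapply der_eq.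
  apply: der_mul; last exact: der_cst.
  by eapply (@der_ln R (fun v => 1 + g * f v) _ x p); repeat der_step.
by rewrite /=; field; rewrite gt_eqF.
Qed.

Lemma Dg_gt0 g v : 0 < v -> 0 < Dg g v.
Proof.
move=> v0; have [c cab] := @mvt R _ _ _ _ (ltW v0) (fun x _ => der_Dg g x).
by rewrite Dg0r !subr0 => ->; rewrite mulr_gt0// expR_gt0.
Qed.

Lemma Dg_lt g u v : u < v -> Dg g u < Dg g v.
Proof.
move=> uv; have -> : v = u + (v - u) by ring.
by rewrite DgD ltrDl mulr_gt0 ?expR_gt0// Dg_gt0// subr_gt0.
Qed.

Lemma Dg_le g u v : u <= v -> Dg g u <= Dg g v.
Proof. by rewrite le_eqVlt => /predU1P[->//|/(Dg_lt g)/ltW]. Qed.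

Lemma ug_bound g y : `|g * y| <= 2^-1 -> `|ug g y - y| <= 2 * `|g| * y ^+ 2.
Proof.
move=> h; rewrite /ug; case: eqP => [->|/eqP g0].
  by rewrite subrr normr0 mulr0 mul0r.
have e : ln (1 + g * y) / g - y = (ln (1 + g * y) - g * y) / g by field.
rewrite e normrM normfV ler_pdivrMr ?normr_gt0//.
apply: (le_trans (ln1D_bound h)).
have : `|g| * `|g| = g * g by rewrite -normrM ger0_norm// -expr2 sqr_ge0.
move=> gg; have -> : 2 * `|g| * y ^+ 2 * `|g| = 2 * y ^+ 2 * (`|g| * `|g|) by ring.
by rewrite gg exprMn; lra.
Qed.

Lemma ug_le g y : 0 < 1 + g * y -> 0 <= g -> ug g y <= y.
Proof.
move=> h g0; rewrite /ug; case: (eqVneq g 0) => [//|gn].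
have gp : 0 < g by rewrite lt_def gn.
by rewrite ler_pdivrMr// [y * g]mulrC; have := ln_le_sub1 h; lra.
Qed.

Lemma ug_ge g y : 0 < 1 + g * y -> g <= 0 -> y <= ug g y.
Proof.
move=> h g0; rewrite /ug; case: (eqVneq g 0) => [//|gn].
have gp : g < 0 by rewrite lt_def eq_sym gn.
by rewrite ler_ndivlMr// [y * g]mulrC; have := ln_le_sub1 h; lra.
Qed.

(** The derivative of [Dg g v] in [g], that is, the integral of [t * expR (g * t)] from 0 to [v];
    also the value of [Hfun g 0] at [expR v]. *)
Definition Qg g v :=
  if g == 0 then v ^+ 2 / 2 else (v * expR (g * v) - Dg g v) / g.

Lemma Qg0r g : Qg g 0 = 0.
Proof.
by rewrite /Qg Dg0r; case: eqP => _; rewrite ?mul0r ?subrr ?expr0n ?mul0r.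
Qed.

Lemma der_Qg g v : has_der v (Qg g) (v * expR (g * v)).
Proof.
case: (eqVneq g 0) => [->|g0].
  have -> : Qg 0 = (fun v => v * v / 2).
    by apply/funext => x; rewrite /Qg eqxx expr2.
  by rewrite mul0r expR0; der; field.
have -> : Qg g = (fun v => (v * expR (g * v) - Dg g v) / g).
  by apply/funext => x; rewrite /Qg (negbTE g0).
have h := der_Dg g v.
by der; field.
Qed.

End Elementary.

(** * Expansion of the log-likelihood *)

(* sealed because conversion would otherwise unfold [expR] at distinct points *)
HB.lock Definition Lam {R : realType} (v : R) : R := expR (- expR (- v)).
HB.lock Definition lam {R : realType} (v : R) : R :=
  expR (- expR (- v)) * expR (- v).

(** * Second-order expansion in the parameters at a fixed point *)

Section LocalExpansion.
Context {R : realType}.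
Implicit Types (g mu sg x y u v : R).

Lemma normM_le (a b A B : R) : `|a| <= A -> `|b| <= B -> `|a * b| <= A * B.
Proof. by move=> ha hb; rewrite normrM ler_pM. Qed.

Lemma normD_le (a b A B : R) : `|a| <= A -> `|b| <= B -> `|a + b| <= A + B.
Proof. by move=> ha hb; rewrite (le_trans (ler_normD _ _))// lerD. Qed.

Lemma normB_le (a b A B : R) : `|a| <= A -> `|b| <= B -> `|a - b| <= A + B.
Proof. by move=> ha hb; rewrite (le_trans (ler_normB _ _))// lerD. Qed.


(** The log-likelihood of one observation on the support, expressed by [ug]. It is a real number
    everywhere; the support is carried separately by [supp]. *)
Definition ell g mu sg x :=
  - ln sg - expR (- ug g ((x - mu) / sg)) - (1 + g) * ug g ((x - mu) / sg).

Definition supp g0 g mu sg v := 0 < 1 + g * ((Dg g0 v - mu) / sg).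
Definition Uf g0 g mu sg v := ug g ((Dg g0 v - mu) / sg).
Definition del g0 g mu sg v := Uf g0 g mu sg v - v.
(* the logarithm of the derivative of [Uf] in [v] *)
Definition mm g0 g mu sg v := - (g - g0) * v - g * del g0 g mu sg v - ln sg.
(* the differential of [Uf] at the true parameter, and its derivative in [v] *)
Definition lin g0 g mu sg v :=
  expR (- (g0 * v)) * (- (g - g0) * Qg g0 v - mu - (sg - 1) * Dg g0 v).
Definition dlin g0 g mu sg v :=
  - (g - g0) * v - g0 * lin g0 g mu sg v - (sg - 1).
(** The first-order part of [ellE]: [del] is replaced by [lin], and [mm] by [dlin]. *)
Definition score g0 g mu sg v :=
  (expR (- v) - 1) * lin g0 g mu sg v + dlin g0 g mu sg v.
(** Second-order remainders of [Uf] and of its derivative [expR mm]; hence [durem] is the derivative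
    of [urem]. *)
Definition urem g0 g mu sg v := del g0 g mu sg v - lin g0 g mu sg v.
Definition durem g0 g mu sg v :=
  (expR (mm g0 g mu sg v) - 1) - dlin g0 g mu sg v.
Definition tau g0 g mu sg v :=
  (expR (- v) - 1) * urem g0 g mu sg v + durem g0 g mu sg v.
Definition rho g0 g mu sg v :=
  ell g mu sg (Dg g0 v) - ell g0 0 1 (Dg g0 v) - score g0 g mu sg v.

Lemma ell0E g0 v : ell g0 0 1 (Dg g0 v) = - expR (- v) - (1 + g0) * v.
Proof. by rewrite /ell ln1 subr0 divr1 DgK; ring. Qed.

(** Change of variables: in the coordinate [v] the density under the other parameter, divided by the
    true one, is [lam (Uf v) * expR (mm v) / lam v]. This is its logarithm. *)
Lemma ellE g0 g mu sg v : ell g mu sg (Dg g0 v) - ell g0 0 1 (Dg g0 v) =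
  expR (- v) * (1 - expR (- del g0 g mu sg v)) - del g0 g mu sg v
  + mm g0 g mu sg v.
Proof.
rewrite ell0E /ell -/(Uf g0 g mu sg v).
have -> : Uf g0 g mu sg v = v + del g0 g mu sg v by rewrite /del; ring.
by rewrite opprD expRD /mm; ring.
Qed.

(* [tau * lam] is the derivative of [urem * lam], and the two subtracted terms
   are nonnegative: this is what makes the expected remainder negative *)
Lemma rhoE g0 g mu sg v : rho g0 g mu sg v = tau g0 g mu sg v
  - expR (- v) * (expR (- del g0 g mu sg v) - 1 + del g0 g mu sg v)
  - (expR (mm g0 g mu sg v) - 1 - mm g0 g mu sg v).
Proof. by rewrite /rho ellE /tau /score /urem /durem; ring. Qed.

(** Chosen so that [(Dg g0 v - mu) / sg = Dg g v + expR (g * v) * ystar]. By [DgD] the displacement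
    [del] is then [ug g] of this small quantity. *)
Definition ystar g0 g mu sg v :=
  expR (- (g * v)) * ((Dg g0 v - mu) / sg - Dg g v).

Lemma ystar_supp g0 g mu sg v :
  1 + g * ystar g0 g mu sg v
  = expR (- (g * v)) * (1 + g * ((Dg g0 v - mu) / sg)).
Proof.
have h := Dg_exp g v; have h2 : expR (- (g * v)) * expR (g * v) = 1.
  by rewrite mulrC expRxMexpNx_1.
by rewrite -[X in X + _]h2 -h /ystar; ring.
Qed.

Lemma supp_ystar g0 g mu sg v :
  supp g0 g mu sg v <-> 0 < 1 + g * ystar g0 g mu sg v.
Proof. by rewrite ystar_supp pmulr_rgt0 ?expR_gt0. Qed.

Lemma del_ystar g0 g mu sg v : supp g0 g mu sg v ->
  del g0 g mu sg v = ug g (ystar g0 g mu sg v).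
Proof.
move=> s; have s' := s; move/supp_ystar in s'.
have e : (Dg g0 v - mu) / sg = Dg g (v + ug g (ystar g0 g mu sg v)).
  rewrite DgD ugK// /ystar mulrA expRxMexpNx_1 mul1r; ring.
by rewrite /del /Uf e DgK; ring.
Qed.

(** Small enough that [D * S] below it keeps the arguments of all elementary expansions within
    [1/2]; the factor [1 + |g0|] comes from the bound on [g]. *)
Definition taylor_radius g0 : R := (128 * (1 + `|g0|))^-1.

(** [S] dominates the functions of [v] by which parameter increments are multiplied in the expansion
    of [Uf], so that [D * S] is the effective small quantity. The last field serves the error of
    [Dg_taylor]. *)
Record weight g0 v (S : R) : Prop := Weight {
  wt1 : 1 <= S;
  wtv : `|v| <= S;
  wtE : expR (- (g0 * v)) <= S;
  wtD : expR (- (g0 * v)) * `|Dg g0 v| <= S;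
  wtQ : expR (- (g0 * v)) * `|Qg g0 v| <= S;
  wt3 : expR (- (g0 * v)) * (`|v| ^+ 3 * (1 + expR (g0 * v))) <= S }.

(** The difference vanishes at 0 and has derivative [expR (g0 * x) * (expR (a * x) - 1 - a * x)]
    with [a = g - g0], so the mean value inequality adds one power of [|v|]. *)
Lemma Dg_taylor g0 g v : `|(g - g0) * v| <= 2^-1 ->
  `|Dg g v - Dg g0 v - (g - g0) * Qg g0 v| <=
  2 * (g - g0) ^+ 2 * (`|v| ^+ 3 * (1 + expR (g0 * v))).
Proof.
move=> hs; pose a := g - g0.
have hder x : has_der x (fun v => Dg g v - Dg g0 v - a * Qg g0 v)
    (expR (g0 * x) * (expR (a * x) - 1 - a * x)).
  have h1 := der_Dg g x; have h2 := der_Dg g0 x; have h3 := der_Qg g0 x.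
  der; rewrite [in LHS](_ : g * x = g0 * x + a * x); last by rewrite /a; ring.
  by rewrite expRD; ring.
have hb x : Num.min 0 v <= x <= Num.max 0 v ->
    `|expR (g0 * x) * (expR (a * x) - 1 - a * x)| <=
    2 * a ^+ 2 * (`|v| ^+ 2 * (1 + expR (g0 * v))).
  move=> hx; have xv : `|x| <= `|v|.
    move: hx; case: (leP 0 v) => v0 /andP[h1 h2].
      by rewrite !ger0_norm.
    by rewrite (ltr0_norm v0) ler_norml; apply/andP; split; lra.
  have hax : `|a * x| <= 2^-1.
    by apply: le_trans hs; rewrite !normrM ler_wpM2l.
  have -> : 2 * a ^+ 2 * (`|v| ^+ 2 * (1 + expR (g0 * v))) =
    (1 + expR (g0 * v)) * (2 * (a ^+ 2 * `|v| ^+ 2)) by ring.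
  apply: normM_le.
    rewrite gtr0_norm ?expR_gt0//.
    have [gx|gx] := leP (g0 * x) 0.
      by rewrite (@le_trans _ _ 1)// ?expR_le1// lerDl expR_ge0.
    rewrite (@le_trans _ _ (expR (g0 * v)))// ?lerDr// ler_expR.
    move: hx; case: (leP 0 v) => v0 /andP[h1 h2].
      by have gp : 0 <= g0; [rewrite leNgt; apply/negP => ?; nra | nra].
    by have gp : g0 <= 0; [rewrite leNgt; apply/negP => ?; nra | nra].
  apply: (le_trans (expR_taylor1 hax)); rewrite ler_wpM2l//.
  rewrite exprMn ler_wpM2l ?sqr_ge0// -(ger0_norm (sqr_ge0 x)) normrX.
  by rewrite lerXn2r ?nnegrE.
have := mvt_bound (fun x _ => hder x) hb.
rewrite !Dg0r Qg0r mulr0 !subr0 => h; apply: (le_trans h).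
by rewrite le_eqVlt; apply/orP; left; apply/eqP; rewrite /a; ring.
Qed.

(** The expansion is carried through [ystar], the product of [X], which equals [lin] up to second
    order, and of [f], which is 1 up to first order. Then [ug_bound] passes to [del], and the
    definition of [mm] gives the rest. *)
Lemma Uf_taylor g0 g mu sg v (D S : R) : weight g0 v S ->
  `|g - g0| <= D -> `|mu| <= D -> `|sg - 1| <= D ->
  D * S <= taylor_radius g0 ->
  [/\ supp g0 g mu sg v,
      `|del g0 g mu sg v| <= 9 * (D * S),
      `|mm g0 g mu sg v| <= 12 * (1 + `|g0|) * (D * S),
      `|urem g0 g mu sg v| <= 157 * (1 + `|g0|) * (D * S) ^+ 2 &
      `|durem g0 g mu sg v| <= 456 * (1 + `|g0|) ^+ 2 * (D * S) ^+ 2].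
Proof.
case=> S1 Sv SE SD SQ S3 hg hmu hsg; rewrite /taylor_radius.
have D0 : 0 <= D := le_trans (normr_ge0 _) hg.
have [G GE] : exists G, G = 1 + `|g0| by exists (1 + `|g0|).
have [d dE] : exists d, d = D * S by exists (D * S).
have [a aE] : exists a, a = g - g0 by exists (g - g0).
rewrite -GE -dE => hDS; rewrite -aE in hg.
have G1 : 1 <= G by rewrite GE lerDl.
have DS0 : 0 <= d by rewrite dE mulr_ge0//; clear - S1; lra.
have dG : d * (128 * G) <= 1.
  by rewrite -ler_pdivlMr ?mul1r//; clear - G1; nra.
have Dd : D <= d by clear - dE D0 S1; nra.
have d1 : d <= 128^-1 by clear - dG G1 DS0; nra.
have dd : d * d <= 128^-1 * d by rewrite ler_wpM2r.
have Gd : G * (d * d) <= 128^-1 * d by clear - dG G1 DS0; nra.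
have hgG : `|g| <= G.
  have -> : g = g0 + a by rewrite aE; ring.
  rewrite (le_trans (ler_normD _ _))// GE addrC lerD2r.
  by clear - hg Dd d1; lra.
have [sg2 sg0] : 2^-1 <= sg <= 2 /\ 0 < sg.
  move: hsg; rewrite ler_norml => /andP[p1 p2].
  by clear - d1 Dd p1 p2; split; [apply/andP; split|]; lra.
have hav : `|a * v| <= d by rewrite dE; exact: normM_le.
have havh : `|a * v| <= 2^-1 by clear - hav d1; lra.
have [k0 kE] : exists k0, k0 = expR (- (g0 * v)) by exists (expR (- (g0 * v))).
have k00 : 0 < k0 by rewrite kE expR_gt0.
rewrite -kE in SE SD SQ S3.
have [e1 e1E] : exists e1, e1 = Dg g v - Dg g0 v - a * Qg g0 v.
  by exists (Dg g v - Dg g0 v - a * Qg g0 v).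
have D2S : D ^+ 2 * S <= d * d.
  have -> : D ^+ 2 * S = D * d by rewrite dE; ring.
  by rewrite ler_wpM2r.
have he1 : `|k0 * e1| <= 2 * (d * d).
  rewrite normrM gtr0_norm//.
  have := @Dg_taylor g0 g v; rewrite -aE -e1E => /(_ havh) h.
  apply: (le_trans (ler_wpM2l (ltW k00) h)).
  apply: (@le_trans _ _ (2 * (D ^+ 2 * S))); last by rewrite ler_wpM2l.
  have -> : k0 * (2 * a ^+ 2 * (`|v| ^+ 3 * (1 + expR (g0 * v)))) =
    2 * (a ^+ 2 * (k0 * (`|v| ^+ 3 * (1 + expR (g0 * v))))) by ring.
  rewrite ler_wpM2l// ler_pM ?sqr_ge0//.
    by rewrite !(mulr_ge0, exprn_ge0, addr_ge0, expR_ge0, ltW k00).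
  by rewrite -(ger0_norm (sqr_ge0 a)) normrX lerXn2r ?nnegrE.
have hQ : `|k0 * Qg g0 v| <= S by rewrite normrM gtr0_norm.
have hD : `|k0 * Dg g0 v| <= S by rewrite normrM gtr0_norm.
have hk : `|k0| <= S by rewrite gtr0_norm.
have [L Ldef] : exists L, L = lin g0 g mu sg v by exists (lin g0 g mu sg v).
have LE : L = - a * (k0 * Qg g0 v) - mu * k0 - (sg - 1) * (k0 * Dg g0 v).
  by rewrite Ldef /lin -aE -kE; ring.
have hL : `|L| <= 3 * d.
  have -> : 3 * d = D * S + D * S + D * S by rewrite dE; ring.
  rewrite LE; apply: normB_le; last exact: normM_le.
  by apply: normB_le; apply: normM_le; rewrite ?normrN.
have [X XE] : exists X, X = k0 * (Dg g0 v - mu - sg * Dg g v).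
  by exists (k0 * (Dg g0 v - mu - sg * Dg g v)).
have hXL : `|X - L| <= 5 * (d * d).
  have -> : X - L = - ((sg - 1) * (a * (k0 * Qg g0 v))) - sg * (k0 * e1).
    by rewrite LE XE e1E; ring.
  apply: (@le_trans _ _ (d * d + 2 * (2 * (d * d)))); last first.
    by clear; lra.
  apply: normB_le; rewrite ?normrN.
    apply: normM_le; first exact: le_trans hsg Dd.
    by rewrite dE; exact: normM_le.
  by apply: normM_le => //; rewrite gtr0_norm//; clear - sg2; lra.
have hX : `|X| <= 4 * d.
  have -> : X = L + (X - L) by ring.
  by apply: (le_trans (normD_le hL hXL)); clear - dd DS0; lra.
have [f fE] : exists f, f = expR (- (a * v)) / sg by exists (expR (- (a * v)) / sg).
have [y yE] : exists y, y = ystar g0 g mu sg v by exists (ystar g0 g mu sg v).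
have sgn0 : sg != 0 by rewrite gt_eqF.
have yX : y = X * f.
  rewrite yE /ystar XE fE kE.
  have -> : - (g * v) = - (g0 * v) + - (a * v) by rewrite aE; ring.
  by rewrite expRD; clear - sgn0; field.
have sgi : 0 < sg^-1 <= 2.
  rewrite invr_gt0 sg0 /=; have -> : 2 = (2^-1)^-1 :> R by rewrite invrK.
  by rewrite lef_pV2 ?posrE//; clear - sg2; lra.
have hf : `|f - 1| <= 6 * d.
  have -> : f - 1 = (expR (- (a * v)) - 1 - (sg - 1)) * sg^-1.
    by rewrite fE; clear - sgn0; field.
  apply: (@le_trans _ _ ((2 * d + d) * 2)); last by clear; lra.
  apply: normM_le; last by rewrite gtr0_norm; clear - sgi; lra.
  apply: normB_le; last exact: le_trans hsg Dd.
  have h := @expR_sub1_bound R (- (a * v)).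
  by rewrite normrN in h; apply: (le_trans (h havh)); clear - hav; lra.
have hf2 : `|f| <= 2.
  have -> : f = (f - 1) + 1 by ring.
  by rewrite (le_trans (normD_le hf (lexx _)))// normr1; clear - d1; lra.
have hy : `|y| <= 8 * d.
  by rewrite yX (le_trans (normM_le hX hf2))//; clear; lra.
have hyL : `|y - L| <= 29 * (d * d).
  have -> : y - L = X * (f - 1) + (X - L) by rewrite yX; ring.
  by apply: (le_trans (normD_le (normM_le hX hf) hXL)); clear; lra.
have hgy : `|g * y| <= 2^-1.
  by apply: (le_trans (normM_le hgG hy)); clear - dG; lra.
have S' : supp g0 g mu sg v.
  apply/supp_ystar; rewrite -yE.
  by move: hgy; rewrite ler_norml => /andP[h _]; clear - h; lra.
have duE := del_ystar S'; rewrite -yE in duE.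
have [u uE] : exists u, u = del g0 g mu sg v by exists (del g0 g mu sg v).
rewrite -uE in duE.
have sq (x c : R) : `|x| <= c -> x ^+ 2 <= c ^+ 2.
  move=> xc; rewrite -(ger0_norm (sqr_ge0 x)) normrX.
  by rewrite lerXn2r ?nnegrE// (le_trans _ xc).
have huy : `|u - y| <= 128 * G * (d * d).
  rewrite duE; apply: (le_trans (ug_bound hgy)).
  have y2 : y ^+ 2 <= 64 * (d * d) by apply: (le_trans (sq _ _ hy)); clear; lra.
  have h2 := ler_pM (normr_ge0 g) (sqr_ge0 y) hgG y2.
  by clear - h2; lra.
have hu : `|u| <= 9 * d.
  have -> : u = y + (u - y) by ring.
  by apply: (le_trans (normD_le hy huy)); clear - Gd; lra.
have [r rE] : exists r, r = urem g0 g mu sg v by exists (urem g0 g mu sg v).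
have rE' : r = u - L by rewrite rE /urem -uE -Ldef.
have hr : `|r| <= 157 * G * d ^+ 2.
  have -> : r = (u - y) + (y - L) by rewrite rE'; ring.
  apply: (le_trans (normD_le huy hyL)).
  have : 0 <= (G - 1) * (d * d) by rewrite !mulr_ge0// subr_ge0.
  by clear; lra.
have hlns : `|ln sg - (sg - 1)| <= 2 * (d * d).
  have -> : ln sg = ln (1 + (sg - 1)) by congr ln; ring.
  have h : `|sg - 1| <= 2^-1 by clear - hsg Dd d1; lra.
  apply: (le_trans (ln1D_bound h)).
  by have := sq _ _ (le_trans hsg Dd); clear; lra.
have hln : `|ln sg| <= 2 * d.
  have -> : ln sg = (sg - 1) + (ln sg - (sg - 1)) by ring.
  by apply: (le_trans (normD_le hsg hlns)); clear - dd Dd DS0; lra.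
have [m mE] : exists m, m = mm g0 g mu sg v by exists (mm g0 g mu sg v).
have mE' : m = - a * v - g * u - ln sg by rewrite mE /mm -uE -aE.
have hm : `|m| <= 12 * G * d.
  rewrite mE'; apply: (@le_trans _ _ (d + G * (9 * d) + 2 * d)).
    apply: normB_le => //; apply: normB_le; last exact: normM_le.
    by rewrite mulNr normrN.
  by clear - G1 DS0; nra.
rewrite -uE -mE -rE; split => //.
have hmh : `|m| <= 2^-1 by clear - hm dG; lra.
have -> : durem g0 g mu sg v = (expR m - 1 - m)
   + (- g0 * r - a * u - (ln sg - (sg - 1))).
  rewrite /durem /dlin -mE -Ldef [X in _ = _ - 1 - X + _]mE' rE' -aE.
  have -> : g = g0 + a by rewrite aE; ring.
  by clear; ring.
have G2 : G * d ^+ 2 <= G ^+ 2 * d ^+ 2.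
  by rewrite ler_wpM2r ?sqr_ge0// expr2 ler_peMr//; clear - G1; lra.
have G3 : d ^+ 2 <= G * d ^+ 2 by rewrite ler_peMl ?sqr_ge0.
apply: (@le_trans _ _ (288 * G ^+ 2 * d ^+ 2 +
    (G * (157 * G * d ^+ 2) + d * (9 * d) + 2 * (d * d)))).
  apply: normD_le.
    by apply: (le_trans (expR_taylor1 hmh)); have := sq _ _ hm; clear; lra.
  apply: normB_le => //; apply: normB_le; apply: normM_le => //.
    by rewrite normrN GE lerDr.
  exact: le_trans hg Dd.
by clear - G2 G3; lra.
Qed.

End LocalExpansion.

(** * Growth of the remainder in the tails *)

Section LocalTail.
Context {R : realType}.
Implicit Types (g mu sg x y u v : R).

Lemma expR_between g x v : Num.min 0 v <= x <= Num.max 0 v ->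
  `|x| <= `|v| /\ expR (g * x) <= 1 + expR (g * v).
Proof.
move=> hx; split.
  move: hx; case: (leP 0 v) => v0 /andP[h1 h2].
    by rewrite !ger0_norm.
  by rewrite (ltr0_norm v0) ler_norml; apply/andP; split; lra.
have [gx|gx] := leP (g * x) 0.
  by rewrite (@le_trans _ _ 1)// ?expR_le1// lerDl expR_ge0.
rewrite (@le_trans _ _ (expR (g * v)))// ?lerDr// ler_expR.
move: hx; case: (leP 0 v) => v0 /andP[h1 h2].
  by have gp : 0 <= g; [rewrite leNgt; apply/negP => ?; nra | nra].
by have gp : g <= 0; [rewrite leNgt; apply/negP => ?; nra | nra].
Qed.

Lemma Dg_bound g v : `|Dg g v| <= `|v| * (1 + expR (g * v)).
Proof.
have hb x : Num.min 0 v <= x <= Num.max 0 v ->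
    `|expR (g * x)| <= 1 + expR (g * v).
  by move=> /(expR_between g)[_]; rewrite gtr0_norm ?expR_gt0.
have := mvt_bound (fun x _ => der_Dg g x) hb.
by rewrite Dg0r !subr0 mulrC.
Qed.

Lemma Qg_bound g v : `|Qg g v| <= `|v| ^+ 2 * (1 + expR (g * v)).
Proof.
have hb x : Num.min 0 v <= x <= Num.max 0 v ->
    `|x * expR (g * x)| <= `|v| * (1 + expR (g * v)).
  move=> /(expR_between g)[h1 h2]; apply: normM_le => //.
  by rewrite gtr0_norm ?expR_gt0.
have := mvt_bound (fun x _ => der_Qg g x) hb.
by rewrite Qg0r !subr0 => h; apply: (le_trans h); rewrite expr2; nra.
Qed.

(** A weight valid at every [v], by [weight_bwt]. [Wt] is its square, from the second-order terms,
    times [(1 + |v|) * (1 + expR (- v))], which controls minus the true log-likelihood. *)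
Definition bwt g v : R := (1 + `|v|) ^+ 3 * (1 + expR (- (g * v))).
Definition Wt g v : R :=
  (1 + `|v|) ^+ 7 * (1 + expR (- (g * v))) ^+ 2 * (1 + expR (- v)).

Lemma bwt_ge1 g v : 1 <= bwt g v.
Proof.
have := expR_gt0 (- (g * v)); have := normr_ge0 v => h1 h2.
have : 1 <= (1 + `|v|) ^+ 3 by rewrite exprn_ege1//; lra.
by rewrite /bwt; nra.
Qed.

Lemma weight_bwt g v : weight g v (bwt g v).
Proof.
have e0 := expR_gt0 (- (g * v)); have v0 := normr_ge0 v.
have ee : expR (- (g * v)) * (1 + expR (g * v)) = 1 + expR (- (g * v)).
  by rewrite mulrDr mulr1 -expRD addNr expR0 addrC.
set e := expR (- (g * v)) in e0 ee *; set t := `|v| in v0 *.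
have t2 : 0 <= t ^+ 2 by exact: sqr_ge0.
have t3 : 0 <= t ^+ 3 by exact: exprn_ge0.
have b0 : 1 <= (1 + t) ^+ 3 by rewrite exprn_ege1//; lra.
have b1 : t <= (1 + t) ^+ 3 by rewrite !exprS expr0; nra.
have b2 : t ^+ 2 <= (1 + t) ^+ 3 by rewrite !exprS expr0; nra.
have b3 : t ^+ 3 <= (1 + t) ^+ 3 by rewrite lerXn2r ?nnegrE//; lra.
split; rewrite ?bwt_ge1// /bwt -/e -/t.
- nra.
- nra.
- apply: (@le_trans _ _ (e * (t * (1 + expR (g * v))))).
    by rewrite ler_wpM2l ?Dg_bound// ltW.
  by rewrite mulrCA ee; nra.
- apply: (@le_trans _ _ (e * (t ^+ 2 * (1 + expR (g * v))))).
    by rewrite ler_wpM2l ?Qg_bound// ltW.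
  by rewrite mulrCA ee; nra.
- by rewrite mulrCA ee; nra.
Qed.

Lemma Wt_ge g v : (1 + `|v|) * (1 + expR (- v)) * bwt g v ^+ 2 = Wt g v.
Proof. by rewrite /Wt /bwt; ring. Qed.

Lemma Wt_ge1 g v : (1 + `|v|) * (1 + expR (- v)) <= Wt g v.
Proof.
by rewrite -(Wt_ge g v) ler_peMr ?exprn_ege1 ?bwt_ge1 ?mulr_ge0 ?addr_ge0
  ?expR_ge0.
Qed.

(** The maximum over [u] is reached at [u = - ln a] and equals [a * ln a - a], which is below
    [a ^+ 2]. *)
Lemma h_le (a u : R) : 0 < a -> - expR (- u) - a * u <= a ^+ 2.
Proof.
move=> a0; have := @ln_le_sub1 R (expR (- u) / a).
rewrite divr_gt0 ?expR_gt0// => /(_ isT).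
rewrite ln_div ?posrE ?expR_gt0// expRK => h.
have h2 := ln_le_sub1 a0.
have e : expR (- u) / a * a = expR (- u) by rewrite divfK// gt_eqF.
have : a * (- u - ln a) <= expR (- u) - a by nra.
nra.
Qed.

Lemma ell_le g mu sg x : -1 < g -> ell g mu sg x <= - ln sg + (1 + g) ^+ 2.
Proof.
move=> g1; rewrite /ell -addrA lerD2l.
by apply: h_le; lra.
Qed.

Lemma ell0_ge g v :
  - ell g 0 1 (Dg g v) <= (1 + `|g|) * ((1 + `|v|) * (1 + expR (- v))).
Proof.
rewrite ell0E.
have : (1 + g) * v <= (1 + `|g|) * `|v|.
  rewrite (le_trans (ler_norm _))// normM_le// ?lexx//.
  by rewrite (le_trans (ler_normD _ _))// normr1.
have e0 := expR_ge0 (- v); have t0 := normr_ge0 v; have a0 := normr_ge0 g.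
have := mulr_ge0 a0 e0; have := mulr_ge0 t0 e0.
have := mulr_ge0 a0 (mulr_ge0 t0 e0); have := mulr_ge0 a0 t0.
by move: a0 t0 e0; clear; lra.
Qed.

(** The factor [128 ^+ 2] is that of the inverse square of [taylor_radius]; it absorbs terms of
    order 1 where the expansion fails, see [rho_le]. *)
Definition rho_const g : R := 128 ^+ 2 * 32 * (1 + `|g|) ^+ 4.

Lemma lin_bound g0 g mu sg v (D S : R) : weight g0 v S ->
  `|g - g0| <= D -> `|mu| <= D -> `|sg - 1| <= D ->
  `|lin g0 g mu sg v| <= 3 * (D * S) /\
  `|dlin g0 g mu sg v| <= 5 * (1 + `|g0|) * (D * S).
Proof.
case=> S1 Sv SE SD SQ _ hg hmu hsg.
have D0 : 0 <= D := le_trans (normr_ge0 _) hg.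
have k0 := expR_gt0 (- (g0 * v)).
have hL : `|lin g0 g mu sg v| <= 3 * (D * S).
  have -> : 3 * (D * S) = D * S + D * S + D * S by ring.
  have -> : lin g0 g mu sg v = - (g - g0) * (expR (- (g0 * v)) * Qg g0 v)
    - mu * expR (- (g0 * v)) - (sg - 1) * (expR (- (g0 * v)) * Dg g0 v).
    by rewrite /lin; ring.
  apply: normB_le; [apply: normB_le|]; apply: normM_le => //.
  - by rewrite normrN.
  - by rewrite normrM gtr0_norm.
  - by rewrite gtr0_norm.
  - by rewrite normrM gtr0_norm.
split => //; rewrite /dlin.
apply: (@le_trans _ _ (D * S + `|g0| * (3 * (D * S)) + D)).
  apply: normB_le => //; apply: normB_le; apply: normM_le => //.
  by rewrite normrN.
have : D <= D * S by rewrite ler_peMr.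
have : 0 <= `|g0| * (D * S) by rewrite !mulr_ge0//; clear - S1; lra.
have : 0 <= D * S by rewrite mulr_ge0//; clear - S1; lra.
by clear; lra.
Qed.

Lemma sqr_le_norm (x c : R) : `|x| <= c -> x ^+ 2 <= c ^+ 2.
Proof.
move=> xc; rewrite -(ger0_norm (sqr_ge0 x)) normrX.
by rewrite lerXn2r ?nnegrE// (le_trans _ xc).
Qed.

Lemma rho_parts g0 g mu sg v (D S : R) : weight g0 v S ->
  `|g - g0| <= D -> `|mu| <= D -> `|sg - 1| <= D ->
  D * S <= taylor_radius g0 ->
  [/\ supp g0 g mu sg v,
    `|tau g0 g mu sg v|
      <= 613 * ((1 + `|g0|) ^+ 2 * (D * S) ^+ 2 * (1 + expR (- v))),
    0 <= expR (- v) * (expR (- del g0 g mu sg v) - 1 + del g0 g mu sg v)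
      <= (1 + expR (- v)) * (162 * (D * S) ^+ 2) &
    0 <= expR (mm g0 g mu sg v) - 1 - mm g0 g mu sg v
      <= 288 * ((1 + `|g0|) ^+ 2 * (D * S) ^+ 2)].
Proof.
move=> hw hg hmu hsg hd; have S1 := wt1 hw.
have [hs hdel hm hr hdr] := Uf_taylor hw hg hmu hsg hd.
have D0 : 0 <= D := le_trans (normr_ge0 _) hg.
have [G GE] : exists G, G = 1 + `|g0| by exists (1 + `|g0|).
have [d dE] : exists d, d = D * S by exists (D * S).
have [e eE] : exists e, e = 1 + expR (- v) by exists (1 + expR (- v)).
have [u uE] : exists u, u = del g0 g mu sg v by exists (del g0 g mu sg v).
have [m mE] : exists m, m = mm g0 g mu sg v by exists (mm g0 g mu sg v).
move: hd; rewrite /taylor_radius -GE -dE => hd.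
rewrite -GE -dE -?uE -?mE in hdel hm hr hdr *; rewrite -eE.
have G1 : 1 <= G by rewrite GE lerDl.
have e1 : 1 <= e by rewrite eE lerDl expR_ge0.
have d0 : 0 <= d by rewrite dE mulr_ge0//; clear - S1; lra.
have dG : d * (128 * G) <= 1.
  by rewrite -ler_pdivlMr ?mul1r//; clear - G1; nra.
have d1 : d * 128 <= 1 by clear - dG G1 d0; nra.
have k1 : `|expR (- v) - 1| <= e.
  rewrite (le_trans (ler_normB _ _))// normr1 gtr0_norm ?expR_gt0//.
  by rewrite eE addrC.
have hu2 : `|- u| <= 2^-1 by rewrite normrN; clear - hdel d1 d0; lra.
have hm2 : `|m| <= 2^-1 by clear - hm dG; lra.
have p0 : 0 <= d ^+ 2 by exact: sqr_ge0.
have p1 : G * d ^+ 2 <= G ^+ 2 * d ^+ 2.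
  by rewrite ler_wpM2r// expr2 ler_peMr//; clear - G1; lra.
have p2 : 0 <= G ^+ 2 * d ^+ 2 by rewrite mulr_ge0 ?sqr_ge0.
split => //.
- rewrite /tau.
  apply: (@le_trans _ _ (e * (157 * G * d ^+ 2) + 456 * G ^+ 2 * d ^+ 2)).
    by apply: normD_le => //; apply: normM_le.
  have : G * d ^+ 2 * e <= G ^+ 2 * d ^+ 2 * e.
    by rewrite ler_wpM2r//; clear - e1; lra.
  have : G ^+ 2 * d ^+ 2 <= G ^+ 2 * d ^+ 2 * e by rewrite ler_peMr.
  by clear; lra.
- apply/andP; split.
    rewrite mulr_ge0 ?expR_ge0//.
    by have := expR_ge1Dx (- u); clear; lra.
  rewrite ler_pM ?expR_ge0//.
  + by have := expR_ge1Dx (- u); clear; lra.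
  + by rewrite eE lerDr.
  have -> : expR (- u) - 1 + u = expR (- u) - 1 - (- u) by ring.
  apply: (le_trans (ler_norm _)); apply: (le_trans (expR_taylor1 hu2)).
  by rewrite sqrrN; have := sqr_le_norm hdel; clear; lra.
- apply/andP; split; first by have := expR_ge1Dx m; clear; lra.
  apply: (le_trans (ler_norm _)); apply: (le_trans (expR_taylor1 hm2)).
  by have := sqr_le_norm hm; clear; lra.
Qed.

Lemma rho_pointwise g0 g mu sg v (D : R) :
  `|g - g0| <= D -> `|mu| <= D -> `|sg - 1| <= D ->
  D * bwt g0 v <= taylor_radius g0 ->
  supp g0 g mu sg v /\
  `|rho g0 g mu sg v| <= rho_const g0 * D ^+ 2 * Wt g0 v.
Proof.
move=> hg hmu hsg hd.
have [hs ht h1 h2] := rho_parts (weight_bwt g0 v) hg hmu hsg hd; split => //.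
rewrite rhoE -Wt_ge /rho_const.
have S1 := bwt_ge1 g0 v.
have D0 : 0 <= D := le_trans (normr_ge0 _) hg.
set x := tau _ _ _ _ _ in ht *; set y := (_ * _) in h1 *.
set z := (_ - _ - _) in h2 *.
have [G GE] : exists G, G = 1 + `|g0| by exists (1 + `|g0|).
have [d dE] : exists d, d = D * bwt g0 v by exists (D * bwt g0 v).
have [e eE] : exists e, e = 1 + expR (- v) by exists (1 + expR (- v)).
have [t tE] : exists t, t = 1 + `|v| by exists (1 + `|v|).
rewrite -GE -dE -eE -?tE in ht h1 h2 *.
have G1 : 1 <= G by rewrite GE lerDl.
have e1 : 1 <= e by rewrite eE lerDl expR_ge0.
have t1 : 1 <= t by rewrite tE lerDl.
have -> : 128 ^+ 2 * 32 * G ^+ 4 * D ^+ 2 * (t * e * bwt g0 v ^+ 2)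
  = 128 ^+ 2 * 32 * (G ^+ 4 * d ^+ 2 * (t * e)) by rewrite dE; ring.
apply: (@le_trans _ _ (613 * (G ^+ 2 * d ^+ 2 * e) + e * (162 * d ^+ 2) +
    288 * (G ^+ 2 * d ^+ 2))).
  apply: normB_le; first apply: normB_le => //.
    by case/andP: h1 => h11 h12; rewrite ger0_norm.
  by case/andP: h2 => h11 h12; rewrite ger0_norm.
have p0 : 0 <= d ^+ 2 by exact: sqr_ge0.
have p1 : 0 <= G ^+ 2 * d ^+ 2 by rewrite mulr_ge0 ?sqr_ge0.
have p2 : G ^+ 2 * d ^+ 2 <= G ^+ 4 * d ^+ 2.
  by rewrite ler_wpM2r// ler_weXn2l.
have p3 : G ^+ 2 * d ^+ 2 * e <= G ^+ 4 * d ^+ 2 * (t * e).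
  by rewrite ler_pM// ?ler_peMl//; clear - e1; lra.
have p4 : G ^+ 2 * d ^+ 2 <= G ^+ 2 * d ^+ 2 * e by rewrite ler_peMr.
have p5 : e * d ^+ 2 <= G ^+ 2 * d ^+ 2 * e.
  rewrite [X in _ <= X]mulrC ler_wpM2l//; first by clear - e1; lra.
  by rewrite ler_peMl// exprn_ege1.
by clear - p3 p4 p5 p1; lra.
Qed.

(** One-sided, but without smallness of [D * bwt]. Where the expansion fails,
    [128 * (1 + |g0|) * D * bwt] is at least 1, so its square dominates constants. The new
    log-likelihood only has to be bounded above, by [ell_le], so [v] may leave the support. *)
Lemma rho_le g0 g mu sg v (D : R) : -2^-1 < g0 ->
  `|g - g0| <= D -> `|mu| <= D -> `|sg - 1| <= D -> D <= 2^-1 -> -2^-1 < g ->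
  rho g0 g mu sg v <= rho_const g0 * D ^+ 2 * Wt g0 v.
Proof.
move=> g0h hg hmu hsg D2 gh.
have [hd|hd] := leP (D * bwt g0 v) (taylor_radius g0).
  have [_] := rho_pointwise hg hmu hsg hd; apply: le_trans; exact: ler_norm.
have D0 : 0 <= D := le_trans (normr_ge0 _) hg.
have hw := weight_bwt g0 v; have S1 := wt1 hw.
have h2 := ell0_ge g0 v.
have [h3 h4] := lin_bound hw hg hmu hsg.
rewrite -Wt_ge /rho_const.
have [G GE] : exists G, G = 1 + `|g0| by exists (1 + `|g0|).
have [d dE] : exists d, d = D * bwt g0 v by exists (D * bwt g0 v).
have [e eE] : exists e, e = 1 + expR (- v) by exists (1 + expR (- v)).
have [t tE] : exists t, t = 1 + `|v| by exists (1 + `|v|).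
move: hd; rewrite /taylor_radius; rewrite -GE -?dE -?eE -?tE in h2 h3 h4 *.
move=> hd.
have G1 : 1 <= G by rewrite GE lerDl.
have e1 : 1 <= e by rewrite eE lerDl expR_ge0.
have t1 : 1 <= t by rewrite tE lerDl.
have d0 : 0 <= d by rewrite dE mulr_ge0//; clear - S1; lra.
have -> : 128 ^+ 2 * 32 * G ^+ 4 * D ^+ 2 * (t * e * bwt g0 v ^+ 2)
  = 128 ^+ 2 * 32 * (G ^+ 4 * d ^+ 2 * (t * e)) by rewrite dE; ring.
have hsgp : 2^-1 <= sg.
  by move: hsg; rewrite ler_norml => /andP[p _]; clear - p D2; lra.
have h1 : ell g mu sg (Dg g0 v) <= 5 * G ^+ 2.
  have g1 : -1 < g by clear - gh; lra.
  apply: (le_trans (ell_le _ _ _ g1)).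
  have : - ln sg <= 1.
    have sp : 0 < sg by clear - hsgp; lra.
    have := @ln_ge R sg sp; have : sg^-1 <= 2.
      rewrite -[X in _ <= X]invrK lef_pV2 ?posrE//; clear - hsgp; lra.
    by clear; lra.
  have : (1 + g) ^+ 2 <= (2 * G) ^+ 2.
    apply: sqr_le_norm; rewrite (le_trans (ler_normD _ _))// normr1.
    have -> : g = g0 + (g - g0) by ring.
    by have := ler_normD g0 (g - g0); have := normr_ge0 g0; rewrite GE; clear - hg D2; lra.
  by clear - G1; nra.
have h5 : - score g0 g mu sg v <= e * (3 * d) + 5 * G * d.
  rewrite (le_trans (ler_norm _))// normrN /score.
  apply: normD_le => //; apply: normM_le => //.
  rewrite (le_trans (ler_normB _ _))// normr1 gtr0_norm ?expR_gt0//.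
  by rewrite eE addrC.
have q1 : 1 <= 128 * (G * d).
  rewrite ltW//; move: hd; rewrite -div1r ltr_pdivrMr.
    by clear; lra.
  by clear - G1; lra.
(* At least 1 here, so the terms of order 0 and 1 in [D] can be multiplied by it. *)
have [X XE] : exists X, X = 128 ^+ 2 * (G ^+ 2 * d ^+ 2).
  by exists (128 ^+ 2 * (G ^+ 2 * d ^+ 2)).
have q2 : 128 * (G * d) <= X.
  have -> : X = (128 * (G * d)) ^+ 2 by rewrite XE; ring.
  by rewrite expr2 ler_peMr//; clear - q1; lra.
have [Y YE] : exists Y, Y = G ^+ 2 * (t * e) by exists (G ^+ 2 * (t * e)).
have -> : 128 ^+ 2 * 32 * (G ^+ 4 * d ^+ 2 * (t * e)) = 32 * (X * Y).
  by rewrite XE YE; ring.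
have te : 1 <= t * e by clear - e1 t1; nra.
have te2 : e <= t * e by clear - e1 t1; nra.
have G2 : G <= G ^+ 2 by rewrite expr2 ler_peMr//; clear - G1; lra.
have y1 : G * (t * e) <= Y by rewrite YE ler_wpM2r//; clear - te; lra.
have y2 : G ^+ 2 <= Y by rewrite YE ler_peMr ?sqr_ge0.
have y0 : e <= Y.
  have G2' : 1 <= G ^+ 2 by rewrite exprn_ege1.
  by rewrite YE; apply: (le_trans te2); rewrite ler_peMl//; clear - te; lra.
have Gd : d <= G * d by rewrite ler_peMl.
have X1 : 1 <= X := le_trans q1 q2.
have y3 : e * d <= X * Y.
  have dX : d <= X by clear - Gd q2 d0; lra.
  have e0 : 0 <= e by clear - e1; lra.
  by rewrite mulrC ler_pM.
have y4 : G * d <= X * Y.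
  have Y1 : 1 <= Y := le_trans e1 y0.
  have : X <= X * Y by rewrite ler_peMr//; clear - X1; lra.
  by clear - q2 q1; lra.
have XY : Y <= X * Y by rewrite ler_peMl//; clear - y0 e1; lra.
by rewrite /rho; clear - h1 h2 h5 y0 e1 y1 y2 y3 y4 XY; lra.
Qed.

End LocalTail.

(** * Empirical averages close to the Gumbel law *)

Section SampleAverage.
Context {R : realType}.
Implicit Types (s : seq R) (f g : R -> R).

Definition avg s f : R := (size s)%:R^-1 * \sum_(v <- s) f v.
Definition ind (a b v : R) : R := (a < v <= b)%R%:R.
Definition ecdf s t : R := avg s (fun v => (v <= t)%R%:R).

Lemma eq_avg s f g : {in s, f =1 g} -> avg s f = avg s g.
Proof. by move=> fg; rewrite /avg; congr (_ * _); exact: eq_big_seq. Qed.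

Lemma avgD s f g : avg s (fun v => f v + g v) = avg s f + avg s g.
Proof. by rewrite /avg big_split mulrDr. Qed.

Lemma avgN s f : avg s (fun v => - f v) = - avg s f.
Proof. by rewrite /avg sumrN mulrN. Qed.

Lemma avgB s f g : avg s (fun v => f v - g v) = avg s f - avg s g.
Proof. by rewrite avgD avgN. Qed.

Lemma avgZ s c f : avg s (fun v => c * f v) = c * avg s f.
Proof. by rewrite /avg -mulr_sumr mulrCA. Qed.

Lemma avg_cst s c : (0 < size s)%N -> avg s (fun=> c) = c.
Proof.
move=> s0; rewrite /avg big_const_seq count_predT iter_addr_0 -[c *+ _]mulr_natl mulrA.
by rewrite mulVf ?mul1r// pnatr_eq0 -lt0n.
Qed.

Lemma avg_eq0 s f : {in s, forall v, f v = 0} -> avg s f = 0.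
Proof. by move=> f0; rewrite /avg big_seq big1 ?mulr0. Qed.

Lemma le_avg s f g : {in s, forall v, f v <= g v} -> avg s f <= avg s g.
Proof.
move=> fg; rewrite /avg ler_wpM2l ?invr_ge0// big_seq [X in _ <= X]big_seq.
exact: ler_sum.
Qed.

Lemma avg_ge0 s f : {in s, forall v, 0 <= f v} -> 0 <= avg s f.
Proof.
move=> fg; rewrite /avg mulr_ge0 ?invr_ge0// big_seq sumr_ge0//.
Qed.

Lemma norm_avg s f g : {in s, forall v, `|f v| <= g v} -> `|avg s f| <= avg s g.
Proof.
move=> fg; rewrite ler_norml -avgN; apply/andP; split; apply: le_avg => v /fg.
  by rewrite ler_norml => /andP[].
by rewrite ler_norml => /andP[].
Qed.

Lemma avg_le1 s (P : R -> bool) : avg s (fun v => (P v)%:R) <= 1.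
Proof.
have [/size0nil->|s0] := posnP (size s).
  by rewrite /avg big_nil mulr0.
rewrite -[X in _ <= X](avg_cst 1 s0); apply: le_avg => v _.
by case: (P v); rewrite ?ler01.
Qed.

Lemma ind_ge0 a b v : 0 <= ind a b v.
Proof. by rewrite /ind ler0n. Qed.

Lemma ind_add a b c v : a <= b -> b <= c -> ind a c v = ind a b v + ind b c v.
Proof.
move=> ab bc; rewrite /ind; case: (leP v b) => vb.
  by rewrite andbT (le_trans vb bc) andbT addr0.
by rewrite andbF add0r (le_lt_trans ab vb).
Qed.

Lemma indE a b v : a <= b -> ind a b v = (v <= b)%R%:R - (v <= a)%R%:R.
Proof.
move=> ab; rewrite /ind; case: (leP v a) => va /=.
  by rewrite (le_trans va ab) subrr.
by rewrite subr0.
Qed.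

Lemma avg_ind s a b : a <= b -> avg s (ind a b) = ecdf s b - ecdf s a.
Proof. by move=> ab; rewrite /ecdf -avgB; apply: eq_avg => v _; rewrite indE. Qed.

Lemma lam_gt0 (v : R) : 0 < lam v.
Proof. by rewrite lam.unlock mulr_gt0 ?expR_gt0. Qed.

Lemma lam_le1 (v : R) : lam v <= 1.
Proof.
rewrite lam.unlock -expRD -expR0 ler_expR; have := expR_ge1Dx (- v); lra.
Qed.

Lemma der_Lam (v : R) : has_der v Lam (lam v).
Proof. by rewrite Lam.unlock lam.unlock; der; ring. Qed.

Lemma Lam_gt0 (v : R) : 0 < Lam v.
Proof. by rewrite Lam.unlock expR_gt0. Qed.

Lemma Lam_lt1 (v : R) : Lam v < 1.
Proof. by rewrite Lam.unlock expR_lt1 oppr_lt0 expR_gt0. Qed.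
Lemma Lam_lt (u v : R) : u < v -> Lam u < Lam v.
Proof. by move=> uv; rewrite Lam.unlock ltr_expR ltrN2 ltr_expR ltrN2. Qed.
(** One constant for size and slope, since both enter the error of [lln_cell]. *)
Definition lip_on a b (K : R) f := forall u v : R,
  a <= u <= b -> a <= v <= b -> `|f v| <= K /\ `|f v - f u| <= K * `|v - u|.

Lemma lip_on_der a b K f df : 0 <= K ->
  (forall v, a <= v <= b -> has_der v f (df v)) ->
  (forall v, a <= v <= b -> `|f v| <= K /\ `|df v| <= K) -> lip_on a b K f.
Proof.
move=> K0 hd hb u v hu hv; split; first exact: (hb _ hv).1.
have hm x : Num.min u v <= x <= Num.max u v -> a <= x <= b.
  move=> /andP[h1 h2]; rewrite (le_trans _ h1) ?(le_trans h2)//.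
    by rewrite ge_max; case/andP: hu => _ ->; case/andP: hv.
  by rewrite le_min; case/andP: hu => ->; case/andP: hv.
by apply: mvt_bound => x /hm; [exact: hd | case/hb].
Qed.

(** [phi] is frozen at [a]. The three errors come from freezing in the sample average, from the
    difference of the two distribution functions, and from freezing in the Gumbel integral, which is
    an increment of the antiderivative [Phi]. *)
Lemma lln_cell s a b K eps (phi Phi : R -> R) : a <= b -> 0 <= K ->
  `|ecdf s a - Lam a| <= eps -> `|ecdf s b - Lam b| <= eps ->
  (forall v, a <= v <= b -> has_der v Phi (phi v * lam v)) ->
  lip_on a b K phi ->
  `|avg s (fun v => phi v * ind a b v) - (Phi b - Phi a)| <=
  K * ((b - a) * avg s (ind a b) + (2 * eps + (b - a) ^+ 2)).
Proof.
move=> ab K0 ha hb hd hl.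
have aab : a <= a <= b by rewrite lexx.
have h1 : `|avg s (fun v => phi v * ind a b v) - phi a * avg s (ind a b)| <=
    K * (b - a) * avg s (ind a b).
  rewrite -(avgZ s (phi a)) -(avgZ s (K * (b - a))) -avgB; apply: norm_avg => v _; rewrite -mulrBl.
  rewrite normrM (ger0_norm (ind_ge0 _ _ _)) /ind.
  case: (boolP (a < v <= b)) => [vab|_]; last by rewrite /= !mulr0.
  rewrite !mulr1; have vab' : a <= v <= b by case/andP: vab => /ltW -> ->.
  have := (hl _ _ aab vab').2 => h; apply: (le_trans h); rewrite ler_wpM2l//.
  by case/andP: vab' => av vb; rewrite ger0_norm ?lerD2r// subr_ge0.
have h2 : `|phi a * avg s (ind a b) - phi a * (Lam b - Lam a)| <= K * (2 * eps).
  rewrite -mulrBr; apply: normM_le; first exact: (hl _ _ aab aab).1.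
  rewrite avg_ind//.
  have -> : ecdf s b - ecdf s a - (Lam b - Lam a) =
    (ecdf s b - Lam b) - (ecdf s a - Lam a) by ring.
  by apply: (le_trans (normB_le hb ha)); clear; lra.
have h3 : `|phi a * (Lam b - Lam a) - (Phi b - Phi a)| <= K * (b - a) ^+ 2.
  have hd' x : Num.min a b <= x <= Num.max a b ->
      has_der x (fun v => Phi v - phi a * Lam v) ((phi x - phi a) * lam x).
    rewrite min_l// max_r// => /hd h; have h' := der_Lam x.
    by der; ring.
  have hb' x : Num.min a b <= x <= Num.max a b ->
      `|(phi x - phi a) * lam x| <= K * (b - a).
    rewrite min_l// max_r// => xab; rewrite -[X in _ <= X]mulr1; apply: normM_le.
      apply: (le_trans (hl _ _ aab xab).2); rewrite ler_wpM2l//.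
      by case/andP: xab => ax xb; rewrite ger0_norm ?lerD2r// subr_ge0.
    by rewrite gtr0_norm ?lam_gt0// lam_le1.
  have := mvt_bound hd' hb'; rewrite distrC.
  rewrite (_ : Phi a - _ - _ = phi a * (Lam b - Lam a) - (Phi b - Phi a)); last by ring.
  by rewrite (@ger0_norm _ (b - a)) ?subr_ge0// -mulrA -expr2.
have -> : avg s (fun v => phi v * ind a b v) - (Phi b - Phi a) =
  (avg s (fun v => phi v * ind a b v) - phi a * avg s (ind a b)) +
  (phi a * avg s (ind a b) - phi a * (Lam b - Lam a)) +
  (phi a * (Lam b - Lam a) - (Phi b - Phi a)) by ring.
apply: (le_trans (normD_le (normD_le h1 h2) h3)).
by rewrite le_eqVlt; apply/orP; left; apply/eqP; ring.
Qed.

Lemma lln_grid s a h K eps (phi Phi : R -> R) (N : nat) : 0 <= h -> 0 <= K ->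
  (forall j, (j <= N)%N ->
     `|ecdf s (a + j%:R * h) - Lam (a + j%:R * h)| <= eps) ->
  (forall v, a <= v <= a + N%:R * h -> has_der v Phi (phi v * lam v)) ->
  lip_on a (a + N%:R * h) K phi ->
  `|avg s (fun v => phi v * ind a (a + N%:R * h) v)
     - (Phi (a + N%:R * h) - Phi a)| <=
  K * (h * avg s (ind a (a + N%:R * h)) + N%:R * (2 * eps + h ^+ 2)).
Proof.
move=> h0 K0; elim: N => [|N IH] hc hd hl.
  rewrite mul0r addr0 subrr subr0 mul0r addr0.
  have -> : avg s (fun v => phi v * ind a a v) = 0.
    rewrite (@eq_avg _ _ (fun=> 0 * 0)) ?avgZ ?mul0r// => v _.
    by rewrite /ind lt_le_asym /= !mulr0.
  rewrite normr0; apply: mulr_ge0 => //; apply: mulr_ge0 => //.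
  by apply: avg_ge0 => v _; exact: ind_ge0.
set b := a + N%:R * h in IH; have ab : a <= b by rewrite lerDl mulr_ge0.
have cE : a + N.+1%:R * h = b + h by rewrite /b -natr1; ring.
rewrite cE in hd hl *; have bc : b <= b + h by rewrite lerDl.
have {}IH := IH (fun j jN => hc j (leqW jN))
  (fun v vab => hd v (andb_true_intro (conj (elimTF andP vab).1 (le_trans (elimTF andP vab).2 bc))))
  (fun u v hu hv => hl u v (andb_true_intro (conj (elimTF andP hu).1 (le_trans (elimTF andP hu).2 bc)))
   (andb_true_intro (conj (elimTF andP hv).1 (le_trans (elimTF andP hv).2 bc)))).
have sub v : b <= v <= b + h -> a <= v <= b + h.
  by case/andP=> h1 ->; rewrite (le_trans ab h1).
have hcb : `|ecdf s b - Lam b| <= eps by exact: (hc N (leqnSn N)).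
have hcc : `|ecdf s (b + h) - Lam (b + h)| <= eps by rewrite -cE; exact: hc.
have := lln_cell bc K0 hcb hcc (fun v hv => hd v (sub v hv))
  (fun u v hu hv => hl u v (sub u hu) (sub v hv)).
have bh : b + h - b = h by ring.
rewrite bh => hcell.
rewrite (@eq_avg _ _ (fun v => phi v * ind a b v + phi v * ind b (b + h) v)); last first.
  by move=> v _; rewrite -mulrDr -ind_add.
rewrite avgD (@eq_avg _ (ind a (b + h)) (fun v => ind a b v + ind b (b + h) v)); last first.
  by move=> v _; rewrite -ind_add.
rewrite avgD.
set p := avg s _ in IH *; set q := avg s _ in hcell *.
have -> : p + q - (Phi (b + h) - Phi a) =
  (p - (Phi b - Phi a)) + (q - (Phi (b + h) - Phi b)) by ring.
apply: (le_trans (normD_le IH hcell)); rewrite -natr1.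
by rewrite le_eqVlt; apply/orP; left; apply/eqP; ring.
Qed.

End SampleAverage.

(** * Law of large numbers uniform over Lipschitz functions *)

Section UniformLLN.
Context {R : realType}.

(** Random samples enter only through a filter on finite sequences, later [sampF]: a set belongs to
    it when the sample lies in it with probability tending to one. *)
Definition gumbel_ecdf (F : set_system (seq R)) : Prop := forall t eps : R,
  0 < eps -> \forall s \near F, `|ecdf s t - Lam t| <= eps.

(** The event does not depend on [phi], because only the values of the empirical distribution
    function at finitely many grid points are used. This uniformity allows the parameters to be
    chosen after the sample. *)
Lemma lln (F : set_system (seq R)) {FF : Filter F} (a b eps : R) :
  gumbel_ecdf F -> a < b -> 0 < eps -> \forall s \near F,
  forall K phi Phi, 0 <= K ->
  (forall v, a <= v <= b -> has_der v Phi (phi v * lam v)) ->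
  lip_on a b K phi ->
  `|avg s (fun v => phi v * ind a b v) - (Phi b - Phi a)| <= K * eps.
Proof.
move=> Fcdf ab e0.
(* Freezing costs at most [K * h] in the sample and [K * h * (b - a)] in the integral. [N] makes
   their sum at most [K * eps / 2], and [e'] below does the same for the distribution functions. *)
pose N := (Num.truncn (2 * ((b - a) * (1 + (b - a))) / eps)).+1.
have N0 : 0 < N%:R :> R by rewrite ltr0n.
pose h := (b - a) / N%:R; have h0 : 0 < h by rewrite divr_gt0// subr_gt0.
have hN : N%:R * h = b - a by rewrite /h mulrC divfK// gt_eqF.
have hh : h * (1 + (b - a)) <= eps / 2.
  have : 2 * ((b - a) * (1 + (b - a))) / eps < N%:R by rewrite truncnS_gt.
  rewrite ltr_pdivrMr// => hx.
  rewrite /h mulrAC ler_pdivrMr//; lra.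
pose e' := eps / (4 * N%:R); have e'0 : 0 < e' by rewrite divr_gt0// mulr_gt0.
have hN' : N%:R * (2 * e') = eps / 2 by rewrite /e'; field; rewrite gt_eqF.
have hgrid M : \forall s \near F, forall j, (j <= M)%N ->
    `|ecdf s (a + j%:R * h) - Lam (a + j%:R * h)| <= e'.
  elim: M => [|M IH].
    near=> s => j; rewrite leqn0 => /eqP ->.
    by near: s; exact: Fcdf.
  near=> s.
  have hM : forall j, (j <= M)%N ->
      `|ecdf s (a + j%:R * h) - Lam (a + j%:R * h)| <= e' by near: s; exact: IH.
  have h1 : `|ecdf s (a + M.+1%:R * h) - Lam (a + M.+1%:R * h)| <= e'.
    by near: s; exact: Fcdf.
  by move=> j; rewrite leq_eqVlt => /orP[/eqP->//|]; exact: hM.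
near=> s => K phi Phi K0 hd hl.
have bE : b = a + N%:R * h by rewrite hN; ring.
have := @lln_grid R s a h K e' phi Phi N (ltW h0) K0.
rewrite -bE => /(_ _ hd hl) H; apply: (le_trans (H _)).
  by near: s; exact: hgrid.
rewrite ler_wpM2l// mulrDr hN'.
have -> : N%:R * h ^+ 2 = h * (b - a) by rewrite -hN; ring.
have : h * avg s (ind a b) <= h by rewrite ler_piMr ?avg_le1// ltW.
lra.
Unshelve. all: by end_near. Qed.

End UniformLLN.

(** * The weight against the Gumbel density *)

Section WeightTails.
Context {R : realType}.
Implicit Types (g mu sg x y u v : R).

(** [kap] and [pexp] bound the exponential growth of [Wt g] at plus and minus infinity. [kap g < 1]
    is equivalent to [g > -1/2], and makes [Wt g] integrable against the Gumbel law, whose upper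
    tail is [expR (- v)]. *)
Definition kap g : R := Num.max (- g) 0 + 2^-1.
Definition pexp g : R := 2 * `|g| + 2.

Lemma kap_bounds g : -2^-1 < g -> 0 < kap g < 1.
Proof. by rewrite /kap => h; case: (leP (- g) 0) => h'; apply/andP; split; lra. Qed.

Lemma poly_exp (n : nat) (e t : R) : (0 < n)%N -> 0 < e <= 1 -> 0 <= t ->
  (1 + t) ^+ n <= (n%:R / e) ^+ n * expR (e * t).
Proof.
move=> n0 /andP[e0 e1] t0; have nr : 1 <= n%:R :> R by rewrite ler1n.
have -> : expR (e * t) = expR (e * t / n%:R) ^+ n.
  by rewrite -expRM_natl; congr expR; rewrite mulrCA divff ?mulr1// gt_eqF; lra.
rewrite -exprMn lerXn2r ?nnegrE//; first lra.
  by rewrite mulr_ge0 ?expR_ge0// divr_ge0//; lra.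
apply: (@le_trans _ _ (n%:R / e * (1 + e * t / n%:R))).
  rewrite mulrDr mulr1.
  have -> : n%:R / e * (e * t / n%:R) = t by field; rewrite !gt_eqF//; lra.
  by rewrite lerD2r ler_pdivlMr// mul1r; lra.
by rewrite ler_wpM2l ?expR_ge1Dx// divr_ge0//; lra.
Qed.

(** With [n = max (- g) 0], the factor [(1 + expR (- (g * v))) ^+ 2] grows at most like
    [expR (2 * n * v)] for positive [v]. The rest [e = 1/2 - n] of [kap g = 2 * n + e] pays for the
    polynomial. *)
Lemma Wt_dom g : -2^-1 < g -> exists2 C, 0 < C &
  forall v, Wt g v <= C * (expR (kap g * v) + expR (- (pexp g * v))).
Proof.
move=> hg; pose n : R := Num.max (- g) 0; pose e : R := 2^-1 - n.
have n0 : 0 <= n by rewrite /n le_max lexx orbT.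
have ng : - g <= n by rewrite /n le_max lexx.
have e0 : 0 < e <= 1.
  by rewrite /e /n; case: (leP (- g) 0) => h'; apply/andP; split; lra.
have kE : kap g = 2 * n + e by rewrite /kap -/n /e; lra.
pose C := (7 / e) ^+ 7.
have C0 : 0 < C by rewrite exprn_gt0// divr_gt0//; lra.
exists (8 * C) => [|v]; first by rewrite mulr_gt0.
have hp := @poly_exp 7 e `|v| isT e0 (normr_ge0 v); rewrite -/C in hp.
have key (a b c : R) : 0 <= a -> 0 <= b ->
   expR (- (g * v)) <= expR a -> expR (- v) <= expR b ->
   e * `|v| + 2 * a + b <= c -> Wt g v <= 8 * C * expR c.
  move=> a0 b0 ha hb hc.
  have a1 : 1 <= expR a by rewrite -expR0 ler_expR.
  have b1 : 1 <= expR b by rewrite -expR0 ler_expR.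
  apply: (@le_trans _ _ (C * expR (e * `|v|) * (2 * expR a) ^+ 2 * (2 * expR b))).
    rewrite /Wt; apply: ler_pM.
    - by rewrite mulr_ge0 ?exprn_ge0 ?addr_ge0 ?expR_ge0.
    - by rewrite addr_ge0 ?expR_ge0.
    - apply: ler_pM => //; rewrite ?exprn_ge0 ?addr_ge0 ?expR_ge0//.
      rewrite lerXn2r ?nnegrE// ?addr_ge0 ?expR_ge0 ?mulr_ge0 ?expR_ge0//.
      by clear - a1 ha; lra.
    - by clear - b1 hb; lra.
  have -> : C * expR (e * `|v|) * (2 * expR a) ^+ 2 * (2 * expR b) =
    8 * C * expR (e * `|v| + 2 * a + b).
    by rewrite !expRD expRM_natl; ring.
  by rewrite ler_wpM2l ?ler_expR// mulr_ge0// ltW.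
have [v0|v0] := leP 0 v.
  apply: (@le_trans _ _ (8 * C * expR (kap g * v))).
    apply: (key (n * v) 0) => //; first by rewrite mulr_ge0.
    - by rewrite ler_expR -mulNr ler_wpM2r.
    - by rewrite ler_expR oppr_le0.
    by rewrite kE ger0_norm// addr0; clear; lra.
  by rewrite ler_wpM2l// ?lerDl ?expR_ge0// mulr_ge0// ltW.
apply: (@le_trans _ _ (8 * C * expR (- (pexp g * v)))).
  apply: (key (`|g| * - v) (- v)) => //.
  - by rewrite mulr_ge0//; lra.
  - by lra.
  - rewrite ler_expR -mulrN ler_wpM2r ?ler_norm//; lra.
  - rewrite ltr0_norm// /pexp; case/andP: e0 => _ e1.
    have : e * - v <= 1 * - v by rewrite ler_wpM2r//; lra.
    by clear; lra.
by rewrite ler_wpM2l// ?lerDr ?expR_ge0// mulr_ge0// ltW.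
Qed.

Lemma expR_ge_sqr4 x : 0 <= x -> x ^+ 2 / 4 <= expR x.
Proof. by move=> x0; have := @expR_ge_sqr R x; have h : -2 <= x by [lra]; move=> /(_ h); lra. Qed.

(** Makes the boundary terms [urem * lam] at [V] and [- V] small relative to [D ^+ 2]. *)
Lemma Wt_lam g : -2^-1 < g -> forall e, 0 < e -> exists2 V0, 0 < V0 &
  forall V, V0 <= V -> Wt g V * lam V <= e /\ Wt g (- V) * lam (- V) <= e.
Proof.
move=> hg e e0; have [C C0 hC] := Wt_dom hg; have /andP[k0 k1] := kap_bounds hg.
pose p := pexp g; have p2 : 2 <= p by rewrite /p /pexp; have := normr_ge0 g; lra.
pose a := 1 - kap g; have a0 : 0 < a by rewrite /a; lra.
(* both weights decay like exp(-a V) at worst; 8 C / (a e) makes that small *)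
pose V0 := Num.max (4 * (p + 2)) (2 * C / (a * e)).
exists V0 => [|V]; first by rewrite lt_max; apply/orP; left; lra.
rewrite ge_max => /andP[hV1 hV2].
have V1 : 0 < V by lra.
have hE : expR (- (a * V)) * (2 * C) <= e.
  have h := expR_ge1Dx (a * V); rewrite expRN mulrC.
  rewrite ler_pdivrMr ?expR_gt0//; rewrite ler_pdivrMr in hV2; last by rewrite mulr_gt0.
  have : e * (a * V) <= e * expR (a * V) by rewrite ler_wpM2l//; lra.
  have -> : e * (a * V) = V * (a * e) by ring.
  by clear - hV2; lra.
split.
  apply: le_trans hE; rewrite mulrC.
  apply: (@le_trans _ _ (expR (- V) * (C * (expR (kap g * V) + expR (kap g * V))))).
    apply: ler_pM; rewrite ?(ltW (lam_gt0 _))//.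
    - by rewrite (le_trans _ (Wt_ge1 g V))// mulr_ge0// addr_ge0// expR_ge0.
    - by rewrite lam.unlock ler_piMl ?expR_ge0// expR_le1 oppr_le0 expR_ge0.
    apply: (le_trans (hC V)); rewrite ler_wpM2l ?(ltW C0)// lerD2l ler_expR.
    by clear - k0 V1 p2; have := mulr_gt0 k0 V1; have : 0 <= p * V; rewrite -/p; nra.
  rewrite /a mulrBl mul1r opprB expRD; clear; lra.
apply: le_trans hE; rewrite mulrC.
have -> : lam (- V) = expR (V - expR V).
  by rewrite lam.unlock opprK -expRD addrC.
apply: (@le_trans _ _ (expR (V - expR V) * (C * (expR (p * V) + expR (p * V))))).
  rewrite ler_wpM2l ?expR_ge0//; apply: (le_trans (hC _)).
  rewrite ler_wpM2l ?(ltW C0)// !mulrN opprK lerD2r ler_expR.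
  by clear - k0 V1 p2; have := mulr_gt0 k0 V1; have : 0 <= p * V; rewrite -/p; nra.
have -> : expR (V - expR V) * (C * (expR (p * V) + expR (p * V))) =
  expR (V - expR V + p * V) * (2 * C) by rewrite !expRD; ring.
rewrite ler_wpM2r ?mulr_ge0 ?(ltW C0)// ler_expR.
have h4 := expR_ge_sqr4 (ltW V1).
have : a <= 1 by rewrite /a; lra.
clear - h4 hV1 V1 p2; nra.
Qed.

End WeightTails.

(** * The local inequality *)

Section LocalBound.
Context {R : realType}.
Implicit Types (g mu sg x y u v : R).

Definition nD g0 g mu sg : R := Num.sqrt ((g - g0) ^+ 2 + mu ^+ 2 + (sg - 1) ^+ 2).

Lemma nD_ge0 g0 g mu sg : 0 <= nD g0 g mu sg.
Proof. exact: sqrtr_ge0. Qed.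

Lemma nD_sqr g0 g mu sg :
  nD g0 g mu sg ^+ 2 = (g - g0) ^+ 2 + mu ^+ 2 + (sg - 1) ^+ 2.
Proof. by rewrite sqr_sqrtr// !addr_ge0 ?sqr_ge0. Qed.

Lemma norm_le_nD g0 g mu sg : [/\ `|g - g0| <= nD g0 g mu sg,
  `|mu| <= nD g0 g mu sg & `|sg - 1| <= nD g0 g mu sg].
Proof.
have sq (x : R) : x ^+ 2 <= (g - g0) ^+ 2 + mu ^+ 2 + (sg - 1) ^+ 2 ->
    `|x| <= nD g0 g mu sg.
  by move=> h; rewrite -sqrtr_sqr ler_wsqrtr.
have := sqr_ge0 (g - g0); have := sqr_ge0 mu; have := sqr_ge0 (sg - 1).
by move=> h1 h2 h3; split; apply: sq; clear - h1 h2 h3; lra.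
Qed.

Lemma nD_le g0 g mu sg (c : R) : `|g - g0| <= c -> `|mu| <= c -> `|sg - 1| <= c ->
  nD g0 g mu sg ^+ 2 <= 3 * c ^+ 2.
Proof.
rewrite nD_sqr => /sqr_le_norm h1 /sqr_le_norm h2 /sqr_le_norm h3; lra.
Qed.

Lemma Dg_lip g (B x y : R) : `|x| <= B -> `|y| <= B ->
  `|Dg g y - Dg g x| <= expR (`|g| * B) * `|y - x|.
Proof.
move=> hx hy; apply: mvt_bound => [z _|z hz]; first exact: der_Dg.
rewrite gtr0_norm ?expR_gt0// ler_expR (le_trans (ler_norm _))// normM_le//.
move: hx hy hz; rewrite !ler_norml => /andP[a1 a2] /andP[b1 b2] /andP[h1 h2].
rewrite (le_trans _ h1) ?(le_trans h2)//.
  by rewrite ge_max a2.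
by rewrite le_min a1.
Qed.

(* [del] and [mm] are tied by [mm + g * del = - (g - g0) * v - ln sg], so if
   both are small near [v = 0] and near [v = 1] then so is every parameter *)
Lemma ident_local g0 : exists2 C, 0 < C & forall g mu sg v0 v1 c,
  supp g0 g mu sg v0 -> `|g - g0| <= 2^-1 -> 0 < sg <= 2 ->
  `|v0| <= 4^-1 -> 3 / 4 <= v1 <= 5 / 4 -> c <= 1 ->
  `|del g0 g mu sg v0| <= c -> `|mm g0 g mu sg v0| <= c ->
  `|del g0 g mu sg v1| <= c -> `|mm g0 g mu sg v1| <= c ->
  nD g0 g mu sg ^+ 2 <= C * c ^+ 2.
Proof.
pose G := 1 + `|g0|; have G1 : 1 <= G by rewrite lerDl.
pose E := expR (G * 2); have E0 : 0 < E by exact: expR_gt0.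
pose K := 8 * G * (1 + 2 * E) + 8 * G * E + 2 * E + 8 * G.
have K0 : 0 < K.
  rewrite /K; have : 0 <= G * E by rewrite mulr_ge0// ltW//; lra.
  by clear - G1 E0; lra.
exists (3 * K ^+ 2) => [|g mu sg v0 v1 c hs hg /andP[sg0 sg2] hv0 /andP[v1l v1u] c1].
  by rewrite mulr_gt0// exprn_gt0.
move=> d0 m0 d1 m1; have c0 : 0 <= c := le_trans (normr_ge0 _) d0.
have hgG : `|g| <= G.
  have -> : g = g0 + (g - g0) by ring.
  by rewrite (le_trans (ler_normD _ _))// /G; clear - hg; lra.
have aux v : `|del g0 g mu sg v| <= c -> `|mm g0 g mu sg v| <= c ->
    `|(g - g0) * v + ln sg| <= 2 * G * c.
  move=> hd hm; have -> : (g - g0) * v + ln sg =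
      - (mm g0 g mu sg v + g * del g0 g mu sg v) by rewrite /mm; ring.
  rewrite normrN; apply: (le_trans (normD_le hm (normM_le hgG hd))).
  by clear - G1 c0; nra.
have hw : `|g - g0| <= 8 * G * c.
  have h : `|(g - g0) * (v1 - v0)| <= 4 * G * c.
    have -> : (g - g0) * (v1 - v0) =
      ((g - g0) * v1 + ln sg) - ((g - g0) * v0 + ln sg) by ring.
    by apply: (le_trans (normB_le (aux _ d1 m1) (aux _ d0 m0))); clear; lra.
  have : 2^-1 <= `|v1 - v0|.
    move: hv0; rewrite ler_norml => /andP[_ h0].
    by rewrite ger0_norm; clear - h0 v1l; lra.
  move: h; rewrite normrM => h h2; have := normr_ge0 (g - g0).
  by clear - h h2; nra.
have hln : `|ln sg| <= 4 * G * c.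
  have -> : ln sg = ((g - g0) * v0 + ln sg) - (g - g0) * v0 by ring.
  by apply: (le_trans (normB_le (aux _ d0 m0) (normM_le hw hv0))); clear; lra.
have hsg : `|sg - 1| <= 8 * G * c.
  have h1 := ln_ge sg0; have h2 := ln_le_sub1 sg0.
  have h3 : sg * (1 - sg^-1) <= sg * ln sg by rewrite ler_wpM2l// ltW.
  rewrite mulrBr mulfV ?gt_eqF// mulr1 in h3.
  have h4 := ler_norm (ln sg); have h5 := ler_norm (- ln sg); rewrite normrN in h5.
  have h6 := normr_ge0 (ln sg).
  rewrite ler_norml; apply/andP; split.
    by clear - h2 h5 hln h6; lra.
  have : sg * ln sg <= 2 * `|ln sg|.
    by apply: (le_trans (ler_norm _)); rewrite normM_le// gtr0_norm.
  by clear - h3 hln; lra.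
(* Once shape and scale are controlled, [mu] is recovered from the value of [Uf] at [v0]. *)
pose y := (Dg g0 v0 - mu) / sg.
have yE : y = Dg g (v0 + del g0 g mu sg v0).
  have -> : v0 + del g0 g mu sg v0 = Uf g0 g mu sg v0 by rewrite /del; ring.
  by rewrite ugK.
have muE : mu = (Dg g0 v0 - Dg g v0) - (sg - 1) * Dg g v0
    - sg * (Dg g (v0 + del g0 g mu sg v0) - Dg g v0).
  by rewrite -yE /y; field; rewrite gt_eqF.
have EG : expR (`|g| * 2) <= E by rewrite ler_expR ler_wpM2r.
have hv02 : `|v0| <= 2 by clear - hv0; lra.
have hDg : `|Dg g v0| <= E.
  have h2 : `|0 : R| <= 2 by rewrite normr0.
  have := Dg_lip g h2 hv02; rewrite Dg0r !subr0 => h; apply: (le_trans h).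
  by rewrite -[X in _ <= X]mulr1 ler_pM ?expR_ge0//; clear - hv0; lra.
have hD2 : `|Dg g (v0 + del g0 g mu sg v0) - Dg g v0| <= E * c.
  have h2 : `|v0 + del g0 g mu sg v0| <= 2.
    by apply: (le_trans (normD_le hv0 d0)); clear - c1; lra.
  apply: (le_trans (Dg_lip g hv02 h2)).
  have -> : v0 + del g0 g mu sg v0 - v0 = del g0 g mu sg v0 by ring.
  by rewrite ler_pM ?expR_ge0.
have hDD : `|Dg g v0 - Dg g0 v0| <= 8 * G * c * (1 + 2 * E).
  have hw2 : `|(g - g0) * v0| <= 2^-1.
    by apply: (le_trans (normM_le hg hv0)); clear; lra.
  have h := Dg_taylor hw2.
  have e2 : expR (g0 * v0) <= E.
    rewrite ler_expR (le_trans (ler_norm _))// normM_le//.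
    by rewrite /G lerDr.
  have v3 : `|v0| ^+ 3 <= 4^-1 by rewrite !exprS expr0; have := normr_ge0 v0; clear - hv0; nra.
  have v2 : `|v0| ^+ 2 <= 4^-1 by rewrite expr2; have := normr_ge0 v0; clear - hv0; nra.
  have hq : `|Qg g0 v0| <= 4^-1 * (1 + E).
    apply: (le_trans (Qg_bound _ _)); rewrite ler_pM ?exprn_ge0 ?addr_ge0 ?expR_ge0//.
    by clear - e2; lra.
  have -> : Dg g v0 - Dg g0 v0 = (Dg g v0 - Dg g0 v0 - (g - g0) * Qg g0 v0)
     + (g - g0) * Qg g0 v0 by ring.
  apply: (le_trans (normD_le h (normM_le hw hq))).
  have hh : (g - g0) ^+ 2 <= 8 * G * c * 2^-1.
    rewrite -(ger0_norm (sqr_ge0 _)) normrX expr2; exact: ler_pM.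
  have : `|v0| ^+ 3 * (1 + expR (g0 * v0)) <= 4^-1 * (1 + E).
    rewrite ler_pM ?exprn_ge0 ?addr_ge0 ?expR_ge0//.
    by clear - e2; lra.
  move=> h3; apply: (@le_trans _ _ (2 * (8 * G * c * 2^-1) * (4^-1 * (1 + E)) + 8 * G * c * (4^-1 * (1 + E)))).
    rewrite lerD2r; apply: ler_pM => //; first [exact: ler_wpM2l
      | by apply: mulr_ge0 => //; exact: sqr_ge0
      | by apply: mulr_ge0; rewrite ?exprn_ge0 ?addr_ge0 ?expR_ge0].
  have : 0 <= G * c * E by rewrite !mulr_ge0//; [clear - G1; lra|exact: ltW].
  have : 0 <= G * c by rewrite mulr_ge0//; clear - G1; lra.
  by clear; lra.
have GcE : 0 <= G * c * E by rewrite !mulr_ge0//; [clear - G1; lra|exact: ltW].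
have Gc : 0 <= G * c by rewrite mulr_ge0//; clear - G1; lra.
have Ec : 0 <= E * c by rewrite mulr_ge0// ltW.
have KE : K * c = 8 * G * c * (1 + 2 * E) + 8 * G * c * E + 2 * (E * c) + 8 * G * c.
  by rewrite /K; ring.
have hmu : `|mu| <= K * c.
  rewrite muE; apply: (@le_trans _ _ (8 * G * c * (1 + 2 * E) + 8 * G * c * E + 2 * (E * c))).
    apply: normB_le; first apply: normB_le.
    - by rewrite distrC.
    - exact: normM_le.
    by apply: normM_le => //; rewrite gtr0_norm.
  by rewrite KE; clear - Gc; lra.
have -> : 3 * K ^+ 2 * c ^+ 2 = 3 * (K * c) ^+ 2 by ring.
apply: nD_le => //.
  by rewrite KE; apply: (le_trans hw); clear - GcE Gc Ec; lra.
by rewrite KE; apply: (le_trans hsg); clear - GcE Gc Ec; lra.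
Qed.

Lemma mmE g0 g mu sg v : mm g0 g mu sg v = g0 * v - g * Uf g0 g mu sg v - ln sg.
Proof. by rewrite /mm /del; ring. Qed.

Lemma der_Uf g0 g mu sg v : 0 < sg -> supp g0 g mu sg v ->
  has_der v (Uf g0 g mu sg) (expR (mm g0 g mu sg v)).
Proof.
move=> sg0 hs.
have hf : has_der v (fun v => (Dg g0 v - mu) / sg) (expR (g0 * v) / sg).
  by have h := der_Dg g0 v; der; field; rewrite gt_eqF.
have := @der_ug R g (fun v => (Dg g0 v - mu) / sg) _ v hs hf => h; apply: (der_eq h).
by rewrite mmE !expRB lnK ?posrE// /Uf ug_exp// mulrAC.
Qed.

Lemma der_lin g0 g mu sg v : has_der v (lin g0 g mu sg) (dlin g0 g mu sg v).
Proof.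
have h1 := der_Dg g0 v; have h2 := der_Qg g0 v.
have h3 : expR (- (g0 * v)) * expR (g0 * v) = 1 by rewrite mulrC expRxMexpNx_1.
rewrite /lin /dlin /lin; der.
set k := expR (- (g0 * v)) in h3 *; set l := expR (g0 * v) in h3 *.
transitivity (- (g - g0) * v * (k * l) - g0 * (k * (- (g - g0) * Qg g0 v - mu - (sg - 1) * Dg g0 v))
   - (sg - 1) * (k * l)); first by ring.
by rewrite h3; ring.
Qed.

Lemma der_urem g0 g mu sg v : 0 < sg -> supp g0 g mu sg v ->
  has_der v (urem g0 g mu sg) (durem g0 g mu sg v).
Proof.
move=> sg0 hs; have h1 := der_Uf sg0 hs; have h2 := der_lin g0 g mu sg v.
by rewrite /urem /durem /del; der; ring.
Qed.

Lemma der_mm g0 g mu sg v : 0 < sg -> supp g0 g mu sg v ->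
  has_der v (mm g0 g mu sg) (- (g - g0) - g * (expR (mm g0 g mu sg v) - 1)).
Proof.
move=> sg0 hs; have h1 := der_Uf sg0 hs.
by rewrite {1}/mm /del; der; ring.
Qed.

Lemma der_urem_lam g0 g mu sg v : 0 < sg -> supp g0 g mu sg v ->
  has_der v (fun v => urem g0 g mu sg v * lam v) (tau g0 g mu sg v * lam v).
Proof.
move=> sg0 hs; have h1 := der_urem sg0 hs.
by rewrite lam.unlock /tau; der; ring.
Qed.

Definition dtau g0 g mu sg v : R :=
  - expR (- v) * urem g0 g mu sg v + (expR (- v) - 1) * durem g0 g mu sg v
  + (- 2 * (g - g0) * (expR (mm g0 g mu sg v) - 1)
     - g * (expR (mm g0 g mu sg v) - 1) ^+ 2 - g0 * durem g0 g mu sg v).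

Lemma der_tau g0 g mu sg v : 0 < sg -> supp g0 g mu sg v ->
  has_der v (tau g0 g mu sg) (dtau g0 g mu sg v).
Proof.
move=> sg0 hs; have h1 := der_urem sg0 hs; have h2 := der_mm sg0 hs.
have h3 := der_lin g0 g mu sg v.
have h4 : has_der v (dlin g0 g mu sg) (- (g - g0) - g0 * dlin g0 g mu sg v).
  by rewrite {1}/dlin; der; ring.
have h5 : has_der v (durem g0 g mu sg) (expR (mm g0 g mu sg v) *
    (- (g - g0) - g * (expR (mm g0 g mu sg v) - 1))
    - (- (g - g0) - g0 * dlin g0 g mu sg v)).
  by rewrite {1}/durem; der; ring.
by rewrite {1}/tau /dtau; der; rewrite /durem; ring.
Qed.

End LocalBound.

(** * Quadratic loss near the true parameter *)

Section LocalTheorem.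
Context {R : realType}.
Implicit Types (g mu sg x y u v : R).

Lemma weightS g v (S S' : R) : S <= S' -> weight g v S -> weight g v S'.
Proof. by move=> h [h1 h2 h3 h4 h5 h6]; split; apply: le_trans h. Qed.

Definition bwtV g V : R := (1 + V) ^+ 3 * (1 + expR (`|g| * V)).

Lemma bwt_le g V v : - V <= v <= V -> bwt g v <= bwtV g V.
Proof.
move=> hv; have nv : `|v| <= V by rewrite ler_norml.
rewrite /bwt /bwtV; apply: ler_pM.
- by rewrite exprn_ge0// addr_ge0.
- by rewrite addr_ge0// expR_ge0.
- by rewrite lerXn2r ?nnegrE ?addr_ge0// ?lerD2l// (le_trans _ nv).
by rewrite lerD2l ler_expR (le_trans (ler_norm _))// normrN normM_le.
Qed.

(** A constant of order [D ^+ 2], uniform in the parameters, is what makes the error of [lln]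
    proportional to the squared distance. *)
Lemma tau_lip g0 V : 0 <= V -> exists2 K, 0 < K & forall g mu sg (D : R),
  `|g - g0| <= D -> `|mu| <= D -> `|sg - 1| <= D -> D <= 2^-1 ->
  D * bwtV g0 V <= taylor_radius g0 ->
  (forall v, - V <= v <= V -> supp g0 g mu sg v) /\
  lip_on (- V) V (K * D ^+ 2) (tau g0 g mu sg).
Proof.
move=> V0.
have [G GE] : exists G, G = 1 + `|g0| by exists (1 + `|g0|).
have [B BE] : exists B, B = bwtV g0 V by exists (bwtV g0 V).
have [e eE] : exists e, e = 1 + expR V by exists (1 + expR V).
have G1 : 1 <= G by rewrite GE lerDl.
have e1 : 1 <= e by rewrite eE lerDl expR_ge0.
have B1 : 1 <= B.
  by rewrite BE (le_trans (bwt_ge1 g0 0))// bwt_le// oppr_le0 V0.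
have [G0 B0 e0] : [/\ 0 < G, 0 < B & 0 < e].
  by split; [clear - G1|clear - B1|clear - e1]; lra.
have [k kE] : exists k : R, k = 2000 by exists 2000.
have k0 : 0 < k by rewrite kE ltr0n.
have K0 : 0 < k * G ^+ 3 * B ^+ 2 * e.
  by rewrite mulr_gt0// mulr_gt0 ?exprn_gt0// mulr_gt0 ?exprn_gt0.
exists (k * G ^+ 3 * B ^+ 2 * e) => //.
move=> g mu sg D hg hmu hsg D2 hD.
have D0 : 0 <= D := le_trans (normr_ge0 _) hg.
have sg0 : 0 < sg by move: hsg; rewrite ler_norml => /andP[h _]; clear - h D2; lra.
have hT v : - V <= v <= V -> _ := fun hv =>
  Uf_taylor (weightS (bwt_le g0 hv) (weight_bwt g0 v)) hg hmu hsg hD.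
have hS v : - V <= v <= V -> supp g0 g mu sg v by case/hT.
split => //; apply: (lip_on_der (df := dtau g0 g mu sg)).
- by rewrite mulr_ge0 ?sqr_ge0// ltW.
- by move=> v hv; apply: der_tau => //; exact: hS.
move=> v hv; have [_ _ hm hr hdr] := hT v hv.
have [_ ht _ _] := rho_parts (weightS (bwt_le g0 hv) (weight_bwt g0 v)) hg hmu hsg hD.
have ev : expR (- v) <= expR V.
  by rewrite ler_expR; case/andP: hv => h _; clear - h; lra.
have hgG : `|g| <= G.
  have -> : g = g0 + (g - g0) by ring.
  by rewrite (le_trans (ler_normD _ _))// GE; clear - hg D2; lra.
move: hm hr hdr ht hD; rewrite /taylor_radius /dtau -BE -GE.
set m := mm _ _ _ _ _; set r := urem _ _ _ _ _; set dr := durem _ _ _ _ _.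
have [d dE] : exists d, d = D * B by exists (D * B).
rewrite -dE => hm hr hdr ht hD.
have d0 : 0 <= d by rewrite dE mulr_ge0//; clear - B1; lra.
have dG : d * (128 * G) <= 1.
  by rewrite -ler_pdivlMr ?mul1r//; clear - G1; nra.
have hmh : `|m| <= 2^-1 by clear - hm dG; lra.
have hd1 : `|expR m - 1| <= 24 * G * d.
  by apply: (le_trans (expR_sub1_bound hmh)); clear - hm; lra.
have KE : k * G ^+ 3 * B ^+ 2 * e * D ^+ 2 = 2000 * (G ^+ 3 * d ^+ 2 * e).
  by rewrite dE kE; ring.
have p0 : 0 <= d ^+ 2 by exact: sqr_ge0.
have G2 : G <= G ^+ 2 by rewrite expr2 ler_peMr//; clear - G1; lra.
have G3 : G ^+ 2 <= G ^+ 3 by rewrite ler_weXn2l.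
have Gp : G ^+ 2 * d ^+ 2 <= G ^+ 3 * d ^+ 2 by rewrite ler_wpM2r.
have Gp1 : G * d ^+ 2 <= G ^+ 3 * d ^+ 2 by rewrite ler_wpM2r// (le_trans G2).
have G0p : 0 <= G ^+ 3 * d ^+ 2 by rewrite mulr_ge0 ?exprn_ge0//; clear - G1; lra.
have Ge : G ^+ 3 * d ^+ 2 <= G ^+ 3 * d ^+ 2 * e by rewrite ler_peMr.
have ee : expR (- v) <= e by rewrite (le_trans ev)// eE lerDr.
rewrite KE; split.
  apply: (le_trans ht).
  have : G ^+ 2 * d ^+ 2 * (1 + expR (- v)) <= G ^+ 3 * d ^+ 2 * e.
    have he : 1 + expR (- v) <= e by rewrite eE lerD2l.
    have p1 : 0 <= G ^+ 2 * d ^+ 2 by rewrite mulr_ge0 ?sqr_ge0.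
    have p2 : 0 <= 1 + expR (- v) by rewrite addr_ge0// expR_ge0.
    exact: ler_pM.
  by clear - G0p Ge; lra.
have De : D <= d by rewrite dE ler_peMr.
apply: (@le_trans _ _ (e * (157 * G * d ^+ 2) + e * (456 * G ^+ 2 * d ^+ 2) +
   (2 * d * (24 * G * d) + G * (24 * G * d) ^+ 2 + G * (456 * G ^+ 2 * d ^+ 2)))).
  apply: normD_le; first apply: normD_le.
  - by apply: normM_le => //; rewrite normrN gtr0_norm ?expR_gt0.
  - apply: normM_le => //; rewrite (le_trans (ler_normB _ _))// normr1 gtr0_norm ?expR_gt0//.
    by rewrite eE addrC lerD2l.
  apply: normB_le; first apply: normB_le.
  - apply: normM_le => //; apply: normM_le; first by rewrite normrN normr_nat.
    exact: le_trans De.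
  - by apply: normM_le => //; rewrite !expr2; exact: normM_le.
  by apply: normM_le => //; rewrite GE lerDr.
have h1 : G * d ^+ 2 * e <= G ^+ 3 * d ^+ 2 * e by rewrite ler_wpM2r//; clear - e1; lra.
have h2 : G ^+ 2 * d ^+ 2 * e <= G ^+ 3 * d ^+ 2 * e by rewrite ler_wpM2r//; clear - e1; lra.
by clear - h1 h2 Ge Gp1 G0p; lra.
Qed.

Definition small_tails g (F : set_system (seq R)) : Prop := forall eps : R,
  0 < eps -> exists V0 : R, forall V, V0 <= V ->
  \forall s \near F, avg s (fun v => Wt g v * (1 - ind (- V) V v)) <= eps.

Lemma freq_ge (F : set_system (seq R)) {FF : Filter F} a b :
  gumbel_ecdf F -> a < b ->
  \forall s \near F, (Lam b - Lam a) / 2 <= avg s (ind a b).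
Proof.
move=> Fcdf ab; have p : 0 < (Lam b - Lam a) / 4 by rewrite divr_gt0// subr_gt0 Lam_lt.
apply: filterS2 (Fcdf a _ p) (Fcdf b _ p) => s /ler_normlP[h1 h2] /ler_normlP[h3 h4].
rewrite (avg_ind s (ltW ab)).
by clear - h1 h2 h3 h4; lra.
Qed.

(** On [[- V, V]] the average of [tau] is, by [lln], a boundary term. The gain is at least of order
    [D ^+ 2] throughout one of two test intervals, around 0 and around 1, each holding a fixed share
    of the sample. Outside [[- V, V]] the upper bound [rho_le] and the small tails apply. *)
Lemma local_bound (F : set_system (seq R)) {FF : Filter F} g0 :
  -2^-1 < g0 -> gumbel_ecdf F -> small_tails g0 F -> exists eps c : R, [/\ 0 < eps, 0 < c &
  \forall s \near F, forall g mu sg, -2^-1 < g -> nD g0 g mu sg < eps ->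
    avg s (rho g0 g mu sg) <= - (c * nD g0 g mu sg ^+ 2)].
Proof.
move=> g0_gt Fcdf Ftail; have [C C0 hC] := ident_local g0.
pose G := 1 + `|g0|; have G1 : 1 <= G by rewrite lerDl.
pose p : R := Num.min ((Lam 4^-1 - Lam (- 4^-1)) / 2) ((Lam (5 / 4) - Lam (3 / 4)) / 2).
have hL1 : Lam (- 4^-1) < Lam (4^-1 : R) by apply: Lam_lt; clear; lra.
have hL2 : Lam (3 / 4) < Lam (5 / 4 : R) by apply: Lam_lt; clear; lra.
have p0 : 0 < p.
  by rewrite lt_min; apply/andP; split; apply: divr_gt0 => //; rewrite subr_gt0.
pose q : R := expR (- 2); have q0 : 0 < q by exact: expR_gt0.
have q1 : q <= 1 by rewrite expR_le1; clear; lra.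
(* The gain is at least [4 * c * D ^+ 2]. The tail, the error of [lln] and the pair of boundary
   terms cost [c * D ^+ 2] each, so that [c * D ^+ 2] remains. *)
pose c := p * q / (32 * C); have c0 : 0 < c by rewrite divr_gt0// mulr_gt0.
have c4 : 4 * c = p * (q / (8 * C)) by rewrite /c; field; rewrite gt_eqF.
have [V1 V10 hV1] := Wt_lam g0_gt (divr_gt0 c0 (mulr_gt0 (ltr0n R 314) (lt_le_trans ltr01 G1))).
have rc0 : 0 < rho_const g0.
  by rewrite /rho_const -/G mulr_gt0// exprn_gt0//; clear - G1; lra.
have [V2 hV2] := Ftail _ (divr_gt0 c0 rc0).
pose V : R := Num.max 2 (Num.max V1 V2).
have [Vge2 VgeV1 VgeV2] : [/\ 2 <= V, V1 <= V & V2 <= V].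
  by rewrite /V !le_max !lexx !orbT.
have V0 : 0 < V by clear - Vge2; lra.
have [K K0 hK] := tau_lip g0 (ltW V0).
pose Bv := bwtV g0 V.
have B1 : 1 <= Bv.
  by rewrite (le_trans (bwt_ge1 g0 0))// bwt_le// oppr_le0 ltW.
have rad0 : 0 < taylor_radius g0 by rewrite invr_gt0 mulr_gt0// -/G; clear - G1; lra.
pose eps := Num.min 2^-1 (taylor_radius g0 / Bv).
have eps0 : 0 < eps.
  by rewrite lt_min divr_gt0 ?invr_gt0//; clear - B1; lra.
exists eps, c; split => //.
have mVV : - V < V by clear - V0; lra.
near=> s => g mu sg hg hD.
have [hdg hmu hsg] := norm_le_nD g0 g mu sg; have D0 := nD_ge0 g0 g mu sg.
move: hD hdg hmu hsg D0; set D := nD _ _ _ _ => hD hdg hmu hsg D0.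
move: hD; rewrite lt_min => /andP[D2 DB].
have DB' : D * Bv <= taylor_radius g0.
  by rewrite -ler_pdivlMr ?ltW//; clear - B1; lra.
have [hS hL] := hK _ _ _ _ hdg hmu hsg (ltW D2) DB'.
have sgp : 0 < sg <= 2.
  move: hsg; rewrite ler_norml => /andP[h1 h2]; clear - h1 h2 D2.
  by apply/andP; split; lra.
have sg0 : 0 < sg by case/andP: sgp.
have hT v : - V <= v <= V -> _ := fun hv =>
  Uf_taylor (weightS (bwt_le g0 hv) (weight_bwt g0 v)) hdg hmu hsg DB'.
have hP v : - V <= v <= V -> _ := fun hv =>
  rho_parts (weightS (bwt_le g0 hv) (weight_bwt g0 v)) hdg hmu hsg DB'.
pose gain v := expR (- v) * (expR (- del g0 g mu sg v) - 1 + del g0 g mu sg v)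
  + (expR (mm g0 g mu sg v) - 1 - mm g0 g mu sg v).
have gain_ge0 v : - V <= v <= V -> 0 <= gain v.
  by case/hP => _ _ /andP[h1 _] /andP[h2 _]; rewrite addr_ge0.
have small v : - V <= v <= V -> `|del g0 g mu sg v| <= 2^-1 /\ `|mm g0 g mu sg v| <= 2^-1.
  case/hT => _ h1 h2 _ _.
  have dG : D * Bv * (128 * G) <= 1.
    by rewrite -ler_pdivlMr ?mul1r//; clear - G1; nra.
  have d0 : 0 <= D * Bv by rewrite mulr_ge0//; clear - B1; lra.
  have d1 : D * Bv * 128 <= 1 by clear - dG d0 G1; nra.
  move: h1 h2; rewrite -/G -/Bv => h1 h2; split.
    by clear - h1 d1 d0; lra.
  by clear - h2 dG; lra.
have gain_ge v : - 2 <= v <= 2 -> q / 4 * (del g0 g mu sg v ^+ 2 + mm g0 g mu sg v ^+ 2) <= gain v.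
  move=> /andP[v1 v2]; have hv : - V <= v <= V by clear - v1 v2 Vge2; apply/andP; split; lra.
  have [] := small v hv; rewrite !ler_norml => /andP[a1 a2] /andP[b1 b2].
  have h1 := @expR_ge_sqr R (- del g0 g mu sg v).
  have h2 := @expR_ge_sqr R (mm g0 g mu sg v).
  have {h1} h1 : del g0 g mu sg v ^+ 2 / 4 <= expR (- del g0 g mu sg v) - 1 + del g0 g mu sg v.
    have := h1; rewrite sqrrN => h; have h' : -2 <= - del g0 g mu sg v by clear - a2; lra.
    by have := h h'; clear; lra.
  have {h2} h2 : mm g0 g mu sg v ^+ 2 / 4 <= expR (mm g0 g mu sg v) - 1 - mm g0 g mu sg v.
    have h' : -2 <= mm g0 g mu sg v by clear - b1; lra.
    by have := h2 h'; clear; lra.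
  have hq : q <= expR (- v) by rewrite ler_expR; clear - v2; lra.
  have e1 : q * (del g0 g mu sg v ^+ 2 / 4) <=
      expR (- v) * (expR (- del g0 g mu sg v) - 1 + del g0 g mu sg v).
    by rewrite ler_pM ?divr_ge0 ?sqr_ge0// ltW.
  have e2 : q * (mm g0 g mu sg v ^+ 2 / 4) <= mm g0 g mu sg v ^+ 2 / 4.
    by rewrite ler_piMl// divr_ge0 ?sqr_ge0.
  by rewrite /gain; clear - e1 e2 h2; lra.
(* some test interval on which the gain is at least q D^2 / (8 C) *)
have [a [b [ab [hab [hfreq hgain]]]]] : exists a b : R, a <= b /\ (- 2 <= a /\ b <= 2) /\
   p <= avg s (ind a b) /\
   forall v, a < v <= b -> q / (8 * C) * D ^+ 2 <= gain v.
  have hf0 : p <= avg s (ind (- 4^-1) 4^-1).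
    apply: (@le_trans _ _ ((Lam 4^-1 - Lam (- 4^-1)) / 2)).
      by rewrite /p ge_min lexx.
    by near: s; apply: freq_ge => //; clear; lra.
  have hf1 : p <= avg s (ind (3 / 4) (5 / 4)).
    apply: (@le_trans _ _ ((Lam (5 / 4) - Lam (3 / 4)) / 2)).
      by rewrite /p ge_min lexx orbT.
    by near: s; apply: freq_ge => //; clear; lra.
  pose P v := q / (8 * C) * D ^+ 2 <= gain v.
  have [h|] := pselect (forall v, - 4^-1 < v <= 4^-1 -> P v).
    by exists (- 4^-1), 4^-1; repeat split => //; clear; lra.
  move=> /existsNP[v0 /not_implyP[/andP[v0l v0u] /negP]]; rewrite -ltNge => hv0.
  have [h|] := pselect (forall v, 3 / 4 < v <= 5 / 4 -> P v).
    by exists (3 / 4), (5 / 4); repeat split => //; clear; lra.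
  move=> /existsNP[v1 /not_implyP[/andP[v1l v1u] /negP]]; rewrite -ltNge => hv1.
  exfalso.
  have g0' := gain_ge v0; have g1' := gain_ge v1.
  have {g0'} g0' : q / 4 * (del g0 g mu sg v0 ^+ 2 + mm g0 g mu sg v0 ^+ 2) < q / (8 * C) * D ^+ 2.
    by apply: le_lt_trans hv0; apply: g0'; clear - v0l v0u; apply/andP; split; lra.
  have {g1'} g1' : q / 4 * (del g0 g mu sg v1 ^+ 2 + mm g0 g mu sg v1 ^+ 2) < q / (8 * C) * D ^+ 2.
    by apply: le_lt_trans hv1; apply: g1'; clear - v1l v1u; apply/andP; split; lra.
  (* If the gain is too small at a point of each interval, [del] and [mm] are at most [cc] at both,
     and [ident_local] gives [D ^+ 2 <= D ^+ 2 / 2]. When [cc > 1] the bound [1/2] is used in its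
     place, and the result contradicts [D ^+ 2 > 2 * C]. *)
  pose cc := Num.sqrt (D ^+ 2 / (2 * C)).
  have cc2 : cc ^+ 2 = D ^+ 2 / (2 * C).
    by rewrite sqr_sqrtr// divr_ge0 ?sqr_ge0// mulr_ge0// ltW.
  have small2 x y : q / 4 * (x ^+ 2 + y ^+ 2) < q / (8 * C) * D ^+ 2 ->
      `|x| <= cc /\ `|y| <= cc.
    have -> : q / (8 * C) * D ^+ 2 = q / 4 * (D ^+ 2 / (2 * C)).
      by field; rewrite gt_eqF.
    rewrite ltr_pM2l ?divr_gt0// -cc2 => h.
    by split; rewrite -sqrtr_sqr -[cc]ger0_norm ?sqrtr_ge0// -sqrtr_sqr ler_wsqrtr//;
      have := sqr_ge0 x; have := sqr_ge0 y; clear - h; lra.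
  have [x0 y0] := small2 _ _ g0'; have [x1 y1] := small2 _ _ g1'.
  have v0V : - V <= v0 <= V by clear - v0l v0u Vge2; apply/andP; split; lra.
  have hv0n : `|v0| <= 4^-1 by rewrite ler_norml; clear - v0l v0u; apply/andP; split; lra.
  have hv1n : 3 / 4 <= v1 <= 5 / 4 by rewrite ltW.
  have hdg2 : `|g - g0| <= 2^-1 by clear - hdg D2; lra.
  have [c1|c1] := leP cc 1.
    have := hC _ _ _ _ _ _ (hS _ v0V) hdg2 sgp hv0n hv1n c1 x0 y0 x1 y1.
    rewrite -/D cc2; have -> : C * (D ^+ 2 / (2 * C)) = D ^+ 2 / 2.
      by field; rewrite gt_eqF.
    move=> hh; have D20 : D ^+ 2 <= 0 by clear - hh; lra.
    have D2e : D ^+ 2 = 0 by apply/eqP; rewrite eq_le D20 sqr_ge0.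
    move: g0'; rewrite D2e mulr0 ltNge => /negP; apply.
    by rewrite mulr_ge0 ?addr_ge0 ?sqr_ge0// divr_ge0// ltW.
  have [s1 s2] := small v0 v0V.
  have v1V : - V <= v1 <= V by clear - v1l v1u Vge2; apply/andP; split; lra.
  have [s3 s4] := small v1 v1V.
  have hh := hC _ _ _ _ _ _ (hS _ v0V) hdg2 sgp hv0n hv1n _ s1 s2 s3 s4.
  have {hh} : D ^+ 2 <= C * 2^-1 ^+ 2 by apply: hh; clear; lra.
  have : 1 < D ^+ 2 / (2 * C).
    by rewrite -cc2 exprn_egt1// ltW.
  rewrite ltr_pdivlMr ?mulr_gt0// mul1r => u1 u2.
  by clear - u1 u2 C0; lra.
pose J v := ind a b v.
have hpt v : v \in s -> rho g0 g mu sg v <= tau g0 g mu sg v * ind (- V) V v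
   - q / (8 * C) * D ^+ 2 * J v + rho_const g0 * D ^+ 2 * (Wt g0 v * (1 - ind (- V) V v)).
  move=> _; have [hv|hv] := boolP (- V < v <= V).
    have hv' : - V <= v <= V by case/andP: hv => /ltW -> ->.
    have -> : ind (- V) V v = 1 by rewrite /ind hv.
    rewrite subrr !mulr0 addr0 mulr1 rhoE -[X in X <= _]addrA lerD2l -opprD lerN2 -/(gain v).
    rewrite /J /ind; case: (boolP (a < v <= b)) => [vab|_].
      by rewrite mulr1 hgain.
    by rewrite mulr0 gain_ge0.
  have -> : ind (- V) V v = 0 by rewrite /ind (negbTE hv).
  have -> : J v = 0.
    rewrite /J /ind; case: (boolP (a < v <= b)) => [/andP[va vb]|//].
    case/negP: hv; case: hab => h1 h2; clear - va vb h1 h2 Vge2.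
    by apply/andP; split; lra.
  rewrite !mulr0 subr0 add0r subr0 mulr1.
  by apply: rho_le => //; rewrite ltW.
apply: (le_trans (le_avg hpt)).
rewrite avgD avgB (avgZ _ (q / (8 * C) * D ^+ 2)) (avgZ _ (rho_const g0 * D ^+ 2)).
have D20 : 0 <= D ^+ 2 by exact: sqr_ge0.
have t1 : rho_const g0 * D ^+ 2 * avg s (fun v => Wt g0 v * (1 - ind (- V) V v)) <= c * D ^+ 2.
  have -> : c * D ^+ 2 = rho_const g0 * D ^+ 2 * (c / rho_const g0).
    by field; rewrite gt_eqF.
  rewrite ler_wpM2l ?mulr_ge0 ?(ltW rc0)//.
  by near: s; exact: hV2.
have t2 : 4 * c * D ^+ 2 <= q / (8 * C) * D ^+ 2 * avg s J.
  rewrite c4 -mulrA mulrC ler_wpM2l//.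
  by rewrite mulr_ge0// divr_ge0 ?mulr_ge0// ltW.
have t3 : `|avg s (fun v => tau g0 g mu sg v * ind (- V) V v)
    - (urem g0 g mu sg V * lam V - urem g0 g mu sg (- V) * lam (- V))| <= c * D ^+ 2.
  have -> : c * D ^+ 2 = K * D ^+ 2 * (c / K) by field; rewrite gt_eqF.
  have hlln : forall K' phi Phi, 0 <= K' ->
      (forall v, - V <= v <= V -> has_der v Phi (phi v * lam v)) ->
      lip_on (- V) V K' phi ->
      `|avg s (fun v => phi v * ind (- V) V v) - (Phi V - Phi (- V))| <= K' * (c / K).
    by near: s; apply: lln => //; rewrite divr_gt0.
  apply: (hlln _ (tau g0 g mu sg) (fun v => urem g0 g mu sg v * lam v)) => //.
    by rewrite mulr_ge0// ltW.
  by move=> v hv; apply: der_urem_lam => //; exact: hS.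
have bd v : - V <= v <= V -> Wt g0 v * lam v <= c / (314 * G) ->
    `|urem g0 g mu sg v * lam v| <= c / 2 * D ^+ 2.
  move=> hv hw; have hdv : D * bwt g0 v <= taylor_radius g0.
    by apply: le_trans DB'; rewrite ler_wpM2l// bwt_le.
  have [_ _ _ hr _] := Uf_taylor (weight_bwt g0 v) hdg hmu hsg hdv.
  rewrite normrM (gtr0_norm (lam_gt0 _)).
  apply: (@le_trans _ _ (157 * G * D ^+ 2 * (Wt g0 v * lam v))).
    rewrite [X in _ <= X]mulrA ler_wpM2r ?(ltW (lam_gt0 _))//; apply: (le_trans hr).
    have -> : 157 * (1 + `|g0|) * (D * bwt g0 v) ^+ 2 = 157 * G * D ^+ 2 * bwt g0 v ^+ 2.
      by rewrite /G; ring.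
    rewrite ler_wpM2l ?mulr_ge0//; first by clear - G1; lra.
    rewrite -Wt_ge ler_peMl ?sqr_ge0//.
    by rewrite mulr_ege1// ?lerDl ?expR_ge0.
  have -> : c / 2 * D ^+ 2 = 157 * G * D ^+ 2 * (c / (314 * G)).
    by field; rewrite gt_eqF//; clear - G1; lra.
  by rewrite ler_wpM2l ?mulr_ge0//; clear - G1; lra.
have [w1 w2] := hV1 V VgeV1.
have VV1 : - V <= V <= V by rewrite lexx ltW.
have VV2 : - V <= - V <= V by rewrite lexx ltW.
have b1 := bd _ VV1 w1; have b2 := bd _ VV2 w2.
have b3 := ler_norm (urem g0 g mu sg V * lam V).
have b4 := ler_norm (- (urem g0 g mu sg (- V) * lam (- V))); rewrite normrN in b4.
have t4 := le_trans (ler_norm _) t3.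
clear - t1 t2 t4 b1 b2 b3 b4; lra.
Unshelve. all: by end_near. Qed.

End LocalTheorem.

(** * The global inequality *)

Section Hellinger.
Context {R : realType}.
Implicit Types (g mu sg x y u v : R).

Lemma expR_sub1_le x : `|expR x - 1| <= `|x| * expR `|x|.
Proof.
have h (y : R) : expR y - 1 <= y * expR y.
  have := expR_ge1Dx (- y); rewrite expRN => e1.
  have e0 := expR_gt0 y.
  have : (1 + - y) * expR y <= (expR y)^-1 * expR y by rewrite ler_pM2r.
  by rewrite mulVf ?gt_eqF//; clear; lra.
have [x0|x0] := leP 0 x.
  by rewrite !ger0_norm// subr_ge0 -expR0 ler_expR.
rewrite (ltr0_norm x0) ltr0_norm ?subr_lt0 ?expR_lt1//.
have h1 := expR_ge1Dx x; have h2 := expR_ge1Dx (- x).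
have : - x * 1 <= - x * expR (- x).
  by rewrite ler_wpM2l//; clear - x0 h2; lra.
by clear - h1; lra.
Qed.

Lemma Dg_lip_param g g0 v :
  `|Dg g v - Dg g0 v| <= `|g - g0| * (`|v| ^+ 2 * expR ((`|g - g0| + `|g0|) * `|v|)).
Proof.
have hd x : has_der x (fun v => Dg g v - Dg g0 v) (expR (g * x) - expR (g0 * x)).
  by have h1 := der_Dg g x; have h2 := der_Dg g0 x; der.
have hb x : Num.min 0 v <= x <= Num.max 0 v ->
    `|expR (g * x) - expR (g0 * x)| <=
    `|g - g0| * `|v| * expR ((`|g - g0| + `|g0|) * `|v|).
  move=> /(expR_between 0)[xv _].
  have -> : expR (g * x) - expR (g0 * x) = (expR ((g - g0) * x) - 1) * expR (g0 * x).
    by rewrite mulrBl mul1r -expRD; congr (expR _ - _); ring.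
  have hx : `|(g - g0) * x| <= `|g - g0| * `|v| by exact: normM_le.
  rewrite (mulrDl _ _ `|v|) expRD [X in _ <= X]mulrA; apply: normM_le.
    apply: (le_trans (expR_sub1_le _)).
    by rewrite ler_pM ?expR_ge0// ler_expR.
  by rewrite gtr0_norm ?expR_gt0// ler_expR (le_trans (ler_norm _))// normM_le.
have := mvt_bound (fun x _ => hd x) hb.
rewrite !Dg0r !subr0 => h; apply: (le_trans h).
by rewrite le_eqVlt; apply/orP; left; apply/eqP; ring.
Qed.

(* three values of [Uf] determine the parameter; [Dg g (-1) = - e^-g Dg g 1]
   isolates the shape parameter *)
Lemma ident_global g0 (Gam S : R) : 0 <= Gam -> 0 < S ->
  exists2 C, 0 < C & forall g mu sg c, `|g| <= Gam -> 0 < sg <= S -> 0 <= c <= 1 ->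
  supp g0 g mu sg (-1) -> supp g0 g mu sg 0 -> supp g0 g mu sg 1 ->
  `|del g0 g mu sg (-1)| <= c -> `|del g0 g mu sg 0| <= c ->
  `|del g0 g mu sg 1| <= c -> nD g0 g mu sg ^+ 2 <= C * c ^+ 2.
Proof.
move=> Gam0 S0.
have [E EE] : exists E, E = expR ((Gam + `|g0|) * 2) by exists (expR ((Gam + `|g0|) * 2)).
have E0 : 0 < E by rewrite EE expR_gt0.
have E1 : 1 <= E by rewrite EE -expR0 ler_expR mulr_ge0// addr_ge0.
have d0 : 0 < Dg g0 1 by exact: Dg_gt0.
have [d dE] : exists d, d = Dg g0 1 by exists (Dg g0 1).
rewrite -dE in d0.
have [k kE] : exists k, k = (1 + E) * (2 * S * E) * E / d by exists ((1 + E) * (2 * S * E) * E / d).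
have k0 : 0 < k.
  by rewrite kE divr_gt0// !mulr_gt0// addr_gt0.
pose K := k + S * E + (2 * S * E + k * (E * E)) * E.
have SE0 : 0 < S * E by rewrite mulr_gt0.
have K0 : 0 < K.
  by rewrite /K !addr_gt0// mulr_gt0// addr_gt0 ?mulr_gt0.
exists (3 * K ^+ 2) => [|g mu sg c hg /andP[sg0 sgS] /andP[c0 c1] hs1 hs2 hs3 h1 h2 h3].
  by rewrite mulr_gt0// exprn_gt0.
have Eg : expR (`|g| * 2) <= E.
  by rewrite EE ler_expR ler_wpM2r// (le_trans hg)// lerDl.
have uK v : supp g0 g mu sg v ->
    Dg g0 v - mu = sg * Dg g (v + del g0 g mu sg v).
  move=> hs; have -> : v + del g0 g mu sg v = Uf g0 g mu sg v by rewrite /del; ring.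
  by rewrite /Uf ugK// mulrC divfK// gt_eqF.
have lip v : `|v| <= 1 -> `|del g0 g mu sg v| <= c ->
    `|sg * Dg g (v + del g0 g mu sg v) - sg * Dg g v| <= S * (E * c).
  move=> hv hd; rewrite -mulrBr; apply: normM_le; first by rewrite gtr0_norm.
  have hv2 : `|v| <= 2 by clear - hv; lra.
  have hv3 : `|v + del g0 g mu sg v| <= 2.
    by apply: (le_trans (normD_le hv hd)); clear - c1; lra.
  apply: (le_trans (Dg_lip g hv2 hv3)).
  have -> : v + del g0 g mu sg v - v = del g0 g mu sg v by ring.
  by rewrite ler_pM ?expR_ge0.
have n1 : `|1 : R| <= 1 by rewrite normr1.
have n0 : `|0 : R| <= 1 by rewrite normr0.
have nm1 : `|-1 : R| <= 1 by rewrite normrN normr1.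
have l1 := lip _ n1 h3; have l0 := lip _ n0 h2; have lm := lip _ nm1 h1.
rewrite -(uK _ hs3) in l1; rewrite -(uK _ hs1) in lm.
rewrite -(uK _ hs2) !Dg0r sub0r mulr0 subr0 in l0.
have hmu : `|mu| <= S * (E * c) by rewrite -normrN.
have e1 : `|Dg g0 1 - sg * Dg g 1| <= 2 * S * E * c.
  have -> : Dg g0 1 - sg * Dg g 1 = (Dg g0 1 - mu - sg * Dg g 1) - - mu by ring.
  by apply: (le_trans (normB_le l1 l0)); clear; lra.
have em : `|Dg g0 (-1) - sg * Dg g (-1)| <= 2 * S * E * c.
  have -> : Dg g0 (-1) - sg * Dg g (-1) = (Dg g0 (-1) - mu - sg * Dg g (-1)) - - mu by ring.
  by apply: (le_trans (normB_le lm l0)); clear; lra.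
have eg : expR g <= E.
  apply: le_trans Eg; rewrite ler_expR (le_trans (ler_norm _))//.
  by rewrite ler_peMr// ler1n.
have eg0 := expR_gt0 g.
have ew : `|sg * Dg g 1 - expR (g - g0) * d| <= E * (2 * S * E * c).
  have -> : sg * Dg g 1 - expR (g - g0) * d = expR g * (Dg g0 (-1) - sg * Dg g (-1)).
    rewrite !DgN !mulr1 dE expRB !expRN.
    by field; rewrite !gt_eqF ?expR_gt0.
  by apply: normM_le => //; rewrite gtr0_norm.
have hx : `|expR (g - g0) - 1| * d <= (1 + E) * (2 * S * E) * c.
  rewrite -[X in _ * X <= _](gtr0_norm d0) -normrM.
  have -> : (expR (g - g0) - 1) * d =
    - (sg * Dg g 1 - expR (g - g0) * d) - (Dg g0 1 - sg * Dg g 1) by rewrite -dE; ring.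
  by rewrite -normrN in ew; apply: (le_trans (normB_le ew e1)); clear; lra.
have hgg : `|g - g0| <= Gam + `|g0|.
  by apply: (le_trans (ler_normB _ _)); rewrite lerD2r.
have hxe : `|g - g0| <= `|expR (g - g0) - 1| * E.
  have [x0|x0] := leP 0 (g - g0).
    have p := expR_ge1Dx (g - g0); rewrite !ger0_norm//; last by clear - p x0; lra.
    have : (expR (g - g0) - 1) * 1 <= (expR (g - g0) - 1) * E.
      by rewrite ler_wpM2l//; clear - p x0; lra.
    by clear - p; lra.
  rewrite (ltr0_norm x0) ltr0_norm ?subr_lt0 ?expR_lt1//.
  have p := expR_ge1Dx (- (g - g0)); rewrite expRN in p.
  have q : (expR (g - g0))^-1 <= E.
    rewrite -expRN EE ler_expR (le_trans (ler_norm _))// normrN (le_trans hgg)//.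
    by rewrite ler_peMr ?ler1n// addr_ge0.
  have ex := expR_gt0 (g - g0).
  have xi : expR (g - g0) * (expR (g - g0))^-1 = 1 by rewrite mulfV// gt_eqF.
  have xl : expR (g - g0) < 1 by rewrite expR_lt1.
  move: p q ex xi xl; set x := expR _; set xx := x^-1 => p q ex xi xl.
  have : (1 - x) * xx <= (1 - x) * E by rewrite ler_wpM2l//; clear - xl; lra.
  by clear - p xi; lra.
have hw : `|g - g0| <= k * c.
  rewrite kE mulrAC ler_pdivlMr//.
  apply: (@le_trans _ _ (`|expR (g - g0) - 1| * E * d)); first by rewrite ler_wpM2r// ltW.
  have := ler_wpM2r (ltW E0) hx; clear; lra.
have DgDg0 : `|Dg g 1 - Dg g0 1| <= k * (E * E) * c.
  apply: (le_trans (Dg_lip_param _ _ _)); rewrite normr1 expr1n mul1r mulr1.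
  have -> : k * (E * E) * c = k * c * (E * E) by ring.
  have h : expR (`|g - g0| + `|g0|) <= E.
    by rewrite EE ler_expR; clear - hgg Gam0; lra.
  apply: ler_pM => //.
  by apply: (le_trans h); rewrite ler_peMr// ltW.
have Dg1 : 1 <= Dg g 1 * E.
  have [cc ccab] := @mvt R _ _ _ _ (@ler01 R) (fun x _ => der_Dg g x).
  rewrite Dg0r subr0 subr0 mulr1 => ->; rewrite EE -expRD -[X in X <= _]expR0 ler_expR.
  have : - (g * cc) <= `|g| * 1.
    rewrite -mulNr (le_trans (ler_norm _))// normM_le ?normrN//.
    by case/andP: ccab => p1 p2; rewrite ger0_norm.
  have := normr_ge0 g0; clear - hg Gam0; lra.
have Dgp : 0 < Dg g 1 by exact: Dg_gt0.
have hsg : `|sg - 1| <= (2 * S * E + k * (E * E)) * E * c.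
  have h : `|(sg - 1) * Dg g 1| <= (2 * S * E + k * (E * E)) * c.
    have -> : (sg - 1) * Dg g 1 = - (Dg g0 1 - sg * Dg g 1) - (Dg g 1 - Dg g0 1) by ring.
    by rewrite -normrN in e1; apply: (le_trans (normB_le e1 DgDg0)); clear; lra.
  rewrite normrM (gtr0_norm Dgp) in h.
  have p1 : `|sg - 1| * 1 <= `|sg - 1| * (Dg g 1 * E) by rewrite ler_wpM2l.
  have p2 := ler_wpM2r (ltW E0) h.
  by clear - p1 p2; lra.
have kc : 0 <= k * c by rewrite mulr_ge0// ltW.
have SEc : 0 <= S * (E * c) by rewrite !mulr_ge0// ltW.
have kEc : 0 <= (2 * S * E + k * (E * E)) * E * c.
  by rewrite !mulr_ge0 ?addr_ge0 ?mulr_ge0// ltW.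
have -> : 3 * K ^+ 2 * c ^+ 2 = 3 * (K * c) ^+ 2 by ring.
have KcE : K * c = k * c + S * (E * c) + (2 * S * E + k * (E * E)) * E * c.
  by rewrite /K; ring.
by apply: nD_le; rewrite KcE; [apply: (le_trans hw)|apply: (le_trans hmu)|apply: (le_trans hsg)];
  clear - kc SEc kEc; lra.
Qed.

Definition lr g0 g mu sg v := ell g mu sg (Dg g0 v) - ell g0 0 1 (Dg g0 v).

Lemma lrE g0 g mu sg v : lr g0 g mu sg v =
  - expR (- Uf g0 g mu sg v) - (1 + g) * Uf g0 g mu sg v - ln sg
  + expR (- v) + (1 + g0) * v.
Proof. by rewrite /lr ell0E /ell -/(Uf g0 g mu sg v); ring. Qed.

(** [expR lr * lam] is the density of the other parameter in the coordinate [v]; its distribution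
    function is [Lam] composed with [Uf]. *)
Lemma der_PL g0 g mu sg v : 0 < sg -> supp g0 g mu sg v ->
  has_der v (fun v => Lam (Uf g0 g mu sg v) - Lam v)
    ((expR (lr g0 g mu sg v) - 1) * lam v).
Proof.
move=> sg0 hs; have h1 := der_Uf sg0 hs.
have h2 : has_der v (fun v => Lam (Uf g0 g mu sg v))
    (lam (Uf g0 g mu sg v) * expR (mm g0 g mu sg v)).
  exact: (der_comp (der_Lam (Uf g0 g mu sg v)) h1).
have h3 := der_Lam v; der.
rewrite mulrBl mul1r; congr (_ - _); rewrite lam.unlock -!expRD; congr expR.
by rewrite mmE lrE; ring.
Qed.

Lemma der_lr g0 g mu sg v : 0 < sg -> supp g0 g mu sg v ->
  has_der v (lr g0 g mu sg) (expR (mm g0 g mu sg v) *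
    (expR (- Uf g0 g mu sg v) - (1 + g)) - expR (- v) + (1 + g0)).
Proof.
move=> sg0 hs; have h1 := der_Uf sg0 hs.
have -> : lr g0 g mu sg = fun v => - expR (- Uf g0 g mu sg v)
  - (1 + g) * Uf g0 g mu sg v - ln sg + expR (- v) + (1 + g0) * v.
  by apply/funext => x; rewrite lrE.
by der; ring.
Qed.

(** [Uf] is not bounded over these parameters. Powers of [expR (- Uf)] are absorbed by the factor
    [expR (- expR (- Uf))] of the density, through [h_le], as long as the exponent is
    nonnegative. *)
Lemma lr_lip g0 (Gam S V : R) : 0 < Gam -> 1 <= S -> 0 <= V ->
  exists2 K, 0 < K & forall g mu sg, -2^-1 < g <= Gam -> S^-1 <= sg <= S ->
  (forall v, - V <= v <= V -> supp g0 g mu sg v) ->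
  lip_on (- V) V K (fun v => expR (lr g0 g mu sg v) - 1).
Proof.
move=> Gam0 S1 V0.
have [E EE] : exists E, E = expR ((2 + 2 * Gam) ^+ 2) by exists (expR ((2 + 2 * Gam) ^+ 2)).
have E1 : 1 <= E by rewrite EE -expR0 ler_expR sqr_ge0.
have [W WE] : exists W, W = expR (expR V + (2 + 2 * `|g0|) * V).
  by exists (expR (expR V + (2 + 2 * `|g0|) * V)).
have W1 : 1 <= W.
  by rewrite WE -expR0 ler_expR addr_ge0 ?expR_ge0// mulr_ge0// addr_ge0// mulr_ge0.
pose T := E * W * S ^+ 2.
have S2 : 1 <= S ^+ 2 by rewrite exprn_ege1.
have EW1 : 1 <= E * W by rewrite mulr_ege1.
have T1 : 1 <= T by rewrite mulr_ege1.
have Tp : 0 < T by clear - T1; lra.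
exists (T * (2 + Gam) + T * (expR V + 2 + `|g0|)).
  have p1 : 0 < 2 + Gam by clear - Gam0; lra.
  have p2 : 0 < expR V + 2 + `|g0|.
    by have e0 := expR_gt0 V; have g00 := normr_ge0 g0; clear - e0 g00; lra.
  by apply: addr_gt0; apply: mulr_gt0.
move=> g mu sg /andP[gl gu] /andP[sgl sgu] hS.
have sg0 : 0 < sg by apply: lt_le_trans sgl; rewrite invr_gt0; clear - S1; lra.
have g0p := normr_ge0 g0.
have eV := expR_gt0 V.
have bound a v : - V <= v <= V -> 0 <= a <= 2 + 2 * Gam ->
    expR (- expR (- Uf g0 g mu sg v) - a * Uf g0 g mu sg v) <= E.
  move=> hv /andP[a0 a1]; rewrite EE ler_expR.
  move: a0; rewrite le_eqVlt => /orP[/eqP <-|ap].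
    rewrite mul0r subr0 (@le_trans _ _ 0)// ?sqr_ge0// oppr_le0 expR_ge0//.
  apply: (le_trans (h_le _ ap)); rewrite lerXn2r ?nnegrE//; first exact: ltW.
  by clear - Gam0; lra.
have lnsg : expR (- ln sg) <= S.
  by rewrite expRN lnK// invf_ple// posrE; clear - S1; lra.
have SS : S <= S ^+ 2 by rewrite expr2 ler_peMr//; clear - S1; lra.
have vb v : - V <= v <= V -> [/\ `|v| <= V, expR (- v) <= expR V & (1 + g0) * v <= (1 + `|g0|) * V].
  move=> hv; have nv : `|v| <= V by rewrite ler_norml.
  split => //; first by rewrite ler_expR; case/andP: hv => p _; clear - p; lra.
  rewrite (le_trans (ler_norm _))// normM_le//.
  by rewrite (le_trans (ler_normD _ _))// normr1.
have hT v : - V <= v <= V -> expR (lr g0 g mu sg v) <= T.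
  move=> hv; have [nv ev gv] := vb v hv.
  have -> : lr g0 g mu sg v = (- expR (- Uf g0 g mu sg v) - (1 + g) * Uf g0 g mu sg v)
     + ((expR (- v) + (1 + g0) * v) + - ln sg) by rewrite lrE; ring.
  rewrite expRD /T -mulrA ler_pM ?expR_ge0//.
    by apply: bound => //; clear - gl gu Gam0; apply/andP; split; lra.
  rewrite expRD ler_pM ?expR_ge0//; last exact: le_trans SS.
  rewrite WE ler_expR lerD// (le_trans gv)// ler_wpM2r//.
  by clear - g0p; lra.
(* The product carries [expR (- ((a + 2 * g) * Uf))], with [a = 1] or [a = 2] in the derivative of
   [expR lr]. For [a = 1] the exponent is nonnegative thanks to [g > -1/2]. *)
have hmm a v : - V <= v <= V -> 0 <= a <= 2 -> 
    expR (lr g0 g mu sg v) * (expR (mm g0 g mu sg v) * expR (- ((a - 1) * Uf g0 g mu sg v))) <= T \/ a + 2 * g < 0 \/ 2 + 2 * Gam < a + 2 * g.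
  move=> hv /andP[a0 a2]; have [nv ev gv] := vb v hv.
  have [h|h] := ltP (a + 2 * g) 0; first by right; left.
  have [h'|h'] := ltP (2 + 2 * Gam) (a + 2 * g); first by right; right.
  left; rewrite -!expRD.
  have -> : lr g0 g mu sg v + (mm g0 g mu sg v + - ((a - 1) * Uf g0 g mu sg v)) =
    (- expR (- Uf g0 g mu sg v) - (a + 2 * g) * Uf g0 g mu sg v)
     + ((expR (- v) + ((1 + g0) * v + g0 * v)) + (- ln sg + - ln sg)).
    by rewrite lrE mmE; ring.
  rewrite expRD /T -mulrA ler_pM ?expR_ge0//.
    by apply: bound => //; rewrite h h'.
  rewrite expRD ler_pM ?expR_ge0//; last first.
    by rewrite expRD expr2 ler_pM ?expR_ge0.
  rewrite WE ler_expR lerD//.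
  have : g0 * v <= `|g0| * V by rewrite (le_trans (ler_norm _))// normM_le.
  by clear - gv nv g0p V0; have : 0 <= V; lra.
apply: (lip_on_der (df := fun v => expR (lr g0 g mu sg v) * (expR (mm g0 g mu sg v) *
    (expR (- Uf g0 g mu sg v) - (1 + g)) - expR (- v) + (1 + g0)))).
- have p1 : 0 <= 2 + Gam by clear - Gam0; lra.
  have p2 : 0 <= expR V + 2 + `|g0| by clear - eV g0p; lra.
  by apply: addr_ge0; apply: mulr_ge0; rewrite ?(ltW Tp).
- move=> v hv; have h := der_lr sg0 (hS v hv); der; ring.
move=> v hv; have [nv ev gv] := vb v hv.
have t0 := expR_gt0 (lr g0 g mu sg v); have t1 := hT v hv.
split.
  apply: (@le_trans _ _ (T + 1)).
    by rewrite (le_trans (ler_normB _ _))// normr1 gtr0_norm// lerD2r.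
  have : 0 <= T * Gam by rewrite mulr_ge0 ?ltW.
  have : 0 <= T * (expR V + 2 + `|g0|).
    by rewrite mulr_ge0 ?(ltW Tp)//; clear - eV g0p; lra.
  by clear - T1; lra.
have b2 : expR (lr g0 g mu sg v) * (expR (mm g0 g mu sg v) * expR (- Uf g0 g mu sg v)) <= T.
  have := @hmm 2 v hv; rewrite (_ : 2 - 1 = 1 :> R); last by ring.
  rewrite mul1r; case; first by clear; apply/andP; split; lra.
    by [].
  by case; [clear - gl|clear - gu]; lra.
have b1 : expR (lr g0 g mu sg v) * expR (mm g0 g mu sg v) <= T.
  have := @hmm 1 v hv; rewrite subrr mul0r oppr0 expR0 mulr1; case.
    by clear; apply/andP; split; lra.
    by [].
  by case; [clear - gl|clear - gu]; lra.
have -> : expR (lr g0 g mu sg v) * (expR (mm g0 g mu sg v) *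
    (expR (- Uf g0 g mu sg v) - (1 + g)) - expR (- v) + (1 + g0)) =
  expR (lr g0 g mu sg v) * (expR (mm g0 g mu sg v) * expR (- Uf g0 g mu sg v))
  - expR (lr g0 g mu sg v) * expR (mm g0 g mu sg v) * (1 + g)
  + expR (lr g0 g mu sg v) * (1 + g0 - expR (- v)) by ring.
have -> : T * (2 + Gam) = T + T * (1 + Gam) by ring.
apply: normD_le; first apply: normB_le.
- by rewrite ger0_norm// !mulr_ge0 ?expR_ge0.
- apply: normM_le; first by rewrite ger0_norm// !mulr_ge0 ?expR_ge0.
  by rewrite ger0_norm; [clear - gu|clear - gl]; lra.
apply: normM_le; first by rewrite ger0_norm// expR_ge0.
apply: (le_trans (ler_normB _ _)); rewrite (gtr0_norm (expR_gt0 _)).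
have := ler_normD 1 g0; rewrite normr1; clear - ev; lra.
Qed.

End Hellinger.

(** * Bounded parameter sets away from the truth *)

Section CompactBound.
Context {R : realType}.
Implicit Types (g mu sg x y u v : R).

Lemma supp_between g0 g mu sg u v w : 0 < sg -> u <= v <= w ->
  supp g0 g mu sg u -> supp g0 g mu sg w -> supp g0 g mu sg v.
Proof.
move=> sg0 /andP[uv vw]; rewrite /supp => hu hw.
have h1 : (Dg g0 u - mu) / sg <= (Dg g0 v - mu) / sg.
  by rewrite ler_wpM2r ?invr_ge0 ?(ltW sg0)// lerD2r Dg_le.
have h2 : (Dg g0 v - mu) / sg <= (Dg g0 w - mu) / sg.
  by rewrite ler_wpM2r ?invr_ge0 ?(ltW sg0)// lerD2r Dg_le.
have [gp|gn] := leP 0 g.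
  by apply: (lt_le_trans hu); rewrite lerD2l ler_wpM2l.
by apply: (lt_le_trans hw); rewrite lerD2l ler_wnM2l// ltW.
Qed.

(** Sample points on both sides of [[- V, V]] force this interval into the support of every
    parameter that supports the whole sample, by [supp_between]. *)
Lemma both_sides (F : set_system (seq R)) {FF : Filter F} V : gumbel_ecdf F ->
  \forall s \near F, [/\ (0 < size s)%N, exists2 v, v \in s & v <= - V &
    exists2 v, v \in s & V < v].
Proof.
move=> Fcdf.
have p1 : 0 < Lam (- V) / 2 by rewrite divr_gt0 ?Lam_gt0.
have p2 : 0 < (1 - Lam V) / 2 by rewrite divr_gt0// subr_gt0 Lam_lt1.
apply: filterS2 (Fcdf (- V) _ p1) (Fcdf V _ p2) => s /ler_normlP[h1 _] /ler_normlP[_ h3].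
have s1 : exists2 v, v \in s & v <= - V.
  apply: contrapT => hn.
  have e0 : ecdf s (- V) = 0.
    apply: avg_eq0 => v vs; case: (leP v (- V)) => // hv.
    by exfalso; apply: hn; exists v.
  by move: h1 p1; rewrite e0; clear; lra.
have s0 : (0 < size s)%N by case: s1 => v; case: (s).
split => //; apply: contrapT => hn.
have e1 : ecdf s V = 1.
  rewrite -(avg_cst 1 s0); apply: eq_avg => v vs; case: (leP v V) => // hv.
  by exfalso; apply: hn; exists v.
by move: h3 p2; rewrite e1; clear; lra.
Qed.

Lemma lr_le g0 g mu sg v (Gam S : R) : 0 < Gam -> 1 <= S -> -2^-1 < g <= Gam ->
  S^-1 <= sg -> lr g0 g mu sg v <= (S + (1 + Gam) ^+ 2 + 1 + `|g0|) * Wt g0 v.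
Proof.
move=> Gam0 S1 /andP[gl gu] sgS.
have S0 : 0 < S by clear - S1; lra.
have sg0 : 0 < sg by apply: lt_le_trans sgS; rewrite invr_gt0.
have g1 : -1 < g by clear - gl; lra.
have h1 := ell_le mu sg (Dg g0 v) g1.
have h2 : - ln sg <= S.
  have := ln_ge sg0; have : sg^-1 <= S by rewrite invf_ple ?posrE.
  by clear; lra.
have h3 : (1 + g) ^+ 2 <= (1 + Gam) ^+ 2.
  by apply: sqr_le_norm; rewrite ger0_norm; [clear - gu|clear - gl]; lra.
have h4 := ell0_ge g0 v; have h5 := Wt_ge1 g0 v.
have h6 := ler_wpM2l (addr_ge0 ler01 (normr_ge0 g0)) h5.
have h7 : 1 <= Wt g0 v.
  apply: le_trans h5; apply: mulr_ege1; first by rewrite lerDl.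
  by rewrite lerDl expR_ge0.
have h8 : S + (1 + Gam) ^+ 2 <= (S + (1 + Gam) ^+ 2) * Wt g0 v.
  by rewrite ler_peMr// addr_ge0 ?sqr_ge0// ltW.
by rewrite /lr; clear - h1 h2 h3 h4 h6 h8; lra.
Qed.

Lemma Lam_near (eps : R) : 0 < eps -> exists2 gap, 0 < gap & forall j x,
  (j == -1) || (j == 0) || (j == 1) -> `|Lam x - Lam j| <= gap -> `|x - j| <= eps.
Proof.
move=> e0; have [d [d0 dl dr]] : exists d : R -> R, [/\ forall j, 0 < d j,
    forall j, d j <= Lam (j + eps) - Lam j & forall j, d j <= Lam j - Lam (j - eps)].
  exists (fun j => Num.min (Lam (j + eps) - Lam j) (Lam j - Lam (j - eps))).
  split=> j /=; [|by rewrite ge_min lexx|by rewrite ge_min lexx orbT].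
  by rewrite lt_min !subr_gt0 !Lam_lt// ?ltrDl// gtrBl.
pose M := Num.min (d (-1)) (Num.min (d 0) (d 1)).
have M0 : 0 < M by rewrite !lt_min !d0.
have Md j : (j == -1) || (j == 0) || (j == 1) -> M / 2 < d j.
  move=> hj; have : M <= d j; last by have := M0; clear; lra.
  move: hj => /orP[/orP[]|] /eqP ->.
  - by rewrite ge_min lexx.
  - by rewrite !ge_min lexx orbT.
  - by rewrite !ge_min lexx !orbT.
exists (M / 2); first by rewrite divr_gt0.
move=> j x /Md hM /ler_normlP[h3 h4]; have := dl j; have := dr j => h2 h1.
rewrite ler_norml; apply/andP; split; rewrite leNgt; apply/negP => h.
  have : Lam x < Lam (j - eps) by apply: Lam_lt; clear - h; lra.
  by clear - h2 h3 hM; lra.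
have : Lam (j + eps) < Lam x by apply: Lam_lt; clear - h; lra.
by clear - h1 h4 hM; lra.
Qed.

(** With [r = expR (lr / 2)], the bound [ln r <= r - 1] gives [lr <= (r ^+ 2 - 1) - (r - 1) ^+ 2].
    The first part averages to an increment of [Pf], a difference of distribution functions, which
    is at most about 0; so a large [H], the average of the squares, concludes. A small [H] makes the
    two distribution functions close at -1, 0 and 1, and [ident_global] contradicts the distance
    [eps]. *)
Lemma compact_bound (F : set_system (seq R)) {FF : Filter F} g0 (Gam S eps : R) :
  -2^-1 < g0 -> gumbel_ecdf F -> small_tails g0 F ->
  0 < Gam -> 1 <= S -> 0 < eps -> exists2 c, 0 < c &
  \forall s \near F, forall g mu sg, -2^-1 < g <= Gam -> S^-1 <= sg <= S ->
    eps <= nD g0 g mu sg -> {in s, forall v, supp g0 g mu sg v} ->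
    avg s (lr g0 g mu sg) <= - c.
Proof.
move=> g0_gt Fcdf Ftail Gam0 S1 eps0.
have S0 : 0 < S by clear - S1; lra.
have [C C0 hC] := @ident_global R g0 (Gam + 1) S (addr_ge0 (ltW Gam0) ler01) S0.
(* [z] will bound [del] at the three points, [gap] is the closeness of distribution functions that
   ensures it, and [l ^+ 2] is the threshold for [H]. *)
have [z [z0 z1 zC]] : exists z, [/\ 0 < z, z <= 1 & C * z ^+ 2 < eps ^+ 2].
  exists (Num.min 1 (eps / (1 + C))).
  have p : 0 < eps / (1 + C) by rewrite divr_gt0// addr_gt0.
  split; [by rewrite lt_min p ltr01|by rewrite ge_min lexx|].
  apply: (@le_lt_trans _ _ (C * (eps / (1 + C)) ^+ 2)).
    rewrite ler_wpM2l ?(ltW C0)// lerXn2r ?nnegrE ?(ltW p)//.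
      by rewrite le_min ler01 ltW.
    by rewrite ge_min lexx orbT.
  rewrite expr_div_n mulrA ltr_pdivrMr ?exprn_gt0 ?addr_gt0//.
  rewrite mulrC ltr_pM2l ?exprn_gt0//; clear - C0; nra.
have [gap gap0 hgap] := Lam_near z0.
have [l [l0 l1 lgap]] : exists l, [/\ 0 < l, l <= 10^-1 & 10 * l <= gap].
  exists (Num.min 10^-1 (gap / 10)); split.
  - by rewrite lt_min invr_gt0 ltr0n divr_gt0 ?ltr0n.
  - by rewrite ge_min lexx.
  - by rewrite mulrC -ler_pdivlMr ?ltr0n// ge_min lexx orbT.
have [e1 [e10 e1l]] : exists e1, 0 < e1 /\ 12 * e1 = l ^+ 2.
  exists (l ^+ 2 / 12); split; first by rewrite divr_gt0 ?exprn_gt0.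
  by field.
have [C1 C1E] : exists C1, C1 = S + (1 + Gam) ^+ 2 + 1 + `|g0|.
  by exists (S + (1 + Gam) ^+ 2 + 1 + `|g0|).
have C10 : 0 < C1.
  by rewrite C1E ltr_wpDr// addr_gt0// addr_gt0// exprn_gt0// addr_gt0.
have [e2 [e20 e2l]] : exists e2, 0 < e2 /\ 4 * ((1 + C1) * e2) = l ^+ 2.
  have p : 0 < 1 + C1 by rewrite addr_gt0.
  exists (l ^+ 2 / (4 * (1 + C1))); split.
    by rewrite divr_gt0 ?exprn_gt0// mulr_gt0.
  by field; rewrite gt_eqF.
have [V2 hV2] := Ftail _ e20.
have [V [Vge2 VV2]] : exists V, 2 <= V /\ V2 <= V.
  by exists (Num.max 2 V2); rewrite !le_max !lexx orbT.
have V0 : 0 <= V by clear - Vge2; lra.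
have [K K0 hK] := lr_lip g0 Gam0 S1 V0.
have eK : 0 < e1 / K by rewrite divr_gt0.
exists (l ^+ 2 / 2); first by rewrite divr_gt0 ?exprn_gt0.
have lt1 : - V < V by clear - Vge2; lra.
have lt2 : - V < -1 by clear - Vge2; lra.
have lt3 : - V < 0 by clear - Vge2; lra.
have lt4 : - V < 1 by clear - Vge2; lra.
pose Q b s := forall K' phi Phi, 0 <= K' ->
  (forall v, - V <= v <= b -> has_der v Phi (phi v * lam v)) ->
  lip_on (- V) b K' phi ->
  `|avg s (fun v => phi v * ind (- V) b v) - (Phi b - Phi (- V))| <= K' * (e1 / K).
apply: (@filter_near_of _ F _ _ FF) => s ?.
move=> g mu sg hg hsg hD hsupp.
have [ss [v1 v1s v1V] [v2 v2s v2V]] : [/\ (0 < size s)%N, exists2 v, v \in s & v <= - V &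
    exists2 v, v \in s & V < v] by near: s; exact: both_sides.
have tail : avg s (fun v => Wt g0 v * (1 - ind (- V) V v)) <= e2.
  by near: s; exact: hV2.
have c1 : `|ecdf s (- V) - Lam (- V)| <= e1 by near: s; exact: Fcdf.
have c2 : `|ecdf s V - Lam V| <= e1 by near: s; exact: Fcdf.
have QV : Q V s by near: s; exact: lln.
have Qm : Q (-1) s by near: s; exact: lln.
have Q0 : Q 0 s by near: s; exact: lln.
have Qp : Q 1 s by near: s; exact: lln.
have sgp : 0 < sg.
  by case/andP: hsg => h _; apply: lt_le_trans h; rewrite invr_gt0.
have hS v : - V <= v <= V -> supp g0 g mu sg v.
  move=> /andP[a1 a2]; apply: (@supp_between _ _ _ _ v1 v v2) => //.
  - by rewrite (le_trans v1V a1) (le_trans a2 (ltW v2V)).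
  - exact: hsupp.
  - exact: hsupp.
have hL := hK _ _ _ hg hsg hS.
have hLb b : b <= V -> lip_on (- V) b K (fun v => expR (lr g0 g mu sg v) - 1).
  move=> bV u v /andP[u1 u2] /andP[w1 w2]; apply: hL.
    by rewrite u1 (le_trans u2).
  by rewrite w1 (le_trans w2).
pose Pf v := Lam (Uf g0 g mu sg v) - Lam v.
have hQ b : b <= V -> Q b s ->
    `|avg s (fun v => (expR (lr g0 g mu sg v) - 1) * ind (- V) b v)
      - (Pf b - Pf (- V))| <= e1.
  move=> bV hq; have -> : e1 = K * (e1 / K) by field; rewrite gt_eqF.
  apply: (hq _ _ Pf (ltW K0) _ (hLb b bV)) => v /andP[w1 w2].
  by apply: der_PL => //; apply: hS; rewrite w1 (le_trans w2).
have qV := hQ _ (lexx V) QV.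
have qm := hQ _ (ltW (lt_le_trans (ltrN10 _) V0)) Qm.
have q0 := hQ _ V0 Q0.
have qp : `|avg s (fun v => (expR (lr g0 g mu sg v) - 1) * ind (- V) 1 v)
      - (Pf 1 - Pf (- V))| <= e1 by apply: hQ Qp; clear - Vge2; lra.
pose r v := expR (lr g0 g mu sg v / 2).
have rr v : r v ^+ 2 = expR (lr g0 g mu sg v).
  by rewrite /r -expRM_natl; congr expR; field.
have r0 v : 0 < r v by exact: expR_gt0.
have [H HE] : exists H, H = avg s (fun v => (r v - 1) ^+ 2 * ind (- V) V v).
  by exists (avg s (fun v => (r v - 1) ^+ 2 * ind (- V) V v)).
have H0 : 0 <= H.
  by rewrite HE; apply: avg_ge0 => v _; rewrite mulr_ge0 ?sqr_ge0 ?ind_ge0.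
have Wt1 v : 1 <= Wt g0 v.
  apply: le_trans (Wt_ge1 g0 v); apply: mulr_ege1; first by rewrite lerDl.
  by rewrite lerDl expR_ge0.
have ind1 a b v : 0 <= 1 - ind a b v :> R.
  by rewrite subr_ge0 /ind; case: (a < v <= b).
have tail1 : 1 - avg s (ind (- V) V) <= e2.
  apply: le_trans tail; rewrite -[X in X - _](avg_cst 1 ss) -avgB.
  by apply: le_avg => v _; rewrite ler_peMl.
rewrite avg_ind ?(ltW lt1)// in tail1.
have TV : 1 - (Lam V - Lam (- V)) <= e2 + 2 * e1.
  move: c1 c2 => /ler_normlP[a1 a2] /ler_normlP[a3 a4].
  by clear - tail1 a1 a2 a3 a4; lra.
have PfE b : Pf b = Lam (Uf g0 g mu sg b) - Lam b by [].
have hl1 : avg s (lr g0 g mu sg) <= (Pf V - Pf (- V)) + e1 - H + C1 * e2.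
  have hpt v : v \in s -> lr g0 g mu sg v <=
      (expR (lr g0 g mu sg v) - 1) * ind (- V) V v - (r v - 1) ^+ 2 * ind (- V) V v
      + C1 * (Wt g0 v * (1 - ind (- V) V v)).
    move=> _; rewrite -rr /ind; case: (boolP (- V < v <= V)) => _.
      rewrite subrr !mulr0 addr0 !mulr1.
      have := expR_ge1Dx (lr g0 g mu sg v / 2); rewrite -/(r v).
      by clear; nra.
    rewrite !mulr0 !subr0 add0r mulr1 C1E.
    by apply: lr_le => //; case/andP: hsg.
  apply: (le_trans (le_avg hpt)); rewrite avgD avgB avgZ -HE.
  move: qV => /ler_normlP[_ a2]; have := ler_wpM2l (ltW C10) tail.
  by clear - a2; lra.
have LUV1 : Lam (Uf g0 g mu sg V) < 1 by exact: Lam_lt1.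
have LUm : 0 < Lam (Uf g0 g mu sg (- V)) by exact: Lam_gt0.
have [Hl|Hl] := leP (l ^+ 2) H.
  apply: (le_trans hl1); rewrite !PfE.
  have : C1 * e2 + e2 <= l ^+ 2 / 4 by clear - e2l; lra.
  have : 3 * e1 <= l ^+ 2 / 4 by clear - e1l; lra.
  by clear - TV Hl LUV1 LUm; lra.
exfalso.
have l2 : l ^+ 2 <= l / 10.
  by rewrite expr2; have := ler_wpM2l (ltW l0) l1; clear; lra.
have e1s : e1 <= l / 120 by clear - e1l l2; lra.
have e2s : e2 <= l / 40.
  have : e2 <= (1 + C1) * e2 by rewrite ler_peMl ?(ltW e20)// lerDl ltW.
  by clear - e2l l2; lra.
have avg_sq : avg s (fun v => (r v + 1) ^+ 2 * ind (- V) V v) <= 6.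
  have hpt v : v \in s -> (r v + 1) ^+ 2 * ind (- V) V v <=
      2 * ((expR (lr g0 g mu sg v) - 1) * ind (- V) V v) + 4 * ind (- V) V v.
    move=> _; rewrite -rr mulrA -mulrDl ler_wpM2r ?ind_ge0//.
    by have := sqr_ge0 (r v - 1); clear; nra.
  apply: (le_trans (le_avg hpt)); rewrite avgD !avgZ.
  have := avg_le1 s (fun v => - V < v <= V); rewrite -/(avg s (ind (- V) V)) => a1.
  move: qV => /ler_normlP[_ a2]; rewrite !PfE in a2.
  by clear - a1 a2 TV e1s e2s l1 LUV1 LUm l0; lra.
(* By [r ^+ 2 - 1 = (r - 1) * (r + 1)] and the inequality between arithmetic and geometric means
   with weight [l], the average up to [b] is at most [H / (2 * l) + 3 * l], hence of order [l]. *)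
have hB b : - V <= b <= V -> `|avg s (fun v => (expR (lr g0 g mu sg v) - 1) * ind (- V) b v)
      - (Pf b - Pf (- V))| <= e1 -> `|Pf b - Pf (- V)| <= 4 * l.
  move=> /andP[b1 b2] hb.
  have h1 : `|avg s (fun v => (expR (lr g0 g mu sg v) - 1) * ind (- V) b v)|
      <= H / (2 * l) + l / 2 * 6.
    apply: (@le_trans _ _ ((2 * l)^-1 * H + l / 2 *
        avg s (fun v => (r v + 1) ^+ 2 * ind (- V) V v))); last first.
      by rewrite [H / _]mulrC lerD2l ler_wpM2l// divr_ge0// ltW.
    rewrite HE -!avgZ -avgD; apply: norm_avg => v _.
    have ib : ind (- V) b v <= ind (- V) V v.
      by rewrite (@ind_add _ (- V) b V)// lerDl ind_ge0.
    have -> : (2 * l)^-1 * ((r v - 1) ^+ 2 * ind (- V) V v)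
        + l / 2 * ((r v + 1) ^+ 2 * ind (- V) V v) =
        ((2 * l)^-1 * (r v - 1) ^+ 2 + l / 2 * (r v + 1) ^+ 2) * ind (- V) V v by ring.
    rewrite normrM (ger0_norm (ind_ge0 _ _ _)) ler_pM ?ind_ge0//.
    rewrite -rr; have -> : r v ^+ 2 - 1 = (r v - 1) * (r v + 1) by ring.
    have il : (2 * l)^-1 * (2 * l) = 1 by rewrite mulVf// gt_eqF// mulr_gt0.
    have i0 : 0 < (2 * l)^-1 by rewrite invr_gt0 mulr_gt0.
    move: (r v - 1) (r v + 1) => x y; move: il i0; set i := (2 * l)^-1 => il i0.
    (* |x y| <= x^2 / (2 l) + l y^2 / 2 *)
    have hx : x = i * x * (2 * l) by rewrite mulrAC il mul1r.
    have p1 : 0 <= i * (x - l * y) ^+ 2 by rewrite mulr_ge0 ?sqr_ge0// ltW.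
    have p2 : 0 <= i * (x + l * y) ^+ 2 by rewrite mulr_ge0 ?sqr_ge0// ltW.
    have q1 : i * (x - l * y) ^+ 2 = i * x ^+ 2 - x * y + l / 2 * y ^+ 2.
      transitivity (i * x ^+ 2 - (i * (2 * l)) * (x * y) + (i * (2 * l)) * (l / 2 * y ^+ 2)).
        by field.
      by rewrite il !mul1r.
    have q2 : i * (x + l * y) ^+ 2 = i * x ^+ 2 + x * y + l / 2 * y ^+ 2.
      transitivity (i * x ^+ 2 + (i * (2 * l)) * (x * y) + (i * (2 * l)) * (l / 2 * y ^+ 2)).
        by field.
      by rewrite il !mul1r.
    rewrite ler_norml; apply/andP; split; first by clear - p2 q2; lra.
    by clear - p1 q1; lra.
  have h2 : H / (2 * l) <= l / 2.
    rewrite ler_pdivrMr ?mulr_gt0//; clear - Hl; lra.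
  have -> : Pf b - Pf (- V) = avg s (fun v => (expR (lr g0 g mu sg v) - 1) * ind (- V) b v)
    - (avg s (fun v => (expR (lr g0 g mu sg v) - 1) * ind (- V) b v) - (Pf b - Pf (- V))) by ring.
  by apply: (le_trans (normB_le h1 hb)); clear - h2 e1s l0; lra.
have bV : - V <= V <= V by rewrite lexx ltW.
have bm : - V <= -1 <= V by clear - Vge2; apply/andP; split; lra.
have b0 : - V <= 0 <= V by clear - Vge2; apply/andP; split; lra.
have bp : - V <= 1 <= V by clear - Vge2; apply/andP; split; lra.
have PV := hB _ bV qV; have Pm := hB _ bm qm; have P0 := hB _ b0 q0; have Pp := hB _ bp qp.
have LV1 : Lam V < 1 :> R by exact: Lam_lt1.
have LmV : 0 < Lam (- V) :> R by exact: Lam_gt0.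
(* [Pf] changes little across [[- V, V]], while the Gumbel mass of this interval is nearly 1; so
   both distribution functions are nearly 0 at [- V]. *)
have PmV : Lam (Uf g0 g mu sg (- V)) <= 5 * l /\ Lam (- V) <= l.
  move: PV => /ler_normlP[a1 a2]; rewrite !PfE in a1 a2.
  by split; clear - a1 a2 TV e1s e2s LUV1 l0 LV1 LmV; lra.
have fin j : (j == -1) || (j == 0) || (j == 1) -> `|Pf j - Pf (- V)| <= 4 * l ->
    `|del g0 g mu sg j| <= z.
  move=> hj hP; apply: (hgap j _ hj).
  apply: le_trans lgap; rewrite -/(Pf j).
  have -> : Pf j = (Pf j - Pf (- V)) + Pf (- V) by ring.
  have h : `|Pf (- V)| <= 6 * l.
    case: PmV => a1 a2; rewrite PfE ler_norml.
    by clear - a1 a2 LUm LmV l0; apply/andP; split; lra.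
  by apply: (le_trans (normD_le hP h)); clear; lra.
have hgG : `|g| <= Gam + 1.
  by case/andP: hg => a1 a2; rewrite ler_norml; clear - a1 a2 Gam0; apply/andP; split; lra.
have sgS : 0 < sg <= S by rewrite sgp; case/andP: hsg.
have z01 : 0 <= z <= 1 by rewrite ltW.
have := hC g mu sg z hgG sgS z01 (hS _ bm) (hS _ b0) (hS _ bp)
  (fin _ _ Pm) (fin _ _ P0) (fin _ _ Pp).
rewrite !eqxx !orbT => /(_ isT isT isT) h.
have : eps ^+ 2 <= nD g0 g mu sg ^+ 2.
  by rewrite lerXn2r ?nnegrE ?nD_ge0// ltW.
by clear - h zC; lra.
Unshelve. all: by end_near. Qed.

End CompactBound.

(** * Extreme scales and large shapes *)

Section Noncompact.
Context {R : realType}.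
Implicit Types (g mu sg x y u v : R) (F : set_system (seq R)).

Lemma Wt_ge_1 g v : 1 <= Wt g v.
Proof.
apply: le_trans (Wt_ge1 g v); apply: mulr_ege1; first by rewrite lerDl.
by rewrite lerDl expR_ge0.
Qed.

Lemma Wt_ge_norm g v : `|v| <= Wt g v.
Proof.
apply: le_trans (Wt_ge1 g v); apply: (@le_trans _ _ (1 + `|v|)); first by rewrite lerDr.
by rewrite ler_peMr// ?addr_ge0// lerDl expR_ge0.
Qed.

Lemma Wt_ge_exp g v : (1 + `|v|) * (1 + expR (- (g * v))) <= Wt g v.
Proof.
have t1 : 1 <= 1 + `|v| by rewrite lerDl.
have e1 : 1 <= 1 + expR (- (g * v)) by rewrite lerDl expR_ge0.
have f1 : 1 <= 1 + expR (- v) by rewrite lerDl expR_ge0.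
have t0 := le_trans ler01 t1; have e0 := le_trans ler01 e1.
rewrite /Wt -[X in X <= _]mulr1 ler_pM ?mulr_ge0//.
by apply: ler_pM => //; apply: ler_eXnr.
Qed.

Lemma avg_Wt F {FF : Filter F} g : small_tails g F ->
  exists2 C, 0 < C & \forall s \near F, avg s (Wt g) <= C.
Proof.
move=> /(_ _ ltr01)[V0 hV]; pose V := Num.max V0 1.
have VV : V0 <= V by rewrite le_max lexx.
have Vp : 0 < V by rewrite lt_max ltr01 orbT.
pose C := (1 + V) * (1 + expR V) * bwtV g V ^+ 2.
have C0 : 0 <= C by rewrite !mulr_ge0 ?sqr_ge0 ?addr_ge0 ?expR_ge0// ltW.
exists (C + 1); first by rewrite ltr_wpDl.
apply: filterS (hV _ VV) => s hs.
have hpt : {in s, forall v, Wt g v <= C * ind (- V) V v + Wt g v * (1 - ind (- V) V v)}.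
  move=> v _; rewrite /ind; case: (boolP (- V < v <= V)) => hv; last first.
    by rewrite mulr0 subr0 mulr1 add0r.
  rewrite subrr mulr0 addr0 mulr1.
  have hv' : - V <= v <= V by case/andP: hv => /ltW -> ->.
  have nv : `|v| <= V by rewrite ler_norml.
  have e0 := expR_ge0 (- v); have b1 := bwt_ge1 g v; have b2 := bwt_le g hv'.
  have p1 : 0 <= 1 + `|v| by rewrite addr_ge0.
  have p2 : 0 <= 1 + expR (- v) by rewrite addr_ge0.
  have p3 : 0 <= bwt g v by exact: le_trans b1.
  rewrite -Wt_ge; apply: ler_pM => //; first exact: mulr_ge0.
  - apply: ler_pM => //; first by rewrite lerD2l.
    by rewrite lerD2l ler_expR; case/andP: hv' => h _; clear - h; lra.
  - by rewrite lerXn2r ?nnegrE// (le_trans p3).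
apply: (le_trans (le_avg hpt)); rewrite avgD avgZ; apply: lerD => //.
by rewrite -[X in _ <= X]mulr1 ler_wpM2l// avg_le1.
Qed.

Lemma ell0_avg F {FF : Filter F} g : small_tails g F ->
  exists2 C, 0 < C & \forall s \near F,
    avg s (fun v => - ell g 0 1 (Dg g v)) <= C.
Proof.
move=> /avg_Wt[C C0 hC]; exists ((1 + `|g|) * C); first by rewrite mulr_gt0// ltr_wpDr.
apply: filterS hC => s hs.
apply: (@le_trans _ _ (avg s (fun v => (1 + `|g|) * Wt g v))).
  apply: le_avg => v _; apply: (le_trans (ell0_ge _ _)).
  by rewrite ler_wpM2l ?addr_ge0// Wt_ge1.
by rewrite avgZ ler_wpM2l// addr_ge0.
Qed.

Lemma ecdf_grid F {FF : Filter F} (a h e : R) (M : nat) : gumbel_ecdf F -> 0 < e ->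
  \forall s \near F, forall j, (j <= M)%N ->
    `|ecdf s (a + j%:R * h) - Lam (a + j%:R * h)| <= e.
Proof.
move=> Fcdf e0; elim: M => [|M IH].
  by apply: filterS (Fcdf (a + 0%:R * h) _ e0) => s hs j; rewrite leqn0 => /eqP ->.
apply: filterS2 IH (Fcdf (a + M.+1%:R * h) _ e0) => s hM h1 j.
by rewrite leq_eqVlt => /orP[/eqP->//|]; exact: hM.
Qed.

Lemma Lam_lip (a b : R) : a <= b -> Lam b - Lam a <= b - a.
Proof.
move=> ab; have [c _ ->] := mvt ab (fun x _ => der_Lam x).
by rewrite ler_piMl ?lam_le1// subr_ge0.
Qed.

(** The window lives on the scale of the observations and has an arbitrary center. Its sample points
    in [[- V, V]] lie within [h] of any one of them, hence in three cells of a fixed grid, so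
    finitely many values of the empirical distribution function suffice for all centers. *)
Lemma window F {FF : Filter F} g0 (eta : R) : gumbel_ecdf F -> small_tails g0 F ->
  0 < eta -> exists2 dl, 0 < dl & \forall s \near F, forall mu,
    avg s (fun v => (`|Dg g0 v - mu| < dl)%R%:R) <= eta.
Proof.
move=> Fcdf Ftail e0.
have e4 : 0 < eta / 4 by rewrite divr_gt0.
have [V0 hV] := Ftail _ e4; pose V := Num.max V0 1.
have VV : V0 <= V by rewrite le_max lexx.
have Vp : 0 < V by rewrite lt_max ltr01 orbT.
pose h := eta / 16; have h0 : 0 < h by rewrite divr_gt0.
(* Moving up by [h] or more from a point of [[- V, V]] moves the image under [Dg g0] by at least
   [2 * dl]. *)
pose dl := expR (- (`|g0| * V)) * Dg g0 h / 2.
have dl0 : 0 < dl by rewrite divr_gt0// mulr_gt0 ?expR_gt0// Dg_gt0.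
pose N := (Num.truncn (2 * V / h)).+4.
exists dl => //.
apply: filterS2 (hV _ VV) (@ecdf_grid F FF (- V - 2 * h) h (eta / 8) N.+1 Fcdf (divr_gt0 e0 (ltr0n _ 8)))
  => s htail hgrid mu.
have ind01 a b v : ind a b v <= 1 :> R by rewrite /ind; case: (a < v <= b).
have hout : avg s (fun v => 1 - ind (- V) V v) <= eta / 4.
  apply: le_trans htail; apply: le_avg => v _.
  by rewrite ler_peMl ?Wt_ge_1// subr_ge0.
have [[va [vas vaV vaw]]|hno] := pselect (exists va, [/\ va \in s, - V < va <= V & `|Dg g0 va - mu| < dl]); last first.
  apply: (@le_trans _ _ (avg s (fun v => 1 - ind (- V) V v))); last first.
    by apply: (le_trans hout); clear - e0; lra.
  apply: le_avg => v vs; rewrite /ind; case: (boolP (- V < v <= V)) => hv.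
    case: (boolP (`|Dg g0 v - mu| < dl)) => hw; last by rewrite subrr.
    by exfalso; apply: hno; exists v.
  by rewrite subr0; case: (_ < _).
have close v w : - V < v -> v <= V -> `|Dg g0 v - mu| < dl -> `|Dg g0 w - mu| < dl -> w < v + h.
  move=> v1 v2 /ltr_normlP[a1 a2] /ltr_normlP[a3 a4]; rewrite ltNge; apply/negP => hw.
  have := Dg_le g0 hw; rewrite DgD.
  have : expR (- (`|g0| * V)) * Dg g0 h <= expR (g0 * v) * Dg g0 h.
    rewrite ler_wpM2r ?(ltW (Dg_gt0 _ _))// ler_expR.
    have : `|g0 * v| <= `|g0| * V by apply: normM_le => //; rewrite ler_norml v2 ltW.
    by rewrite ler_norml => /andP[].
  have : expR (- (`|g0| * V)) * Dg g0 h = 2 * dl by rewrite /dl; field.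
  by clear - a1 a2 a3 a4; lra.
pose x := (va + V) / h.
have x0 : 0 <= x.
  by rewrite divr_ge0 ?(ltW h0)//; case/andP: vaV => p _; clear - p; lra.
pose j := Num.truncn x.
have /andP[j1 j2] : j%:R <= x < j.+1%:R by exact: truncn_itv.
have xh : x * h = va + V by rewrite /x divfK// gt_eqF.
have jN : (j <= Num.truncn (2 * V / h))%N.
  apply: le_truncn; rewrite /x ler_wpM2r ?invr_ge0 ?(ltW h0)//.
  by case/andP: vaV => _ p; clear - p; lra.
pose t (i : nat) := - V - 2 * h + i%:R * h.
have tj : t (j.+1) <= va - h.
  have := ler_wpM2r (ltW h0) j1; rewrite xh /t -natr1; clear; lra.
have tj4 : va + h <= t (j.+4).
  have := ler_wpM2r (ltW h0) (ltW j2); rewrite xh /t -!natr1; clear; lra.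
have tt' : t j.+1 <= t j.+4 by clear - tj tj4 h0; lra.
have tdiff : t j.+4 - t j.+1 = 3 * h by rewrite /t -!natr1; ring.
apply: (@le_trans _ _ (avg s (fun v => (1 - ind (- V) V v) + ind (t j.+1) (t j.+4) v))).
  apply: le_avg => v vs; case: (boolP (`|Dg g0 v - mu| < dl)) => hw; last first.
    by rewrite addr_ge0 ?ind_ge0// subr_ge0.
  rewrite {1}/ind; case: (boolP (- V < v <= V)) => [/andP[v1 v2]|_]; last first.
    by rewrite subr0 lerDl ind_ge0.
  case/andP: vaV => va1 va2.
  have c1 := close _ _ v1 v2 hw vaw; have c2 := close _ _ va1 va2 vaw hw.
  rewrite subrr add0r /ind; case: (boolP (_ < v <= _)) => // /negP[].
  by clear - c1 c2 tj tj4; apply/andP; split; lra.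
rewrite avgD avg_ind//.
have g1 : `|ecdf s (t j.+1) - Lam (t j.+1)| <= eta / 8.
  by apply: hgrid; rewrite /N !ltnS (leq_trans jN)// ltnW// ltnW// ltnW.
have g2 : `|ecdf s (t j.+4) - Lam (t j.+4)| <= eta / 8.
  by apply: hgrid; rewrite /N !ltnS (leq_trans jN).
have l1 := Lam_lip tt'; rewrite tdiff in l1.
move: g1 g2 => /ler_normlP[a1 a2] /ler_normlP[a3 a4].
have : h = eta / 16 by [].
by clear - a1 a2 a3 a4 l1 hout e0; lra.
Qed.

(* For bounded shape the log-likelihood decays faster than [- ln (1 + |y|)] in
   the standardized observation [y], which rules out small scales. *)
Lemma ell_decay (Gam : R) : 1 <= Gam -> exists2 C, 0 < C & forall g mu sg x,
  -2^-1 < g <= Gam -> 0 < 1 + g * ((x - mu) / sg) ->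
  ell g mu sg x <= - ln sg + C - (1 + Gam^-1) * ln (1 + `|(x - mu) / sg| / 4).
Proof.
move=> G1; have G0 : 0 < Gam by clear - G1; lra.
have i1 : Gam^-1 <= 1 by rewrite invf_le1.
have i0 : 0 < Gam^-1 by rewrite invr_gt0.
exists ((2 + Gam) ^+ 2) => [|g mu sg x /andP[gl gu]]; first by rewrite exprn_gt0// addr_gt0.
rewrite /ell; move: ((x - mu) / sg) => y hw.
set L := ln (1 + `|y| / 4).
have L0 : 0 <= L by rewrite ln_ge0// lerDl divr_ge0.
have L2 : (1 + Gam^-1) * L <= 2 * L by rewrite ler_wpM2r//; clear - i1; lra.
rewrite -!addrA lerD2l.
have [y0|y0] := leP 0 y.
  have yn : `|y| = y by rewrite ger0_norm.
  have hu : (1 + Gam^-1) * L <= (1 + g) * ug g y.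
    have [gp|gn] := leP g 0.
      have h1 := ug_ge hw gp; have h2 : L <= y / 4.
        have := @ln_le_sub1 R (1 + y / 4); rewrite /L yn => h; apply: (le_trans (h _)).
          by clear - y0; lra.
        by clear; lra.
      have : 2^-1 * y <= (1 + g) * ug g y.
        by rewrite ler_pM ?invr_ge0//; clear - gl; lra.
      by clear - h2 L2; lra.
    have [g2|g2] := leP g 2^-1.
      have hl : 0 <= 2 * g <= 1 by clear - gn g2; apply/andP; split; lra.
      have hy2 : 0 < 1 + y / 2 by clear - y0; lra.
      have := ln_concave_at1 hl hy2.
      have -> : 1 + 2 * g * (1 + y / 2 - 1) = 1 + g * y by field.
      have LL : L <= ln (1 + y / 2).
        by rewrite /L yn ler_ln ?posrE ?lerD2l; clear - y0; lra.
      move=> h; have hug : 2 * ln (1 + y / 2) <= ug g y.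
        by rewrite /ug gt_eqF// ler_pdivlMr//; clear - h; lra.
      have up : 0 <= ug g y.
        apply: le_trans hug; rewrite mulr_ge0// ln_ge0//; clear - y0; lra.
      have : ug g y <= (1 + g) * ug g y by rewrite ler_peMl// lerDl ltW.
      by clear - hug LL L2; lra.
    have LL : L <= ln (1 + g * y).
      have gy := ler_wpM2r y0 (ltW g2).
      by rewrite /L yn ler_ln ?posrE ?lerD2l; clear - y0 gy; lra.
    rewrite /ug gt_eqF//.
    have -> : (1 + g) * (ln (1 + g * y) / g) = (1 + g^-1) * ln (1 + g * y).
      by field; rewrite gt_eqF.
    apply: ler_pM => //; first by clear - i0; lra.
    by rewrite lerD2l lef_pV2 ?posrE.
  have := expR_ge0 (- ug g y); have := sqr_ge0 (2 + Gam).
  by clear - hu; lra.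
have yn : `|y| = - y by rewrite ltr0_norm.
have hu : 2 * L <= - ug g y.
  have LL : L <= - y / 4.
    have := @ln_le_sub1 R (1 + - y / 4); rewrite /L yn => h; apply: (le_trans (h _)).
      by clear - y0; lra.
    by clear; lra.
  have [gp|gn] := leP 0 g.
    have h1 := ug_le hw gp; clear - h1 LL y0; lra.
  have hl : 0 <= 2 * - g <= 1 by clear - gn gl; apply/andP; split; lra.
  have hy2 : 0 < 1 + - y / 2 by clear - y0; lra.
  have := ln_concave_at1 hl hy2.
  have -> : 1 + 2 * - g * (1 + - y / 2 - 1) = 1 + g * y by field.
  have LL2 : L <= ln (1 + - y / 2).
    by rewrite /L yn ler_ln ?posrE ?lerD2l; clear - y0; lra.
  move=> h; have hug : 2 * ln (1 + - y / 2) <= - ug g y.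
    rewrite /ug lt_eqF// -mulrN -invrN ler_pdivlMr ?oppr_gt0//; clear - h; lra.
  by clear - hug LL2; lra.
have ap : 0 < 2 + g by clear - gl; lra.
have := h_le (ug g y) ap.
have : (2 + g) ^+ 2 <= (2 + Gam) ^+ 2.
  by apply: sqr_le_norm; rewrite gtr0_norm ?lerD2l.
by clear - hu L2; lra.
Qed.

(** For a small scale, [window] leaves at most a share [c / 4] of the observations within [dl] of
    [mu]. The others lose [(1 + c) * ln (1 / sg)] up to constants, and
    [(1 + c) * (1 - c / 4) >= 1 + c / 2] outweighs the gain [- ln sg]. For a large scale the term
    [- ln sg] alone suffices. *)
Lemma scale_bound F {FF : Filter F} g0 (Gam M : R) : gumbel_ecdf F ->
  small_tails g0 F -> 1 <= Gam -> exists2 S, 1 <= S & \forall s \near F,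
  forall g mu sg, -2^-1 < g <= Gam -> 0 < sg -> ~~ (S^-1 <= sg <= S) ->
    {in s, forall v, supp g0 g mu sg v} ->
    avg s (fun v => ell g mu sg (Dg g0 v)) <= - M.
Proof.
move=> Fcdf Ftail G1; have G0 : 0 < Gam by clear - G1; lra.
have [C C0 hC] := ell_decay G1.
have [c cE] : exists c, c = Gam^-1 by exists Gam^-1.
have c0 : 0 < c by rewrite cE invr_gt0.
have c1 : c <= 1 by rewrite cE invf_le1.
rewrite -cE in hC.
have [dl dl0 hdl] := window Fcdf Ftail (divr_gt0 c0 (ltr0n _ 4)).
pose A := C - (1 + c / 2) * ln (dl / 4).
pose S := expR (`|M| + (1 + Gam) ^+ 2 + 2 / c * (`|M| + `|A|)).
have M0 := normr_ge0 M; have A0 := normr_ge0 A.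
have q0 : 0 <= 2 / c * (`|M| + `|A|) by rewrite mulr_ge0 ?addr_ge0// divr_ge0// ltW.
have S1 : 1 <= S.
  by rewrite /S -[X in X <= _]expR0 ler_expR !addr_ge0 ?sqr_ge0.
exists S => //.
apply: filterS2 hdl (both_sides 0 Fcdf) => s hw [s0 _ _] g mu sg hg sg0 hS hsupp.
have gp := hg; move: gp => /andP[gl gu].
have SE : S = expR (`|M| + (1 + Gam) ^+ 2 + 2 / c * (`|M| + `|A|)) by [].
move: hS; rewrite negb_and -!ltNge => /orP[sgl|sgu]; last first.
  apply: (@le_trans _ _ (avg s (fun=> - ln sg + (1 + Gam) ^+ 2))).
    apply: le_avg => v _; have g1 : -1 < g by clear - gl; lra.
    apply: (le_trans (ell_le _ _ _ g1)); rewrite lerD2l.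
    by apply: sqr_le_norm; rewrite ger0_norm; [clear - gu|clear - gl]; lra.
  rewrite avg_cst//.
  have : ln S < ln sg by rewrite ltr_ln ?posrE// SE expR_gt0.
  rewrite SE expRK; have := ler_norm M; clear - q0; lra.
have lsg : ln sg < - (`|M| + (1 + Gam) ^+ 2 + 2 / c * (`|M| + `|A|)).
  have : ln sg < ln S^-1 by rewrite ltr_ln ?posrE// invr_gt0 SE expR_gt0.
  by rewrite lnV ?posrE ?SE ?expR_gt0// expRK.
pose L := ln (1 + dl / (4 * sg)).
have dsg0 : 0 < dl / (4 * sg) by rewrite divr_gt0// mulr_gt0.
have L0 : 0 <= L by rewrite ln_ge0// lerDl ltW.
have L1 : ln (dl / 4) - ln sg <= L.
  have -> : ln (dl / 4) - ln sg = ln (dl / (4 * sg)).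
    by rewrite -ln_div ?posrE ?divr_gt0// invfM mulrA.
  by rewrite ler_ln ?posrE ?addr_gt0// lerDr.
have hpt : {in s, forall v, ell g mu sg (Dg g0 v) <=
    (- ln sg + C) - (1 + c) * L * (1 - (`|Dg g0 v - mu| < dl)%R%:R)}.
  move=> v vs; apply: (le_trans (hC _ _ _ _ hg (hsupp v vs))).
  rewrite lerD2l lerN2 -mulrA ler_wpM2l ?addr_ge0 ?(ltW c0)//.
  case: (ltP `|Dg g0 v - mu| dl) => hv.
    by rewrite subrr mulr0 ln_ge0// lerDl divr_ge0.
  have p1 : 0 < 1 + dl / (4 * sg) by rewrite addr_gt0.
  have p2 : 0 < 1 + `|(Dg g0 v - mu) / sg| / 4 by rewrite ltr_wpDr// divr_ge0.
  rewrite subr0 mulr1 ler_ln ?posrE// lerD2l normrM normfV (gtr0_norm sg0) invfM mulrA mulrAC.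
  by rewrite ler_wpM2r ?invr_ge0// ler_wpM2r// invr_ge0 ltW.
apply: (le_trans (le_avg hpt)); rewrite avgB avgZ avgB !avg_cst//.
have := hw mu; set W := avg s _ => hW.
have W1 : (1 + c / 2) * L <= (1 + c) * L * (1 - W).
  rewrite mulrAC ler_wpM2r//.
  have := ler_wpM2l (ltW c0) hW; have := ler_wpM2l (ltW c0) c1; clear - hW c0; lra.
have W2 : (1 + c / 2) * (ln (dl / 4) - ln sg) <= (1 + c / 2) * L.
  by rewrite ler_wpM2l//; clear - c0; lra.
have W3 : c / 2 * ln sg <= - (`|M| + `|A|).
  have : c / 2 * ln sg <= c / 2 * - (2 / c * (`|M| + `|A|)).
    rewrite ler_wpM2l//; first by clear - c0; lra.
    by have := sqr_ge0 (1 + Gam); clear - lsg M0; lra.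
  have -> : c / 2 * - (2 / c * (`|M| + `|A|)) = - (`|M| + `|A|).
    by field; rewrite gt_eqF.
  by [].
have : C - (1 + c / 2) * ln (dl / 4) <= `|A| by exact: ler_norm.
have := ler_norm M.
by clear - W1 W2 W3; lra.
Qed.

(* The shape may be as large as a power of the sample size, and the density may
   then peak just above its left endpoint; [near_min] bounds the number of points
   that can sit in that peak. *)
Definition near_min (q : R) F : Prop := exists2 h, 0 < h &
  \forall s \near F, exists2 t, t <= 0 &
    (exists2 v, v \in s & v <= t - h) /\
    forall g, 1 <= g -> g < powR (size s)%:R q ->
      ecdf s t * ((1 + g) * (1 + ln (1 + g))) <= 2^-1.

Lemma h_le_ln (a u : R) : 0 < a -> - expR (- u) - a * u <= a * ln a.
Proof.
move=> a0; have := @ln_le_sub1 R (expR (- u) / a).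
rewrite divr_gt0 ?expR_gt0// => /(_ isT).
rewrite ln_div ?posrE ?expR_gt0// expRK => h.
have e : expR (- u) / a * a = expR (- u) by rewrite divfK// gt_eqF.
have : a * (- u - ln a) <= a * (expR (- u) / a - 1) by rewrite ler_wpM2l// ltW.
by clear - e a0; lra.
Qed.

Lemma shape_bound F {FF : Filter F} g0 (q M : R) : gumbel_ecdf F ->
  small_tails g0 F -> near_min q F -> exists2 Gam, 1 <= Gam & \forall s \near F,
  forall g mu sg, Gam <= g -> g < powR (size s)%:R q -> 0 < sg ->
    {in s, forall v, supp g0 g mu sg v} ->
    avg s (fun v => ell g mu sg (Dg g0 v)) <= - M.
Proof.
move=> Fcdf Ftail [h h0 hnear]; have [CW CW0 hCW] := avg_Wt Ftail.
have D20 : 0 < Dg g0 2 by apply: Dg_gt0.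
have Dh0 : 0 < Dg g0 h by apply: Dg_gt0.
have [ds dsE] : exists x, x = Dg g0 2 - Dg g0 0 by exists (Dg g0 2 - Dg g0 0).
have ds0 : 0 < ds by rewrite dsE subr_gt0 Dg_lt.
have [p pE] : exists p : R, p = (Lam 2 - Lam (-2)) / 2.
  by exists ((Lam 2 - Lam (-2)) / 2).
have p0 : 0 < p by rewrite pE divr_gt0// subr_gt0 Lam_lt//; clear; lra.
(* k1 v bounds - ln d and k2 v bounds d_* / d - 1 at points away from the minimum *)
pose ih := expR (g0 * h) / Dg g0 h.
have ih0 : 0 < ih by rewrite divr_gt0// expR_gt0.
pose C1 := `|g0| * (1 + h) + `|ln (Dg g0 h)|.
pose C2 := (`|Dg g0 2| + 1) * ih.
have C10 : 0 <= C1 by rewrite addr_ge0// mulr_ge0// addr_ge0// ltW.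
have C20 : 0 <= C2 by rewrite mulr_ge0 ?addr_ge0// ltW.
pose B := (C1 + C2) * CW + 2 * p^-1 + `|ln ds| + 1.
pose Gam := expR (`|M| + B).
have B0 : 0 <= B.
  have hc : 0 <= (C1 + C2) * CW.
    by apply: mulr_ge0; [exact: addr_ge0|exact: ltW].
  have hp : 0 <= p^-1 by rewrite invr_ge0 ltW.
  by have hl := normr_ge0 (ln ds); rewrite /B; clear - hc hp hl; lra.
exists Gam; first by rewrite -[X in X <= _]expR0 ler_expR addr_ge0.
have lt22 : -2 < 2 :> R by clear; lra.
apply: filterS3 hCW (freq_ge Fcdf lt22) (filterI hnear (both_sides 0 Fcdf)) => s hW; rewrite -pE => hp.
move=> [[t t0 [[v1 v1s v1t] hfr]] [s0 _ _]] g mu sg gG gk sg0 hsupp.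
have g1 : 1 <= g.
  by apply: le_trans gG; rewrite -[X in X <= _]expR0 ler_expR addr_ge0.
have gp : 0 < g by clear - g1; lra.
pose e := mu - sg / g.
have wE v : 1 + g * ((Dg g0 v - mu) / sg) = g / sg * (Dg g0 v - e).
  by rewrite /e; field; rewrite !gt_eqF.
have gsg : 0 < g / sg by rewrite divr_gt0.
have dpos v : supp g0 g mu sg v -> 0 < Dg g0 v - e.
  by rewrite /supp wE pmulr_rgt0.
have d1 := dpos _ (hsupp _ v1s).
pose dd v := Dg g0 v - e; have d2 : ds <= dd 2.
  have v10 : v1 <= 0 by clear - v1t t0 h0; lra.
  by have := Dg_le g0 v10; rewrite dsE /dd; clear - d1; lra.
have d20 : 0 < dd 2 := lt_le_trans ds0 d2.
(* The value of [ug] at the reference point [v = 2]; it collects the unknown scale and is eliminated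
   at the end. *)
pose X := ln (g / sg * dd 2) / g.
have uE v : supp g0 g mu sg v ->
    ug g ((Dg g0 v - mu) / sg) = X + (ln (dd v) - ln (dd 2)) / g.
  move=> hs; have hd : 0 < dd v := dpos _ hs.
  rewrite /ug gt_eqF// wE -/(dd v) /X !lnM ?posrE ?invr_gt0//.
  by field; rewrite gt_eqF.
have ellE' v : supp g0 g mu sg v -> ell g mu sg (Dg g0 v) =
    - ln g - ln (dd v) - ug g ((Dg g0 v - mu) / sg) - expR (- ug g ((Dg g0 v - mu) / sg)).
  move=> hs; have hd : 0 < dd v := dpos _ hs; rewrite /ell.
  have -> : (1 + g) * ug g ((Dg g0 v - mu) / sg) = ug g ((Dg g0 v - mu) / sg)
      + (ln g - ln sg + ln (dd v)).
    rewrite mulrDl mul1r; congr (_ + _); rewrite /ug gt_eqF// wE mulrCA divff ?gt_eqF// mulr1.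
    by rewrite lnM ?posrE ?divr_gt0// ln_div ?posrE.
  by ring.
have hd v : t < v -> expR (g0 * v) / ih <= dd v.
  move=> tv; have : Dg g0 v1 <= Dg g0 (v - h) by apply: Dg_le; clear - tv v1t; lra.
  have -> : expR (g0 * v) / ih = Dg g0 v - Dg g0 (v - h).
    have -> : Dg g0 v = Dg g0 (v - h + h) by congr (Dg g0 _); ring.
    rewrite DgD /ih invfM invrK -expRN mulrA -expRD.
    by have -> : g0 * v + - (g0 * h) = g0 * (v - h) by [ring]; ring.
  by rewrite /dd; clear - d1; lra.
have hdp v : t < v -> 0 < dd v.
  by move=> /hd; apply: lt_le_trans; rewrite divr_gt0// expR_gt0.
have k1 v : t < v -> - ln (dd v) <= C1 * Wt g0 v.
  move=> tv; have h1 : ln (expR (g0 * v) / ih) <= ln (dd v).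
    by rewrite ler_ln ?posrE ?hdp ?hd// divr_gt0// expR_gt0.
  have : - ln (expR (g0 * v) / ih) <= `|g0| * `|v| + (`|g0| * h + `|ln (Dg g0 h)|).
    rewrite ln_div ?posrE ?expR_gt0// expRK /ih ln_div ?posrE ?expR_gt0// expRK.
    have a1 : - (g0 * v) <= `|g0| * `|v| by rewrite -normrM -normrN ler_norm.
    have a2 : g0 * h <= `|g0| * h by rewrite ler_wpM2r ?ler_norm// ltW.
    have := ler_norm (- ln (Dg g0 h)); rewrite normrN.
    by clear - a1 a2; lra.
  have w1 := Wt_ge_1 g0 v; have w2 := Wt_ge_norm g0 v.
  have a3 : `|g0| * `|v| <= `|g0| * Wt g0 v by rewrite ler_wpM2l.
  have a4 : (`|g0| * h + `|ln (Dg g0 h)|) * 1 <= (`|g0| * h + `|ln (Dg g0 h)|) * Wt g0 v.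
    by rewrite ler_wpM2l// addr_ge0// mulr_ge0// ltW.
  by rewrite /C1; clear - h1 a3 a4; lra.
have k2 v : t < v -> (ln (dd 2) - ln (dd v)) / g <= C2 * Wt g0 v.
  move=> tv; have dv := hdp v tv.
  have a1 : ln (dd 2) - ln (dd v) <= (`|Dg g0 2| + `|Dg g0 v|) * (ih * expR (- (g0 * v))).
    rewrite -ln_div ?posrE//; apply: (le_trans (ln_le_sub1 _)); first by rewrite divr_gt0.
    have -> : dd 2 / dd v - 1 = (Dg g0 2 - Dg g0 v) / dd v.
      by rewrite /dd; field; rewrite gt_eqF.
    apply: (le_trans (ler_norm _)); rewrite normrM; apply: ler_pM => //.
      exact: ler_normB.
    rewrite gtr0_norm ?invr_gt0//.
    have -> : ih * expR (- (g0 * v)) = (expR (g0 * v) / ih)^-1.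
      by rewrite invfM invrK expRN mulrC.
    by rewrite lef_pV2 ?posrE ?hd// divr_gt0// expR_gt0.
  have a2 : (`|Dg g0 2| + `|Dg g0 v|) * (ih * expR (- (g0 * v))) <= C2 * Wt g0 v.
    have -> : (`|Dg g0 2| + `|Dg g0 v|) * (ih * expR (- (g0 * v))) =
      ih * (`|Dg g0 2| * expR (- (g0 * v)) + `|Dg g0 v| * expR (- (g0 * v))) by ring.
    have -> : C2 * Wt g0 v = ih * ((`|Dg g0 2| + 1) * Wt g0 v) by rewrite /C2; ring.
    rewrite ler_wpM2l ?(ltW ih0)//.
    have e0 := expR_ge0 (- (g0 * v)); have w := Wt_ge_exp g0 v; have v0 := normr_ge0 v.
    have ve : 0 <= `|v| * expR (- (g0 * v)) by rewrite mulr_ge0.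
    have b1 : `|Dg g0 v| * expR (- (g0 * v)) <= Wt g0 v.
      apply: le_trans w; apply: (@le_trans _ _ (`|v| * (1 + expR (g0 * v)) * expR (- (g0 * v)))).
        by rewrite ler_wpM2r// Dg_bound.
      rewrite -mulrA mulrDl mul1r expRxMexpNx_1.
      by clear - e0 v0 ve; lra.
    have b2 : `|Dg g0 2| * expR (- (g0 * v)) <= `|Dg g0 2| * Wt g0 v.
      by rewrite ler_wpM2l//; apply: le_trans w; clear - e0 v0 ve; lra.
    by clear - b1 b2; lra.
  apply: le_trans a2; apply: (@le_trans _ _ (Num.max 0 (ln (dd 2) - ln (dd v)))).
    rewrite ler_pdivrMr//; case: (leP 0 (ln (dd 2) - ln (dd v))) => hx.
      by rewrite ler_peMr.
    by rewrite mul0r ltW.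
  rewrite ge_max a1 andbT; apply: mulr_ge0; first exact: addr_ge0.
  by apply: mulr_ge0; [exact: ltW|exact: expR_ge0].
pose Nr v : R := (v <= t)%R%:R.
pose A := `|ln ds| + (1 + g) * ln (1 + g).
have lg : 0 <= ln (1 + g) by rewrite ln_ge0// lerDl ltW.
have W0 v : 0 <= Wt g0 v by exact: le_trans (Wt_ge_1 g0 v).
have hpt : {in s, forall v, ell g mu sg (Dg g0 v) <=
   (- ln g - X) + (A + (1 + g) * X) * Nr v + (C1 + C2) * Wt g0 v
   - expR (- X) * ((1 - Nr v) * ind (-2) 2 v)}.
  move=> v vs; have hs := hsupp _ vs; rewrite /Nr.
  have Wp : 0 <= (C1 + C2) * Wt g0 v by rewrite mulr_ge0// addr_ge0.
  rewrite (ellE' _ hs); case: (leP v t) => tv.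
    rewrite subrr mul0r mulr0 subr0 mulr1.
    have hh := h_le_ln (ug g ((Dg g0 v - mu) / sg)) (ltr_wpDl ler01 gp).
    have -> : ln (dd v) = g * ug g ((Dg g0 v - mu) / sg) - g * X + ln (dd 2).
      by rewrite uE//; field; rewrite gt_eqF.
    have : ln ds <= ln (dd 2) by rewrite ler_ln.
    have := ler_norm (- ln ds); rewrite normrN /A.
    by clear - hh Wp; lra.
  rewrite mulr0 addr0 subr0 mul1r uE//.
  have kk1 := k1 v tv; have kk2 := k2 v tv.
  have kk3 : - ((ln (dd v) - ln (dd 2)) / g) <= C2 * Wt g0 v.
    by rewrite -mulNr opprB.
  have : expR (- X) * ind (-2) 2 v <= expR (- (X + (ln (dd v) - ln (dd 2)) / g)).
    rewrite /ind; case: (boolP (-2 < v <= 2)) => [/andP[_ v2]|_]; last first.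
      by rewrite mulr0 expR_ge0.
    rewrite mulr1 ler_expR lerN2 gerDl pmulr_lle0 ?invr_gt0// subr_le0.
    have ddle : dd v <= dd 2 by rewrite lerD2r Dg_le.
    by rewrite ler_ln// posrE; exact: hdp.
  by clear - kk1 kk3; lra.
apply: (le_trans (le_avg hpt)).
rewrite avgB !avgD !avg_cst// !avgZ.
have f0 : 0 <= avg s Nr by apply: avg_ge0 => v _; rewrite ler0n.
have hf := hfr g g1 gk; rewrite -/(avg s Nr) in hf.
have {hf} hf : avg s Nr * ((1 + g) * (1 + ln (1 + g))) <= 2^-1 by exact: hf.
set f := avg s Nr in f0 hf *.
have fg0 : 0 <= f * (1 + g) by rewrite mulr_ge0// addr_ge0// ltW.
have fgl : 0 <= f * (1 + g) * ln (1 + g) by rewrite mulr_ge0.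
have hfg : f * (1 + g) <= 2^-1 by clear - hf fgl; lra.
have hf1 : f <= 2^-1 by have := mulr_ge0 f0 (ltW gp); clear - hfg; lra.
have hA : A * f <= `|ln ds| + 2^-1.
  have : `|ln ds| * f <= `|ln ds| by rewrite ler_piMr//; clear - hf1; lra.
  by rewrite /A; clear - hf fg0; lra.
have hmid : p <= avg s (fun v => (1 - Nr v) * ind (-2) 2 v) + f.
  apply: (le_trans hp); rewrite -avgD; apply: le_avg => v _.
  rewrite /Nr; case: (v <= t); rewrite ?subrr ?subr0 ?mul1r ?mul0r ?addr0 ?add0r//.
  by rewrite /ind; case: (_ < v <= _).
set m := avg s _ in hmid *.
have [pi piE] : exists pi, pi = p^-1 by exists p^-1.
have ppi : p * pi = 1 by rewrite piE mulfV// gt_eqF.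
have pi0 : 0 < pi by rewrite piE invr_gt0.
have Bpi : 2 * pi <= B.
  rewrite /B -piE; have : 0 <= (C1 + C2) * CW.
    by apply: mulr_ge0; [exact: addr_ge0|exact: ltW].
  by have := normr_ge0 (ln ds); clear; lra.
have gpi : pi <= g.
  apply: le_trans gG; apply: le_trans (expR_ge1Dx _).
  by have := normr_ge0 M; clear - Bpi pi0; lra.
have fp : f <= p / 2.
  have h1 : f * pi <= 2^-1.
    by apply: le_trans hfg; rewrite ler_wpM2l//; clear - gpi; lra.
  have := ler_wpM2l (ltW p0) h1; rewrite mulrCA ppi mulr1; clear; lra.
have mp : p / 2 <= m by clear - hmid fp; lra.
have lng : `|M| + B <= ln g.
  by rewrite -[X in X <= _]expRK ler_ln ?posrE ?expR_gt0.
have hW' : (C1 + C2) * avg s (Wt g0) <= (C1 + C2) * CW by rewrite ler_wpM2l// addr_ge0.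
have eX : expR (- X) * (p / 2) <= expR (- X) * m by rewrite ler_wpM2l// expR_ge0.
(* After averaging, [X] occurs linearly with a coefficient at most [-1/2], and in [- expR (- X)]
   with weight at least [p / 2]; the sum is bounded above whatever the sign of [X]. *)
have main : forall Y : R, - ((1 - f * (1 + g)) * Y) - expR (- Y) * (p / 2) <= 2 * pi.
  move=> Y.
  have e0 := expR_ge0 (- Y).
  have ep : 0 <= expR (- Y) * (p / 2) by rewrite mulr_ge0// divr_ge0// ltW.
  have [Y0|Y0] := leP 0 Y.
    have : 0 <= (1 - f * (1 + g)) * Y by rewrite mulr_ge0//; clear - hfg; lra.
    by clear - ep pi0; lra.
  have Y2 : - 2 <= - Y by clear - Y0; lra.
  have h1 := expR_ge_sqr Y2; rewrite sqrrN in h1.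
  have h2 : Y ^+ 2 / 4 * (p / 2) <= expR (- Y) * (p / 2).
    by rewrite ler_wpM2r ?divr_ge0 ?(ltW p0)//; clear - h1 Y0; lra.
  have h3 : 0 <= f * (1 + g) * - Y by rewrite mulr_ge0//; clear - Y0; lra.
  have h4 : 0 <= p * (Y + 4 * pi) ^+ 2 by rewrite mulr_ge0 ?sqr_ge0// ltW.
  have h5 : p * (Y + 4 * pi) ^+ 2 = p * Y ^+ 2 + 8 * (p * pi) * Y + 16 * (p * pi) * pi.
    by ring.
  by rewrite ppi in h5; clear - h2 h3 h4 h5; lra.
have {}main := main X.
have := ler_norm M; rewrite /B -piE in lng.
by clear - main eX hW' lng hA; lra.
Qed.

End Noncompact.

Section Global.
Context {R : realType}.

Lemma global_bound (F : set_system (seq R)) {FF : Filter F} (g0 q eps : R) :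
  -2^-1 < g0 -> gumbel_ecdf F -> small_tails g0 F -> near_min q F -> 0 < eps ->
  exists2 c, 0 < c & \forall s \near F, forall g mu sg,
    -2^-1 < g -> g < powR (size s)%:R q -> 0 < sg -> eps <= nD g0 g mu sg ->
    {in s, forall v, supp g0 g mu sg v} -> avg s (lr g0 g mu sg) <= - c.
Proof.
move=> g0_gt Fcdf Ftail Fmin eps0.
have [C0 C00 hC0] := ell0_avg Ftail.
(* The margin [C0 + 1] leaves -1 once the average of minus the true log-likelihood is added. *)
have [Gam G1 hG] := shape_bound (C0 + 1) Fcdf Ftail Fmin.
have [S S1 hS] := scale_bound (C0 + 1) Fcdf Ftail G1.
have [c c0 hc] := compact_bound g0_gt Fcdf Ftail (lt_le_trans ltr01 G1) S1 eps0.
exists (Num.min c 1); first by rewrite lt_min c0 ltr01.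
apply: filterS3 (filterI hC0 hG) hS hc => s [h0 hg] hs hk g mu sg gl gk sg0 hD hsupp.
have lrE' : avg s (lr g0 g mu sg) = avg s (fun v => ell g mu sg (Dg g0 v))
    + avg s (fun v => - ell g0 0 1 (Dg g0 v)) by rewrite -avgD.
have [gG|gG] := leP Gam g.
  apply: (@le_trans _ _ (-1)); last by rewrite lerN2 ge_min lexx orbT.
  rewrite lrE'; have := hg _ _ _ gG gk sg0 hsupp; clear - h0; lra.
have gg : -2^-1 < g <= Gam by rewrite gl ltW.
have [sgS|sgS] := boolP (S^-1 <= sg <= S).
  apply: (le_trans (hk _ _ _ gg sgS hD hsupp)).
  by rewrite lerN2 ge_min lexx.
apply: (@le_trans _ _ (-1)); last by rewrite lerN2 ge_min lexx orbT.
rewrite lrE'; have := hs _ _ _ gg sg0 sgS hsupp; clear - h0; lra.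
Qed.

End Global.

(** * The second-order condition *)

Section OrientedIntegral.
Context {R : realType}.
Implicit Types (f F : R -> R) (x v : R).

Lemma oint_ftc f F x : 1 <= x ->
  (forall v, 1 <= v <= x -> has_der v F (f v)) ->
  (forall v, 1 <= v <= x -> {for v, continuous f}) ->
  oint f x = F x - F 1.
Proof.
move=> x1 dF cf; rewrite /oint x1; move: x1; rewrite le_eqVlt => /orP[/eqP <-|x1].
  by rewrite set_itv1 Rintegral_set1 subrr.
rewrite /Rintegral (@continuous_FTC2 R f F 1 x x1) //.
- apply: continuous_in_subspaceT => z; rewrite inE /= in_itv /=; exact: cf.
- have cF z : 1 <= z <= x -> {for z, continuous F} by move=> /dF; exact: der_continuous.
  split.
  + move=> z; rewrite in_itv /= => /andP[z1 z2].
    by have := dF z; rewrite !ltW// => /(_ isT) [].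
  + by apply: cvg_at_right_filter; apply: cF; rewrite lexx ltW.
  + by apply: cvg_at_left_filter; apply: cF; rewrite lexx ltW.
- move=> z; rewrite in_itv /= => /andP[z1 z2].
  have := dF z; rewrite !ltW// => /(_ isT) hz.
  by rewrite derive1E; apply: derive_val.
Qed.

Lemma eq_oint f g x : 1 <= x -> (forall v, 1 <= v <= x -> f v = g v) ->
  oint f x = oint g x.
Proof.
move=> x1 fg; rewrite /oint x1; apply: eq_Rintegral => v.
by rewrite inE /= in_itv /=; exact: fg.
Qed.

Lemma der_comp_ln F a x : 0 < x -> has_der (ln x) F a ->
  has_der x (fun v => F (ln v)) (a / x).
Proof. by move=> x0 h; apply: der_comp => //; exact: is_derive1_ln. Qed.

Lemma powR_expln g v : 0 < v -> powR v (g - 1) = expR (g * ln v) / v.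
Proof.
move=> v0; rewrite /powR gt_eqF// mulrBl mul1r expRB lnK//.
Qed.

Lemma continuous_powR g v : 0 < v -> {for v, continuous (fun u => powR u g)}.
Proof.
by move=> v0; apply: (@der_continuous _ _ (g * powR v (g - 1)));
  apply: is_derive1_powR.
Qed.

Lemma oint_powR g x : 1 <= x -> oint (fun u => powR u (g - 1)) x = Dg g (ln x).
Proof.
move=> x1; rewrite (@oint_ftc _ (fun v => Dg g (ln v)))//.
- by rewrite ln1 Dg0r subr0.
- move=> v /andP[v1 _]; have v0 : 0 < v := lt_le_trans ltr01 v1.
  by rewrite powR_expln//; apply: der_comp_ln => //; exact: der_Dg.
- move=> v /andP[v1 _]; apply: continuous_powR; exact: lt_le_trans v1.
Qed.

(** [Hfun g rho] at [expR t] in closed form; the case [rho = 0] is the limit. *)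
Definition HH (g rho t : R) : R :=
  if rho == 0 then Qg g t else (Dg (g + rho) t - Dg g t) / rho.

Lemma HH0r g rho : HH g rho 0 = 0.
Proof. by rewrite /HH Qg0r !Dg0r subrr mul0r; case: ifP. Qed.

Lemma der_HH g rho t : has_der t (HH g rho) (expR (g * t) * Dg rho t).
Proof.
case: (eqVneq rho 0) => [->|r0].
  have -> : HH g 0 = Qg g by apply/funext => x; rewrite /HH eqxx.
  by rewrite mulrC {1}/Dg eqxx; exact: der_Qg.
have -> : HH g rho = fun t => (Dg (g + rho) t - Dg g t) / rho.
  by apply/funext => x; rewrite /HH (negbTE r0).
have h1 := der_Dg (g + rho) t; have h2 := der_Dg g t.
by der; rewrite (mulrDl g rho) expRD /Dg (negbTE r0); field.
Qed.

Lemma Hfun_HH g rho x : 1 <= x -> Hfun g rho x = HH g rho (ln x).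
Proof.
move=> x1; rewrite /Hfun.
rewrite (@eq_oint _ (fun v => powR v (g - 1) * Dg rho (ln v)))//; last first.
  by move=> v /andP[v1 _]; rewrite oint_powR.
rewrite (@oint_ftc _ (fun v => HH g rho (ln v)))//.
- by rewrite ln1 HH0r subr0.
- move=> v /andP[v1 _]; have v0 : 0 < v := lt_le_trans ltr01 v1.
  rewrite powR_expln// mulrAC.
  by apply: der_comp_ln => //; exact: der_HH.
- move=> v /andP[v1 _]; have v0 : 0 < v := lt_le_trans ltr01 v1.
  apply: continuousM; first exact: continuous_powR.
  by apply: der_continuous; apply: der_comp_ln => //; exact: der_Dg.
Qed.

Lemma eq_der (f h df : R -> R) x : (forall v, has_der v f (df v)) ->
  (forall v, has_der v h (df v)) -> f 0 = h 0 -> f x = h x.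
Proof.
move=> df1 df2 e0.
have hd v : has_der v (fun v => f v - h v) 0.
  by have h1 := df1 v; have h2 := df2 v; der; ring.
have hb v : Num.min 0 x <= v <= Num.max 0 x -> `|0 : R| <= 0 by rewrite normr0.
have := mvt_bound (fun v _ => hd v) hb.
rewrite mul0r normr_le0 e0 subrr subr0 subr_eq0 => /eqP //.
Qed.

Lemma HHD g rho t u : HH g rho (t + u) = HH g rho t +
  expR (g * t) * (Dg rho t * Dg g u + expR (rho * t) * HH g rho u).
Proof.
apply: (@eq_der (fun u => HH g rho (t + u)) (fun u => HH g rho t +
  expR (g * t) * (Dg rho t * Dg g u + expR (rho * t) * HH g rho u))
  (fun u => expR (g * (t + u)) * Dg rho (t + u))).
- move=> v; rewrite -[X in has_der _ _ X]mulr1.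
  apply: (@der_comp _ (HH g rho) (fun u => t + u)); first exact: der_HH.
  by der; ring.
- move=> v; have h1 := der_Dg g v; have h2 := der_HH g rho v.
  by der; rewrite (DgD rho) (mulrDr g t) expRD; ring.
- by rewrite Dg0r HH0r addr0 !mulr0 addr0 mulr0 addr0.
Qed.

(** The second difference that annihilates [Dg g], whose value at [2 * L] is [1 + expR (g * L)]
    times its value at [L]. Applied to [b] it leaves a multiple of [A]; [HHc_gt0] makes the multiple
    nonzero, so that [A] can be read off [b]. *)
Definition HHc (g rho L : R) : R := HH g rho (2 * L) - (1 + expR (g * L)) * HH g rho L.

Lemma HHcE g rho t L :
  HH g rho (t + 2 * L) - HH g rho (t + L)
  - expR (g * L) * (HH g rho (t + L) - HH g rho t) =
  expR ((g + rho) * t) * HHc g rho L.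
Proof.
have e2 : Dg g (2 * L) = (1 + expR (g * L)) * Dg g L.
  by have -> : 2 * L = L + L by [ring]; rewrite DgD; ring.
rewrite !(HHD _ _ t) e2 /HHc (mulrDl g) expRD; ring.
Qed.

Lemma HHc_gt0 g rho L : 0 < L -> 0 < HHc g rho L.
Proof.
move=> L0; have -> : HHc g rho L = expR (g * L) * Dg rho L * Dg (g + rho) L.
  have hE : HHc g rho L = expR (g * L) * (Dg rho L * Dg g L + (expR (rho * L) - 1) * HH g rho L).
    by rewrite /HHc; have -> : 2 * L = L + L by [ring]; rewrite HHD; ring.
  rewrite hE -(Dg_exp rho) /HH; case: (eqVneq rho 0) => [->|r0].
    by rewrite addr0; ring.
  by field.
by rewrite !mulr_gt0 ?expR_gt0 ?Dg_gt0.
Qed.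

End OrientedIntegral.

Unset Implicit Arguments.
Section Limits.
Context {R : realType} {T : Type} {F : set_system T} {FF : Filter F}.
Implicit Types (f g : T -> R) (a b : R).

Lemma lim_add f g a b : f x @[x --> F] --> a -> g x @[x --> F] --> b ->
  (f x + g x) @[x --> F] --> a + b.
Proof. exact: cvgD. Qed.
Lemma lim_sub f g a b : f x @[x --> F] --> a -> g x @[x --> F] --> b ->
  (f x - g x) @[x --> F] --> a - b.
Proof. exact: cvgB. Qed.
Lemma lim_mul f g a b : f x @[x --> F] --> a -> g x @[x --> F] --> b ->
  (f x * g x) @[x --> F] --> a * b.
Proof. exact: cvgM. Qed.
Lemma lim_inv f a : a != 0 -> f x @[x --> F] --> a -> (f x)^-1 @[x --> F] --> a^-1.
Proof. exact: cvgV. Qed.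
Lemma lim_cst a : (fun _ : T => a) x @[x --> F] --> a.
Proof. exact: cvg_cst. Qed.
Lemma lim_eq f g a : f x @[x --> F] --> a -> (\forall x \near F, f x = g x) ->
  g x @[x --> F] --> a.
Proof. by move=> fa fg; apply: cvg_trans fa; exact: near_eq_cvg. Qed.
Lemma lim_near f a (e : R) : f x @[x --> F] --> a -> 0 < e ->
  \forall x \near F, `|f x - a| <= e.
Proof.
move=> /cvgrPdist_le fa e0; apply: filterS (fa e e0) => x.
by rewrite distrC.
Qed.
Lemma near_lim f a : (forall e : R, 0 < e -> \forall x \near F, `|f x - a| <= e) ->
  f x @[x --> F] --> a.
Proof.
move=> h; apply/cvgrPdist_le => e e0; apply: filterS (h e e0) => x.
by rewrite distrC.
Qed.

End Limits.
Set Implicit Arguments.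
Arguments lim_add {R T F FF f g a b}.
Arguments lim_sub {R T F FF f g a b}.
Arguments lim_mul {R T F FF f g a b}.
Arguments lim_inv {R T F FF f a}.
Arguments lim_cst {R T F FF} a.
Arguments lim_eq {R T F FF f g a}.
Arguments lim_near {R T F FF f a e}.
Arguments near_lim {R T F FF f a}.

Lemma near_pos_neq0 (R : realType) (x l : R) : 0 < l -> `|x - l| <= l / 2 -> x != 0.
Proof.
move=> l0; apply: contraTneq => ->; rewrite sub0r normrN gtr0_norm// -ltNge.
by lra.
Qed.

(** * Regular variation derived from the second-order condition *)

Section SecondOrder.
Context {R : realType}.
Variables (b a Af : R -> R) (g rho : R).

Definition incr (t s : R) : R := (b (s * expR t) - b s) / a s.

Hypothesis a_gt0 : forall s, 0 < a s.
Hypothesis A_neq0 : \forall s \near +oo, Af s != 0.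
Hypothesis A_cvg0 : Af s @[s --> +oo] --> 0.
Hypothesis so : forall t, 0 <= t ->
  ((Af s)^-1 * (incr t s - Dg g t)) @[s --> +oo] --> HH g rho t.

Lemma scale_near (P : R -> Prop) t : (\forall s \near +oo, P s) ->
  \forall s \near +oo, P (s * expR t).
Proof.
move=> [M [Mr hM]]; exists (M / expR t); split; first exact: num_real.
by move=> s; rewrite ltr_pdivrMr ?expR_gt0// => /hM.
Qed.

Lemma scale_lim (f : R -> R) (l t : R) : f s @[s --> +oo] --> l ->
  f (s * expR t) @[s --> +oo] --> l.
Proof.
move=> fl; apply: near_lim => e e0.
by apply: (@scale_near (fun s => `|f s - l| <= e)); exact: lim_near.
Qed.

Lemma incr_lim t : 0 <= t -> incr t s @[s --> +oo] --> Dg g t.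
Proof.
move=> t0; pose proof (lim_add (lim_mul A_cvg0 (so t0)) (lim_cst (Dg g t))) as h.
rewrite mul0r add0r in h; refine (lim_eq h _).
apply: filterS A_neq0 => s As0; rewrite mulrA mulfV// mul1r; ring.
Qed.

Lemma a_incr t u s : a (s * expR t) / a s * incr u (s * expR t) =
  incr (t + u) s - incr t s.
Proof.
rewrite /incr expRD -(mulrA s).
have := a_gt0 s; have := a_gt0 (s * expR t) => h1 h2.
by field; rewrite !gt_eqF.
Qed.

(** The increment of [b] over the same interval, measured from base [s] and from base [s * expR t],
    differs exactly by the ratio of the scales. *)
Lemma a_lim t : 0 <= t -> (a (s * expR t) / a s) @[s --> +oo] --> expR (g * t).
Proof.
move=> t0; have D1 : 0 < Dg g 1 by apply: Dg_gt0.
have t1 : 0 <= t + 1 by rewrite addr_ge0.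
pose proof (lim_sub (incr_lim t1) (incr_lim t0)) as h1.
have h2 : incr 1 (s * expR t) @[s --> +oo] --> Dg g 1.
  by apply: (@scale_lim (incr 1)); apply: incr_lim.
pose proof (lim_mul h1 (lim_inv (lt0r_neq0 D1) h2)) as h3.
have e : (Dg g (t + 1) - Dg g t) / Dg g 1 = expR (g * t).
  by rewrite DgD; field; rewrite gt_eqF.
rewrite e in h3; refine (lim_eq h3 _).
have D2 : 0 < Dg g 1 / 2 by rewrite divr_gt0.
apply: filterS (lim_near h2 D2) => s hs.
rewrite -a_incr mulfK//; exact: near_pos_neq0 hs.
Qed.

Definition curv (L s : R) : R := incr (2 * L) s - (1 + expR (g * L)) * incr L s.

Lemma curv_lim L : 0 <= L -> ((Af s)^-1 * curv L s) @[s --> +oo] --> HHc g rho L.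
Proof.
move=> L0; have L20 : 0 <= 2 * L by rewrite mulr_ge0.
pose proof (lim_sub (so L20) (lim_mul (lim_cst (1 + expR (g * L))) (so L0))) as h.
apply: (lim_eq h); near=> s; rewrite /curv.
have -> : Dg g (2 * L) = (1 + expR (g * L)) * Dg g L.
  by have -> : 2 * L = L + L by [ring]; rewrite DgD; ring.
ring.
Unshelve. all: by end_near. Qed.

Lemma curv_shift t L s : a (s * expR t) / a s * curv L (s * expR t) =
  incr (t + 2 * L) s - incr (t + L) s
  - expR (g * L) * (incr (t + L) s - incr t s).
Proof.
rewrite /curv mulrBr a_incr mulrCA a_incr; ring.
Qed.

(** The same curvature of [b] is computed from base [s * expR t], where it is a multiple of the
    shifted [A], and from base [s], where it is a multiple of [A s]. The quotient of the two gives
    the ratio. *)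
Lemma A_ratio_lim t : 0 <= t -> (Af (s * expR t) / Af s) @[s --> +oo] --> expR (rho * t).
Proof.
move=> t0; pose c := HHc g rho 1; have c0 : 0 < c by apply: HHc_gt0.
have p1 : 0 <= t + 2 * 1 by rewrite addr_ge0.
have p2 : 0 <= t + 1 by rewrite addr_ge0.
pose proof (lim_sub (lim_sub (so p1) (so p2))
  (lim_mul (lim_cst (expR (g * 1))) (lim_sub (so p2) (so t0)))) as h1.
have h2 : ((Af (s * expR t))^-1 * curv 1 (s * expR t)) @[s --> +oo] --> c.
  by apply: (@scale_lim (fun s => (Af s)^-1 * curv 1 s)); apply: curv_lim.
pose proof (lim_mul h1 (lim_mul (lim_inv (lt0r_neq0 c0) h2)
  (lim_inv (lt0r_neq0 (expR_gt0 (g * t))) (a_lim t0)))) as h3.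
rewrite HHcE -/c (mulrDl g rho) expRD in h3.
have e : expR (g * t) * expR (rho * t) * c * (c^-1 / expR (g * t)) = expR (rho * t).
  by field; rewrite !gt_eqF ?expR_gt0.
rewrite e in h3; refine (lim_eq h3 _).
near=> s.
have As : Af s != 0 by near: s.
have As' : Af (s * expR t) != 0 by near: s; exact: (@scale_near (fun s => Af s != 0)).
have cs : curv 1 (s * expR t) != 0.
  have hc0 : (Af (s * expR t))^-1 * curv 1 (s * expR t) != 0.
    apply: (near_pos_neq0 c0); near: s; apply: (lim_near h2); exact: divr_gt0.
  by move: hc0; rewrite mulf_eq0 negb_or => /andP[].
have ha : a (s * expR t) / a s != 0 by rewrite gt_eqF// divr_gt0.
have hc := curv_shift t 1 s; rewrite mulr1 in hc.
transitivity ((Af s)^-1 * (a (s * expR t) / a s * curv 1 (s * expR t)) *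
  (((Af (s * expR t))^-1 * curv 1 (s * expR t))^-1 / (a (s * expR t) / a s))).
  rewrite hc; congr (_ * _).
  have -> : Dg g (t + 1) = Dg g t + expR (g * t) * Dg g 1 by rewrite DgD.
  have -> : Dg g (t + 2 * 1) = Dg g t + expR (g * t) * ((1 + expR (g * 1)) * Dg g 1).
    have -> : 2 * 1 = 1 + 1 :> R by ring.
    by rewrite !DgD; ring.
  by rewrite !mulr1; ring.
move: ha cs; set r := a _ / _; set k := curv _ _ => r0 k0.
by field; rewrite As As' r0.
Unshelve. all: by end_near. Qed.

(** [a_incr] expresses [incr (t + 1)] at base [s] by an increment at base [s * expR t]. Subtracting
    the two second-order expansions and dividing by [Dg g 1] isolates the ratio of scales. *)
Lemma a_second_lim t : 0 < t ->
  ((Af s)^-1 * (a (s * expR t) / a s - expR (g * t))) @[s --> +oo] -->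
  expR (g * t) * Dg rho t.
Proof.
move=> tp; have t0 := ltW tp; have D1 : 0 < Dg g 1 by apply: Dg_gt0.
have p2 : 0 <= t + 1 by rewrite addr_ge0.
pose proof (lim_sub (so p2) (so t0)) as h1.
have h2 : ((Af (s * expR t))^-1 * (incr 1 (s * expR t) - Dg g 1)) @[s --> +oo] --> HH g rho 1.
  by apply: (@scale_lim (fun s => (Af s)^-1 * (incr 1 s - Dg g 1))); apply: so.
pose proof (lim_mul (lim_mul (a_lim t0) (A_ratio_lim t0)) h2) as h3.
pose proof (lim_mul (lim_sub h1 h3) (lim_cst (Dg g 1)^-1)) as h4.
have e : (HH g rho (t + 1) - HH g rho t - expR (g * t) * expR (rho * t) * HH g rho 1)
   * (Dg g 1)^-1 = expR (g * t) * Dg rho t.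
  by rewrite HHD; field; rewrite gt_eqF.
rewrite e in h4; refine (lim_eq h4 _); near=> s.
have As : Af s != 0 by near: s.
have As' : Af (s * expR t) != 0 by near: s; exact: (@scale_near (fun s => Af s != 0)).
have hi := a_incr t 1 s.
have hi' : incr (t + 1) s = incr t s + a (s * expR t) / a s * incr 1 (s * expR t).
  by rewrite hi; ring.
rewrite hi' DgD; move: (a _ / _) (incr 1 _) (incr t s) => r k j.
by field; rewrite As As' gt_eqF.
Unshelve. all: by end_near. Qed.

End SecondOrder.

(** * Accumulation of errors along a geometric grid *)

Section Chains.
Context {R : realType}.
Implicit Types (z r : nat -> R) (B : R).

Lemma telescope_le z B i j : (i <= j)%N ->
  (forall l, (i <= l < j)%N -> `|z l.+1 - z l| <= B) ->
  `|z j - z i| <= (j - i)%:R * B.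
Proof.
move=> ij h; rewrite -(telescope_sumr z ij).
apply: le_trans (ler_norm_sum _ _ _) _.
rewrite mulr_natl -sumr_const_nat; apply: ler_sum_nat => l hl; exact: h.
Qed.

Lemma mult_chain r B N : 0 <= B -> 2 * N%:R * B <= 1 -> r 0%N = 1 ->
  (forall i, (i < N)%N -> `|r i.+1 - r i| <= `|r i| * B) ->
  forall i, (i <= N)%N -> `|r i - 1| <= 2 * i%:R * B.
Proof.
move=> B0 NB r0 h; elim=> [|i ih] iN; first by rewrite r0 subrr normr0 mulr0 mul0r.
have h1 := h i iN; have h2 := ih (ltnW iN).
have iB : 2 * i%:R * B <= 1.
  by apply: le_trans NB; apply: ler_wpM2r => //; apply: ler_wpM2l; rewrite // ler_nat ltnW.
have h3 : `|r i| <= 2.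
  have := ler_normD (r i - 1) 1; rewrite subrK normr1 => h4.
  by clear - h4 h2 iB; lra.
have h4 : `|r i.+1 - 1| <= `|r i.+1 - r i| + `|r i - 1|.
  by apply: le_trans (ler_normD _ _); rewrite addrA subrK.
have h5 : `|r i| * B <= 2 * B by exact: ler_wpM2r.
by rewrite -natr1; clear - h1 h2 h4 h5; lra.
Qed.

End Chains.

Section Grid.
Context {R : realType}.

Definition geo (L s : R) (i : nat) : R := s * expR (i%:R * L).

Lemma geoS L s i : geo L s i.+1 = geo L s i * expR L.
Proof. by rewrite /geo -natr1 mulrDl mul1r expRD mulrA. Qed.

(** The scales divided by [expR (g * i * L)] form a multiplicative chain that stays near 1; the
    errors [z] then form an additive chain started at [J]. Between [J] and [i] its steps carry the
    weights [expR (g * (l - J) * L)], monotone in [l], whence the maximum with 1. *)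
Lemma grid_chain (b a : R -> R) g L s B N J : (forall s, 0 < a s) -> 0 < L -> 0 <= B -> B <= 1 -> (J <= N)%N ->
  4 * N%:R * (B * expR (- (g * L))) <= 1 ->
  (forall i, (i < N)%N -> `|incr b a L (geo L s i) - Dg g L| <= B) ->
  (forall i, (i < N)%N -> `|a (geo L s i * expR L) / a (geo L s i) - expR (g * L)| <= B) ->
  forall i, (i <= N)%N ->
  `|(b (geo L s i) - b (geo L s J)) / a (geo L s J) - Dg g ((i%:R - J%:R) * L)| <=
  N%:R * (8 * N%:R * (B * expR (- (g * L))) * (Dg g L + 1) + B) *
    Num.max 1 (expR (g * ((i%:R - J%:R) * L))).
Proof.
move=> a_gt0 L0 B0 B1 JN; set B' := B * _ => NB hi ha i iN.
have B'0 : 0 <= B' by rewrite mulr_ge0 ?expR_ge0.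
pose r i := a (geo L s i) / a (geo L s 0) * expR (- (g * (i%:R * L))).
have r1 : r 0%N = 1 by rewrite /r divff ?gt_eqF// mul0r mulr0 oppr0 expR0 mulr1.
have rpos j : 0 < r j by rewrite /r mulr_gt0 ?expR_gt0// divr_gt0.
have hr j : (j < N)%N -> `|r j.+1 - r j| <= `|r j| * B'.
  move=> jN; have -> : r j.+1 - r j = r j *
      ((a (geo L s j * expR L) / a (geo L s j) - expR (g * L)) * expR (- (g * L))).
    have e : expR (g * L) != 0 by rewrite gt_eqF ?expR_gt0.
    have e2 : expR (g * (j%:R * L)) != 0 by rewrite gt_eqF ?expR_gt0.
    rewrite /r geoS -natr1 mulrDl mul1r (mulrDr g) opprD expRD !expRN.
    by field; rewrite e e2 !gt_eqF.
  rewrite normrM ler_wpM2l// normrM (ger0_norm (expR_ge0 _)).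
  by apply: ler_wpM2r; rewrite ?expR_ge0// ha.
have NB2 : 2 * N%:R * B' <= 1.
  by apply: le_trans NB; apply: ler_wpM2r => //; apply: ler_wpM2r; rewrite ?ler0n ?ler_nat.
have hr1 j : (j <= N)%N -> `|r j - 1| <= 2 * N%:R * B'.
  move=> jN; apply: le_trans (mult_chain B'0 NB2 r1 hr jN) _.
  by apply: ler_wpM2r => //; apply: ler_wpM2l; rewrite ?ler_nat.
pose E := 8 * N%:R * B' * (Dg g L + 1) + B.
pose z j := (b (geo L s j) - b (geo L s J)) / a (geo L s J) - Dg g ((j%:R - J%:R) * L).
have zJ : z J = 0 by rewrite /z !subrr !mul0r Dg0r subr0.
have DL0 : 0 < Dg g L by apply: Dg_gt0.
have E0 : 0 <= E.
  apply: addr_ge0 => //; apply: mulr_ge0; last by rewrite addr_ge0// ltW.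
  by apply: mulr_ge0 => //; apply: mulr_ge0; rewrite ?ler0n.
have hz j : (j < N)%N -> `|z j.+1 - z j| <= expR (g * ((j%:R - J%:R) * L)) * E.
  move=> jN; set e := expR (g * ((j%:R - J%:R) * L)).
  have -> : z j.+1 - z j = e * (r j / r J * incr b a L (geo L s j) - Dg g L).
    have hD : Dg g ((j.+1%:R - J%:R) * L) = Dg g ((j%:R - J%:R) * L) + e * Dg g L.
      by rewrite /e -DgD; congr (Dg g _); rewrite -natr1; ring.
    have he : e * (r j / r J) = a (geo L s j) / a (geo L s J).
      rewrite /e /r mulrBl mulrBr expRB !expRN.
      by field; rewrite !gt_eqF ?expR_gt0.
    rewrite /z hD mulrBr mulrA he /incr geoS.
    by field; rewrite !gt_eqF.
  rewrite normrM ger0_norm ?expR_ge0//; apply: ler_wpM2l; first exact: expR_ge0.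
  have h1 := hr1 J JN; have h2 := hr1 j (ltnW jN); have h3 := hi j jN.
  set c := N%:R * B' in h1 h2.
  have [c' cE] : exists c', c' = N%:R * B' by exists (N%:R * B').
  have hc : 4 * c' <= 1 by rewrite cE mulrA.
  rewrite -mulrA -cE in h1; rewrite -mulrA -cE in h2.
  have c'0 : 0 <= c' by rewrite cE mulr_ge0 ?ler0n.
  have rJ : 2^-1 <= r J by move: h1; rewrite ler_norml; clear - hc; lra.
  have hq : `|r j / r J - 1| <= 8 * c'.
    have -> : r j / r J - 1 = ((r j - 1) - (r J - 1)) / r J.
      by field; rewrite gt_eqF.
    rewrite normrM normfV (ger0_norm (ltW (rpos J))) ler_pdivrMr//.
    have h4 := ler_normB (r j - 1) (r J - 1).
    have h5 : 8 * c' * 2^-1 <= 8 * c' * r J by apply: ler_wpM2l => //; clear - c'0; lra.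
    by clear - h4 h1 h2 h5; lra.
  have -> : r j / r J * incr b a L (geo L s j) - Dg g L =
    (r j / r J - 1) * incr b a L (geo L s j) + (incr b a L (geo L s j) - Dg g L) by ring.
  apply: le_trans (ler_normD _ _) _; apply: lerD => //; rewrite normrM.
  have -> : 8 * N%:R * B' = 8 * c' by rewrite cE mulrA.
  apply: ler_pM => //.
  have := ler_normD (incr b a L (geo L s j) - Dg g L) (Dg g L); rewrite subrK (ger0_norm (ltW DL0)).
  by clear - h3 B1; lra.
have Lm l u v : ((u <= l <= v) || (v <= l <= u))%N -> 
  expR (g * ((l%:R - u%:R) * L)) <= Num.max 1 (expR (g * ((v%:R - u%:R) * L))).
  move=> /orP[/andP[h1 h2]|/andP[h1 h2]]; rewrite le_max -[X in _ <= X]expR0 !ler_expR.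
  - have [g0|g0] := leP 0 g.
      apply/orP; right; apply: ler_wpM2l => //; apply: ler_wpM2r; first exact: ltW.
      by rewrite lerD2r ler_nat.
    apply/orP; left; rewrite nmulr_rle0//; apply: mulr_ge0; last exact: ltW.
    by rewrite subr_ge0 ler_nat.
  - have [g0|g0] := leP 0 g.
      apply/orP; left; apply: mulr_ge0_le0 => //; apply: mulr_le0_ge0; last exact: ltW.
      by rewrite subr_le0 ler_nat.
    apply/orP; right; apply: ler_wnM2l; first exact: ltW.
    by apply: ler_wpM2r; [exact: ltW|rewrite lerD2r ler_nat].
have hzi : `|z i| <= N%:R * (Num.max 1 (expR (g * ((i%:R - J%:R) * L))) * E).
  have M0 : 0 <= Num.max 1 (expR (g * ((i%:R - J%:R) * L))) * E.
    by apply: mulr_ge0 => //; rewrite le_max ler01.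
  have [Ji|iJ] := leqP J i.
    rewrite -[z i]subr0 -zJ; apply: le_trans (telescope_le (B :=
      Num.max 1 (expR (g * ((i%:R - J%:R) * L))) * E) Ji _) _.
      move=> l /andP[l1 l2]; apply: le_trans (hz l (leq_trans l2 iN)) _.
      by apply: ler_wpM2r => //; apply: Lm; rewrite l1 ltnW.
    by apply: ler_wpM2r => //; rewrite ler_nat (leq_trans (leq_subr _ _)).
  rewrite -normrN -[- z i]add0r -zJ; apply: le_trans (telescope_le (B :=
      Num.max 1 (expR (g * ((i%:R - J%:R) * L))) * E) (ltnW iJ) _) _.
    move=> l /andP[l1 l2]; apply: le_trans (hz l (leq_trans l2 JN)) _.
    by apply: ler_wpM2r => //; apply: Lm; rewrite l1 (ltnW l2) orbT.
  by apply: ler_wpM2r => //; rewrite ler_nat (leq_trans (leq_subr _ _)).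
by apply: le_trans hzi _; rewrite le_eqVlt; apply/orP; left; apply/eqP; rewrite /E; ring.
Qed.

End Grid.

Section Asymptotics.
Context {R : realType}.

Lemma poly_decay n (c d e : R) : 0 <= c -> 0 < d -> 0 < e ->
  \forall x \near +oo, c * (1 + x) ^+ n * expR (- (d * x)) <= e.
Proof.
move=> c0 d0 e0; pose d' := Num.min (d / 2) 1.
have d'0 : 0 < d' by rewrite lt_min ltr01 divr_gt0.
have d'1 : d' <= 1 by rewrite ge_min lexx orbT.
have d'd : d' <= d / 2 by rewrite ge_min lexx.
pose K := (n.+1%:R / d') ^+ n.+1.
have K0 : 0 <= K by rewrite exprn_ge0// divr_ge0// ltW.
near=> x.
have x1 : 1 <= x by near: x; apply: nbhs_pinfty_ge; rewrite num_real.
have x2 : 2 * c * K / (d * e) <= x by near: x; apply: nbhs_pinfty_ge; rewrite num_real.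
have x0 : 0 < x by apply: lt_le_trans x1.
have h1 : (1 + x) ^+ n <= (1 + x) ^+ n.+1.
  by rewrite ler_eXn2l//; rewrite ltrDl.
have h2 : (1 + x) ^+ n.+1 <= K * expR (d' * x).
  by apply: poly_exp => //; rewrite ?d'0//= ltW.
have h3 : expR (d' * x) <= expR (d / 2 * x) by rewrite ler_expR ler_wpM2r// ltW.
have y0 : 0 < d / 2 * x by rewrite mulr_gt0// divr_gt0.
have h4 : d / 2 * x <= expR (d / 2 * x).
  by apply: le_trans (expR_ge1Dx _); rewrite lerDr.
have h5 : c * (1 + x) ^+ n <= c * (K * expR (d / 2 * x)).
  apply: ler_wpM2l => //; apply: le_trans h1 _; apply: le_trans h2 _.
  by apply: ler_wpM2l.
apply: (@le_trans _ _ (c * (K * expR (d / 2 * x)) * expR (- (d * x)))).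
  by apply: ler_wpM2r => //; exact: expR_ge0.
have -> : - (d * x) = - (d / 2 * x) - d / 2 * x by field.
rewrite expRD expRN; set E := expR _ in h4 *.
have E0 : 0 < E by exact: expR_gt0.
have -> : c * (K * E) * (E^-1 / E) = c * K / E by field; rewrite gt_eqF.
rewrite ler_pdivrMr//; apply: (@le_trans _ _ (e * (d / 2 * x))); last first.
  by apply: ler_wpM2l => //; exact: ltW.
move: x2; rewrite ler_pdivrMr ?mulr_gt0// => h; clear - h; lra.
Unshelve. all: by end_near. Qed.

End Asymptotics.

Section Chain.
Context {R : realType}.

Definition second_order (b a Af : R -> R) (g rho : R) : Prop :=
  [/\ (forall s, 0 < a s), (\forall s \near +oo, Af s != 0),
      Af s @[s --> +oo] --> 0, rho <= 0 &
      forall t, 0 <= t ->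
        ((Af s)^-1 * (incr b a t s - Dg g t)) @[s --> +oo] --> HH g rho t].

Lemma near_quot (Af f : R -> R) l : (\forall s \near +oo, Af s != 0) ->
  ((Af s)^-1 * f s) @[s --> +oo] --> l ->
  \forall s \near +oo, `|f s| <= (`|l| + 1) * `|Af s|.
Proof.
move=> A0 h; apply: filterS2 A0 (lim_near h ltr01) => s As0 hs.
have -> : f s = ((Af s)^-1 * f s) * Af s by field.
rewrite normrM; apply: ler_wpM2r => //.
by
  have := ler_normD ((Af s)^-1 * f s - l) l; rewrite subrK; clear - hs; lra.
Qed.

(** In one step [A] may shrink by a fixed factor [expR k], but it grows by at most [expR d] with [d]
    arbitrarily small, because [rho <= 0]. *)
Lemma one_step b a Af g rho L : second_order b a Af g rho -> 0 < L ->
  exists C k, [/\ 0 < C, 0 <= k & forall d, 0 < d -> \forall s \near +oo,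
   [/\ `|incr b a L s - Dg g L| <= C * `|Af s|,
       `|a (s * expR L) / a s - expR (g * L)| <= C * `|Af s|,
       `|Af s| <= expR k * `|Af (s * expR L)| &
       `|Af (s * expR L)| <= expR d * `|Af s|]].
Proof.
move=> [a0 A0 Ac rho0 so] L0; have L0' := ltW L0.
have h1 := near_quot A0 (so L L0').
pose proof (a_second_lim a0 A0 Ac so L0) as h2'.
have h2 := near_quot A0 h2'.
pose proof (A_ratio_lim a0 A0 Ac so L0') as h3.
pose l := expR (rho * L).
have l0 : 0 < l by exact: expR_gt0.
have l1 : l <= 1 by rewrite -[X in _ <= X]expR0 ler_expR mulr_le0_ge0.
pose k := - ln (l / 2).
have kE : expR k = (l / 2)^-1 by rewrite expRN lnK// posrE divr_gt0.
have k0 : 0 <= k.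
  by rewrite oppr_ge0 ln_le0//; clear - l1; lra.
exists (Num.max (`|HH g rho L| + 1) (`|expR (g * L) * Dg rho L| + 1)), k; split => //.
move=> d d0; have l20 : 0 < l / 2 by rewrite divr_gt0.
pose proof (lim_near h3 l20) as h4; pose proof (lim_near h3 d0) as h5.
apply: filterS3 (filterI h1 h2) (filterI h4 h5) A0 => s [{}h1 {}h2] [{}h4 {}h5] As.
split.
- by apply: le_trans h1 _; apply: ler_wpM2r => //; rewrite le_max lexx.
- by apply: le_trans h2 _; apply: ler_wpM2r => //; rewrite le_max lexx orbT.
- have hr : l / 2 <= `|Af (s * expR L) / Af s|.
    apply: le_trans _ (ler_norm _); move: h4; rewrite -/l ler_norml; clear; lra.
  rewrite kE mulrC ler_pdivlMr//; move: hr; rewrite normrM normfV ler_pdivlMr ?normr_gt0//.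
  by rewrite mulrC.
- have hr : `|Af (s * expR L) / Af s| <= expR d.
    have := ler_normD (Af (s * expR L) / Af s - l) l; rewrite subrK (gtr0_norm l0).
    by have := expR_ge1Dx d; move: h5; rewrite -/l; clear - l1; lra.
  by move: hr; rewrite normrM normfV ler_pdivrMr ?normr_gt0.
Qed.

End Chain.

Section GridApprox.
Context {R : realType}.

Lemma geo_back L s J i : geo L (s * expR (- (J%:R * L))) i = s * expR ((i%:R - J%:R) * L) :> R.
Proof. by rewrite /geo -mulrA -expRD; congr (_ * expR _); ring. Qed.

(** The rates are asymmetric: few steps are made below [s J], where the crude rate [k] is
    affordable, and many above it, where [d] has to be small. *)
Lemma A_chain (Af : R -> R) (s : nat -> R) (k d y : R) (J N : nat) :
  0 <= k -> 0 <= d -> (J <= N)%N ->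
  (forall i, `|Af (s i)| <= expR k * `|Af (s i.+1)|) ->
  (forall i, `|Af (s i.+1)| <= expR d * `|Af (s i)|) ->
  k * J%:R <= y -> d * (N - J)%:R <= y ->
  forall i, (i <= N)%N -> `|Af (s i)| <= expR y * `|Af (s J)|.
Proof.
move=> k0 d0 JN hk hd kJ dN i iN.
have back j : (j <= J)%N -> `|Af (s (J - j)%N)| <= expR (k * j%:R) * `|Af (s J)|.
  elim: j => [|j ih] jJ; first by rewrite subn0 mulr0 expR0 mul1r.
  have := hk (J - j.+1)%N; rewrite -subSn// subSS => /le_trans; apply.
  have -> : k * j.+1%:R = k + k * j%:R by rewrite -natr1; ring.
  by rewrite expRD -mulrA ler_wpM2l ?expR_ge0// ih// ltnW.
have forw j : `|Af (s (J + j)%N)| <= expR (d * j%:R) * `|Af (s J)|.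
  elim: j => [|j ih]; first by rewrite addn0 mulr0 expR0 mul1r.
  rewrite addnS; apply: le_trans (hd _) _.
  have -> : d * j.+1%:R = d + d * j%:R by rewrite -natr1; ring.
  by rewrite expRD -mulrA ler_wpM2l ?expR_ge0// ih.
have [iJ|Ji] := leqP i J.
  have h := back (J - i)%N (leq_subr _ _); rewrite subKn// in h; apply: le_trans h _.
  apply: ler_wpM2r => //; rewrite ler_expR; apply: le_trans kJ.
  by apply: ler_wpM2l => //; rewrite ler_nat leq_subr.
have h := forw (i - J)%N; rewrite subnKC// in h; last exact: ltnW.
apply: le_trans h _; apply: ler_wpM2r => //; rewrite ler_expR; apply: le_trans dN.
by apply: ler_wpM2l => //; rewrite ler_nat leq_sub2r.
Qed.

Lemma grid_bound (N n e D B W E eta c0 : R) : 0 <= N -> N <= n -> 1 <= n -> 0 <= e -> 0 <= D ->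
  0 <= B -> 1 <= W -> 0 <= E -> 1 <= W * E -> c0 = 8 * (1 + e) * (D + 2) ->
  n ^+ 2 * c0 * B * W <= eta -> eta <= 1 ->
  [/\ B <= 1, 4 * N * (B * e) <= 1 &
   N * (8 * N * (B * e) * (D + 1) + B) * Num.max 1 E <= eta * E].
Proof.
move=> N0 Nn n1 e0 D0 B0 W1 E0 WE c0E hQ eta1.
have eD : 0 <= e * D by exact: mulr_ge0.
have c04 : 1 <= c0 /\ 4 * e <= c0 by rewrite c0E; split; clear - e0 D0 eD; nra.
have c08 : 8 * e * (D + 1) + 1 <= c0 by rewrite c0E; clear - e0 D0 eD; nra.
case: c04 => c01 c04.
have n2 : 1 <= n ^+ 2 by apply: exprn_ege1.
have Nn2 : N <= n ^+ 2 by apply: le_trans Nn _; rewrite expr2 ler_peMl// (le_trans ler01).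
have NN2 : N * N <= n ^+ 2 by rewrite expr2; apply: ler_pM.
have n20 : 0 <= n ^+ 2 by apply: le_trans n2.
have Q0 : 0 <= n ^+ 2 * c0 * B.
  by apply: mulr_ge0 => //; apply: mulr_ge0 => //; apply: le_trans c01.
have QW : n ^+ 2 * c0 * B <= eta.
  by apply: le_trans hQ; rewrite ler_peMr.
have Q1 := le_trans QW eta1.
split.
- apply: le_trans Q1; rewrite ler_peMl//.
  by rewrite -[X in X <= _](mulr1 1); apply: ler_pM.
- apply: le_trans Q1.
  have -> : 4 * N * (B * e) = N * (4 * e) * B by ring.
  by apply: ler_wpM2r => //; apply: ler_pM => //; apply: mulr_ge0.
- have WE' : Num.max 1 E <= W * E by rewrite ge_max WE ler_peMl.
  apply: (@le_trans _ _ (n ^+ 2 * c0 * B * (W * E))); last first.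
    by rewrite mulrA; apply: ler_wpM2r.
  apply: ler_pM => //.
  + apply: mulr_ge0 => //; apply: addr_ge0 => //.
    by do !apply: mulr_ge0 => //; rewrite addr_ge0.
  + by rewrite le_max ler01.
  have -> : N * (8 * N * (B * e) * (D + 1) + B) = (N * N * (8 * e * (D + 1)) + N) * B by ring.
  apply: ler_wpM2r => //.
  have h0 : 0 <= 8 * e * (D + 1) by do !apply: mulr_ge0 => //; rewrite addr_ge0.
  have h1 : N * N * (8 * e * (D + 1)) <= n ^+ 2 * (8 * e * (D + 1)) by apply: ler_wpM2r.
  have h2 : n ^+ 2 * (8 * e * (D + 1) + 1) <= n ^+ 2 * c0 by apply: ler_wpM2l.
  by clear - h1 h2 Nn2; lra.
Qed.

(** From [s], [J] steps go down and [M] steps go up; [x] is the logarithm of the number of blocks in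
    the application. Going up, [expR (g * tau)] may be as small as [expR (- (G * x))], and the error
    relative to it vanishes only if [A], of order [expR (- (x / 2))], is smaller: this is
    [G < 1/2]. *)
Lemma grid_approx (I : Type) (F : set_system I) {FF : Filter F}
    (b a Af : R -> R) (g rho L d C eta : R) (s x : I -> R) (J M : I -> nat) :
  second_order b a Af g rho -> 0 < L -> 0 <= d ->
  (1 + d) * Num.max (- g) 0 < 2^-1 -> 0 < C -> 0 < eta ->
  (s n * expR (- ((J n)%:R * L))) @[n --> F] --> +oo ->
  x n @[n --> F] --> +oo ->
  (\forall n \near F, `|Af (s n)| <= C * expR (- (x n / 2))) ->
  (forall c : R, 0 < c -> \forall n \near F, c * (J n)%:R <= x n) ->
  (\forall n \near F, (M n)%:R * L <= (1 + d) * x n) ->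
  \forall n \near F, forall i, (i <= J n + M n)%N ->
    `|(b (s n * expR ((i%:R - (J n)%:R) * L)) - b (s n)) / a (s n)
      - Dg g ((i%:R - (J n)%:R) * L)| <= eta * expR (g * ((i%:R - (J n)%:R) * L)).
Proof.
move=> so L0 d0 hG C0 eta0 sF xF AF JF MF.
have a0 : forall s, 0 < a s by case: so.
have [C1 [k [C10 k0 hstep]]] := one_step so L0.
have [G GE] : exists G, G = (1 + d) * Num.max (- g) 0 by eexists.
rewrite -GE in hG.
have d10 : 0 < 1 + d by rewrite ltr_wpDr.
have gG : - g * (1 + d) <= G by rewrite GE mulrC; apply: ler_wpM2l; [exact: ltW|rewrite le_max lexx].
have G0 : 0 <= G by rewrite GE mulr_ge0 ?(ltW d10)// le_max lexx orbT.
(* Of the margin [1/2 - G = 4 * dl], one [dl] pays for the growth of [A] along the grid, one for the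
   steps below [s], and two remain as the rate of decay. *)
have [dl dlE] : exists dl : R, dl = (2^-1 - G) / 4 by eexists.
have dl0 : 0 < dl by rewrite dlE divr_gt0// subr_gt0.
have d1p : 0 < dl * L / (1 + d) by rewrite divr_gt0// mulr_gt0.
have [M0 [_ hM0]] := hstep _ d1p.
have [K KE] : exists K, K = 1 + (1 + d) / L by eexists.
have K1 : 1 <= K by rewrite KE lerDl divr_ge0// ltW.
have [e eE] : exists e, e = expR (- (g * L)) by eexists.
have e0 : 0 <= e by rewrite eE expR_ge0.
have D0 : 0 < Dg g L by exact: Dg_gt0.
have [D DE] : exists D, D = Dg g L by eexists.
have [c0 c0E] : exists c0, c0 = 8 * (1 + e) * (D + 2) by eexists.
have eta'0 : 0 < Num.min eta 1 by rewrite lt_min eta0 ltr01.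
have cc0 : 0 <= K ^+ 2 * c0 * (C1 * C).
  rewrite c0E DE; apply: mulr_ge0; last by rewrite mulr_ge0// ltW.
  apply: mulr_ge0; first by rewrite sqr_ge0.
  by do !apply: mulr_ge0 => //; rewrite addr_ge0// ltW.
have d20 : 0 < 2 * dl by rewrite mulr_gt0.
have hdec := poly_decay 2 cc0 d20 eta'0.
have pinf (f : I -> R) (c : R) : f n @[n --> F] --> +oo -> \forall n \near F, c < f n.
  by move=> /(_ _ (nbhs_pinfty_gt (num_real c))).
have hx : \forall n \near F, K ^+ 2 * c0 * (C1 * C) * (1 + x n) ^+ 2 *
    expR (- (2 * dl * x n)) <= Num.min eta 1 by exact: xF _ hdec.
have h1 := pinf _ (Num.max M0 0) sF.
have h2 := pinf _ 1 xF.
have k1 : 0 < (k + 1) / dl by rewrite divr_gt0// ltr_wpDl.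
have k2 : 0 < (`|g| * L + 1) / dl by rewrite divr_gt0// ltr_wpDl// mulr_ge0// ltW.
pose proof (filterI (filterI (filterI hx h1) (filterI h2 AF))
  (filterI (filterI (JF _ k1) (JF _ k2)) (filterI (JF _ ltr01) MF))) as base.
apply: (@filterS _ F FF _ _ _ base) => n [[[{}hx {}h1] [{}h2 hA]] [[hJ1 hJ2] [hJ3 hM]]] i iN.
move: hJ1 hJ2 hJ3 hM hx h1 h2 hA iN.
set S := s n; set X := x n; set j := J n; set mm := M n.
rewrite mul1r => hJ1 hJ2 hJ3 hM hx; rewrite gt_max => /andP[s0M s00] X1 hA iN.
have X0 : 0 < X by apply: lt_trans X1.
set s0 := S * _ in s0M s00.
have gge q : M0 < geo L s0 q.
  apply: lt_le_trans s0M _; rewrite /geo ler_peMr ?(ltW s00)//.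
  by rewrite -[X in X <= _]expR0 ler_expR mulr_ge0// ltW.
have gJ : geo L s0 j = S by rewrite geo_back subrr mul0r expR0 mulr1.
pose N := (j + mm)%N.
have kJ : k * j%:R <= dl * X.
  move: hJ1; rewrite mulrAC ler_pdivrMr// => hJ1; have : 0 <= j%:R :> R by [].
  by clear - hJ1; lra.
have gJ' : `|g| * L * j%:R <= dl * X.
  move: hJ2; rewrite mulrAC ler_pdivrMr// => hJ2; have : 0 <= j%:R :> R by [].
  by clear - hJ2; lra.
have dN : dl * L / (1 + d) * (N - j)%:R <= dl * X.
  rewrite /N addKn -!mulrA; apply: ler_wpM2l; first exact: ltW.
  by rewrite mulrCA ler_pdivrMl// [L * _]mulrC.
have hAi q : (q <= N)%N -> `|Af (geo L s0 q)| <= expR (dl * X) * `|Af S|.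
  rewrite -gJ; apply: (@A_chain Af (geo L s0) k (dl * L / (1 + d))) => //.
  - exact: ltW.
  - exact: leq_addr.
  - by move=> q'; have [_ _] := hM0 _ (gge q'); rewrite -geoS.
  - by move=> q'; have [_ _ _] := hM0 _ (gge q'); rewrite -geoS.
pose B := C1 * (expR (dl * X) * (C * expR (- (X / 2)))).
have hB q : (q <= N)%N -> C1 * `|Af (geo L s0 q)| <= B.
  move=> qN; apply: ler_wpM2l; first exact: ltW.
  by apply: le_trans (hAi q qN) _; apply: ler_wpM2l => //; exact: expR_ge0.
have B0 : 0 <= B by rewrite /B !mulr_ge0 ?expR_ge0// ltW.
pose W := expR (dl * X + G * X).
pose tau := (i%:R - j%:R) * L : R.
have iNr : (i%:R : R) <= j%:R + mm%:R by rewrite -natrD ler_nat.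
have tau1 : tau <= (1 + d) * X.
  apply: le_trans _ hM; apply: ler_wpM2r; first exact: ltW.
  by clear - iNr; lra.
have tau2 : - tau <= j%:R * L.
  rewrite /tau -mulNr; apply: ler_wpM2r; first exact: ltW.
  by have : 0 <= i%:R :> R by []; clear; lra.
have gtau : 0 <= dl * X + G * X + g * tau.
  have dX : 0 <= dl * X by rewrite mulr_ge0 ?ltW.
  have GX : 0 <= G * X by rewrite mulr_ge0// ltW.
  case: (leP 0 tau) => [tp|/ltW tn]; case: (leP 0 g) => [gp|/ltW gn].
  - by rewrite !addr_ge0// mulr_ge0.
  - have h3 : g * ((1 + d) * X) <= g * tau by apply: ler_wnM2l.
    have h4 : - g * (1 + d) * X <= G * X by apply: ler_wpM2r => //; exact: ltW X0.
    by clear - h3 h4 dX; lra.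
  - have h3 : g * (- tau) <= g * (j%:R * L) by apply: ler_wpM2l.
    move: gJ'; rewrite (ger0_norm gp) => gJ'.
    by clear - h3 GX gJ'; lra.
  - have : 0 <= g * tau by rewrite mulr_le0.
    by clear - GX dX; lra.
have [q1 q2 q3] : [/\ B <= 1, 4 * N%:R * (B * e) <= 1 &
   N%:R * (8 * N%:R * (B * e) * (D + 1) + B) * Num.max 1 (expR (g * tau))
     <= Num.min eta 1 * expR (g * tau)].
  apply: (@grid_bound _ (K * (1 + X)) e D B W _ _ c0) => //.
  - rewrite /N natrD KE.
    have : mm%:R <= (1 + d) / L * X by rewrite mulrAC ler_pdivlMr.
    have : 0 <= (1 + d) / L by rewrite divr_ge0// ltW.
    by clear - hJ3; nra.
  - by rewrite -[X in X <= _](mulr1 1); apply: ler_pM => //; rewrite lerDl ltW.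
  - by rewrite DE ltW.
  - by rewrite /W -[X in X <= _]expR0 ler_expR addr_ge0// mulr_ge0// ltW.
  - by rewrite /W -expRD -[X in X <= _]expR0 ler_expR.
  - apply: le_trans _ hx; rewrite le_eqVlt; apply/orP; left; apply/eqP.
    have -> : - (2 * dl * X) = dl * X + (- (X / 2)) + (dl * X + G * X) by rewrite dlE; field.
    by rewrite expRD (expRD (dl * X)) -/W /B; ring.
  - by rewrite ge_min lexx orbT.
have hgrid := @grid_chain _ b a g L s0 B N j a0 L0 B0 q1 (leq_addr _ _).
have := hgrid _ _ _ i iN; rewrite -eE -DE gJ geo_back -/tau => hh.
apply: le_trans (hh q2 _ _) _.
- move=> q qN; have [hq _ _ _] := hM0 _ (gge q); rewrite -DE in hq *.
  by apply: le_trans hq (hB _ (ltnW qN)).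
- move=> q qN; have [_ hq _ _] := hM0 _ (gge q).
  by apply: le_trans hq (hB _ (ltnW qN)).
apply: le_trans q3 _; apply: ler_wpM2r; first exact: expR_ge0.
by rewrite ge_min lexx.
Qed.

End GridApprox.

(** * Why the number of blocks grows subexponentially in the block length *)

Section Monotone.
Context {R : realType}.

(** A monotone function has countably many discontinuities, whereas an interval has positive
    measure. At any other point the one-sided limits agree and enclose the value. *)
Lemma mono_continuity_point (S : R -> R) (u v : R) : u < v ->
  {homo S : x y / x <= y} -> exists2 x, u < x & {for x, continuous S}.
Proof.
move=> uv ndS.
have ndI : {in `[u, v] &, {homo S : x y / x <= y}} by move=> x y _ _; exact: ndS.
have cD := discontinuity_countable ndI.
have [x [xuv nd]] : exists x, (x \in `]u, v[) /\ ~ discontinuity S x.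
  apply: contrapT => h.
  have sD : `]u, v[%classic `<=` [set x | x \in (`]u, v[) /\ discontinuity S x].
    move=> x xuv; split => //; apply: contrapT => nd; apply: h; by exists x.
  have := countable_lebesgue_measure0 (sub_countable (subset_card_le sD) cD).
  rewrite lebesgue_measure_itv/= lte_fin uv -EFinB => -[/eqP].
  by rewrite subr_eq0 (gt_eqF uv).
exists x; first by move: xuv; rewrite in_itv/= => /andP[].
have cl : cvg (S y @[y --> x^'-]).
  apply: nondecreasing_at_left_is_cvgr; apply: nearW => r.
    by move=> y z _ _; exact: ndS.
  by exists (S x) => _ [y /= + <-]; rewrite in_itv/= => /andP[_ /ltW /ndS].
have cr : cvg (S y @[y --> x^'+]).
  apply: nondecreasing_at_right_is_cvgr; apply: nearW => r.
    by move=> y z _ _; exact: ndS.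
  by exists (S x) => _ [y /= + <-]; rewrite in_itv/= => /andP[/ltW /ndS].
have lr : lim (S y @[y --> x^'-]) = lim (S y @[y --> x^'+]).
  by apply/eqP; apply: contrapT => /negP h; apply: nd.
have le1 : lim (S y @[y --> x^'-]) <= S x.
  apply: limr_le => //; near=> y; apply: ndS.
  by near: y; exact: nbhs_left_le.
have le2 : S x <= lim (S y @[y --> x^'+]).
  apply: limr_ge => //; near=> y; apply: ndS.
  by near: y; exact: nbhs_right_ge.
have e1 : lim (S y @[y --> x^'-]) = S x by apply/eqP; rewrite eq_le le1 lr le2.
apply/left_right_continuousP; split.
- by rewrite -e1; exact: cl.
- by rewrite -e1 lr; exact: cr.
Unshelve. all: by end_near. Qed.

End Monotone.

Section LowerBound.
Context {R : realType}.

Lemma near_along (I : Type) (F : set_system I) (s : I -> R) (Q : R -> Prop) :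
  s n @[n --> F] --> +oo -> (\forall x \near +oo, Q x) -> \forall n \near F, Q (s n).
Proof. by move=> sF hQ; exact: sF _ hQ. Qed.

(** The scale [a] cancels in this ratio, which therefore inherits continuity from [b] alone; by
    [crat_bounds] it is comparable with [A]. *)
Definition crat (b a : R -> R) (g s : R) : R := curv b a g 1 s / incr b a 1 s.

Lemma crat_bounds b a Af g rho : second_order b a Af g rho -> exists2 q : R, 0 < q &
  \forall s \near +oo, [/\ 0 < incr b a 1 s, q * `|Af s| <= `|crat b a g s|,
     `|crat b a g s| <= 3 * q * `|Af s| & Af s != 0].
Proof.
move=> [a0 A0 Ac rho0 so].
have D0 : 0 < Dg g 1 by exact: Dg_gt0.
have c0 : 0 < HHc g rho 1 by exact: HHc_gt0.
pose proof (incr_lim A0 Ac so (@ler01 R)) as hi.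
pose proof (curv_lim so (@ler01 R)) as hc.
pose proof (lim_mul hc (lim_inv (lt0r_neq0 D0) hi)) as h.
have [r rE] : exists r, r = HHc g rho 1 / Dg g 1 by eexists.
rewrite -rE in h; have r0 : 0 < r by rewrite rE divr_gt0.
have r20 : 0 < r / 2 by rewrite divr_gt0.
have D20 : 0 < Dg g 1 / 2 by rewrite divr_gt0.
exists (r / 2) => //.
pose proof (filterI (filterI (lim_near h r20) (lim_near hi D20)) A0) as base.
apply: (@filterS _ _ _ _ _ _ base) => s [[{}h {}hi] As].
have i0 : 0 < incr b a 1 s by move: hi; rewrite ler_norml; clear - D0; lra.
have e : `|crat b a g s| = `|(Af s)^-1 * curv b a g 1 s / incr b a 1 s| * `|Af s|.
  by rewrite -normrM; congr (`| _ |); rewrite /crat; field; rewrite As gt_eqF.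
split=> //; rewrite e; apply: ler_wpM2r => //.
- apply: le_trans _ (ler_norm _); move: h; rewrite ler_norml; clear; lra.
- have := ler_normD ((Af s)^-1 * curv b a g 1 s / incr b a 1 s - r) r.
  by rewrite subrK (gtr0_norm r0); clear - h r0; lra.
Qed.

(** A continuity point of the sum of three translates of a monotone function is one of each
    translate, because their increments have the same sign. *)
Lemma crat_continuous b a g u : (forall s, 0 < a s) ->
  (forall x y, 0 < x -> x <= y -> b x <= b y) ->
  exists2 x, u < x & 0 < incr b a 1 (expR x) ->
    (crat b a g (expR y)) @[y --> x] --> crat b a g (expR x).
Proof.
move=> a0 bmono; pose B y := b (expR y).
have Bm : {homo B : x y / x <= y}.
  by move=> x y xy; apply: bmono; rewrite ?expR_gt0// ler_expR.
pose S y := B y + B (y + 1) + B (y + 2).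
have Sm : {homo S : x y / x <= y}.
  by move=> x y xy; apply: lerD; [apply: lerD|]; apply: Bm => //; rewrite lerD2r.
have [|x ux cS] := @mono_continuity_point _ S u (u + 1) _ Sm; first by rewrite ltrDl.
exists x => // i0.
have cB i : i \in [:: 0; 1; 2] -> (B (y + i)) @[y --> x] --> B (x + i).
  move=> iI; apply: near_lim => e e0.
  pose proof (lim_near cS e0) as h; apply: filterS h => y.
  rewrite /S; case: (leP x y) => [xy|/ltW xy].
    have h0 := Bm _ _ xy; have h1 : B (x + 1) <= B (y + 1) by apply: Bm; rewrite lerD2r.
    have h2 : B (x + 2) <= B (y + 2) by apply: Bm; rewrite lerD2r.
    move: iI; rewrite !inE !ler_norml => /or3P[] /eqP ->; rewrite ?addr0; clear - h0 h1 h2; lra.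
  have h0 := Bm _ _ xy; have h1 : B (y + 1) <= B (x + 1) by apply: Bm; rewrite lerD2r.
  have h2 : B (y + 2) <= B (x + 2) by apply: Bm; rewrite lerD2r.
  move: iI; rewrite !inE !ler_norml => /or3P[] /eqP ->; rewrite ?addr0; clear - h0 h1 h2; lra.
pose N y := B (y + 2) - B (y + 0) - (1 + expR (g * 1)) * (B (y + 1) - B (y + 0)).
pose Dn y := B (y + 1) - B (y + 0).
have cE y : crat b a g (expR y) = N y * (Dn y)^-1.
  have ay := a0 (expR y).
  rewrite /crat /curv /incr /N /Dn /B addr0 (expRD y 2) (expRD y 1) !mulr1.
  have -> : (b (expR y * expR 2) - b (expR y)) / a (expR y) - (1 + expR g) *
     ((b (expR y * expR 1) - b (expR y)) / a (expR y)) =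
     (b (expR y * expR 2) - b (expR y) - (1 + expR g) * (b (expR y * expR 1) - b (expR y)))
     / a (expR y) by field; rewrite gt_eqF.
  by rewrite invfM invrK mulrACA mulVf ?(gt_eqF ay)// mulr1.
have c0 : (B (y + 0)) @[y --> x] --> B (x + 0) by apply: cB; rewrite !inE eqxx.
 have c1 : (B (y + 1)) @[y --> x] --> B (x + 1) by apply: cB; rewrite !inE eqxx orbT.
have c2 : (B (y + 2)) @[y --> x] --> B (x + 2) by apply: cB; rewrite !inE eqxx !orbT.
have Dx : Dn x != 0.
  rewrite gt_eqF//; move: i0; rewrite /incr /Dn /B addr0 expRD.
  by rewrite pmulr_lgt0// invr_gt0.
pose proof (lim_mul (lim_sub (lim_sub c2 c0) (lim_mul (lim_cst (1 + expR (g * 1))) (lim_sub c1 c0)))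
   (lim_inv Dx (lim_sub c1 c0))) as h.
rewrite cE; refine (lim_eq h _); apply: nearW => y; exact/esym/cE.
Qed.

(** From [s n] one descends by factors [expR 1] to a bounded range of logarithms. This takes at most
    [ln (s n)] steps, each costing a factor [K1], hence a power of [s n] in all, which the
    exponential decay beats. So [crat] tends to 0 along the end points [u n] shifted by any fixed
    [h > 0], although it is nonzero at all large arguments. *)
Lemma no_fast_decay (I : Type) (F : set_system I) {FF : ProperFilter F}
    b a Af g rho (C c : R) (s : I -> R) :
  second_order b a Af g rho -> (forall x y, 0 < x -> x <= y -> b x <= b y) ->
  0 < c -> 0 < C -> s n @[n --> F] --> +oo ->
  (\forall n \near F, `|Af (s n)| <= C * expR (- (c * s n))) -> False.
Proof.
move=> so bmono c0 C0 sF hA; have a0 : forall s, 0 < a s by case: so.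
have [q q0 hq] := crat_bounds so.
have [C1 [k [C10 k0 hstep]]] := one_step so (@ltr01 R).
have [K1 K1E] : exists K1, K1 = 3 * expR k by eexists.
have K11 : 1 <= K1.
  by have := expR_ge1Dx k; rewrite K1E; clear - k0; lra.
have hcr : \forall S \near +oo, [/\ 0 < incr b a 1 S, 0 < `|crat b a g S| &
    `|crat b a g S| <= K1 * `|crat b a g (S * expR 1)|].
  pose proof (filterI (filterI hq (scale_near 1 hq)) (hstep 1 ltr01)) as base.
  apply: (@filterS _ _ _ _ _ _ base) => S [[[i0 h1 h2 As] [_ h3 _ _]] [_ _ h4 _]].
  split=> //; first by apply: lt_le_trans h1; rewrite mulr_gt0// normr_gt0.
  apply: le_trans h2 _; rewrite K1E.
  have h5 : 3 * q * `|Af S| <= 3 * q * (expR k * `|Af (S * expR 1)|).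
    by apply: ler_wpM2l => //; rewrite mulr_ge0// ltW.
  apply: le_trans h5 _.
  have -> : 3 * q * (expR k * `|Af (S * expR 1)|) = 3 * expR k * (q * `|Af (S * expR 1)|) by ring.
  by apply: ler_wpM2l => //; rewrite mulr_ge0// expR_ge0.
have [M0 [_ hM0]] := hcr.
have [T0 T0E] : exists T0, T0 = Num.max M0 0 by eexists.
have T00 : 0 <= T0 by rewrite T0E le_max lexx orbT.
have big t : T0 <= t -> M0 < expR t.
  move=> h; apply: (@lt_le_trans _ _ (1 + t)); last exact: expR_ge1Dx.
  have : M0 <= T0 by rewrite T0E le_max lexx.
  by clear - h; lra.
pose f t := `|crat b a g (expR t)|.
pose j n := Num.truncn (ln (s n) - T0).
pose u n := ln (s n) - (j n)%:R.
have sF0 : \forall n \near F, expR T0 < s n by exact: sF _ (nbhs_pinfty_gt (num_real _)).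
have uP : \forall n \near F, [/\ T0 <= u n, u n <= T0 + 1 & (j n)%:R <= ln (s n)].
  apply: filterS sF0 => n hn.
  have s0 : 0 < s n by apply: lt_trans hn; exact: expR_gt0.
  have t0 : 0 <= ln (s n) - T0.
    by rewrite subr_ge0 -[X in X <= _]expRK ler_ln ?posrE ?expR_gt0// ltW.
  have /andP[h1 h2] := truncn_itv t0.
  rewrite -/(j n) -natr1 in h1 h2; rewrite /u; clear - h1 h2 T00; split; lra.
have small h e : 0 < h -> 0 < e -> \forall n \near F, f (u n + h) <= e.
  move=> h0 e0.
  have [C1' [k' [_ _ hstep']]] := one_step so h0.
  (* The power of [1 + s n] that dominates the total cost [K1 ^+ j n], since [j n <= ln (s n)]. *)
  pose p := (Num.truncn (ln K1)).+1.
  have pK : ln K1 <= p%:R by apply: ltW; apply: truncnS_gt.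
  have K20 : 0 <= 3 * q * (expR 1 * C) by rewrite !mulr_ge0 ?expR_ge0// ltW.
  have hd := poly_decay p K20 c0 e0.
  have e1 : \forall n \near F, 3 * q * (expR 1 * C) * (1 + s n) ^+ p * expR (- (c * s n)) <= e
    by exact: near_along sF hd.
  have e2 : \forall n \near F, `|crat b a g (s n * expR h)| <= 3 * q * `|Af (s n * expR h)|.
    by apply: filterS (near_along sF (scale_near h hq)) => n [].
  have e3 : \forall n \near F, `|Af (s n * expR h)| <= expR 1 * `|Af (s n)|.
    by apply: filterS (near_along sF (hstep' 1 ltr01)) => n [].
  pose proof (filterI (filterI e1 e2) (filterI e3 (filterI uP (filterI hA sF0)))) as base.
  apply: (@filterS _ _ _ _ _ _ base) => n [[{}e1 {}e2] [{}e3 [[u1 u2 jl] [An sn]]]].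
  have s0 : 0 < s n by apply: lt_trans sn; exact: expR_gt0.
  have chain i : f (u n + h) <= K1 ^+ i * f (u n + h + i%:R).
    elim: i => [|i ih]; first by rewrite expr0 mul1r addr0.
    apply: le_trans ih _; rewrite exprSr -mulrA; apply: ler_wpM2l.
      by apply: exprn_ge0; apply: le_trans K11.
    have [] := hM0 (expR (u n + h + i%:R)).
      apply: big; apply: (le_trans u1); rewrite -addrA lerDl.
      by rewrite addr_ge0// ltW.
    by move=> _ _; rewrite -expRD -(addrA (u n + h)) natr1.
  apply: le_trans (chain (j n)) _.
  have -> : f (u n + h + (j n)%:R) = `|crat b a g (s n * expR h)|.
    rewrite /f; congr (`| crat b a g _ |); rewrite /u -[in RHS](lnK (x := s n)) ?posrE//.
    by rewrite -expRD; congr expR; ring.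
  have Kj : K1 ^+ j n <= (1 + s n) ^+ p.
    have K10 : 0 < K1 by apply: lt_le_trans K11.
    have l0 : 0 <= ln (s n).
      by apply: ln_ge0; apply: le_trans (ltW sn); rewrite -[X in X <= _]expR0 ler_expR.
    have lK0 : 0 <= ln K1 by apply: ln_ge0.
    apply: (@le_trans _ _ (expR (p%:R * ln (s n)))).
      rewrite -[X in X ^+ _](lnK (x := K1)) ?posrE// -expRM_natl ler_expR mulrC.
      by apply: ler_pM.
    rewrite expRM_natl lnK ?posrE//; apply: lerXn2r; rewrite ?nnegrE ?addr_ge0 ?(ltW s0)//.
    by rewrite lerDr.
  apply: le_trans _ e1.
  have h6 : `|crat b a g (s n * expR h)| <= 3 * q * (expR 1 * (C * expR (- (c * s n)))).
    apply: le_trans e2 _; apply: ler_wpM2l; first by rewrite mulr_ge0// ltW.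
    by apply: le_trans e3 _; apply: ler_wpM2l => //; exact: expR_ge0.
  apply: (@le_trans _ _ ((1 + s n) ^+ p * (3 * q * (expR 1 * (C * expR (- (c * s n))))))).
    by apply: ler_pM => //; apply: exprn_ge0; apply: le_trans K11.
  rewrite le_eqVlt; apply/orP; left; apply/eqP.
  move: ((1 + s n) ^+ p) (expR 1) (expR (- (c * s n))) => y1 y2 y3.
  by clear; ring.
(* The end points [u n] stay in a segment and cluster at some [v]. The free shift [h = x - v]
   carries [v] to a point where [crat] is continuous and nonzero. *)
have PG : ProperFilter (u @ F) by apply: fmap_proper_filter.
have [v [vI hv]] : `[T0, T0 + 1]%classic `&` cluster (u @ F) !=set0.
  apply: segment_compact; apply: filterS uP => n [h1 h2 _].
  by rewrite /= in_itv/= h1.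
move: vI; rewrite /= in_itv/= => /andP[v1 v2].
have [x vx cx] := @crat_continuous b a g v a0 bmono.
have T0x : T0 <= x by apply: le_trans v1 (ltW vx).
have [i0 r0 _] := hM0 _ (big _ T0x).
pose r := `|crat b a g (expR x)|.
have r20 : 0 < r / 2 by rewrite divr_gt0.
have h0 : 0 < x - v by rewrite subr_gt0.
have r40 : 0 < r / 4 by rewrite divr_gt0.
pose proof (lim_near (cx i0) r20) as hcx.
have hB : nbhs v [set y | r / 2 <= f (y + (x - v))].
  have : (fun y => y + (x - v)) y @[y --> v] --> x.
    pose proof (lim_add (@cvg_id _ (nbhs v)) (lim_cst (x - v))) as hl.
    by rewrite (_ : v + (x - v) = x) in hl; [exact: hl|ring].
  move=> /(_ _ hcx) h; apply: (@filterS _ (nbhs v) _ _ _ _ h) => y /= hy.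
  have := ler_normB (crat b a g (expR (y + (x - v))) - crat b a g (expR x)) (crat b a g (expR (y + (x - v)))).
  rewrite addrAC subrr add0r normrN -/r -/(f _) => h1.
  by move: h1 hy; clear; lra.
have [y []] := hv [set y | f (y + (x - v)) <= r / 4] _ (small _ _ h0 r40) hB.
by move=> /= h1 h2; move: (le_trans h2 h1) r40; clear; lra.
Qed.

End LowerBound.

(** * Quantiles, block maxima and mixing *)

Section Quantiles.
Context {R : realType}.

Definition cdf_like (F : R -> R) : Prop :=
  [/\ continuous F, {homo F : x y / x <= y},
      F x @[x --> -oo] --> (0 : R) & F x @[x --> +oo] --> (1 : R)].

Variable F : R -> R.
Hypothesis Fcdf : cdf_like F.

Lemma quantile_has_inf tau : 0 < tau < 1 -> has_inf [set x | tau <= F x].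
Proof.
case: Fcdf => _ Fm F0 F1 /andP[t0 t1]; split.
  have e0 : 0 < 1 - tau by rewrite subr_gt0.
  have [M [_ hM]] := lim_near F1 e0; exists (M + 1).
  have : M < M + 1 by rewrite ltrDl.
  by move=> /hM /=; rewrite ler_norml; lra.
have e0 : 0 < tau / 2 by rewrite divr_gt0.
have [M [_ hM]] := lim_near F0 e0; exists (M - 1) => x /= tx.
rewrite leNgt; apply/negP => xM.
have : M - 1 < M by rewrite gtrBl.
move=> /hM /=; rewrite subr0 ler_norml; have := Fm _ _ (ltW xM).
by clear - tx t0; lra.
Qed.

Lemma quantile_le tau x : 0 < tau < 1 -> tau <= F x -> quantile F tau <= x.
Proof. by move=> ht tx; apply: ge_inf => //; case: (quantile_has_inf ht). Qed.

Lemma quantile_ge tau x : 0 < tau < 1 -> quantile F tau <= x -> tau <= F x.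
Proof.
move=> ht; case: Fcdf => Fc Fm _ _ qx.
apply: le_trans _ (Fm _ _ qx); rewrite leNgt; apply/negP => hlt.
have e0 : 0 < (tau - F (quantile F tau)) / 2 by rewrite divr_gt0// subr_gt0.
have [d /= d0 hd] := lim_near (Fc (quantile F tau)) e0.
have [y /= ty yq] := inf_adherent d0 (quantile_has_inf ht).
have qy : quantile F tau <= y by exact: quantile_le.
have := hd y; rewrite /ball /= distrC ger0_norm ?subr_ge0// ltrBlDl => /(_ yq).
by rewrite ler_norml; clear - ty hlt; lra.
Qed.

Lemma quantile_mono tau tau' : 0 < tau -> tau <= tau' -> tau' < 1 ->
  quantile F tau <= quantile F tau'.
Proof.
move=> t0 ltt t1; apply: quantile_le; first by rewrite t0 (le_lt_trans ltt).
apply: (le_trans ltt); by apply: quantile_ge => //; rewrite (lt_le_trans t0 ltt) t1.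
Qed.

Lemma F_quantile tau : 0 < tau < 1 -> F (quantile F tau) = tau.
Proof.
move=> ht; apply/eqP; rewrite eq_le (quantile_ge ht)// andbT.
case: Fcdf => Fc Fm _ _.
rewrite leNgt; apply/negP => hlt.
have e0 : 0 < (F (quantile F tau) - tau) / 2 by rewrite divr_gt0// subr_gt0.
have [d /= d0 hd] := lim_near (Fc (quantile F tau)) e0.
pose y := quantile F tau - d / 2.
have : tau <= F y.
  have := hd y; rewrite /ball /= /y subKr gtr0_norm ?divr_gt0//.
  have -> : d / 2 < d by clear - d0; lra.
  by move=> /(_ isT); rewrite ler_norml; clear - hlt; lra.
by move=> /(quantile_le ht); rewrite /y; clear - d0; lra.
Qed.

Lemma expRNV_itv (t : R) : 0 < t -> 0 < expR (- t^-1) < 1.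
Proof. by move=> t0; rewrite expR_gt0 expR_lt1 oppr_lt0 invr_gt0. Qed.

Lemma bfun_mono x y : 0 < x -> x <= y -> bfun F x <= bfun F y.
Proof.
move=> x0 xy; have y0 : 0 < y by apply: lt_le_trans xy.
have /andP[h1 _] := expRNV_itv x0; have /andP[_ h2] := expRNV_itv y0.
by apply: quantile_mono => //; rewrite ler_expR lerN2 lef_pV2.
Qed.

End Quantiles.

Section Cdf.
Context {R : realType} {d : measure_display} {T : measurableType d}.
Variables (P : probability T R) (X : nat -> T -> R).
Hypothesis mX : forall t, measurable_fun setT (X t).
Hypothesis cF : continuous (cdf1 P X).
Let F := cdf1 P X.

Lemma measurable_le (f : T -> R) c : measurable_fun setT f -> measurable [set w | f w <= c].
Proof.
move=> mf; have -> : [set w | f w <= c] = setT `&` f @^-1` `]-oo, c].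
  by rewrite setTI; apply/seteqP; split => w /=; rewrite in_itv.
by apply: mf => //; exact: measurable_itv.
Qed.

Lemma prob_le (A B : set T) : measurable A -> measurable B -> A `<=` B ->
  fine (P A) <= fine (P B).
Proof.
by move=> mA mB AB; apply: fine_le; rewrite ?fin_num_measure// le_measure ?inE.
Qed.

Lemma cdf1_cdf_like : cdf_like F.
Proof.
pose Y : {RV P >-> R} := HB.pack (X 1%N) (isMeasurableFun.Build _ _ _ _ (X 1%N) (mX 1)).
have FE r : (F r)%:E = cdf Y r.
  by rewrite /F /cdf1 fineK ?fin_num_measure//; last exact: measurable_le.
pose proof (fine_cvg (cvg_cdfNy0 Y)) as h0.
pose proof (fine_cvg (cvg_cdfy1 Y)) as h1.
split => //.
by move=> x y xy; rewrite -lee_fin !FE; exact: cdf_nondecreasing.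
Qed.

(** The probability integral transform. Quantiles give one-sided bounds at each level, and comparing
    with a level strictly between [u] and the probability turns them into an equality. *)
Lemma prob_F_le u : 0 <= u <= 1 -> fine (P [set w | F (X 1%N w) <= u]) = u.
Proof.
have FC := cdf1_cdf_like; have [Fc Fm F0 F1] := FC.
have mFX c : measurable [set w | F (X 1%N w) <= c].
  apply: (@measurable_le (F \o X 1%N)).
  by apply: measurableT_comp => //; exact: continuous_measurable_fun.
have upper v : 0 < v < 1 -> forall u', u' < v -> fine (P [set w | F (X 1%N w) <= u']) <= v.
  move=> hv u' u'v; rewrite -[X in _ <= X](F_quantile FC hv) /F /cdf1.
  apply: prob_le => //; first exact: measurable_le.
  move=> w /= h; rewrite leNgt; apply/negP => /ltW /Fm; rewrite F_quantile//.
  by move=> h'; move: (le_trans h' h); rewrite leNgt u'v.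
have lower v : 0 < v < 1 -> v <= fine (P [set w | F (X 1%N w) <= v]).
  move=> hv; rewrite -[X in X <= _](F_quantile FC hv) [X in X <= _]/F /cdf1.
  apply: prob_le => //; first exact: measurable_le.
  by move=> w /= h; rewrite -[leRHS](F_quantile FC hv); exact: Fm.
have mono u1 u2 : u1 <= u2 ->
    fine (P [set w | F (X 1%N w) <= u1]) <= fine (P [set w | F (X 1%N w) <= u2]).
  by move=> h; apply: prob_le => // w /= h1; exact: le_trans h.
move=> /andP[u0 u1]; set p := fine _.
have p0 : 0 <= p by exact: fine_ge0.
have p1 : p <= 1 by rewrite -lee_fin fineK ?fin_num_measure// probability_le1.
apply/eqP; rewrite eq_le; apply/andP; split; rewrite leNgt; apply/negP => h.
  have hv : 0 < (u + p) / 2 < 1 by clear - h p1 u0; lra.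
  by have := upper _ hv u; rewrite -/p; move: h; clear; lra.
have hv : 0 < (u + p) / 2 < 1 by clear - h p0 u1; lra.
have h1 := lower _ hv; have h2 : (u + p) / 2 <= u by clear - h; lra.
by move: (le_trans h1 (mono _ _ h2)); rewrite -/p; move: h; clear; lra.
Qed.

End Cdf.

Lemma dist_prod_le1 (R : realType) (x y z : R) : 0 <= x <= 1 -> 0 <= y <= 1 ->
  0 <= z <= 1 -> `|z - x * y| <= 1.
Proof. by move=> /andP[a b] /andP[e f] /andP[g h]; rewrite ler_norml; nra. Qed.

Lemma dist_exp_le1 (R : realType) N (x y : R) : 0 <= x <= 1 -> 0 <= y <= 1 ->
  `|x - y ^+ N| <= 1.
Proof.
move=> hx /andP[b0 b1]; rewrite -[x](expr1 x) expr1 -[y ^+ N]mulr1.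
by apply: dist_prod_le1 => //; rewrite ?exprn_ge0 ?exprn_ile1// ler01 lexx.
Qed.

(** * Mixing coefficients and blocks *)

Section Mixing.
Context {R : realType} {d : measure_display} {T : measurableType d}.
Variables (P : probability T R) (Y : nat -> T -> R).
Hypothesis mY : forall t, measurable_fun setT (Y t).

Lemma fineP_01 (A : set T) : measurable A -> 0 <= fine (P A) <= 1.
Proof.
by move=> mA; rewrite fine_ge0//= -lee_fin fineK ?fin_num_measure// probability_le1.
Qed.

Lemma sig_of_measurable (I : set nat) (A : set T) : sig_of Y I A -> measurable A.
Proof.
apply: (@smallest_sub _ (sigma_algebra setT)); first exact: sigma_algebra_measurable.
move=> _ [t [It [B [mB ->]]]]; rewrite -[X in measurable X]setTI; exact: mY.
Qed.

Lemma sig_of_forall (I : set nat) (m : nat) (t : nat -> nat) (c : R) :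
  (forall j, (j < m)%N -> I (t j)) ->
  sig_of Y I [set w | forall j, (j < m)%N -> Y (t j) w <= c].
Proof.
move=> It; rewrite /sig_of; set G := [set A | _].
have -> : [set w | forall j, (j < m)%N -> Y (t j) w <= c] =
    \bigcap_(j in `I_m) [set w | Y (t j) w <= c].
  by apply/seteqP; split => w /= h j /=; exact: h.
change (@measurable _ (g_sigma_algebraType G)
  (\bigcap_(j in `I_m) [set w | Y (t j) w <= c])).
apply: fin_bigcap_measurable => [|j jm]; first exact: finite_II.
apply: sub_sigma_algebra; exists (t j); split; first exact: It.
by exists `]-oo, c]%classic; split=> //; apply/seteqP; split=> w /=; rewrite in_itv.
Qed.

(** A real supremum bounds its elements only when the set is bounded above; the trivial bound 1 on
    these covariances provides this. *)
Lemma le_alpha (r l : nat) (A B : set T) : (1 <= r)%N ->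
  sig_of Y [set t | (1 <= t <= r)%N] A -> sig_of Y [set t | (r + l <= t)%N] B ->
  `|fine (P (A `&` B)) - fine (P A) * fine (P B)| <= alpha P Y l.
Proof.
move=> r1 hA hB.
have bnd A' B' : measurable A' -> measurable B' ->
    `|fine (P (A' `&` B')) - fine (P A') * fine (P B')| <= 1.
  by move=> mA mB; apply: dist_prod_le1; apply: fineP_01 => //; exact: measurableI.
have ar r' : alpha_r P Y r' l <= 1.
  apply: ge_sup.
    exists 0; exists set0, set0; split; try exact: sigma_algebra0.
    by rewrite setI0 measure0 /= mul0r subrr normr0.
  move=> _ [A' [B' [/sig_of_measurable mA /sig_of_measurable mB ->]]]; exact: bnd.
apply: (@le_trans _ _ (alpha_r P Y r l)).
  apply: ub_le_sup; last by exists A, B.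
  exists 1 => _ [A' [B' [/sig_of_measurable mA /sig_of_measurable mB ->]]]; exact: bnd.
apply: ub_le_sup; last by exists r.
by exists 1 => _ [r' _ <-].
Qed.

Lemma alpha_ge0 l : 0 <= alpha P Y l.
Proof.
apply: le_trans (normr_ge0 _) (@le_alpha 1 l set0 set0 _ _ _) => //; exact: sigma_algebra0.
Qed.

End Mixing.

Section Blocks.
Context {R : realType} {d : measure_display} {T : measurableType d}.
Variables (P : probability T R) (X : nat -> T -> R).
Hypothesis mX : forall t, measurable_fun setT (X t).
Hypothesis stat : strictly_stationary P X.
Hypothesis cF : continuous (cdf1 P X).
Let F := cdf1 P X.
Variables (m l : nat).
Hypothesis m0 : (0 < m)%N.

Definition ublk (i : nat) (w : T) : R := F (blockmax X m l i w).

Lemma F_01 x : 0 <= F x <= 1.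
Proof. by apply: fineP_01; exact: measurable_le. Qed.

Lemma F_mono : {homo F : x y / x <= y}.
Proof. by case: (cdf1_cdf_like mX cF). Qed.

Lemma mF : measurable_fun setT F.
Proof. exact: continuous_measurable_fun. Qed.

Lemma ublk_le i c w : ublk i w <= c <->
  forall j, (j < m)%N -> F (X (1 + i * (m + l) + j)%N w) <= c.
Proof.
rewrite /ublk /blockmax; split => [h j jm|h].
  apply: le_trans h; apply: F_mono; rewrite addnAC.
  exact: (@le_bigmax_ord _ _ _ _ (Ordinal jm) (fun j => X (1 + j + i * (m + l))%N w)) ||
  exact: (le_bigmax _ (fun j : 'I_m => X (1 + j + i * (m + l))%N w) (Ordinal jm)).
apply: (big_ind (fun y => F y <= c)).
- by have := h 0%N m0; rewrite addn0.
- by move=> x y hx hy; rewrite /Num.max; case: ifP.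
- by move=> j _; rewrite addnAC; exact: h.
Qed.

Lemma measurable_ublk i c : measurable [set w | ublk i w <= c].
Proof.
have -> : [set w | ublk i w <= c] =
    \bigcap_(j in `I_m) [set w | (F \o X (1 + i * (m + l) + j)%N) w <= c].
  by apply/seteqP; split => w /=; rewrite ublk_le.
apply: fin_bigcap_measurable => [|j jm]; first exact: finite_II.
by apply: measurable_le; apply: measurableT_comp => //; exact: mF.
Qed.

Lemma ublk_stat i c : P [set w | ublk i w <= c] = P [set w | ublk 0 w <= c].
Proof.
have e i' : [set w | ublk i' w <= c] =
   [set w | forall j, (j < m)%N -> (fun _ : nat => [set x | F x <= c]) j (X (1 + i' * (m + l) + j)%N w)].
  by apply/seteqP; split => w /=; rewrite ublk_le.
rewrite !e; apply: (@stat m (i * (m + l))%N (fun _ => [set x | F x <= c])) => j.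
by apply: measurable_le; exact: mF.
Qed.

(** By the probability integral transform the comparison probability in [beta] equals its argument
    [s]. At [s = c ^ (m * th)] the coefficient therefore bounds the error in the law of a block
    maximum. *)
Lemma beta_bound (th c : R) : 0 < th -> (1 <= Num.truncn (th * m%:R))%N -> 0 <= c <= 1 ->
  `|fine (P [set w | ublk 0 w <= c]) - powR c (m%:R * th)| <= beta P X F th m.
Proof.
move=> th0 N1 /andP[c0 c1].
have mth : 0 < m%:R * th by rewrite mulr_gt0// ltr0n.
have one : powR 1 (m%:R * th) = 1 by rewrite powR1.
set N := Num.truncn (th * m%:R) in N1 *.
have N0 : 0 < N%:R :> R by rewrite ltr0n.
have Nn0 : N%:R != 0 :> R by rewrite gt_eqF.
have key s : 0 <= s <= 1 -> fine (P [set w | F (X 1%N w) ^+ N <= s]) ^+ N = s.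
  move=> /andP[s0 s1]; pose r := powR s (N%:R^-1).
  have r0 : 0 <= r by exact: powR_ge0.
  have rN : r ^+ N = s.
    by rewrite -powR_mulrn// /r -powRrM mulVf// powRr1.
  have r1 : r <= 1 by rewrite -(@ler_pXn2r _ N)// ?nnegrE// rN expr1n.
  have -> : [set w | F (X 1%N w) ^+ N <= s] = [set w | F (X 1%N w) <= r].
    apply/seteqP; split=> w /=; have /andP[h0 _] := F_01 (X 1%N w);
    by rewrite -rN ler_pXn2r// nnegrE.
  by rewrite (prob_F_le mX cF) ?r0//.
have mpow s : measurable [set w | forall i, (1 <= i <= m)%N -> powR (F (X i w)) (m%:R * th) <= s].
  have -> : [set w | forall i, (1 <= i <= m)%N -> powR (F (X i w)) (m%:R * th) <= s] =
    \bigcap_(i in [set i | (1 <= i <= m)%N]) [set w | (fun w => powR (F (X i w)) (m%:R * th)) w <= s].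
    by apply/seteqP; split => w /= h j /=; exact: h.
  apply: fin_bigcap_measurable => [|j jm].
    by apply: (@sub_finite_set _ _ `I_m.+1) => // j /= /andP[_]; rewrite ltnS.
  apply: measurable_le; apply: (measurableT_comp (measurable_powR _)).
  by apply: measurableT_comp => //; exact: mF.
have mN s : measurable [set w | F (X 1%N w) ^+ N <= s].
  apply: (@measurable_le _ _ _ (fun w => F (X 1%N w) ^+ N)).
  by apply: measurable_funX; apply: measurableT_comp => //; exact: mF.
apply: ub_le_sup.
  by exists 1 => _ [s _ <-]; apply: dist_exp_le1; exact: fineP_01.
exists (powR c (m%:R * th)).
  rewrite /= in_itv/= powR_ge0/=.
  by rewrite -[X in _ <= X]one; apply: ge0_ler_powR; rewrite ?nnegrE// ltW.
rewrite key; last first.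
  rewrite powR_ge0/= -[X in _ <= X]one.
  by apply: ge0_ler_powR; rewrite ?nnegrE// ltW.
congr (`|fine (P _) - _|); apply/seteqP; split => w /= h.
  apply/ublk_le => j jm; have := h j.+1 jm.
  have /andP[h0 _] := F_01 (X j.+1 w).
  rewrite mul0n addn0 add1n => hp; rewrite leNgt; apply/negP => hlt; move: hp; apply/negP.
  by rewrite -ltNge; apply: gt0_ltr_powR; rewrite ?nnegrE.
move/ublk_le: h => h i /andP[i1 im].
have := h i.-1; rewrite mul0n addn0 add1n prednK// im => /(_ isT) hi.
by have /andP[h0 _] := F_01 (X i w); apply: ge0_ler_powR; rewrite ?nnegrE// ltW.
Qed.

Lemma measurable_Yeps eps t : eps <= 1 -> measurable_fun setT (Yeps F X eps t).
Proof.
move=> e1; have mg : measurable_fun setT (fun x : R => F x * (if 1 - eps < F x then 1 else 0)).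
  apply: nondecreasing_measurable => // x y xy; have h := F_mono xy.
  have /andP[h0 _] := F_01 x; have /andP[h0' _] := F_01 y.
  case: ifPn => h1; case: ifPn => h2; rewrite ?mulr1 ?mulr0//.
  by move: h2; rewrite (lt_le_trans h1 h).
exact: (measurableT_comp mg (mX t)).
Qed.

(** For [c >= 1 - eps] the truncation is invisible: [Yeps <= c] and [F X <= c] are the same event.
    The two blocks are separated by at least the gap [l]. *)
Lemma pair_mixing (eps c : R) i j : 0 < eps <= 1 -> 1 - eps <= c -> (i < j)%N ->
  `|fine (P ([set w | ublk i w <= c] `&` [set w | ublk j w <= c]))
    - fine (P [set w | ublk i w <= c]) * fine (P [set w | ublk j w <= c])|
  <= alpha P (Yeps F X eps) l.
Proof.
move=> /andP[e0 e1] ec ij.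
have c0 : 0 <= c by apply: le_trans ec; rewrite subr_ge0.
have mY t := measurable_Yeps t e1.
have yle t w : (Yeps F X eps t w <= c) = (F (X t w) <= c).
  rewrite /Yeps; case: ifPn => h; rewrite ?mulr1// mulr0 c0; apply/esym.
  by rewrite -leNgt in h; exact: le_trans h ec.
have e i' : [set w | ublk i' w <= c] =
   [set w | forall j, (j < m)%N -> Yeps F X eps (1 + i' * (m + l) + j)%N w <= c].
  apply/seteqP; split => w /=; rewrite ublk_le => h j' jm; have := h j' jm; by rewrite yle.
rewrite !e; apply: (le_alpha P mY (r := (m + i * (m + l))%N)).
- by rewrite (leq_trans m0)// leq_addr.
- by apply: sig_of_forall => j' jm /=; lia.
- apply: sig_of_forall => j' jm /=.
  have : (i.+1 * (m + l) <= j * (m + l))%N by rewrite leq_mul2r ij orbT.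
  by rewrite mulSn; lia.
Qed.

End Blocks.

(** * Markov and Chebyshev inequalities for counts *)

Section Expectation.
Context {R : realType} {d : measure_display} {T : measurableType d}.
Variable P : probability T R.
Implicit Types (I : Type).

Definition pr (b : T -> bool) : R := fine (P [set w | b w]).

Lemma pr_ge0 (b : T -> bool) : 0 <= pr b. Proof. exact: fine_ge0. Qed.

Lemma pr_le1 (b : T -> bool) : measurable [set w | b w] -> pr b <= 1.
Proof. by move=> mb; have /andP[] := fineP_01 P mb. Qed.

Lemma measurable_fun_bool_nat (b : T -> bool) : measurable [set w | b w] ->
  measurable_fun setT (fun w => (b w)%:R : R).
Proof.
move=> mb; have -> : (fun w => (b w)%:R : R) = \1_[set w | b w].
  by apply/funext => w; rewrite indicE mem_setE.
exact: measurable_indic.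
Qed.

Lemma measurable_wsum I (r : seq I) (c : I -> R) (b : I -> T -> bool) :
  (forall i, measurable [set w | b i w]) ->
  measurable_fun setT (fun w => \sum_(i <- r) c i * (b i w)%:R).
Proof.
move=> mb; apply: measurable_sum => i.
by apply: measurable_funM => //; exact: measurable_fun_bool_nat.
Qed.

Lemma integral_wsum I (r : seq I) (c : I -> R) (b : I -> T -> bool) :
  (forall i, 0 <= c i) -> (forall i, measurable [set w | b i w]) ->
  (\int[P]_w (\sum_(i <- r) c i * (b i w)%:R)%:E)%E = (\sum_(i <- r) c i * pr (b i))%:E.
Proof.
move=> c0 mb.
under eq_integral do rewrite -sumEFin.
rewrite ge0_integral_sum//; last 2 first.
- move=> i; apply/measurable_EFinP; apply: measurable_funM => //.
  exact: measurable_fun_bool_nat.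
- by move=> i w _; rewrite lee_fin mulr_ge0.
rewrite -sumEFin; apply: eq_bigr => i _.
under eq_integral do rewrite EFinM.
rewrite ge0_integralZl//; last 2 first.
- by apply/measurable_EFinP; exact: measurable_fun_bool_nat.
- by rewrite lee_fin.
rewrite EFinM; congr (_ * _)%E.
have -> : (\int[P]_w ((b i w)%:R)%:E)%E = (\int[P]_w (\1_[set w | b i w] w)%:E)%E.
  by apply: eq_integral => w _; rewrite indicE mem_setE.
by rewrite integral_indic// setIT /pr fineK// fin_num_measure.
Qed.

(** The form to which Markov and Chebyshev are both reduced: the sums are nonnegative on both sides,
    so no question of integrability arises. *)
Lemma expect_le I J (r : seq I) (s : seq J) (c : I -> R) (c' : J -> R)
    (b : I -> T -> bool) (b' : J -> T -> bool) :
  (forall i, 0 <= c i) -> (forall i, measurable [set w | b i w]) ->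
  (forall j, 0 <= c' j) -> (forall j, measurable [set w | b' j w]) ->
  (forall w, \sum_(i <- r) c i * (b i w)%:R <= \sum_(j <- s) c' j * (b' j w)%:R) ->
  \sum_(i <- r) c i * pr (b i) <= \sum_(j <- s) c' j * pr (b' j).
Proof.
move=> c0 mb c'0 mb' h; rewrite -lee_fin -!integral_wsum//.
apply: ge0_le_integral => //.
- by move=> w _; rewrite lee_fin sumr_ge0// => i _; rewrite mulr_ge0.
- by apply/measurable_EFinP; exact: measurable_wsum.
- by apply/measurable_EFinP; exact: measurable_wsum.
- by move=> w _; rewrite lee_fin.
Qed.

Lemma weighted_markov I (r : seq I) (c : I -> R) (b : I -> T -> bool) (bad : T -> bool) (e : R) : 0 < e ->
  (forall i, 0 <= c i) -> (forall i, measurable [set w | b i w]) ->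
  measurable [set w | bad w] ->
  (forall w, bad w -> e <= \sum_(i <- r) c i * (b i w)%:R) ->
  pr bad <= e^-1 * \sum_(i <- r) c i * pr (b i).
Proof.
move=> e0 c0 mb mbad h; rewrite ler_pdivlMl//.
have := @expect_le unit I [:: tt] r (fun=> e) c (fun=> bad) b.
rewrite !big_seq1; apply => // [_|w]; first exact: ltW.
rewrite big_seq1; case: (boolP (bad w)) => hb; first by rewrite mulr1 h.
by rewrite mulr0 sumr_ge0// => i _; rewrite mulr_ge0.
Qed.

(** The square is expanded and its negative term moved to the left: [e ^+ 2 * 1_bad + 2 * k * p * S
    <= S ^+ 2 + k ^+ 2 * p ^+ 2] for the count [S]. Pairs off the diagonal are independent up to
    [al], and the diagonal contributes [k * p]. *)
Lemma chebyshev_count (k : nat) (b : nat -> T -> bool) (bad : T -> bool) (p al e : R) :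
  0 <= al -> (forall i, measurable [set w | b i w]) -> measurable [set w | bad w] ->
  (forall i, pr (b i) = p) ->
  (forall i j, (i < j)%N -> `|pr (fun w => b i w && b j w) - p * p| <= al) ->
  0 < e ->
  (forall w, bad w -> e <= `|\sum_(i <- iota 0 k) (b i w)%:R - k%:R * p|) ->
  pr bad <= (k%:R * p + k%:R ^+ 2 * al) / e ^+ 2.
Proof.
move=> al0 mb mbad hp hmix e0 hbad.
have p0 : 0 <= p by rewrite -(hp 0%N) pr_ge0.
rewrite ler_pdivlMr ?exprn_gt0// mulrC.
set Ik := iota 0 k.
have sI : \sum_(i <- Ik) (1 : R) = k%:R.
  by rewrite big_const_seq count_predT size_iota iter_addr addr0.
have sIc (x : R) : \sum_(i <- Ik) x = k%:R * x.
  by rewrite -sI mulr_suml; apply: eq_bigr => i _; rewrite mul1r.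
pose bb (ij : nat * nat) w := b ij.1 w && b ij.2 w.
have mbb ij : measurable [set w | bb ij w].
  have -> : [set w | bb ij w] = [set w | b ij.1 w] `&` [set w | b ij.2 w].
    by apply/seteqP; split => w /=; rewrite /bb => /andP.
  exact: measurableI.
(* [None] stands for the event [bad] on the left and for the constant term on the right. *)
pose LI : seq (option nat) := None :: [seq Some i | i <- Ik].
pose Lc (i : option nat) : R := if i is Some _ then 2 * k%:R * p else e ^+ 2.
pose Lb (i : option nat) := if i is Some i then b i else bad.
pose RI : seq (option (nat * nat)) := None :: [seq Some ij | ij <- [seq (i, j) | i <- Ik, j <- Ik]].
pose Rc (i : option (nat * nat)) : R := if i is Some _ then 1 else k%:R ^+ 2 * p ^+ 2.
pose Rb (i : option (nat * nat)) := if i is Some ij then bb ij else xpredT.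
have := @expect_le _ _ LI RI Lc Rc Lb Rb.
have Lc0 i : 0 <= Lc i by case: i => [i|] /=; rewrite ?sqr_ge0// !mulr_ge0.
have Rc0 i : 0 <= Rc i by case: i => [i|] /=; rewrite ?ler01// mulr_ge0 ?sqr_ge0.
have mLb i : measurable [set w | Lb i w] by case: i.
have mRb i : measurable [set w | Rb i w].
  case: i => [ij|]; first exact: mbb.
  by rewrite (_ : [set w | Rb None w] = setT)//; apply/seteqP; split.
move=> /(_ Lc0 mLb Rc0 mRb).
have prT : pr xpredT = 1.
  rewrite /pr (_ : [set w | xpredT w] = setT) ?probability_setT//.
  by apply/seteqP; split.
have hw w : \sum_(i <- LI) Lc i * (Lb i w)%:R <= \sum_(j <- RI) Rc j * (Rb j w)%:R.
  rewrite !big_cons !big_map /= mulr1.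
  rewrite big_allpairs /= -mulr_sumr.
  set S := \sum_(i <- Ik) (b i w)%:R.
  have -> : \sum_(i <- Ik) \sum_(j <- Ik) 1 * (bb (i, j) w)%:R = S * S :> R.
    rewrite mulr_suml; apply: eq_bigr => i _; rewrite mulr_sumr; apply: eq_bigr => j _.
    by rewrite mul1r /bb /= -natrM mulnb.
  have sq : e ^+ 2 * (bad w)%:R <= (S - k%:R * p) ^+ 2.
    case: (boolP (bad w)) => hb; last by rewrite mulr0 sqr_ge0.
    rewrite mulr1 -[leRHS]real_normK ?num_real//.
    by rewrite ler_sqr ?nnegrE//; [exact: hbad|exact: ltW].
  move: sq; clear; move: (e ^+ 2 * _) S k%:R => E S K; lra.
move=> /(_ hw); rewrite !big_cons !big_map /= prT mulr1 big_allpairs /= -mulr_sumr.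
have -> : \sum_(i <- Ik) pr (b i) = k%:R * p.
  by rewrite -sIc; apply: eq_bigr => i _; exact: hp.
have hb1 i j : pr (bb (i, j)) <= (i == j)%:R * p + (p * p + al).
  have [<-|ij] := eqVneq i j.
    have -> : pr (bb (i, i)) = p by rewrite -(hp i); congr pr; apply/funext => w; rewrite /bb andbb.
    by rewrite mul1r lerDl addr_ge0// mulr_ge0.
  rewrite mul0r add0r; have [ij'|ji|e'] := ltngtP i j; last by rewrite e' eqxx in ij.
    by have := hmix _ _ ij'; rewrite ler_norml /bb /=; clear; lra.
  have -> : bb (i, j) = fun w => b j w && b i w by apply/funext => w; rewrite /bb andbC.
  by have := hmix _ _ ji; rewrite ler_norml /bb /=; clear; lra.
have hsum : \sum_(i <- Ik) \sum_(j <- Ik) 1 * pr (bb (i, j)) <=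
    \sum_(i <- Ik) (p + k%:R * (p * p + al)).
  rewrite big_seq [leRHS]big_seq; apply: ler_sum => i iI.
  have -> : p + k%:R * (p * p + al) = \sum_(j <- Ik) ((i == j)%:R * p + (p * p + al)).
    rewrite big_split /= sIc; congr (_ + _).
    rewrite (bigD1_seq i) ?iota_uniq//= eqxx mul1r big1 ?addr0// => j ji.
    by rewrite eq_sym (negbTE ji) mul0r.
  by apply: ler_sum => j _; rewrite mul1r.
move=> h; move: (le_trans h (lerD (lexx _) hsum)); rewrite sIc.
clear; move: (e ^+ 2 * pr bad) k%:R => E K; lra.
Qed.

End Expectation.

(** * Events with probability tending to one *)

Section WithProbability.
Context {R : realType} {d : measure_display} {T : measurableType d}.
Variable P : probability T R.

(** [Q n] need not be measurable; it only has to contain measurable events whose probabilities tend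
    to one. *)
Definition wp (Q : nat -> T -> Prop) : Prop := exists E : nat -> set T,
  [/\ forall n, measurable (E n), forall n w, E n w -> Q n w &
      (fine (P (E n)) : R) @[n --> \oo] --> (1 : R)].

Lemma wp_S (Q Q' : nat -> T -> Prop) : (forall n w, Q n w -> Q' n w) -> wp Q -> wp Q'.
Proof. by move=> h [E [mE EQ lE]]; exists E; split => // n w /EQ; exact: h. Qed.

Lemma wp_bound (B : nat -> T -> bool) (e : nat -> R) (Q : nat -> T -> Prop) :
  (\forall n \near \oo, measurable [set w | B n w]) ->
  (\forall n \near \oo, pr P (B n) <= e n) -> e n @[n --> \oo] --> (0 : R) ->
  (\forall n \near \oo, forall w, ~~ B n w -> Q n w) -> wp Q.
Proof.
move=> mB hB e0 hQ.
pose good n := measurable [set w | B n w] /\ forall w, ~~ B n w -> Q n w.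
(* The assumptions hold only eventually; at the other indices the empty event is taken. *)
exists (fun n => if pselect (good n) then ~` [set w | B n w] else set0); split.
- move=> n; case: pselect => [gd|ng]; last exact: measurable0.
  by apply: measurableC; case: gd.
- move=> n w; case: pselect => [gd|ng] /=; last by [].
  by have [_ h] := gd => /negP /h.
- apply: near_lim => x x0; pose proof (lim_near e0 x0) as hx.
  pose proof (filterI (filterI mB hB) (filterI hx hQ)) as base.
  apply: (@filterS _ _ _ _ _ _ base) => n [[mb hb] [{}hx hq]].
  case: pselect => [gd|ng]; last by case: ng; split.
  rewrite probability_setC// fineB ?fin_num_measure//= addrAC subrr add0r normrN.
  have := pr_ge0 P (B n); rewrite /pr => h0; rewrite ger0_norm//.
  apply: le_trans hb _; apply: le_trans (ler_norm _) _; by rewrite -[e n]subr0.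
Qed.

Lemma wp_near (Q : nat -> T -> Prop) : (\forall n \near \oo, forall w, Q n w) -> wp Q.
Proof.
move=> h; apply: (@wp_bound (fun _ _ => false) (fun=> 0)).
- by apply: nearW => n; rewrite (_ : [set w | false] = set0)//; apply/seteqP; split.
- apply: nearW => n; rewrite /pr (_ : [set w | false] = set0) ?measure0//.
  by apply/seteqP; split.
- exact: cvg_cst.
- by apply: filterS h => n h w _.
Qed.

Lemma wp_and (Q Q' : nat -> T -> Prop) : wp Q -> wp Q' -> wp (fun n w => Q n w /\ Q' n w).
Proof.
move=> [E [mE EQ lE]] [E' [mE' EQ' lE']].
exists (fun n => E n `&` E' n); split.
- by move=> n; exact: measurableI.
- by move=> n w [/EQ h /EQ' h'].
- apply: near_lim => e e0; have e20 : 0 < e / 2 by rewrite divr_gt0.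
  pose proof (filterI (lim_near lE e20) (lim_near lE' e20)) as base.
  apply: (@filterS _ _ _ _ _ _ base) => n [h1 h2].
  have mI := measurableI _ _ (mE n) (mE' n).
  have h3 : fine (P (E n)) + fine (P (E' n)) <= 1 + fine (P (E n `&` E' n)).
    have : (P (~` (E n `&` E' n)) <= P (~` E n) + P (~` E' n))%E.
      by rewrite setCI; apply: measureU2; exact: measurableC.
    rewrite !probability_setC// -[P (E n)]fineK ?fin_num_measure//.
    rewrite -[P (E' n)]fineK ?fin_num_measure// -[P (_ `&` _)]fineK ?fin_num_measure//.
    by rewrite -!EFinB -EFinD lee_fin /=; clear; lra.
  have /andP[_ h4] := fineP_01 P mI.
  move: h1 h2 h3 h4; rewrite !ler_norml; clear; lra.
Qed.

End WithProbability.

Section SecondOrderSequence.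
Context {R : realType}.

Lemma cond_SO_second_order (b : R -> R) g m k (a A : R -> R) rho lam :
  cond_SO b g m k a A rho lam -> second_order b a A g rho.
Proof.
move=> [a0 hA [A0 rho0] hso _]; split => //.
  by case: hA; apply: filterS => s h; rewrite ?(gt_eqF h) ?(lt_eqF h).
move=> t t0; have := hso _ (expR_gt0 t).
have e1 : 1 <= expR t by rewrite -[X in X <= _]expR0 ler_expR.
by rewrite (oint_powR _ e1) (Hfun_HH _ _ e1) expRK; exact.
Qed.

(** The condition bounds [sqrt k * A m], and [A_ratio_lim] with [t = - ln th >= 0] moves the bound
    from [m] to [th * m]. *)
Lemma A_bound (b : R -> R) g (m k : nat -> nat) (a A : R -> R) rho lam th :
  cond_SO b g m k a A rho lam -> 0 < th <= 1 ->
  ((m n)%:R : R) @[n --> \oo] --> +oo -> ((k n)%:R : R) @[n --> \oo] --> +oo ->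
  exists2 C, 0 < C & \forall n \near \oo,
    `|A (th * (m n)%:R)| <= C * expR (- (ln (k n)%:R / 2)).
Proof.
move=> hSO /andP[th0 th1] moo koo; have so := cond_SO_second_order hSO.
have [_ _ _ _ hlam] := hSO; have [a0 A0 Ac rho0 soL] := so.
have t0 : 0 <= - ln th by rewrite oppr_ge0 ln_le0.
pose proof (A_ratio_lim a0 A0 Ac soL t0) as hr.
pose r := expR (rho * - ln th); have r0 : 0 < r by exact: expR_gt0.
have smoo : (th * (m n)%:R) @[n --> \oo] --> +oo.
  apply/cvgryPge => B; have : \forall n \near \oo, B / th <= (m n)%:R.
    exact: near_along moo (nbhs_pinfty_ge (num_real _)).
  by apply: filterS => n; rewrite ler_pdivrMr// mulrC.
have r20 : 0 < r / 2 by rewrite divr_gt0.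
have hr2 : \forall n \near \oo, `|A (th * (m n)%:R)| <= 2 / r * `|A (m n)%:R|.
  pose proof (filterI A0 (lim_near hr r20)) as hb.
  apply: filterS (near_along smoo hb) => n [As h].
  have e : th * (m n)%:R * expR (- ln th) = (m n)%:R.
    by rewrite expRN lnK ?posrE//; field; rewrite gt_eqF.
  move: h; rewrite e -/r => h.
  have h2 : r / 2 <= `|A (m n)%:R / A (th * (m n)%:R)|.
    by apply: le_trans _ (ler_norm _); move: h; rewrite ler_norml; lra.
  move: h2; rewrite normrM normfV ler_pdivlMr ?normr_gt0// => h2.
  have -> : 2 / r = (r / 2)^-1 by field; rewrite gt_eqF.
  by rewrite ler_pdivlMl.
exists (2 / r * (`|lam| + 1)); first by rewrite mulr_gt0 ?divr_gt0// ltr_wpDl.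
pose proof (lim_near hlam ltr01) as hl.
have k1 : \forall n \near \oo, 1 < ((k n)%:R : R).
  exact: near_along koo (nbhs_pinfty_gt (num_real _)).
pose proof (filterI hr2 (filterI hl k1)) as base.
apply: (@filterS _ _ _ _ _ _ base) => n [{}hr2 [{}hl {}k1]].
apply: le_trans hr2 _; rewrite -[X in _ <= X]mulrA; apply: ler_wpM2l; first by rewrite ltW// divr_gt0.
have k0 : 0 < ((k n)%:R : R) by apply: lt_trans k1.
have e : expR (- (ln (k n)%:R / 2)) = (Num.sqrt (k n)%:R)^-1 :> R.
  rewrite expRN; congr (_^-1); apply: (@pexpIrn _ 2); rewrite ?nnegrE ?sqrtr_ge0 ?expR_ge0//.
  by rewrite sqr_sqrtr ?(ltW k0)// -expRM_natl mulrC divfK// lnK ?posrE.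
rewrite e ler_pdivlMr ?sqrtr_gt0// mulrC -[X in X * _](ger0_norm (sqrtr_ge0 _)) -normrM.
have := ler_normD (Num.sqrt (k n)%:R * A (m n)%:R - lam) lam; rewrite subrK.
by move: hl; clear; lra.
Qed.

(** If the inequality failed infinitely often, [A] would be at most [C * expR (- s / (2 * B))] along
    the failing indices, against [no_fast_decay]. The subsequence is represented by the proper
    filter [within D \oo]. *)
Lemma growth (b : R -> R) g (a A : R -> R) rho (s x : nat -> R) C B :
  second_order b a A g rho -> (forall u v, 0 < u -> u <= v -> b u <= b v) ->
  0 < C -> s n @[n --> \oo] --> +oo ->
  (\forall n \near \oo, `|A (s n)| <= C * expR (- (x n / 2))) -> 0 < B ->
  \forall n \near \oo, B * x n <= s n.
Proof.
move=> so bm C0 soo hA B0; apply: contrapT => hn.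
pose D := [set n | s n < B * x n].
have FF : ProperFilter (within D \oo).
  apply: Build_ProperFilter => hD; apply: hn.
  apply: (@filterS _ \oo _ [set n | D n -> set0 n] _ _ hD) => n /= h.
  by rewrite leNgt; apply/negP => /h.
have c0 : 0 < (2 * B)^-1 by rewrite invr_gt0 mulr_gt0.
apply: (@no_fast_decay _ nat (within D \oo) FF b a A g rho C (2 * B)^-1 s so bm c0 C0).
  exact: cvg_within_filter soo.
apply: filterS hA => n hA' Dn; apply: le_trans hA' _.
apply: ler_wpM2l; first exact: ltW.
rewrite ler_expR lerN2 ler_pdivrMl ?mulr_gt0//.
have -> : 2 * B * (x n / 2) = B * x n by field.
exact: ltW.
Qed.

End SecondOrderSequence.

Section GumbelScale.
Context {R : realType}.

(* [glev s t] is the level whose [s]-th power is [Lam t]. *)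
Definition glev (s t : R) : R := expR (- (s * expR t)^-1).

Lemma glev_le s t t' : 0 < s -> (glev s t <= glev s t') = (t <= t').
Proof.
move=> s0; rewrite /glev ler_expR lerN2 lef_pV2 ?posrE ?mulr_gt0 ?expR_gt0//.
by rewrite ler_pM2l// ler_expR.
Qed.

Lemma glev_itv s t : 0 < s -> 0 < glev s t < 1.
Proof. by move=> s0; apply: expRNV_itv; rewrite mulr_gt0// expR_gt0. Qed.

Lemma glev_powR s t : 0 < s -> powR (glev s t) s = Lam t.
Proof.
move=> s0; have /andP[g0 _] := glev_itv t s0.
rewrite Lam.unlock /powR gt_eqF// /glev expRK; congr (expR _); rewrite expRN.
by field; rewrite !gt_eqF// expR_gt0.
Qed.

Lemma glevK s U : 0 < s -> 0 < U < 1 -> exists y, U = glev s y.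
Proof.
move=> s0 /andP[U0 U1]; have l0 : 0 < - ln U by rewrite oppr_gt0 ln_lt0// U0.
exists (- ln (s * - ln U)); rewrite /glev expRN lnK ?posrE ?mulr_gt0//.
have -> : - (s * (s * - ln U)^-1)^-1 = ln U.
  by rewrite invfM invrK; field; rewrite gt_eqF.
by rewrite lnK// posrE.
Qed.

(** [Mx] lies between two consecutive grid values of [b]. As [eta] is at most the size of the
    increment of [Dg g] over one step in either direction, the error of a grid value amounts to at
    most one further step, whence [2 * L]. *)
Lemma grid_value (F : R -> R) (s a g L eta Mx y0 y1 : R) (J M : nat) :
  cdf_like F -> 0 < s -> 0 < a -> 0 < L -> eta <= Dg g L -> eta <= - Dg g (- L) ->
  (forall i, (i <= J + M)%N ->
    `|(bfun F (s * expR ((i%:R - J%:R) * L)) - bfun F s) / a - Dg g ((i%:R - J%:R) * L)|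
      <= eta * expR (g * ((i%:R - J%:R) * L))) ->
  - (J%:R * L) <= y0 -> y1 < M%:R * L ->
  ~~ (F Mx <= glev s y0) -> F Mx <= glev s y1 ->
  exists y, [/\ (forall t, (F Mx <= glev s t) = (y <= t)), y0 <= y <= y1,
    0 < 1 + g * ((Mx - bfun F s) / a) & `|ug g ((Mx - bfun F s) / a) - y| <= 2 * L].
Proof.
move=> FC s0 a0 L0 eta1 eta2 hgrid hy0 hy1 U0 U1.
have [y hy] : exists y, F Mx = glev s y.
  apply: glevK => //; move: U0; rewrite -ltNge => U0.
  have /andP[h0 _] := glev_itv y0 s0; have /andP[_ h1] := glev_itv y1 s0.
  by rewrite (lt_trans h0 U0) (le_lt_trans U1 h1).
have yt t : (F Mx <= glev s t) = (y <= t) by rewrite hy glev_le.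
rewrite yt -ltNge in U0; rewrite yt in U1.
have yJ : 0 <= (y + J%:R * L) / L.
  by rewrite divr_ge0 ?(ltW L0)//; move: U0 hy0; clear; lra.
pose j := Num.truncn ((y + J%:R * L) / L).
have /andP[j1 j2] := truncn_itv yJ; rewrite -/j -natr1 in j1 j2.
have h1 : (j%:R - J%:R) * L <= y by move: j1; rewrite ler_pdivlMr//; clear; lra.
have h2 : y < (j.+1%:R - J%:R) * L.
  by move: j2; rewrite ltr_pdivrMr// -natr1; clear; lra.
have jN : (j.+1 <= J + M)%N.
  rewrite -(@ltr_nat R) natrD; apply: le_lt_trans j1 _; rewrite ltr_pdivrMr//.
  by move: U1 hy1; clear; lra.
have b1 : bfun F (s * expR ((j%:R - J%:R) * L)) <= Mx.
  by apply: (quantile_le FC); [exact: glev_itv|rewrite -/(glev s _) hy glev_le].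
have b2 : Mx < bfun F (s * expR ((j.+1%:R - J%:R) * L)).
  rewrite ltNge; apply/negP => /(quantile_ge FC (glev_itv _ s0)).
  by rewrite hy -/(glev s _) glev_le// leNgt h2.
set z := (Mx - bfun F s) / a.
have [t1 t1E] : exists t1, t1 = (j%:R - J%:R) * L by eexists.
have [t2 t2E] : exists t2, t2 = (j.+1%:R - J%:R) * L by eexists.
have t12 : t2 = t1 + L by rewrite t1E t2E -natr1; ring.
have g1 := hgrid j (ltnW jN); have g2 := hgrid j.+1 jN.
rewrite -t1E in h1 b1 g1; rewrite -t2E in h2 b2 g2.
have z1 : Dg g (t1 - L) <= z.
  apply: (@le_trans _ _ ((bfun F (s * expR t1) - bfun F s) / a)); last first.
    by rewrite ler_pM2r ?invr_gt0// lerD2r.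
  have : eta * expR (g * t1) <= - Dg g (- L) * expR (g * t1).
    by apply: ler_wpM2r => //; exact: expR_ge0.
  by rewrite DgD; move: g1; rewrite ler_norml; clear; lra.
have z2 : z <= Dg g (t2 + L).
  apply: (@le_trans _ _ ((bfun F (s * expR t2) - bfun F s) / a)).
    by rewrite ler_pM2r ?invr_gt0// lerD2r ltW.
  have : eta * expR (g * t2) <= Dg g L * expR (g * t2).
    by apply: ler_wpM2r => //; exact: expR_ge0.
  by rewrite DgD; move: g2; rewrite ler_norml; clear; lra.
have zs : 0 < 1 + g * z.
  have [g0|g0] := leP 0 g.
    apply: (@lt_le_trans _ _ (1 + g * Dg g (t1 - L))); first exact: Dg_supp.
    by rewrite lerD2l; apply: ler_wpM2l.
  apply: (@lt_le_trans _ _ (1 + g * Dg g (t2 + L))); first exact: Dg_supp.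
  by rewrite lerD2l; apply: ler_wnM2l => //; exact: ltW.
exists y; split => //; first by rewrite (ltW U0) U1.
have v1 : t1 - L <= ug g z.
  by rewrite leNgt; apply/negP => /(@Dg_lt _ g); rewrite ugK// ltNge z1.
have v2 : ug g z <= t2 + L.
  by rewrite leNgt; apply/negP => /(@Dg_lt _ g); rewrite ugK// ltNge z2.
by rewrite ler_norml; move: v1 v2 h1 h2; rewrite t12; clear; lra.
Qed.

End GumbelScale.

(** * Samples close to the Gumbel law *)

Section Events.
Context {R : realType} {d : measure_display} {T : measurableType d}.
Variable P : probability T R.

Lemma log_small (c : R) : 0 < c -> \forall x \near +oo, c * (ln (2 * x) + 1) <= x.
Proof.
move=> c0; near=> x.
have x0 : 0 < x by near: x; exact: nbhs_pinfty_gt.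
have hx : 2 * (c * (ln (4 * c) + 1)) <= x.
  by near: x; apply: nbhs_pinfty_ge; rewrite num_real.
have h := @ln_le_sub1 R (2 * x / (4 * c)).
rewrite divr_gt0 ?mulr_gt0// in h; have {}h := h isT.
rewrite ln_div ?posrE ?mulr_gt0// in h.
have : c * (ln (2 * x) - ln (4 * c)) <= c * (2 * x / (4 * c) - 1).
  by apply: ler_wpM2l => //; exact: ltW.
have -> : c * (2 * x / (4 * c) - 1) = x / 2 - c by field; rewrite gt_eqF.
move: hx c0; clear; move: (ln _) (ln _) => u v; lra.
Unshelve. all: by end_near. Qed.

(* [ev n t i w] is the event that the [i]-th of the [k = exp (x n)] points of the
   [n]-th sample, on the Gumbel scale, is at most [t]. *)
Definition gumbel_events (ev : nat -> R -> nat -> T -> bool) (x bt al : nat -> R) : Prop :=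
  [/\ x n @[n --> \oo] --> +oo, (expR (2 * x n) * al n) @[n --> \oo] --> (0 : R) /\
      (expR (x n) * bt n) @[n --> \oo] --> (0 : R),
      forall n, 0 <= al n /\ 0 <= bt n,
      \forall n \near \oo, forall t i, [/\ measurable [set w | ev n t i w],
         pr P (ev n t i) = pr P (ev n t 0%N) & `|pr P (ev n t i) - Lam t| <= bt n] &
      \forall n \near \oo, forall t, - ln (2 * x n) <= t -> forall i j, (i < j)%N ->
        `|pr P (fun w => ev n t i w && ev n t j w) - pr P (ev n t 0%N) * pr P (ev n t 0%N)| <= al n].

Lemma measurable_has (k : nat) (b : nat -> T -> bool) :
  (forall i, measurable [set w | b i w]) ->
  measurable [set w | has (fun i => b i w) (iota 0 k)].
Proof.
move=> mb; rewrite (_ : [set w | _] = \bigcup_(i in `I_k) [set w | b i w]).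
  by apply: fin_bigcup_measurable => //; exact: finite_II.
apply/seteqP; split => w /=.
  by move=> /hasP[i]; rewrite mem_iota add0n => /andP[_ ik] bi; exists i.
by move=> [i /= ik bi]; apply/hasP; exists i; rewrite // mem_iota add0n.
Qed.

Lemma union_wp (k : nat -> nat) (b : nat -> nat -> T -> bool) (e : nat -> R) :
  (\forall n \near \oo, forall i, measurable [set w | b n i w]) ->
  (\forall n \near \oo, forall i, pr P (b n i) <= e n) ->
  ((k n)%:R * e n) @[n --> \oo] --> (0 : R) ->
  wp P (fun n w => forall i, (i < k n)%N -> ~~ b n i w).
Proof.
move=> mb hb he; apply: (@wp_bound _ _ _ _ (fun n w => has (fun i => b n i w) (iota 0 (k n)))
  (fun n => (k n)%:R * e n)) => //.
- by apply: filterS mb => n mb; exact: measurable_has.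
- apply: filterS2 mb hb => n mb hb.
  have mh := measurable_has (k n) mb.
  have := @weighted_markov _ _ _ P nat (iota 0 (k n)) (fun=> 1) (b n) _ 1 ltr01 _ mb mh.
  move=> /(_ (fun=> ler01)); rewrite invr1 mul1r => h; apply: le_trans (h _) _.
    move=> w /hasP[i ik bi]; rewrite (bigD1_seq i) ?iota_uniq//= bi mulr1 lerDl.
    by apply: sumr_ge0 => j _; rewrite mul1r.
  apply: (@le_trans _ _ (\sum_(i <- iota 0 (k n)) e n)).
    by apply: ler_sum => i _; rewrite mul1r.
  by rewrite big_const_seq count_predT size_iota iter_addr addr0 mulr_natl.
- apply: nearW => n w /hasPn h i ik; apply: h; by rewrite mem_iota add0n.
Qed.

Lemma expRN_lim (c : R) (x : nat -> R) : 0 < c -> x n @[n --> \oo] --> +oo ->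
  expR (- (c * x n)) @[n --> \oo] --> (0 : R).
Proof.
move=> c0 xoo; apply: near_lim => e e0.
have := @poly_decay R 0 1 c e ler01 c0 e0 => hd.
apply: filterS (near_along xoo hd) => n; by rewrite expr0 !mul1r subr0 ger0_norm.
Qed.

Lemma Lam_tail (t : R) : 1 - Lam t <= expR (- t).
Proof. by rewrite Lam.unlock; have := expR_ge1Dx (- expR (- t)); lra. Qed.

Lemma Lam_Nln (y : R) : 0 < y -> Lam (- ln y) = expR (- y).
Proof. by move=> y0; rewrite Lam.unlock opprK lnK. Qed.

(** A point falls below the lower level with probability about [expR (- (2 * x n))] and above the
    upper one with probability at most about [expR (- ((1 + dl) * x n))]. Both are negligible
    against [expR (x n)] points, so a union bound suffices. *)
Lemma range_wp ev x bt al (k : nat -> nat) (dl : R) : gumbel_events ev x bt al -> 0 < dl ->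
  (\forall n \near \oo, (k n)%:R = expR (x n) :> R) ->
  wp P (fun n w => forall i, (i < k n)%N ->
    ~~ ev n (- ln (2 * x n)) i w /\ ev n ((1 + dl) * x n) i w).
Proof.
move=> [xoo [_ hbt] _ hev _] dl0 kx.
have x1 : \forall n \near \oo, 1 < x n by exact: near_along xoo (nbhs_pinfty_gt (num_real _)).
have lo : wp P (fun n w => forall i, (i < k n)%N -> ~~ ev n (- ln (2 * x n)) i w).
  apply: (@union_wp _ _ (fun n => expR (- (2 * x n)) + bt n)).
  - by apply: filterS hev => n h i; have [] := h (- ln (2 * x n)) i.
  - apply: filterS2 hev x1 => n h {}x1 i; have [_ _] := h (- ln (2 * x n)) i.
    rewrite Lam_Nln; first by rewrite ler_norml; move: (pr _ _) (expR _) => u v; lra.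
    by rewrite mulr_gt0// (lt_trans ltr01).
  - pose proof (lim_add (expRN_lim ltr01 xoo) hbt) as hl; rewrite addr0 in hl.
    refine (lim_eq hl _); apply: filterS kx => n ->.
    by rewrite mulrDr -expRD mul1r; congr (expR _ + _); ring.
have hi : wp P (fun n w => forall i, (i < k n)%N -> ~~ ~~ ev n ((1 + dl) * x n) i w).
  apply: (@union_wp _ _ (fun n => expR (- ((1 + dl) * x n)) + bt n)).
  - apply: filterS hev => n h i; have [mh _ _] := h ((1 + dl) * x n) i.
    rewrite (_ : [set w | _] = ~` [set w | ev n ((1 + dl) * x n) i w]); first exact: measurableC.
    by apply/seteqP; split=> w /= /negP.
  - apply: filterS hev => n h i; have [mh _] := h ((1 + dl) * x n) i.
    have -> : pr P (fun w => ~~ ev n ((1 + dl) * x n) i w) = 1 - pr P (ev n ((1 + dl) * x n) i).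
      rewrite /pr (_ : [set w | _] = ~` [set w | ev n ((1 + dl) * x n) i w]).
        by rewrite probability_setC// fineB// fin_num_measure.
      by apply/seteqP; split=> w /= /negP.
    have := Lam_tail ((1 + dl) * x n).
    by rewrite ler_norml; move: (pr _ _) (expR _) (Lam _) => u v z; lra.
  - pose proof (lim_add (expRN_lim dl0 xoo) hbt) as hl; rewrite addr0 in hl.
    refine (lim_eq hl _); apply: filterS kx => n ->.
    by rewrite mulrDr -expRD; congr (expR _ + _); ring.
apply: wp_S (wp_and lo hi) => n w [h1 h2] i ik; split; first exact: h1.
by have := h2 _ ik; rewrite negbK.
Qed.

(* The points [v] of the sample are, uniformly, within [2 L] of points [y] on the
   exact Gumbel scale of the events. *)
Definition tracks (ev : nat -> R -> nat -> T -> bool) (x : nat -> R) (k : nat -> nat)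
    (dl : R) (v : nat -> nat -> T -> R) : Prop :=
  forall L, 0 < L -> wp P (fun n w => forall i, (i < k n)%N ->
    exists y, [/\ (forall t, ev n t i w = (y <= t)), - ln (2 * x n) <= y <= (1 + dl) * x n &
      `|v n i w - y| <= 2 * L]).

End Events.

Section Arith.
Context {R : realType}.

Lemma cheb_arith (K p q al0 e a1 : R) : 0 < K -> 0 <= p -> p <= 1 -> 0 <= al0 -> 0 < e ->
  4 <= a1 * e ^+ 2 * K / 2 -> K ^+ 2 * al0 <= e ^+ 2 * a1 / 8 -> 1 <= K ->
  (K * p + K ^+ 2 * al0) / (K * (e / 2)) ^+ 2 <= a1.
Proof.
move=> K0 p0 p1 al00 e0 h1 h2 K1; rewrite ler_pdivrMr ?exprn_gt0 ?mulr_gt0 ?divr_gt0//.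
have -> : a1 * (K * (e / 2)) ^+ 2 = (a1 * e ^+ 2 * K / 2) * K / 2 by field.
have h3 : 4 * K <= a1 * e ^+ 2 * K / 2 * K by apply: ler_wpM2r => //; exact: ltW.
have a10 : 0 <= e ^+ 2 * a1.
  have : 0 < a1 * e ^+ 2 * K by clear - h1; lra.
  by rewrite pmulr_lgt0// mulrC => /ltW.
have h4 : e ^+ 2 * a1 / 8 <= a1 * e ^+ 2 * K / 2 * K / 4.
  have -> : a1 * e ^+ 2 * K / 2 * K / 4 = e ^+ 2 * a1 / 8 * (K * K) by field.
  apply: ler_peMr; first by rewrite divr_ge0.
  by rewrite -[X in X <= _](mulr1 1); apply: ler_pM.
have h5 : K * p <= K by rewrite ler_piMr// ltW.
by clear - h2 h3 h4 h5; lra.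
Qed.

Lemma geom_tail (rho D : R) (r N : nat) : 0 <= rho <= 1 -> 0 <= D ->
  \sum_(r <= j < N) D * (1 - rho) * rho ^+ j <= D * rho ^+ r.
Proof.
move=> /andP[r0 r1] D0; have [rN|Nr] := leqP r N; last first.
  by rewrite big_geq ?(ltnW Nr)// mulr_ge0// exprn_ge0.
have -> : \sum_(r <= j < N) D * (1 - rho) * rho ^+ j =
   D * \sum_(r <= j < N) (- rho ^+ j.+1 - - rho ^+ j).
  by rewrite mulr_sumr; apply: eq_bigr => j _; rewrite exprS; ring.
rewrite telescope_sumr//; apply: ler_wpM2l => //.
have := exprn_ge0 N r0; lra.
Qed.

Lemma half_arith (u K : R) : 8 < K * u -> 4 <= u * K / 2.
Proof. by lra. Qed.

End Arith.

Section Laws.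
Context {R : realType} {d : measure_display} {T : measurableType d}.
Variable P : probability T R.

Definition freq (k : nat) (b : nat -> T -> bool) (w : T) : R :=
  k%:R^-1 * \sum_(i <- iota 0 k) (b i w)%:R.

Lemma freq_ge0 k (b : nat -> T -> bool) w : 0 <= freq k b w.
Proof. by rewrite mulr_ge0 ?invr_ge0// sumr_ge0. Qed.

Lemma sub_freq k (b b' : nat -> T -> bool) w : (forall i, (i < k)%N -> b i w -> b' i w) -> freq k b w <= freq k b' w.
Proof.
move=> h; rewrite /freq ler_wpM2l ?invr_ge0// big_seq [leRHS]big_seq.
apply: ler_sum => i; rewrite mem_iota add0n => /andP[_ /h].
by case: (b i w) => [->|]// _; rewrite ler0n.
Qed.

Lemma measurable_freq k (b : nat -> T -> bool) : (forall i, measurable [set w | b i w]) ->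
  measurable_fun setT (freq k b).
Proof.
move=> mb; apply: measurable_funM => //; apply: measurable_sum => i.
exact: measurable_fun_bool_nat.
Qed.

Lemma wp_pr0 (b : nat -> T -> bool) : (\forall n \near \oo, measurable [set w | b n w]) ->
  wp P (fun n w => ~~ b n w) -> pr P (b n) @[n --> \oo] --> (0 : R).
Proof.
move=> mb [E [mE hE lE]]; apply: near_lim => e e0.
pose proof (filterI mb (lim_near lE e0)) as base.
apply: (@filterS _ _ _ _ _ _ base) => n [mbn hE1]; rewrite subr0 ger0_norm ?pr_ge0//.
have : pr P (b n) <= fine (P (~` E n)).
  apply: prob_le => //; first exact: measurableC.
  by move=> w /= bw /hE; rewrite bw.
rewrite probability_setC// fineB ?fin_num_measure//= => h1.
by move: h1 hE1; rewrite ler_norml; lra.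
Qed.

Lemma wp_limsup (b : nat -> T -> bool) (Q : nat -> T -> Prop) :
  (\forall n \near \oo, measurable [set w | b n w]) ->
  (forall e : R, 0 < e -> \forall n \near \oo, pr P (b n) <= e) ->
  (\forall n \near \oo, forall w, ~~ b n w -> Q n w) -> wp P Q.
Proof.
move=> mb hb hQ; apply: (@wp_bound _ _ _ _ b (fun n => pr P (b n))) => //.
  exact: nearW.
apply: near_lim => e /hb; apply: filterS => n h.
by rewrite subr0 ger0_norm// pr_ge0.
Qed.

Lemma measurable_lt_fun (f : T -> R) (c : R) : measurable_fun setT f ->
  measurable [set w | c < f w].
Proof.
move=> mf; rewrite (_ : [set w | _] = ~` [set w | f w <= c]); last first.
  by apply/seteqP; split=> w /=; rewrite ltNge => /negP.
by apply: measurableC; exact: measurable_le.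
Qed.

Variables (ev : nat -> R -> nat -> T -> bool) (x bt al : nat -> R) (k : nat -> nat).
Hypothesis hev : gumbel_events P ev x bt al.
Hypothesis kx : \forall n \near \oo, (k n)%:R = expR (x n) :> R.

Lemma x_gt (c : R) : \forall n \near \oo, c < x n.
Proof. by case: hev => xoo *; exact: near_along xoo (nbhs_pinfty_gt (num_real _)). Qed.

Lemma bt_small (e : R) : 0 < e -> \forall n \near \oo, expR (x n) * bt n <= e.
Proof.
case: hev => _ [_ h] _ _ _ e0; apply: filterS (lim_near h e0) => n.
by rewrite subr0; exact: le_trans (ler_norm _).
Qed.

Lemma al_small (e : R) : 0 < e -> \forall n \near \oo, expR (2 * x n) * al n <= e.
Proof.
case: hev => _ [h _] _ _ _ e0; apply: filterS (lim_near h e0) => n.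
by rewrite subr0; exact: le_trans (ler_norm _).
Qed.

(** Chebyshev's inequality around the exact probability, which is within [bt n] of [Lam t]. A fixed
    [t] eventually exceeds [- ln (2 * x n)], so the mixing bound is available. *)
Lemma event_lln (t e : R) : 0 < e ->
  wp P (fun n w => `|freq (k n) (ev n t) w - Lam t| <= e).
Proof.
move=> e0; case: (hev) => [xoo _ h0 hm hmix].
pose p n := pr P (ev n t 0%N).
apply: (@wp_limsup (fun n w => (k n)%:R * (e / 2) <
   `|\sum_(i <- iota 0 (k n)) (ev n t i w)%:R - (k n)%:R * p n|)).
- apply: filterS hm => n hm; apply: measurable_lt_fun.
  apply: measurableT_comp => //.
  apply: measurable_funB => //; apply: measurable_sum => i.
  by apply: measurable_fun_bool_nat; have [] := hm t i.
- move=> a1 a10.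
  have c1 : 0 < e ^+ 2 * a1 / 8 by rewrite divr_gt0// mulr_gt0// exprn_gt0.
  pose proof (filterI (filterI hm hmix) (filterI (filterI kx (al_small c1))
    (filterI (x_gt 0) (filterI (x_gt (8 / (a1 * e ^+ 2))) (x_gt (expR (- t))))))) as base.
  apply: (@filterS _ _ _ _ _ _ base) => n [[{}hm {}hmix] [[kn hal] [x0 [x1 xt]]]].
  have K0 : 0 < (k n)%:R :> R by rewrite kn expR_gt0.
  have K1 : 1 <= (k n)%:R :> R.
    by rewrite kn; apply: le_trans (expR_ge1Dx _); rewrite lerDl ltW.
  have [al0 _] := h0 n.
  have tl : - ln (2 * x n) <= t.
    rewrite lerNl -[X in X <= _]expRK ler_ln ?posrE ?expR_gt0 ?mulr_gt0//.
    by apply: le_trans (ltW xt) _; rewrite ler_peMl ?(ltW x0)// ler1n.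
  have pm : forall i, pr P (ev n t i) = p n by move=> i; have [_ ->] := hm t i.
  have mt : forall i, measurable [set w | ev n t i w] by move=> i; have [] := hm t i.
  have Ke : 0 < (k n)%:R * (e / 2) by rewrite mulr_gt0// divr_gt0.
  apply: le_trans (@chebyshev_count _ _ _ P (k n) (ev n t) _ (p n) (al n)
    ((k n)%:R * (e / 2)) al0 mt _ pm _ Ke _) _.
  + apply: measurable_lt_fun; apply: measurableT_comp => //.
    apply: measurable_funB => //; apply: measurable_sum => i.
    exact: measurable_fun_bool_nat.
  + by move=> i j ij; exact: hmix.
  + by move=> w /ltW.
  apply: cheb_arith => //; rewrite ?pr_ge0 ?pr_le1//.
  + have ae : 0 < a1 * e ^+ 2 by rewrite mulr_gt0// exprn_gt0.
    have : 8 / (a1 * e ^+ 2) < (k n)%:R.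
      rewrite kn; apply: lt_le_trans x1 _; apply: le_trans (expR_ge1Dx _).
      by rewrite lerDr.
    rewrite ltr_pdivrMr//; exact: half_arith.
  + by rewrite kn -expRM_natl.
have e20 : 0 < e / 2 by rewrite divr_gt0.
pose proof (filterI (filterI hm kx) (filterI (x_gt 0) (bt_small e20))) as base.
apply: (@filterS _ _ _ _ _ _ base) => n [[{}hm kn] [x0 hb]] w.
rewrite -leNgt => h.
have K0 : 0 < (k n)%:R :> R by rewrite kn expR_gt0.
have hp : `|p n - Lam t| <= e / 2.
  have [_ _ hp] := hm t 0%N; apply: le_trans hp _; apply: le_trans hb.
  have [_ b0] := h0 n; rewrite ler_peMl//.
  by apply: le_trans (expR_ge1Dx _); rewrite lerDl ltW.
have h1 : `|freq (k n) (ev n t) w - p n| <= e / 2.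
  have -> : freq (k n) (ev n t) w - p n =
     (k n)%:R^-1 * (\sum_(i <- iota 0 (k n)) (ev n t i w)%:R - (k n)%:R * p n).
    by rewrite /freq mulrBr mulKf// gt_eqF.
  by rewrite normrM ger0_norm ?invr_ge0// ler_pdivrMl.
rewrite (_ : freq _ _ _ - _ = (freq (k n) (ev n t) w - p n) + (p n - Lam t)); last by ring.
by apply: le_trans (ler_normD _ _) _; move: h1 hp; lra.
Qed.

End Laws.

(** * Weighted tails of the sample *)

Section Tails.
Context {R : realType} {d : measure_display} {T : measurableType d}.
Variable P : probability T R.

Lemma wp_forall (r : nat) (Q : nat -> nat -> T -> Prop) :
  (forall j, wp P (Q j)) -> wp P (fun n w => forall j, (j < r)%N -> Q j n w).
Proof.
move=> h; elim: r => [|r ih]; first by apply: wp_near; apply: nearW.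
apply: wp_S (wp_and ih (h r)) => n w [h1 h2] j; rewrite ltnS leq_eqVlt => /orP[/eqP ->|] //.
exact: h1.
Qed.

Lemma pr_or (b b' : T -> bool) : measurable [set w | b w] -> measurable [set w | b' w] ->
  pr P (fun w => b w || b' w) <= pr P b + pr P b'.
Proof.
move=> mb mb'; rewrite /pr.
have -> : [set w | b w || b' w] = [set w | b w] `|` [set w | b' w].
  by apply/seteqP; split=> w /= /orP.
rewrite -lee_fin EFinD !fineK ?fin_num_measure//; last exact: measurableU.
exact: measureU2.
Qed.

Lemma pr_sub (b b' : T -> bool) : measurable [set w | b w] -> measurable [set w | b' w] ->
  (forall w, b w -> b' w) -> pr P b <= pr P b'.
Proof. by move=> mb mb' h; apply: prob_le. Qed.

Lemma measurable_wfreq (k : nat) (c : nat -> R) (b : nat -> nat -> T -> bool) (r N : nat) :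
  (forall j i, measurable [set w | b j i w]) ->
  measurable_fun setT (fun w => \sum_(r <= j < N) c j * freq k (b j) w).
Proof.
move=> mb; apply: measurable_sum => j; apply: measurable_funM => //.
exact: measurable_freq.
Qed.

Lemma wfreq_markov (k : nat) (c q : nat -> R) (b : nat -> nat -> T -> bool)
    (r N : nat) (e beta : R) :
  (0 < k)%N -> 0 < e -> (forall j, 0 <= c j) ->
  (forall j i, measurable [set w | b j i w]) ->
  (forall j i, pr P (b j i) <= q j + beta) ->
  pr P (fun w => e < \sum_(r <= j < N) c j * freq k (b j) w) <=
    e^-1 * \sum_(r <= j < N) c j * (q j + beta).
Proof.
move=> k0 e0 c0 mb hb; have kr : 0 < k%:R :> R by rewrite ltr0n.
pose L := [seq (j, i) | j <- index_iota r N, i <- iota 0 k].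
have := @weighted_markov _ _ _ P _ L (fun ji => c ji.1 / k%:R) (fun ji => b ji.1 ji.2)
  (fun w => e < \sum_(r <= j < N) c j * freq k (b j) w) e e0.
move=> h; apply: le_trans (h _ _ _ _) _.
- by move=> ji; rewrite divr_ge0.
- by move=> ji; exact: mb.
- by apply: measurable_lt_fun; exact: measurable_wfreq.
- move=> w /ltW /le_trans; apply; rewrite big_allpairs /=.
  apply: ler_sum => j _; rewrite /freq mulrA mulr_sumr.
  by apply: ler_sum => i _; rewrite lexx.
apply: ler_wpM2l; first by rewrite invr_ge0 ltW.
rewrite big_allpairs /=; apply: ler_sum => j _.
apply: (@le_trans _ _ (\sum_(i <- iota 0 k) c j / k%:R * (q j + beta))).
  by apply: ler_sum => i _; apply: ler_wpM2l; rewrite ?divr_ge0.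
rewrite big_const_seq count_predT size_iota iter_addr addr0 -[X in X <= _]mulr_natr.
by rewrite le_eqVlt; apply/orP; left; apply/eqP; field; rewrite gt_eqF.
Qed.

(** Finitely many layers obey the law of large numbers; those beyond [r] have a geometrically small
    expected weight, and Markov's inequality applies. As the number [N n] of layers may grow, the
    error [bt n] is charged with their total weight. *)
Lemma weighted_tail_wp (k N : nat -> nat) (f : nat -> nat -> nat -> T -> bool)
    (c q : nat -> R) (D rho eps : R) (bt : nat -> R) :
  (forall j, 0 <= c j) -> 0 <= rho < 1 -> 0 <= D -> 0 < eps -> D <= eps / 4 ->
  (forall j, c j * q j <= D * (1 - rho) * rho ^+ j) ->
  (\forall n \near \oo, (0 < k n)%N) ->
  (\forall n \near \oo, forall j i, measurable [set w | f n j i w] /\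
     pr P (f n j i) <= q j + bt n) ->
  (forall j (e : R), 0 < e -> wp P (fun n w => freq (k n) (f n j) w <= q j + e)) ->
  (forall e : R, 0 < e -> \forall n \near \oo, bt n * \sum_(0 <= j < N n) c j <= e) ->
  (\forall n \near \oo, 0 <= bt n) ->
  wp P (fun n w => \sum_(0 <= j < N n) c j * freq (k n) (f n j) w <= eps).
Proof.
move=> c0 /andP[r0 r1] D0 eps0 De hcq hk hf hlln hbt bt0.
have rr : 0 <= rho <= 1 by rewrite r0 ltW.
have mall : \forall n \near \oo, forall r M e, measurable [set w | e <
    \sum_(r <= j < M) c j * freq (k n) (f n j) w].
  apply: filterS hf => n hf r M e; apply: measurable_lt_fun; apply: measurable_wfreq.
  by move=> j i; have [] := hf j i.
apply: (@wp_limsup _ _ _ P (fun n w => eps < \sum_(0 <= j < N n) c j * freq (k n) (f n j) w)).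
- by apply: filterS mall.
- move=> e e0; have e20 : 0 < e / 2 by rewrite divr_gt0.
  have ee0 : 0 < eps * e / 8 by rewrite divr_gt0// mulr_gt0.
  have eps20 : 0 < eps / 2 by rewrite divr_gt0.
  (* The expected weight beyond layer [r] and the total error from [bt] are at most [eps * e / 8]
     each; dividing by the threshold [eps / 2] leaves [e / 2]. *)
  have [r hr] : exists r, D * rho ^+ r <= eps * e / 8.
    have r1' : `|rho| < 1 by rewrite ger0_norm.
    have h := lim_mul (lim_cst D) (cvg_expr r1').
    have [r _ hr] := lim_near (h _ _) ee0.
    exists r; have := hr r (leqnn r); rewrite /= mulr0 subr0.
    exact: le_trans (ler_norm _).
  pose Cr := \sum_(0 <= j < r) c j.
  have Cr0 : 0 <= Cr by apply: sumr_ge0.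
  have e'0 : 0 < eps / 4 / (Cr + 1) by rewrite divr_gt0 ?divr_gt0// ltr_wpDl.
  have lln := wp_forall r (fun j => hlln j _ e'0).
  have head : wp P (fun n w => ~~ (eps / 2 < \sum_(0 <= j < r) c j * freq (k n) (f n j) w)).
    apply: wp_S lln => n w h; rewrite -leNgt.
    apply: (@le_trans _ _ (\sum_(0 <= j < r) c j * (q j + eps / 4 / (Cr + 1)))).
      by apply: ler_sum_nat => j jr; apply: ler_wpM2l => //; apply: h.
    have -> : \sum_(0 <= j < r) c j * (q j + eps / 4 / (Cr + 1)) =
      \sum_(0 <= j < r) c j * q j + Cr * (eps / 4 / (Cr + 1)).
      by rewrite mulr_suml -big_split /=; apply: eq_bigr => j _; rewrite mulrDr.
    have h1 : \sum_(0 <= j < r) c j * q j <= D.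
      apply: le_trans (ler_sum _ (fun j _ => hcq j)) _.
      by apply: le_trans (geom_tail _ _ rr D0) _; rewrite expr0 mulr1.
    have h2 : Cr * (eps / 4 / (Cr + 1)) <= eps / 4.
      have C1 : 0 < Cr + 1 by rewrite ltr_wpDl.
      rewrite mulrA ler_pdivrMr// mulrC ler_wpM2l ?lerDl//.
      by rewrite divr_ge0// ltW.
    by move: h1 h2 De; lra.
  have mh : \forall n \near \oo, measurable
     [set w | eps / 2 < \sum_(0 <= j < r) c j * freq (k n) (f n j) w].
    by apply: filterS mall.
  pose proof (lim_near (wp_pr0 mh head) e20) as hhead.
  pose proof (filterI (filterI mall hf) (filterI (filterI hk bt0) (filterI (hbt _ ee0) hhead))) as base.
  apply: (@filterS _ _ _ _ _ _ base) => n [[mn fn] [[kn btn] [hb hh]]].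
  rewrite subr0 ger0_norm ?pr_ge0// in hh.
  have tail := @wfreq_markov (k n) c q (f n) r (N n) (eps / 2) (bt n) kn eps20 c0
    (fun j i => (fn j i).1) (fun j i => (fn j i).2).
  have mor : measurable [set w | (eps / 2 < \sum_(0 <= j < r) c j * freq (k n) (f n j) w) ||
     (eps / 2 < \sum_(r <= j < N n) c j * freq (k n) (f n j) w)].
    rewrite (_ : [set w | _] = [set w | eps / 2 < \sum_(0 <= j < r) c j * freq (k n) (f n j) w]
      `|` [set w | eps / 2 < \sum_(r <= j < N n) c j * freq (k n) (f n j) w]).
      exact: measurableU.
    by apply/seteqP; split=> w /= /orP.
  apply: le_trans (pr_sub (mn _ _ _) mor _) _.
    move=> w hw; apply: contraTT hw; rewrite negb_or -!leNgt => /andP[h1 h2].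
    have [rN|Nr] := leqP r (N n).
      by rewrite (big_cat_nat (leq0n r) rN) //=; move: h1 h2; lra.
    apply: le_trans (le_trans h1 _); last by lra.
    rewrite [leRHS](big_cat_nat (leq0n (N n)) (ltnW Nr))//= lerDl.
    by apply: sumr_ge0 => j _; rewrite mulr_ge0// freq_ge0.
  apply: le_trans (pr_or (mn _ _ _) (mn _ _ _)) _.
  have h3 : \sum_(r <= j < N n) c j * (q j + bt n) <= eps * e / 8 + eps * e / 8.
    have -> : \sum_(r <= j < N n) c j * (q j + bt n) =
       \sum_(r <= j < N n) c j * q j + bt n * \sum_(r <= j < N n) c j.
      by rewrite mulr_sumr -big_split /=; apply: eq_bigr => j _; ring.
    apply: lerD.
      apply: le_trans (ler_sum _ (fun j _ => hcq j)) _.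
      exact: le_trans (geom_tail _ _ rr D0) hr.
    apply: le_trans hb; apply: ler_wpM2l => //.
    have [rN|Nr] := leqP r (N n); last by rewrite big_geq ?(ltnW Nr)// sumr_ge0.
    by rewrite [leRHS](big_cat_nat (leq0n r) rN)//= lerDr sumr_ge0.
  have h4 : (eps / 2)^-1 * (eps * e / 8 + eps * e / 8) = e / 2.
    by field; rewrite gt_eqF.
  have h5 : (eps / 2)^-1 * \sum_(r <= j < N n) c j * (q j + bt n) <= e / 2.
    by rewrite -h4; apply: ler_wpM2l => //; rewrite invr_ge0 ltW.
  by move: (le_trans tail h5) hh; lra.
- by apply: nearW => n w; rewrite -leNgt.
Qed.

End Tails.

Section TailArith.
Context {R : realType}.

(** Passes from the tail in [v] to the tail in [y]: a displacement of at most 1 costs a constant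
    factor and one unit of [V]. *)
Lemma Wt_tail (g C V v y : R) : 0 < C ->
  Wt g v <= C * (expR (kap g * v) + expR (- (pexp g * v))) ->
  0 < kap g -> 0 < pexp g -> 1 <= V -> `|v - y| <= 1 ->
  Wt g v * (1 - ind (- V) V v) <= 2 * C * (expR (kap g) + expR (pexp g)) *
    (expR (kap g * y) * (V - 1 <= y)%R%:R + expR (- (pexp g * y)) * (y <= - (V - 1))%R%:R).
Proof.
set ka := kap g; set p := pexp g => C0 hW k0 p0 V1; rewrite ler_norml => /andP[vy1 vy2].
have E0 (u : R) : 0 <= expR u by exact: expR_ge0.
have C20 : 0 <= 2 * C by rewrite mulr_ge0// ltW.
have [/andP[v1 v2]|hv] := boolP (- V < v <= V).
  rewrite /ind v1 v2 subrr mulr0; apply: mulr_ge0.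
    by apply: mulr_ge0 => //; exact: addr_ge0.
  by apply: addr_ge0; exact: mulr_ge0.
have -> : ind (- V) V v = 0 by rewrite /ind (negbTE hv).
rewrite subr0 mulr1; apply: le_trans hW _; rewrite -mulrA (mulrC 2 C) -!mulrA.
apply: ler_wpM2l; first exact: ltW.
have [Vv|vV] := ltP V v.
  have -> : (V - 1 <= y)%R = true by apply/idP; clear - Vv vy2; lra.
  have h1 : expR (- (p * v)) <= expR (ka * (y + 1)).
    rewrite ler_expR; have : 0 <= p * v by rewrite mulr_ge0 ?(ltW k0) ?(ltW p0)//; clear - Vv V1; lra.
    have : 0 <= ka * (y + 1) by rewrite mulr_ge0 ?(ltW k0) ?(ltW p0)//; clear - Vv V1 vy2; lra.
    by clear; lra.
  have h2 : expR (ka * v) <= expR (ka * (y + 1)).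
    by rewrite ler_expR ler_wpM2l ?(ltW k0)//; clear - vy2; lra.
  rewrite mulr1; apply: (@le_trans _ _ (2 * (expR ka * expR (ka * y)))).
    rewrite -expRD; have -> : ka + ka * y = ka * (y + 1) by ring.
    by clear - h1 h2; lra.
  apply: ler_wpM2l => //; apply: ler_pM => //; first by rewrite lerDl.
  by rewrite lerDl mulr_ge0.
have vn : v <= - V by move: hv; rewrite vV andbT -leNgt.
have -> : (y <= - (V - 1))%R = true by apply/idP; clear - vn vy1; lra.
have h1 : expR (ka * v) <= expR (- (p * (y - 1))).
  rewrite ler_expR; have : ka * v <= 0 by rewrite mulr_ge0_le0 ?(ltW k0) ?(ltW p0)//; clear - vn V1; lra.
  have : p * (y - 1) <= 0 by rewrite mulr_ge0_le0 ?(ltW k0) ?(ltW p0)//; clear - vn V1 vy1; lra.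
  by clear; lra.
have h2 : expR (- (p * v)) <= expR (- (p * (y - 1))).
  by rewrite ler_expR lerN2 ler_wpM2l ?(ltW p0)//; clear - vy1; lra.
rewrite mulr1; apply: (@le_trans _ _ (2 * (expR p * expR (- (p * y))))).
  rewrite -expRD; have -> : p + - (p * y) = - (p * (y - 1)) by ring.
  by clear - h1 h2; lra.
apply: ler_wpM2l => //; apply: ler_pM => //; first by rewrite lerDr.
by rewrite lerDr mulr_ge0.
Qed.

(** The unit layer that contains [y] already dominates. The event is taken one unit lower, at
    [W + j - 1], because it is a strict inequality. *)
Lemma upper_layers (ka W y X : R) : 0 < ka -> 0 <= W -> y <= X ->
  expR (ka * y) * (W <= y)%R%:R <= \sum_(0 <= j < (Num.truncn X).+1)
     expR (ka * (W + j%:R + 1)) * (~~ (y <= W + j%:R - 1)%R)%:R.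
Proof.
move=> k0 W0 yX; case: (leP W y) => [Wy|_]; last first.
  by rewrite mulr0 sumr_ge0// => j _; rewrite mulr_ge0// expR_ge0.
have t0 : 0 <= y - W by rewrite subr_ge0.
have /andP[j1 j2] := truncn_itv t0; set j := Num.truncn (y - W) in j1 j2.
have jX : (j < (Num.truncn X).+1)%N.
  rewrite ltnS; apply: le_truncn; clear - W0 yX; lra.
rewrite -natr1 in j2; rewrite mulr1.
rewrite (bigD1_seq j) ?iota_uniq ?mem_index_iota//=.
have -> : (~~ (y <= W + j%:R - 1)%R)%:R = 1 :> R by rewrite -ltNge; have -> : W + j%:R - 1 < y by clear - j1; lra.
rewrite mulr1; apply: (@le_trans _ _ (expR (ka * (W + j%:R + 1)))).
  by rewrite ler_expR ler_wpM2l ?(ltW k0)//; clear - j2; lra.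
by rewrite lerDl sumr_ge0// => i _; rewrite mulr_ge0// expR_ge0.
Qed.

Lemma lower_layers (p W y X : R) : 0 < p -> 0 <= W -> - X <= y ->
  expR (- (p * y)) * (y <= - W)%R%:R <= \sum_(0 <= j < (Num.truncn X).+1)
     expR (p * (W + j%:R + 1)) * (y <= - (W + j%:R))%R%:R.
Proof.
move=> p0 W0 yX; case: (leP y (- W)) => [Wy|_]; last first.
  by rewrite mulr0 sumr_ge0// => j _; rewrite mulr_ge0// expR_ge0.
have t0 : 0 <= - y - W by clear - Wy; lra.
have /andP[j1 j2] := truncn_itv t0; set j := Num.truncn (- y - W) in j1 j2.
have jX : (j < (Num.truncn X).+1)%N.
  rewrite ltnS; apply: le_truncn; clear - W0 yX; lra.
rewrite -natr1 in j2; rewrite mulr1.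
rewrite (bigD1_seq j) ?iota_uniq ?mem_index_iota//=.
have -> : (y <= - (W + j%:R))%R = true by apply/idP; clear - j1; lra.
rewrite mulr1; apply: (@le_trans _ _ (expR (p * (W + j%:R + 1)))).
  by rewrite ler_expR -mulrN ler_wpM2l ?(ltW p0)//; clear - j2; lra.
by rewrite lerDl sumr_ge0// => i _; rewrite mulr_ge0// expR_ge0.
Qed.

(** [Lam (- t) = expR (- expR t)] decays faster than every power of [expR t]. *)
Lemma Lam_superexp (p : R) : 0 < p -> exists2 C, 0 < C & forall t, 0 <= t ->
  expR (p * (t + 1)) * Lam (- t) <= C * expR (- t).
Proof.
move=> p0; pose n := (Num.truncn (p + 1)).+1.
have np : p + 1 <= n%:R by apply: ltW; exact: truncnS_gt.
exists (expR p * n%:R ^+ n); first by rewrite mulr_gt0 ?expR_gt0// exprn_gt0// ltr0n.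
move=> t t0; rewrite Lam.unlock opprK.
have := @poly_exp R n 1 (expR t) isT; rewrite ltr01 lexx expR_ge0 divr1 mul1r => /(_ isT isT) h.
have h1 : expR ((p + 1) * t) <= expR (expR t) * n%:R ^+ n.
  apply: (@le_trans _ _ ((1 + expR t) ^+ n)); last by rewrite mulrC.
  apply: (@le_trans _ _ (expR t ^+ n)).
    by rewrite -expRM_natl ler_expR ler_wpM2r.
  by apply: lerXn2r; rewrite ?nnegrE ?addr_ge0 ?expR_ge0// lerDr.
have -> : p * (t + 1) = (p + 1) * t + p - t by ring.
rewrite expRN mulrC ler_pdivrMl ?expR_gt0//.
rewrite !expRD -[X in X <= _]mulrA.
rewrite [X in _ <= X](_ : _ = expR (expR t) * n%:R ^+ n * (expR p * expR (- t))); last by ring.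
by apply: ler_wpM2r => //; rewrite mulr_ge0 ?expR_ge0.
Qed.

End TailArith.

Section LayerCounts.
Context {R : realType}.

(* The number of unit layers is at most linear in [x], and [bt] beats [exp (- x)],
   so the total weight of the layers times the error [bt] vanishes. *)
Lemma upper_weight (ka W dl : R) : 0 < ka -> (1 + dl) * ka < 1 -> 0 < dl -> 0 <= W ->
  \forall x \near +oo, \sum_(0 <= j < (Num.truncn ((1 + dl) * x)).+1)
     expR (ka * (W + j%:R + 1)) <= expR x.
Proof.
move=> k0 k1 dl0 W0; have d0 : 0 < 1 - (1 + dl) * ka by rewrite subr_gt0.
have c0 : 0 <= expR (ka * (W + 1)) * (1 + dl) by rewrite mulr_ge0 ?expR_ge0// addr_ge0// ltW.
near=> x.
have x0 : 0 < x by near: x; exact: nbhs_pinfty_gt.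
have hd : expR (ka * (W + 1)) * (1 + dl) * (1 + x) ^+ 1 * expR (- ((1 - (1 + dl) * ka) * x)) <= 1.
  by near: x; exact: poly_decay.
have X0 : 0 <= (1 + dl) * x by rewrite mulr_ge0 ?ltW// addr_gt0.
set N := Num.truncn _; have /andP[N1 _] := truncn_itv X0; rewrite -/N in N1.
apply: (@le_trans _ _ (\sum_(0 <= j < N.+1) expR (ka * (W + 1) + ka * ((1 + dl) * x)))).
  apply: ler_sum_nat => j /andP[_ jN]; rewrite ler_expR.
  have : ka * j%:R <= ka * ((1 + dl) * x).
    by apply: ler_wpM2l; [exact: ltW|apply: le_trans N1; rewrite ler_nat -ltnS].
  by clear; lra.
rewrite sumr_const_nat subn0 -[X in X <= _]mulr_natl expRD.
have N2 : N.+1%:R <= (1 + dl) * (1 + x) by rewrite -natr1; clear - N1 dl0; lra.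
have -> : ka * ((1 + dl) * x) = x - (1 - (1 + dl) * ka) * x by ring.
rewrite expRD.
apply: (@le_trans _ _ ((1 + dl) * (1 + x) *
   (expR (ka * (W + 1)) * (expR x * expR (- ((1 - (1 + dl) * ka) * x)))))).
  by apply: ler_wpM2r => //; rewrite !mulr_ge0 ?expR_ge0.
move: hd; rewrite expr1; move: (expR (ka * (W + 1))) (expR (- _)) => a b hd.
rewrite [X in X <= _](_ : _ = a * (1 + dl) * (1 + x) * b * expR x); last by ring.
by rewrite -[X in _ <= X]mul1r; apply: ler_wpM2r => //; exact: expR_ge0.
Unshelve. all: by end_near. Qed.

(** Only about [ln (2 * x)] layers occur on this side, so their total weight is bounded by a power
    of [x]. *)
Lemma lower_weight (p W : R) : 0 < p -> 0 <= W ->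
  \forall x \near +oo, \sum_(0 <= j < (Num.truncn (ln (2 * x))).+1)
     expR (p * (W + j%:R + 1)) <= expR x.
Proof.
move=> p0 W0; pose n := (Num.truncn p).+1.
have np : p <= n%:R by apply: ltW; exact: truncnS_gt.
have c0 : 0 <= expR (p * (W + 1)) * 2 ^+ n.+1 by rewrite mulr_ge0 ?expR_ge0// exprn_ge0.
near=> x.
have x1 : 1 < x by near: x; exact: nbhs_pinfty_gt.
have hd : expR (p * (W + 1)) * 2 ^+ n.+1 * (1 + x) ^+ n.+1 * expR (- (1 * x)) <= 1.
  by near: x; exact: poly_decay.
have x20 : 1 <= 2 * x by clear - x1; lra.
have X0 : 0 <= ln (2 * x) by exact: ln_ge0.
set N := Num.truncn _; have /andP[N1 _] := truncn_itv X0; rewrite -/N in N1.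
apply: (@le_trans _ _ (\sum_(0 <= j < N.+1) expR (p * (W + 1) + p * ln (2 * x)))).
  apply: ler_sum_nat => j /andP[_ jN]; rewrite ler_expR.
  have : p * j%:R <= p * ln (2 * x).
    by apply: ler_wpM2l; [exact: ltW|apply: le_trans N1; rewrite ler_nat -ltnS].
  by clear; lra.
rewrite sumr_const_nat subn0 -[X in X <= _]mulr_natl expRD.
have l2 : ln (2 * x) <= 2 * x - 1 by apply: ln_le_sub1; clear - x1; lra.
have N2 : N.+1%:R <= 2 * (1 + x) by rewrite -natr1; clear - N1 l2; lra.
have h2 : expR (p * ln (2 * x)) <= (2 * (1 + x)) ^+ n.
  apply: (@le_trans _ _ (expR (n%:R * ln (2 * x)))); first by rewrite ler_expR ler_wpM2r.
  rewrite expRM_natl lnK ?posrE; last by clear - x1; lra.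
  by apply: lerXn2r; rewrite ?nnegrE; clear - x1; lra.
apply: (@le_trans _ _ (2 * (1 + x) * (expR (p * (W + 1)) * (2 * (1 + x)) ^+ n))).
  by apply: ler_pM => //; rewrite ?mulr_ge0 ?expR_ge0// ler_wpM2l// expR_ge0.
move: hd; rewrite mul1r expRN ler_pdivrMr ?expR_gt0// mul1r => hd; apply: le_trans hd.
rewrite exprMn !exprS le_eqVlt; apply/orP; left; apply/eqP; ring.
Unshelve. all: by end_near. Qed.

End LayerCounts.

(** * The random samples as a filter *)

Section Sample.
Context {R : realType} {d : measure_display} {T : measurableType d}.
Variable P : probability T R.

Definition samp (v : nat -> nat -> T -> R) (k : nat -> nat) (n : nat) (w : T) : seq R :=
  [seq v n i w | i <- iota 0 (k n)].

Definition sampF (v : nat -> nat -> T -> R) (k : nat -> nat) : set_system (seq R) :=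
  [set S | wp P (fun n w => S (samp v k n w))].

Lemma sampF_filter v k : Filter (sampF v k).
Proof.
split.
- by apply: wp_near; exact: nearW.
- by move=> S S' h h'; exact: wp_and.
- by move=> S S' SS' h; apply: wp_S h => n w; exact: SS'.
Qed.

Lemma avg_samp v k f n w :
  avg (samp v k n w) f = (k n)%:R^-1 * \sum_(i <- iota 0 (k n)) f (v n i w).
Proof. by rewrite /avg /samp size_map size_iota big_map. Qed.

Lemma freqN k (b : nat -> T -> bool) w : (0 < k)%N ->
  freq k (fun i w => ~~ b i w) w = 1 - freq k b w :> R.
Proof.
move=> k0; rewrite /freq; have kn0 : k%:R != 0 :> R by rewrite gt_eqF// ltr0n.
have -> : \sum_(i <- iota 0 k) (~~ b i w)%:R = \sum_(i <- iota 0 k) (1 - (b i w)%:R) :> R.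
  by apply: eq_bigr => i _; case: (b i w); rewrite ?subrr ?subr0.
rewrite sumrB mulrBr; congr (_ - _).
by rewrite big_const_seq count_predT size_iota iter_addr addr0 mulVf.
Qed.

Lemma prN (b : T -> bool) : measurable [set w | b w] ->
  measurable [set w | ~~ b w] /\ pr P (fun w => ~~ b w) = 1 - pr P b.
Proof.
move=> mb; have e : [set w | ~~ b w] = ~` [set w | b w].
  by apply/seteqP; split=> w /= /negP.
split; first by rewrite e; exact: measurableC.
by rewrite /pr e probability_setC// fineB// fin_num_measure.
Qed.

Variables (ev : nat -> R -> nat -> T -> bool) (x bt al : nat -> R) (k : nat -> nat).
Variables (dl : R) (v : nat -> nat -> T -> R).
Hypothesis hev : gumbel_events P ev x bt al.
Hypothesis kx : \forall n \near \oo, (k n)%:R = expR (x n) :> R.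
Hypothesis htr : tracks P ev x k dl v.

Lemma k_gt0 : \forall n \near \oo, (0 < k n)%N.
Proof. by apply: filterS kx => n h; rewrite -(ltr0n R) h expR_gt0. Qed.

(** Tracking within [2 * L = e / 2] squeezes the empirical distribution function at [t] between
    event frequencies at [t - e / 2] and [t + e / 2], and [Lam] has Lipschitz constant 1. *)
Lemma samp_gumbel : gumbel_ecdf (sampF v k).
Proof.
move=> t e e0; have L0 : 0 < e / 4 by rewrite divr_gt0.
have e20 : 0 < e / 2 by rewrite divr_gt0.
have l1 := event_lln hev kx (t + 2 * (e / 4)) e20.
have l2 := event_lln hev kx (t - 2 * (e / 4)) e20.
rewrite /prop_near1 /nbhs /=.
apply: wp_S (wp_and (htr L0) (wp_and l1 l2)) => n w [h [h1 h2]].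
rewrite /= /ecdf avg_samp.
have u1 : freq (k n) (fun i w => (v n i w <= t)%R) w <= freq (k n) (ev n (t + 2 * (e / 4))) w :> R.
  apply: (@sub_freq R d T) => i ik vt; have [y [-> _]] := h i ik.
  by move: vt; rewrite ler_norml; lra.
have u2 : freq (k n) (ev n (t - 2 * (e / 4))) w <= freq (k n) (fun i w => (v n i w <= t)%R) w :> R.
  apply: (@sub_freq R d T) => i ik; have [y [-> _]] := h i ik.
  by rewrite ler_norml; lra.
have h3 : Lam (t + 2 * (e / 4)) - Lam t <= t + 2 * (e / 4) - t by apply: Lam_lip; lra.
have h4 : Lam t - Lam (t - 2 * (e / 4)) <= t - (t - 2 * (e / 4)) by apply: Lam_lip; lra.
move: u1 u2 h1 h2 h3 h4; rewrite /freq !ler_norml; lra.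
Qed.

(** On the upper side the layer at [W + j] weighs about [expR (ka * (W + j))] and has probability of
    order [expR (- (W + j))], so the layers decay with ratio [rho = expR (- (1 - ka))]. On the lower
    side the probabilities are doubly exponentially small. [(1 + dl) * kap g < 1] keeps the total
    weight of the upper layers below [expR (x n)]. *)
Lemma samp_tails g : -2^-1 < g -> 0 < dl -> (1 + dl) * kap g < 1 ->
  small_tails g (sampF v k).
Proof.
move=> g0 dl0 hdl eps eps0; have /andP[ka0 ka1] := kap_bounds g0.
have p0 : 0 < pexp g by rewrite /pexp ltr_wpDl// mulr_ge0.
have [C C0 hC] := Wt_dom g0; have [Cp Cp0 hCp] := Lam_superexp p0.
set ka := kap g in ka0 ka1 hdl; set p := pexp g in p0 hCp.
pose C' := 2 * C * (expR ka + expR p).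
have C'0 : 0 < C' by rewrite !mulr_gt0// addr_gt0 ?expR_gt0.
pose rho := expR (- (1 - ka)).
have rho0 : 0 <= rho by exact: expR_ge0.
have rho1 : rho < 1 by rewrite expR_lt1 oppr_lt0 subr_gt0.
pose D0 := (expR (ka + 1) + Cp) / (1 - rho).
have D00 : 0 < D0 by rewrite divr_gt0 ?subr_gt0// addr_gt0 ?expR_gt0.
pose eps' := eps / (2 * C').
have eps'0 : 0 < eps' by rewrite divr_gt0// mulr_gt0.
have ka1' : 0 < 1 - ka by rewrite subr_gt0.
(* Makes [D], which bounds the expected weight beyond [V], at most [eps' / 4]. *)
exists (1 + 4 * D0 / eps' / (1 - ka)) => V hV.
have q0 : 0 <= 4 * D0 / eps' / (1 - ka) by rewrite ltW// !divr_gt0// mulr_gt0.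
pose W := V - 1.
have hW : 4 * D0 / eps' / (1 - ka) <= W by rewrite /W lerBrDl.
have W0 : 0 <= W by exact: le_trans hW.
have V1 : 1 <= V by rewrite -subr_ge0.
pose D := D0 * expR (- ((1 - ka) * W)).
have D_ge0 : 0 <= D by rewrite mulr_ge0 ?expR_ge0// ltW.
have De : D <= eps' / 4.
  rewrite /D expRN ler_pdivrMr ?expR_gt0//.
  have h1 : (1 - ka) * W <= expR ((1 - ka) * W).
    by apply: le_trans (expR_ge1Dx _); rewrite lerDr.
  rewrite ler_pdivrMr// (mulrC W) in hW.
  have h2 : eps' / 4 * (4 * D0 / eps') <= eps' / 4 * expR ((1 - ka) * W).
    apply: ler_wpM2l; first by rewrite divr_ge0// ltW.
    exact: le_trans hW h1.
  by apply: le_trans h2; rewrite le_eqVlt; apply/orP; left; apply/eqP; field; rewrite gt_eqF.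
have rr : 0 <= rho < 1 by rewrite rho0.
have D1 j : D * (1 - rho) * rho ^+ j = (expR (ka + 1) + Cp) * expR (- ((1 - ka) * (W + j%:R))).
  have -> : rho ^+ j = expR (j%:R * - (1 - ka)) by rewrite /rho -expRM_natl.
  rewrite /D /D0.
  have -> : - ((1 - ka) * (W + j%:R)) = - ((1 - ka) * W) + j%:R * - (1 - ka) by ring.
  by rewrite (expRD (- _)); field; rewrite gt_eqF// subr_gt0.
have [xoo _ h0 hm _] := hev.
have bt0 : \forall n \near \oo, 0 <= bt n by apply: nearW => n; have [] := h0 n.
have hbt c (N : nat -> nat) :
    (\forall n \near \oo, \sum_(0 <= j < N n) c j <= expR (x n)) ->
    forall e : R, 0 < e -> \forall n \near \oo, bt n * \sum_(0 <= j < N n) c j <= e.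
  move=> hN e e0; pose proof (filterI hN (filterI bt0 (bt_small hev e0))) as base.
  apply: (@filterS _ _ _ _ _ _ base) => n [h1 [h2 h3]].
  by apply: le_trans h3; rewrite mulrC; apply: ler_wpM2r.
pose N1 n := (Num.truncn ((1 + dl) * x n)).+1.
pose N2 n := (Num.truncn (ln (2 * x n))).+1.
have up : wp P (fun n w => \sum_(0 <= j < N1 n) expR (ka * (W + j%:R + 1)) *
    freq (k n) (fun i w => ~~ ev n (W + j%:R - 1) i w) w <= eps').
  apply: (@weighted_tail_wp _ _ _ P k N1 (fun n j i w => ~~ ev n (W + j%:R - 1) i w)
    (fun j => expR (ka * (W + j%:R + 1))) (fun j => 1 - Lam (W + j%:R - 1)) D rho eps' bt) => //.
  - move=> j; rewrite D1.
    apply: (@le_trans _ _ (expR (ka * (W + j%:R + 1)) * expR (- (W + j%:R - 1)))).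
      by apply: ler_wpM2l; [exact: expR_ge0|exact: Lam_tail].
    rewrite -expRD (mulrDl (expR _)) -expRD.
    have -> : ka * (W + j%:R + 1) + - (W + j%:R - 1) = ka + 1 + - ((1 - ka) * (W + j%:R)) by ring.
    by rewrite lerDl mulr_ge0 ?expR_ge0// ltW.
  - exact: k_gt0.
  - apply: filterS hm => n hm j i; have [m1 _ m2] := hm (W + j%:R - 1) i.
    have [m3 ->] := prN m1; split => //.
    by move: m2; rewrite ler_norml; lra.
  - move=> j e e0; apply: wp_S (wp_and (event_lln hev kx (W + j%:R - 1) e0) (wp_near P _)); last first.
      by apply: filterS k_gt0 => n h w; exact: h.
    move=> n w [h kn]; rewrite freqN//.
    by move: h; rewrite ler_norml; lra.
  - apply: hbt; exact: near_along xoo (upper_weight ka0 hdl dl0 W0).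
have lo : wp P (fun n w => \sum_(0 <= j < N2 n) expR (p * (W + j%:R + 1)) *
    freq (k n) (ev n (- (W + j%:R))) w <= eps').
  apply: (@weighted_tail_wp _ _ _ P k N2 (fun n j i w => ev n (- (W + j%:R)) i w)
    (fun j => expR (p * (W + j%:R + 1))) (fun j => Lam (- (W + j%:R))) D rho eps' bt) => //.
  - move=> j; rewrite D1.
    have Wj : 0 <= W + j%:R by rewrite addr_ge0.
    apply: le_trans (hCp _ Wj) _; apply: ler_pM; rewrite ?expR_ge0 ?(ltW Cp0)//.
      by rewrite lerDr expR_ge0.
    rewrite ler_expR lerN2 mulrBl mul1r gerBl; apply: mulr_ge0 => //; exact: ltW.
  - exact: k_gt0.
  - apply: filterS hm => n hm j i; have [m1 _ m2] := hm (- (W + j%:R)) i.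
    by split => //; move: m2; rewrite ler_norml; lra.
  - move=> j e e0; apply: wp_S (event_lln hev kx (- (W + j%:R)) e0) => n w.
    by rewrite ler_norml; lra.
  - apply: hbt; exact: near_along xoo (lower_weight p0 W0).
have h20 : 0 < (2 : R)^-1 by rewrite invr_gt0.
rewrite /prop_near1 /nbhs /=.
apply: wp_S (wp_and (htr h20) (wp_and up lo)) => n w [htrk [{}up {}lo]].
rewrite /= avg_samp.
pose S1 := \sum_(0 <= j < N1 n) expR (ka * (W + j%:R + 1)) *
    freq (k n) (fun i w => ~~ ev n (W + j%:R - 1) i w) w.
pose S2 := \sum_(0 <= j < N2 n) expR (p * (W + j%:R + 1)) * freq (k n) (ev n (- (W + j%:R))) w.
apply: (@le_trans _ _ (C' * (S1 + S2))); last first.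
  apply: (@le_trans _ _ (C' * (eps' + eps'))).
    by apply: ler_wpM2l; [exact: ltW|exact: lerD].
  by rewrite le_eqVlt; apply/orP; left; apply/eqP; rewrite /eps'; field; rewrite gt_eqF.
pose s1 i := \sum_(0 <= j < N1 n) expR (ka * (W + j%:R + 1)) * (~~ ev n (W + j%:R - 1) i w)%:R.
pose s2 i := \sum_(0 <= j < N2 n) expR (p * (W + j%:R + 1)) * (ev n (- (W + j%:R)) i w)%:R.
have -> : C' * (S1 + S2) = (k n)%:R^-1 * \sum_(i <- iota 0 (k n)) C' * (s1 i + s2 i).
  have swap (c : nat -> R) (b : nat -> nat -> bool) N :
      \sum_(0 <= j < N) c j * ((k n)%:R^-1 * \sum_(i <- iota 0 (k n)) (b j i)%:R) =
      (k n)%:R^-1 * \sum_(i <- iota 0 (k n)) \sum_(0 <= j < N) c j * (b j i)%:R.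
    rewrite exchange_big mulr_sumr; apply: eq_bigr => j _ /=.
    by rewrite -mulr_sumr; ring.
  by rewrite -mulr_sumr big_split /= /S1 /S2 /freq !swap; ring.
apply: ler_wpM2l; first by rewrite invr_ge0.
rewrite big_seq [leRHS]big_seq; apply: ler_sum => i; rewrite mem_iota add0n => /andP[_ ik].
have [y [hy /andP[y1 y2] hvy]] := htrk i ik.
rewrite mulfV ?pnatr_eq0// in hvy.
apply: le_trans (Wt_tail C0 (hC (v n i w)) ka0 p0 V1 hvy) _.
apply: ler_wpM2l; first exact: ltW.
apply: lerD.
  rewrite /s1; under [leRHS]eq_bigr do rewrite hy.
  exact: upper_layers.
rewrite /s2; under [leRHS]eq_bigr do rewrite hy.
exact: lower_layers.
Qed.

End Sample.

Section Arith.
Context {R : realType}.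

Lemma shape_count (a qa q x g K : R) : 1 <= x -> q <= a -> 0 <= a -> a <= 1 -> K = expR x ->
  expR (- (qa * x)) * (2 * expR (a * x) * (2 + x)) <= 2^-1 ->
  1 <= g -> g < powR K q ->
  expR (- (qa * x)) * ((1 + g) * (1 + ln (1 + g))) <= 2^-1.
Proof.
move=> x1 qa' a0 a1 KE hs g1 gK; apply: le_trans hs; apply: ler_wpM2l; first exact: expR_ge0.
have gE : g <= expR (a * x).
  apply: le_trans (ltW gK) _; rewrite /powR KE gt_eqF ?expR_gt0// expRK ler_expR.
  by apply: ler_wpM2r => //; apply: le_trans x1.
have x0 : 0 <= x by apply: le_trans x1.
have E1 : 1 <= expR (a * x) by rewrite -[X in X <= _]expR0 ler_expR mulr_ge0.
have h1 : 1 + g <= 2 * expR (a * x) by clear - gE E1; lra.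
have g2 : 0 < 1 + g by clear - g1; lra.
have l2 : ln 2 <= 1 :> R by have := @ln_le_sub1 R 2; rewrite ltr0n => /(_ isT); lra.
have h2 : ln (1 + g) <= 1 + x.
  apply: (@le_trans _ _ (ln (2 * expR (a * x)))).
    by rewrite ler_ln ?posrE// mulr_gt0// expR_gt0.
  rewrite lnM ?posrE ?expR_gt0// expRK; apply: lerD => //.
  by rewrite ler_piMl.
apply: ler_pM => //; first exact: ltW.
  by rewrite addr_ge0// ln_ge0//; clear - g1; lra.
by clear - h2; lra.
Qed.

Lemma cheb_exist (K p al qc x e : R) : K = expR x -> 0 < e -> 
  expR (- (qc * x)) / 2 <= p -> p <= 1 -> 0 <= al -> qc <= 1 -> 0 <= x ->
  2 * expR (- ((1 - qc) * x)) <= e / 2 -> expR (2 * x) * al <= e / 8 ->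
  (K * p + K ^+ 2 * al) / (K * p) ^+ 2 <= e.
Proof.
move=> KE e0 hp p1 al0 q1 x0 h1 h2.
have K0 : 0 < K by rewrite KE expR_gt0.
have p0 : 0 < p by apply: lt_le_trans hp; rewrite divr_gt0 ?expR_gt0.
have -> : (K * p + K ^+ 2 * al) / (K * p) ^+ 2 = (K * p)^-1 + al / p ^+ 2.
  by field; rewrite !gt_eqF.
have h3 : (K * p)^-1 <= e / 2.
  apply: le_trans h1; rewrite KE -[X in _ <= X]invrK lef_pV2 ?posrE ?mulr_gt0 ?expR_gt0 ?invr_gt0//.
    rewrite invfM -expRN opprK.
    apply: (@le_trans _ _ (expR x * (expR (- (qc * x)) / 2))); last first.
      by rewrite ler_wpM2l ?expR_ge0.
    rewrite mulrA -expRD mulrC le_eqVlt; apply/orP; left; apply/eqP; congr (expR _ / _); ring.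
  by rewrite mulr_gt0 ?expR_gt0.
have h4 : al / p ^+ 2 <= e / 2.
  rewrite ler_pdivrMr ?exprn_gt0//.
  have h5 : (expR (- (qc * x)) / 2) ^+ 2 <= p ^+ 2.
    by apply: lerXn2r; rewrite ?nnegrE ?(ltW p0)// divr_ge0 ?expR_ge0.
  have h6 : expR (- (2 * x)) <= expR (- (qc * x)) ^+ 2.
    rewrite -expRM_natl ler_expR; have : qc * x <= x by rewrite ler_piMl.
    by clear; lra.
  have h7 : al <= e / 8 * expR (- (2 * x)).
    by rewrite expRN ler_pdivlMr ?expR_gt0// mulrC.
  apply: le_trans h7 _.
  apply: (@le_trans _ _ (e / 8 * expR (- (qc * x)) ^+ 2)).
    by apply: ler_wpM2l => //; rewrite divr_ge0// ltW.
  have -> : e / 8 * expR (- (qc * x)) ^+ 2 = e / 2 * (expR (- (qc * x)) / 2) ^+ 2 by field.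
  by apply: ler_wpM2l => //; rewrite divr_ge0// ltW.
by clear - h3 h4; lra.
Qed.

End Arith.

(** * Points near the sample minimum *)

Section Minimum.
Context {R : realType} {d : measure_display} {T : measurableType d}.
Variable P : probability T R.
Variables (ev : nat -> R -> nat -> T -> bool) (x bt al : nat -> R) (k : nat -> nat).
Variables (dl : R) (v : nat -> nat -> T -> R).
Hypothesis hev : gumbel_events P ev x bt al.
Hypothesis kx : \forall n \near \oo, (k n)%:R = expR (x n) :> R.
Hypothesis htr : tracks P ev x k dl v.

(** The level has Gumbel probability [expR (- (qb * x n))], so Markov's inequality leaves the
    vanishing factor [expR (- ((qb - qa) * x n))]. *)
Lemma low_count_wp (qa qb : R) : 0 < qb -> qa < qb -> qb < 1 ->
  wp P (fun n w => freq (k n) (ev n (- ln (qb * x n))) w <= expR (- (qa * x n))).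
Proof.
move=> qb0 qab qb1; have [xoo _ h0 hm _] := hev.
have qd : 0 < qb - qa by rewrite subr_gt0.
apply: (@wp_limsup _ _ _ P (fun n w => expR (- (qa * x n)) <
   \sum_(0 <= j < 1) 1 * freq (k n) (ev n (- ln (qb * x n))) w)).
- apply: filterS hm => n hm; apply: measurable_lt_fun.
  by apply: (@measurable_wfreq _ _ _ (k n) (fun=> 1) (fun _ => ev n _)) => _ i; have [] := hm (- ln (qb * x n)) i.
- move=> e e0; have e20 : 0 < e / 2 by rewrite divr_gt0.
  pose proof (lim_near (expRN_lim qd xoo) e20) as hl.
  pose proof (filterI (filterI hm hl) (filterI (filterI (k_gt0 kx) (bt_small hev e20)) (x_gt hev 0))) as base.
  apply: (@filterS _ _ _ _ _ _ base) => n [[{}hm {}hl] [[k0 hb] x0]].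
  rewrite subr0 ger0_norm ?expR_ge0// in hl.
  apply: le_trans (@wfreq_markov _ _ _ P (k n) (fun=> 1) (fun=> expR (- (qb * x n)))
    (fun _ => ev n (- ln (qb * x n))) 0 1 _ (bt n) k0 (expR_gt0 _) (fun=> ler01) _ _) _.
  + by move=> _ i; have [] := hm (- ln (qb * x n)) i.
  + move=> _ i; have [_ _] := hm (- ln (qb * x n)) i.
    rewrite Lam_Nln ?mulr_gt0//.
    by rewrite ler_norml; move: (pr _ _) (expR _) => a b; lra.
  rewrite big_nat1 mul1r -expRN opprK mulrDr -expRD.
  have -> : qa * x n + - (qb * x n) = - ((qb - qa) * x n) by ring.
  have [_ b0] := h0 n.
  have h1 : expR (qa * x n) * bt n <= expR (x n) * bt n.
    apply: ler_wpM2r => //; rewrite ler_expR ler_piMl ?ltW//.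
    exact: lt_trans qab qb1.
  by move: h1 hl hb; lra.
- by apply: nearW => n w; rewrite -leNgt big_nat1 mul1r.
Qed.

(** The expected number of points is about [expR ((1 - qc) * x n)], which tends to infinity;
    Chebyshev's inequality then excludes a zero count. *)
Lemma exist_low_wp (qc : R) : 0 < qc -> qc < 1 ->
  wp P (fun n w => exists2 i, (i < k n)%N & ev n (- ln (qc * x n)) i w).
Proof.
move=> q0 q1; have [xoo _ h0 hm hmix] := hev.
have qd : 0 < 1 - qc by rewrite subr_gt0.
pose t n := - ln (qc * x n).
apply: (@wp_limsup _ _ _ P (fun n w => ~~ has (fun i => ev n (t n) i w) (iota 0 (k n)))).
- apply: filterS hm => n hm; apply: (prN P (measurable_has (k n) _)).1 => i.
  by have [] := hm (t n) i.
- move=> e e0; have e80 : 0 < e / 8 by rewrite divr_gt0.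
  have e40 : 0 < e / 4 by rewrite divr_gt0.
  have h20 : 0 < (2 : R)^-1 by rewrite invr_gt0.
  pose proof (lim_near (expRN_lim qd xoo) e40) as hl.
  pose proof (filterI (filterI (filterI hm hmix) hl) (filterI (filterI kx (bt_small hev h20))
    (filterI (x_gt hev 0) (al_small hev e80)))) as base.
  apply: (@filterS _ _ _ _ _ _ base) => n [[[{}hm {}hmix] {}hl] [[kn hb] [x0 hal]]].
  rewrite subr0 ger0_norm ?expR_ge0// in hl.
  have [al0 b0] := h0 n.
  pose p := pr P (ev n (t n) 0%N).
  have pm i : pr P (ev n (t n) i) = p by have [_ ->] := hm (t n) i.
  have mt i : measurable [set w | ev n (t n) i w] by have [] := hm (t n) i.
  have hp : expR (- (qc * x n)) / 2 <= p.
    have [_ _] := hm (t n) 0%N; rewrite /t Lam_Nln ?mulr_gt0// -/(t n) -/p.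
    have : bt n <= expR (- (qc * x n)) / 2.
      rewrite expRN ler_pdivlMl ?expR_gt0//; apply: le_trans hb.
      by apply: ler_wpM2r => //; rewrite ler_expR ler_piMl ?ltW.
    by rewrite ler_norml; move: (expR _) => a; lra.
  have p0 : 0 < p by apply: lt_le_trans hp; rewrite divr_gt0 ?expR_gt0.
  have K0 : 0 < (k n)%:R :> R by rewrite kn expR_gt0.
  have tl : - ln (2 * x n) <= t n.
    rewrite lerN2 ler_ln ?posrE ?mulr_gt0//; apply: ler_wpM2r; first exact: ltW.
    by apply: le_trans (ltW q1) _; rewrite ler1n.
  apply: le_trans (@chebyshev_count _ _ _ P (k n) (ev n (t n)) _ p (al n) ((k n)%:R * p)
    al0 mt _ pm _ _ _) _.
  + by apply: (prN P _).1; exact: measurable_has.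
  + by move=> i j ij; exact: hmix.
  + exact: mulr_gt0.
  + move=> w /hasPn hw; rewrite big_seq big1; last by move=> i /hw /negbTE ->.
    by rewrite sub0r normrN ger0_norm// ltW// mulr_gt0.
  apply: (@cheb_exist _ _ _ _ qc (x n)) => //.
  + by apply: pr_le1; exact: mt.
  + exact: ltW.
  + exact: ltW.
  by move: hl; lra.
- apply: nearW => n w; rewrite negbK => /hasP[i]; rewrite mem_iota add0n => /andP[_ ik] h.
  by exists i.
Qed.

(** The exponents satisfy [max q 0 < qa < qb < qc < 1]. Below the level of [qb] the share of points
    is at most [k ^ (- qa)], which beats [g * ln g] for [g < k ^ q]; below the level of [qc] there
    is still a point. The two levels differ by the constant [2 * h], which leaves room for the
    tracking error. *)
Lemma samp_min (q : R) : q < 1 -> near_min q (sampF P v k).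
Proof.
move=> q1; pose a := Num.max q 0.
have a0 : 0 <= a by rewrite le_max lexx orbT.
have qa_ : q <= a by rewrite le_max lexx.
have a1 : a < 1 by rewrite gt_max q1 ltr01.
pose qa := a + (1 - a) / 4; pose qb := a + (1 - a) / 2; pose qc := a + 3 * (1 - a) / 4.
have qb0 : 0 < qb by rewrite /qb; lra.
have qab : qa < qb by rewrite /qa /qb; lra.
have qbc : qb < qc by rewrite /qb /qc; lra.
have qc1 : qc < 1 by rewrite /qc; lra.
have qb1 := lt_trans qbc qc1; have qc0 := lt_trans qb0 qbc.
pose h := ln (qc / qb) / 2.
have l0 : 0 < ln (qc / qb) by rewrite ln_gt0// ltr_pdivlMr// mul1r.
have h0 : 0 < h by rewrite /h divr_gt0.
have L0 : 0 < h / 4 by rewrite divr_gt0.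
exists h => //.
have qd : 0 < qa - a by rewrite /qa; lra.
have [xoo _ _ _ _] := hev.
have c40 : 0 <= 4 :> R by [].
have h20 : 0 < (2 : R)^-1 by rewrite invr_gt0.
have hdec := near_along xoo (poly_decay 1 c40 qd h20).
have hn := wp_near P (Q := fun n _ => [/\ (k n)%:R = expR (x n) :> R, 1 < x n, qb^-1 < x n &
   4 * (1 + x n) ^+ 1 * expR (- ((qa - a) * x n)) <= 2^-1]) _.
rewrite /prop_near1 /nbhs /=.
apply: wp_S (wp_and (wp_and (htr L0) (hn _)) (wp_and (low_count_wp qb0 qab qb1) (exist_low_wp qc0 qc1))); last first.
  pose proof (filterI (filterI kx (x_gt hev 1)) (filterI (x_gt hev qb^-1) hdec)) as base.
  by apply: (@filterS _ _ _ _ _ _ base) => n [[h1 h2] [h3 h4]] w.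
move=> n w [[tr [kn x1 xb hd]] [hcount [i ik hi]]] /=.
have x0 : 0 < x n by apply: lt_trans x1.
(* [t] lies [h / 2], the tracking error, below [t1]; the low point is then at most
   [t1 - 2 * h + h / 2 = t - h]. *)
pose t1 := - ln (qb * x n); pose t := t1 - h / 2.
have t2E : - ln (qc * x n) = t1 - 2 * h.
  rewrite /t1 /h ln_div ?posrE// !lnM ?posrE//; lra.
exists t.
  have : 0 <= ln (qb * x n).
    by apply: ln_ge0; move: xb => /ltW; rewrite -[X in X <= _]mul1r ler_pdivrMr// mulrC.
  by rewrite /t /t1; move: h0; lra.
split.
  have [y [hy _ hv]] := tr i ik; exists (v n i w).
    by apply/mapP; exists i; rewrite // mem_iota add0n.
  by move: hi hv; rewrite hy t2E ler_norml /t; lra.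
move=> g g1 gk; rewrite /samp size_map size_iota in gk.
have cnt : ecdf (samp v k n w) t <= expR (- (qa * x n)).
  apply: le_trans hcount; rewrite /ecdf avg_samp.
  apply: (@sub_freq R d T (k n) (fun i w => (v n i w <= t)%R)) => j jk vt.
  have [y [-> _ hv]] := tr j jk; rewrite -/t1.
  by move: vt hv; rewrite ler_norml /t; lra.
have g3 : 0 <= (1 + g) * (1 + ln (1 + g)).
  by apply: mulr_ge0; [lra|rewrite addr_ge0// ln_ge0//; lra].
apply: le_trans (ler_wpM2r g3 cnt) _.
apply: (@shape_count _ a qa q (x n) g (k n)%:R) => //; try exact: ltW.
apply: le_trans hd.
rewrite expr1 [X in X <= _](_ : _ = 2 * (2 + x n) * expR (- ((qa - a) * x n))); last first.
  have -> : - ((qa - a) * x n) = - (qa * x n) + a * x n by ring.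
  by rewrite expRD; ring.
by apply: ler_wpM2r; [exact: expR_ge0|lra].
Qed.

End Minimum.

(** * Block maxima *)

Section Arith.
Context {R : realType}.

(** Levels down to [- ln (2 * x)] stay above [1 - eps], where the mixing condition gives
    information, provided [s] is large against [x]. *)
Lemma glev_ge (s t x eps : R) : 0 < eps -> 0 < s -> 0 < x -> 2 / eps * x <= s ->
  - ln (2 * x) <= t -> 1 - eps <= glev s t.
Proof.
move=> e0 s0 x0 hs ht; rewrite /glev.
apply: le_trans (expR_ge1Dx _); rewrite lerD2l lerN2.
have h1 : (2 * x)^-1 <= expR t.
  by rewrite -[X in X^-1]lnK ?posrE ?mulr_gt0// -expRN ler_expR.
have h2 : eps^-1 <= s * expR t.
  apply: (@le_trans _ _ (s * (2 * x)^-1)); last by rewrite ler_wpM2l// ltW.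
  rewrite ler_pdivlMr ?mulr_gt0//; move: hs; rewrite mulrAC ler_pdivrMr// => hs.
  by rewrite mulrC ler_pdivrMr.
by rewrite -[X in _ <= X]invrK lef_pV2 ?posrE ?invr_gt0// mulr_gt0// expR_gt0.
Qed.

Lemma grid_low (L x : R) : 0 < L -> 1 < x ->
  let J := (Num.truncn (ln (2 * x) / L)).+1 in
  [/\ ln (2 * x) <= J%:R * L, J%:R * L <= ln (2 * x) + L &
      J%:R <= (L^-1 + 1) * (ln (2 * x) + 1)].
Proof.
move=> L0 x1 J; have x0 : 0 < x by apply: lt_trans x1.
have l0 : 0 <= ln (2 * x) by apply: ln_ge0; clear - x1; lra.
have t0 : 0 <= ln (2 * x) / L by rewrite divr_ge0// ltW.
have /andP[h1 h2] := truncn_itv t0.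
rewrite /J; split.
- by move: h2; rewrite ltr_pdivrMr// => /ltW.
- by rewrite -natr1 mulrDl mul1r lerD2r -ler_pdivlMr.
- rewrite -natr1; have : 0 < L^-1 by rewrite invr_gt0.
  by move: h1 l0; clear; move: (L^-1) (ln _) => u z; nra.
Qed.

Lemma grid_high (L y : R) : 0 < L -> 0 <= y ->
  let M := (Num.truncn (y / L)).+1 in y < M%:R * L /\ M%:R * L <= y + L.
Proof.
move=> L0 y0 M; have t0 : 0 <= y / L by rewrite divr_ge0// ltW.
have /andP[h1 h2] := truncn_itv t0; rewrite /M; split.
  by move: h2; rewrite ltr_pdivrMr.
by rewrite -natr1 mulrDl mul1r lerD2r -ler_pdivlMr.
Qed.

End Arith.

Section BlockMaxima.
Context {R : realType} {d : measure_display} {T : measurableType d}.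
Variables (P : probability T R) (X : nat -> T -> R) (g0 th0 : R) (m l : nat -> nat).
Variables (a A : R -> R) (rho0 lam0 : R).
Hypothesis mX : forall t, measurable_fun setT (X t).
Hypothesis stat : strictly_stationary P X.
Hypothesis cF : continuous (cdf1 P X).
Hypothesis g0_gt : -2^-1 < g0.
Hypothesis th01 : 0 < th0 <= 1.
Hypothesis moo : ((m n)%:R : R) @[n --> \oo] --> +oo.
Hypothesis koo : ((kn m l n)%:R : R) @[n --> \oo] --> +oo.
Hypothesis hSO : cond_SO (bfun (cdf1 P X)) g0 m (kn m l) a A rho0 lam0.
Hypothesis hMIX : cond_MIX P X (cdf1 P X) th0 m l (kn m l).
Let F := cdf1 P X.
Let b := bfun F.

Definition lnk n : R := ln (kn m l n)%:R.
Definition blk_scale n : R := th0 * (m n)%:R.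
Definition blk_ev n t i w : bool := ublk P X (m n) (l n) i w <= glev (blk_scale n) t.
Definition blk_z n i w : R :=
  (blockmax X (m n) (l n) i w - b (blk_scale n)) / a (blk_scale n).
Definition blk_v n i w : R := ug g0 (blk_z n i w).

Lemma lnk_oo : lnk n @[n --> \oo] --> +oo.
Proof.
apply/cvgryPge => B; apply: filterS (near_along koo (nbhs_pinfty_ge (num_real (expR B)))) => n h.
rewrite -[X in X <= _](expRK B) /lnk ler_ln ?posrE ?expR_gt0//.
by apply: lt_le_trans h; exact: expR_gt0.
Qed.

Lemma knE : \forall n \near \oo, (kn m l n)%:R = expR (lnk n) :> R.
Proof.
apply: filterS (near_along koo (nbhs_pinfty_gt (num_real 0))) => n h.
by rewrite /lnk lnK.
Qed.

Lemma blk_scale_oo : blk_scale n @[n --> \oo] --> +oo.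
Proof.
have [th0p _] := andP th01.
apply/cvgryPge => B; apply: filterS (near_along moo (nbhs_pinfty_ge (num_real (B / th0)))) => n.
by rewrite ler_pdivrMr// mulrC.
Qed.

(** Serves twice: the grid has to start at infinity, and the lowest levels must stay in the range of
    the mixing condition, by [glev_ge]. *)
Lemma scale_growth B : 0 < B -> \forall n \near \oo, B * lnk n <= blk_scale n.
Proof.
move=> B0; have [C C0 hC] := A_bound hSO th01 moo koo.
apply: (growth (cond_SO_second_order hSO) _ C0 blk_scale_oo hC B0).
exact: bfun_mono (cdf1_cdf_like mX cF).
Qed.

Lemma m_large : \forall n \near \oo,
  [/\ (0 < m n)%N, (1 <= Num.truncn (blk_scale n))%N & 0 < blk_scale n].
Proof.
apply: filterS2 (near_along moo (nbhs_pinfty_gt (num_real 0)))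
  (near_along blk_scale_oo (nbhs_pinfty_ge (num_real 1))) => n h1 h2.
split; first by rewrite -(ltr0n R).
  by rewrite truncn_gt0.
exact: lt_le_trans h2.
Qed.

Lemma blk_events : exists al, gumbel_events P blk_ev lnk (fun n => `|beta P X F th0 (m n)|) al.
Proof.
have [eps [epsi hal0 hsum hbeta]] := hMIX; have [e0 e1] := andP epsi.
have [th0p _] := andP th01.
have mY t := measurable_Yeps (P := P) mX cF t e1.
exists (fun n => alpha P (Yeps F X eps) (l n)); split.
- exact: lnk_oo.
- split; apply: near_lim => e e_gt0.
    pose proof (filterI (lim_near hsum e_gt0) (filterI knE
      (near_along lnk_oo (nbhs_pinfty_gt (num_real 1))))) as base.
    apply: (@filterS _ _ _ _ _ _ base) => n [h [hk x1]]; rewrite !subr0 in h *.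
    have al0 := alpha_ge0 P mY (l n).
    rewrite ger0_norm; last by rewrite mulr_ge0// expR_ge0.
    apply: le_trans (le_trans (ler_norm _) h).
    rewrite expRM_natl -hk; set K := (_%:R ^+ 2).
    have K0 : 0 <= K by rewrite exprn_ge0.
    have l4 : 1 <= (ln (kn m l n)%:R) ^+ 4 :> R by apply: exprn_ege1; exact: ltW.
    have k1 : (1 < (kn m l n).+1)%N.
      by rewrite ltnS -(ltr0n R) hk expR_gt0.
    (* The term [r = 1] of the sum is the coefficient at the gap [l n]; the other terms are
       nonnegative and the power of the logarithm is at least 1. *)
    rewrite big_ltn// subnn mul0n add0n mul1r.
    set S := \sum_(_ <= _ < _) _.
    have S0 : 0 <= S.
      by apply: sumr_ge0 => r _; rewrite mulr_ge0//; exact: (alpha_ge0 P mY).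
    apply: ler_pM => //; first by rewrite ler_peMr.
    by rewrite lerDl.
  pose proof (filterI (lim_near hbeta e_gt0) knE) as base.
  apply: (@filterS _ _ _ _ _ _ base) => n [h hk]; rewrite !subr0 in h *.
  by rewrite -hk normrM normr_id -normrM.
- by move=> n; split; [exact: (alpha_ge0 P mY)|exact: normr_ge0].
- apply: filterS m_large => n [m0 N1 s0] t i.
  have /andP[c0 c1] := glev_itv t s0.
  split; first exact: measurable_ublk.
    by rewrite /pr /blk_ev (ublk_stat mX stat cF).
  rewrite /pr /blk_ev (ublk_stat mX stat cF)// -(glev_powR t s0).
  have -> : blk_scale n = (m n)%:R * th0 by rewrite /blk_scale mulrC.
  apply: le_trans (ler_norm _).
  have := @beta_bound _ _ _ P X mX cF (m n) (l n) m0 th0 (glev (blk_scale n) t) th0p N1.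
  by rewrite /blk_scale mulrC; apply; rewrite mulrC (ltW c0) (ltW c1).
- have e20 : 0 < 2 / eps by rewrite divr_gt0.
  pose proof (filterI m_large (filterI (scale_growth e20)
     (near_along lnk_oo (nbhs_pinfty_gt (num_real 0))))) as base.
  apply: (@filterS _ _ _ _ _ _ base) => n [[m0 N1 s0] [hs x0]] t ht i j ij.
  have hc := glev_ge e0 s0 x0 hs ht.
  have := @pair_mixing _ _ _ P X mX cF (m n) (l n) m0 eps _ i j epsi hc ij.
  rewrite /pr /blk_ev !(ublk_stat mX stat cF _ m0 _) //.
  rewrite (_ : [set w | _ && _] = [set w | ublk P X (m n) (l n) i w <= glev (blk_scale n) t]
    `&` [set w | ublk P X (m n) (l n) j w <= glev (blk_scale n) t])//.
  by apply/seteqP; split=> w /= /andP.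
Qed.

(** [J] covers the range down to [- ln (2 * lnk n)] and [M] the range up to [(1 + dl) * lnk n].
    Rounding up to a multiple of [L] is what the second [dl] in the hypothesis pays for. *)
Lemma blk_tracks dl al bt : gumbel_events P blk_ev lnk bt al -> 0 < dl ->
  (1 + 2 * dl) * Num.max (- g0) 0 < 2^-1 -> forall L, 0 < L ->
  wp P (fun n w => forall i, (i < kn m l n)%N -> 0 < 1 + g0 * blk_z n i w /\
    exists y, [/\ (forall t, blk_ev n t i w = (y <= t)),
      - ln (2 * lnk n) <= y <= (1 + dl) * lnk n & `|blk_v n i w - y| <= 2 * L]).
Proof.
move=> hev dl0 hdl L L0.
have FC := cdf1_cdf_like mX cF.
have so := cond_SO_second_order hSO; have a0 : forall s, 0 < a s by case: so.
have [C C0 hC] := A_bound hSO th01 moo koo.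
pose eta := Num.min (Dg g0 L) (- Dg g0 (- L)).
have eta0 : 0 < eta.
  by rewrite lt_min Dg_gt0//= oppr_gt0 -(Dg0r g0) Dg_lt// oppr_lt0.
pose J n := (Num.truncn (ln (2 * lnk n) / L)).+1.
pose M n := (Num.truncn ((1 + dl) * lnk n / L)).+1.
have x1 : \forall n \near \oo, 1 < lnk n by exact: near_along lnk_oo (nbhs_pinfty_gt (num_real _)).
(* [expR (J * L)] is at most a constant times [lnk n], and the scale grows faster by
   [scale_growth]. *)
have soo : (blk_scale n * expR (- ((J n)%:R * L))) @[n --> \oo] --> +oo.
  apply/cvgryPge => B.
  have B0 : 0 < (`|B| + 1) * (2 * expR L) by rewrite !mulr_gt0 ?expR_gt0// ltr_wpDl.
  pose proof (filterI (scale_growth B0) (filterI x1 m_large)) as base.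
  apply: (@filterS _ _ _ _ _ _ base) => n [h [{}x1 [_ _ s0]]].
  have [_ j2 _] := grid_low L0 x1; rewrite -/(J n) in j2.
  have x0 : 0 < lnk n by apply: lt_trans x1.
  have h1 : expR ((J n)%:R * L) <= 2 * lnk n * expR L.
    rewrite -[X in _ <= X * _](lnK (x := 2 * lnk n)) ?posrE ?mulr_gt0//.
    by rewrite -expRD ler_expR.
  rewrite expRN ler_pdivlMr ?expR_gt0//.
  apply: le_trans h; apply: (@le_trans _ _ ((`|B| + 1) * (2 * lnk n * expR L))).
    apply: (@le_trans _ _ ((`|B| + 1) * expR ((J n)%:R * L))).
      apply: ler_wpM2r; first exact: expR_ge0.
      by apply: le_trans (ler_norm B) _; rewrite lerDl.
    by apply: ler_wpM2l => //; rewrite addr_ge0.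
  by rewrite le_eqVlt; apply/orP; left; apply/eqP; ring.
have hJ : forall c : R, 0 < c -> \forall n \near \oo, c * (J n)%:R <= lnk n.
  move=> c c0; have cc : 0 < c * (L^-1 + 1) by rewrite mulr_gt0// addr_gt0// invr_gt0.
  pose proof (filterI x1 (near_along lnk_oo (log_small cc))) as base.
  apply: (@filterS _ _ _ _ _ _ base) => n [{}x1 h].
  have [_ _ j3] := grid_low L0 x1; apply: le_trans h; rewrite -mulrA.
  by apply: ler_wpM2l => //; exact: ltW.
have hM : \forall n \near \oo, (M n)%:R * L <= (1 + 2 * dl) * lnk n.
  pose proof (filterI x1 (near_along lnk_oo (nbhs_pinfty_gt (num_real (L / dl))))) as base.
  apply: (@filterS _ _ _ _ _ _ base) => n [{}x1 h].
  have x0 : 0 < lnk n by apply: lt_trans x1.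
  have y0 : 0 <= (1 + dl) * lnk n by rewrite mulr_ge0 ?ltW// addr_gt0.
  have [_ m2] := grid_high L0 y0; apply: le_trans m2 _.
  by move: h; rewrite ltr_pdivrMr//; lra.
have d20 : 0 <= 2 * dl by rewrite mulr_ge0// ltW.
pose proof (@grid_approx R nat \oo _ b a A g0 rho0 L (2 * dl) C eta blk_scale lnk J M
  so L0 d20 hdl C0 eta0 soo lnk_oo hC hJ hM) as hgrid.
have hnear : wp P (fun n _ => [/\ 1 < lnk n, 0 < blk_scale n, (0 < m n)%N & forall i, (i <= J n + M n)%N ->
    `|(b (blk_scale n * expR ((i%:R - (J n)%:R) * L)) - b (blk_scale n)) / a (blk_scale n)
      - Dg g0 ((i%:R - (J n)%:R) * L)| <= eta * expR (g0 * ((i%:R - (J n)%:R) * L))]).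
  apply: wp_near; pose proof (filterI hgrid (filterI x1 m_large)) as base.
  by apply: (@filterS _ _ _ _ _ _ base) => n [h [h1 [h2 _ h3]]] w; split.
apply: wp_S (wp_and (range_wp hev dl0 knE) hnear) => n w [hr [{}x1 s0 m0 hg]] i ik.
have [r1 r2] := hr i ik.
have x0 : 0 < lnk n by apply: lt_trans x1.
have y0 : 0 <= (1 + dl) * lnk n by rewrite mulr_ge0 ?ltW// addr_gt0.
have [m1 _] := grid_high L0 y0; have [j1 _ _] := grid_low L0 x1.
have e1 : eta <= Dg g0 L by rewrite ge_min lexx.
have e2 : eta <= - Dg g0 (- L) by rewrite ge_min lexx orbT.
rewrite -lerN2 in j1.
have [y [h1 h2 h3 h4]] := grid_value FC s0 (a0 _) L0 e1 e2 hg j1 m1 r1 r2.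
split; first exact: h3.
by exists y.
Qed.

End BlockMaxima.

(** * The likelihood of the block maxima *)

Section Likelihood.
Context {R : realType}.
Implicit Types (g mu sg z v : R).

Lemma ln_gev_density g y : 0 < 1 + g * y ->
  0 < gev_density g y /\ ln (gev_density g y) = - expR (- ug g y) - (1 + g) * ug g y.
Proof.
rewrite /gev_density /GEV /ug; case: (eqVneq g 0) => [->|gn0] hy.
  split; first by rewrite mulr_gt0 ?expR_gt0.
  by rewrite -expRD expRK addr0 mul1r.
rewrite hy /powR (gt_eqF hy).
have e1 : - g^-1 * ln (1 + g * y) = - (ln (1 + g * y) / g) by ring.
split; first by rewrite mulr_gt0 ?expR_gt0.
by rewrite -expRD expRK e1; field.
Qed.

Lemma loglik_ell g mu sg z : 0 < sg -> 0 < 1 + g * ((z - mu) / sg) ->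
  loglik_r g mu sg z = ell g mu sg z.
Proof.
move=> sg0 hz; have [d0 dE] := ln_gev_density hz.
by rewrite /loglik_r ln_div ?posrE// dE /ell; ring.
Qed.

Lemma quadratic_der (f : R -> R) (x a C de : R) : 0 < de ->
  (forall h, `|h| <= de -> `|f (x + h) - f x - h * a| <= C * h ^+ 2) -> has_der x f a.
Proof.
move=> de0 hf.
have hl : (fun h : R => h^-1 *: ((f \o shift x) (h *: 1) - f x)) @ 0^' --> a.
  apply: near_lim => e e0.
  have C1 : 0 < `|C| + 1 by rewrite ltr_wpDl.
  pose r := Num.min de (e / (`|C| + 1)).
  have r0 : 0 < r by rewrite lt_min de0 divr_gt0.
  near=> h.
  have hn0 : h != 0 by near: h; exact: nbhs_dnbhs_neq.
  have hr : `|h| <= r.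
    by near: h; apply: dnbhs0_le.
  have hd : `|h| <= de by apply: le_trans hr _; rewrite ge_min lexx.
  have he : `|h| <= e / (`|C| + 1) by apply: le_trans hr _; rewrite ge_min lexx orbT.
  rewrite /= /GRing.scale /= mulr1 [h + x]addrC.
  have -> : h^-1 * (f (x + h) - f x) - a = h^-1 * (f (x + h) - f x - h * a) by field.
  have h0 : 0 < `|h| by rewrite normr_gt0.
  rewrite normrM normfV ler_pdivrMl//; apply: le_trans (hf h hd) _.
  rewrite -real_normK ?num_real// expr2 mulrA (mulrC `|h|); apply: ler_wpM2r => //.
  move: he; rewrite ler_pdivlMr// => he.
  have h1 : C * `|h| <= `|C| * `|h| by apply: ler_wpM2r => //; exact: ler_norm.
  by move: he h1 h0; lra.
split; first by apply/cvg_ex; exists a.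
exact/cvg_lim.
Unshelve. all: by end_near. Qed.

(** The derivative is read off the second-order bound [rho_pointwise], so the density is never
    differentiated in the shape, in particular at shape 0 where its formula changes. [f] is a
    coordinate line through the truth, and [f (s + 1)] its unit step, at which the linear score is
    evaluated. *)
Lemma loglik_der (f : R -> R * R * R) g0 v (s : R) :
  (forall x, score g0 (f x).1.1 (f x).1.2 (f x).2 v = (x - s) * score g0 (f (s + 1)).1.1 (f (s + 1)).1.2 (f (s + 1)).2 v) ->
  f s = (g0, 0, 1) -> (forall h, `|(f (s + h)).1.1 - g0| <= `|h|) ->
  (forall h, `|(f (s + h)).1.2| <= `|h|) -> (forall h, `|(f (s + h)).2 - 1| <= `|h|) ->
  has_der s (fun x => loglik_r (f x).1.1 (f x).1.2 (f x).2 (Dg g0 v))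
    (score g0 (f (s + 1)).1.1 (f (s + 1)).1.2 (f (s + 1)).2 v).
Proof.
move=> hs fs h1 h2 h3.
have b0 : 0 < bwt g0 v by apply: lt_le_trans (bwt_ge1 g0 v).
have r0 : 0 < taylor_radius g0 by rewrite invr_gt0 mulr_gt0// ltr_wpDr.
pose de := Num.min 2^-1 (taylor_radius g0 / bwt g0 v).
have de0 : 0 < de by rewrite lt_min divr_gt0// invr_gt0 ltr0n.
apply: (@quadratic_der _ s _ (rho_const g0 * Wt g0 v) de de0) => h hh.
have hD : `|h| * bwt g0 v <= taylor_radius g0.
  by rewrite -ler_pdivlMr//; apply: le_trans hh _; rewrite ge_min lexx orbT.
have hD2 : `|h| <= 2^-1 by apply: le_trans hh _; rewrite ge_min lexx.
have [sp hr] := rho_pointwise (h1 h) (h2 h) (h3 h) hD.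
have sg0 : 0 < (f (s + h)).2.
  by have := le_trans (h3 h) hD2; rewrite ler_norml; lra.
rewrite (loglik_ell sg0 sp) fs /= loglik_ell//; last first.
  by rewrite subr0 divr1; exact: Dg_supp.
have := hs (s + h); rewrite addrAC subrr add0r => hs'.
rewrite -hs' -/(rho g0 _ _ _ v).
by apply: le_trans hr _; rewrite real_normK ?num_real// mulrAC.
Qed.

Lemma score_split g0 g mu sg v : score g0 g mu sg v =
  (g - g0) * score g0 (g0 + 1) 0 1 v + mu * score g0 g0 1 1 v
  + (sg - 1) * score g0 g0 0 2 v.
Proof. rewrite /score /dlin /lin; ring. Qed.

Lemma der_scaled_sum (I : Type) (r : seq I) (c : R) (f : I -> R -> R) (df : I -> R) (x : R) :
  (forall i, has_der x (f i) (df i)) ->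
  has_der x (fun y => c * \sum_(i <- r) f i y) (c * \sum_(i <- r) df i).
Proof.
move=> h; have hsum : has_der x (fun y => \sum_(i <- r) f i y) (\sum_(i <- r) df i).
  elim: r => [|i r ih].
    rewrite big_nil (_ : (fun _ => _) = fun=> 0); first exact: der_cst.
    by apply/funext => y; rewrite big_nil.
  rewrite big_cons (_ : (fun _ => _) = fun y => f i y + \sum_(j <- r) f j y).
    by apply: der_add.
  by apply/funext => y; rewrite big_cons.
by apply: (der_eq (der_mul (der_cst c x) hsum)); ring.
Qed.

End Likelihood.

(** * The sample log-likelihood and its gradient *)

Section SampleLikelihood.
Context {R : realType} {d : measure_display} {T : measurableType d}.
Variables (X : nat -> T -> R) (m l k : nat) (am bm g0 : R) (w : T).
Let z i := (blockmax X m l i w - bm) / am.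
Let s := [seq ug g0 (z i) | i <- iota 0 k].
Hypothesis hz : forall i, (i < k)%N -> 0 < 1 + g0 * z i.

Lemma zE i : (i < k)%N -> z i = Dg g0 (ug g0 (z i)).
Proof. by move=> /hz h; rewrite ugK. Qed.

Lemma avg_s f : avg s f = k%:R^-1 * \sum_(i < k) f (ug g0 (z i)).
Proof.
rewrite /avg /s size_map size_iota big_map.
by rewrite -(big_mkord xpredT (fun i => f (ug g0 (z i)))) /index_iota subn0.
Qed.

Lemma Ln_supported g mu sg : 0 < sg -> {in s, forall v, supp g0 g mu sg v} ->
  Ln X m l k am bm g mu sg w = (avg s (fun v => ell g mu sg (Dg g0 v)))%:E.
Proof.
move=> sg0 hs; rewrite /Ln avg_s EFinM -sumEFin; congr (_ * _)%E.
apply: eq_bigr => i _; rewrite -/(z i) -(zE (ltn_ord i)) /loglik.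
have hi : 0 < 1 + g * ((z i - mu) / sg).
  have := hs (ug g0 (z i)); rewrite /supp -(zE (ltn_ord i)); apply.
  by apply/mapP; exists (i : nat); rewrite // mem_iota add0n ltn_ord.
by rewrite hi -(loglik_ell sg0 hi).
Qed.

(** Makes both inequalities trivial as soon as one observation leaves the support. *)
Lemma Ln_unsupported g mu sg : ~ {in s, forall v, supp g0 g mu sg v} ->
  Ln X m l k am bm g mu sg w = -oo%E.
Proof.
move=> hs; have [i hi] : exists i : 'I_k, ~~ (0 < 1 + g * ((z i - mu) / sg)).
  apply: contrapT => h; apply: hs => v /mapP[i]; rewrite mem_iota add0n => /andP[_ ik] ->.
  rewrite /supp -(zE ik); apply: contrapT => /negP hn; apply: h.
  by exists (Ordinal ik).
rewrite /Ln; have -> : (\sum_(i < k) loglik g mu sg ((blockmax X m l i w - bm) / am) = -oo)%E.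
  by apply/esum_eqNyP; exists i; split; rewrite ?mem_index_enum// /loglik -/(z i) (negbTE hi).
rewrite gt0_muleNy// lte_fin invr_gt0 ltr0n.
by apply: leq_trans (ltn_ord i).
Qed.

Lemma score_linE g mu sg :
  score_lin X m l k am bm g0 g mu sg w = avg s (score g0 g mu sg).
Proof.
have der (f : R -> R * R * R) (c : R) : (forall i : 'I_k, has_der c
     (fun x => loglik_r (f x).1.1 (f x).1.2 (f x).2 (Dg g0 (ug g0 (z i))))
     (score g0 (f (c + 1)).1.1 (f (c + 1)).1.2 (f (c + 1)).2 (ug g0 (z i)))) ->
   derive1 (fun x => Ln_r X m l k am bm (f x).1.1 (f x).1.2 (f x).2 w) c =
   avg s (score g0 (f (c + 1)).1.1 (f (c + 1)).1.2 (f (c + 1)).2).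
  move=> h; have := der_scaled_sum (index_enum 'I_k) (k%:R^-1) h.
  rewrite -avg_s => hd.
  have -> : (fun x => Ln_r X m l k am bm (f x).1.1 (f x).1.2 (f x).2 w) = (fun x => k%:R^-1 *
    \sum_(i < k) loglik_r (f x).1.1 (f x).1.2 (f x).2 (Dg g0 (ug g0 (z i)))).
    by apply/funext => x; rewrite /Ln_r; congr (_ * _); apply: eq_bigr => i _;
       rewrite -(zE (ltn_ord i)).
  by rewrite derive1E; exact: derive_val.
rewrite /score_lin.
have n1 : `|0 : R| <= 0 by rewrite normr0.
have d1 := @der (fun x => (x, 0, 1)) g0.
have d2 := @der (fun x => (g0, x, 1)) 0.
have d3 := @der (fun x => (g0, 0, x)) 1.
rewrite d1 /=; last first.
  move=> i; apply: (@loglik_der _ (fun x => (x, 0, 1))) => //= [x|h|h|h].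
  - by rewrite (score_split g0 x); ring.
  - by rewrite addrAC subrr add0r.
  - by rewrite normr0.
  - by rewrite subrr normr0.
rewrite d2 /=; last first.
  move=> i; apply: (@loglik_der _ (fun x => (g0, x, 1))) => //= [x|h|h|h].
  - by rewrite (score_split g0 g0 x) add0r; ring.
  - by rewrite subrr normr0.
  - by rewrite add0r.
  - by rewrite subrr normr0.
rewrite d3 /=; last first.
  move=> i; apply: (@loglik_der _ (fun x => (g0, 0, x))) => //= [x|h|h|h].
  - by rewrite (score_split g0 g0 0 x) (_ : 1 + 1 = 2 :> R)//; ring.
  - by rewrite subrr normr0.
  - by rewrite normr0.
  - by rewrite addrAC subrr add0r.
rewrite -!avgZ -!avgD; apply: eq_avg => v _ /=.
by rewrite (score_split g0 g mu sg) add0r (_ : 1 + 1 = 2 :> R).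
Qed.

End SampleLikelihood.

Theorem theorem3p5 (R : realType) (d : measure_display) (T : measurableType d)
  (P : probability T R) (X : nat -> T -> R)
  (g0 th0 : R) (m l : nat -> nat) (a A : R -> R) (rho0 lam0 q : R) :
  (forall t, measurable_fun setT (X t)) ->
  strictly_stationary P X ->
  continuous (cdf1 P X) ->
  -2^-1 < g0 ->
  in_MDA (cdf1 P X) g0 ->
  0 < th0 <= 1 ->
  has_extremal_index P X (cdf1 P X) th0 ->
  (((m n)%:R : R) @[n --> \oo] --> +oo) ->
  (((l n)%:R : R) @[n --> \oo] --> +oo) ->
  (((l n)%:R / (m n)%:R : R) @[n --> \oo] --> 0) ->
  (((m n)%:R / n%:R : R) @[n --> \oo] --> 0) ->
  (((kn m l n)%:R : R) @[n --> \oo] --> +oo) ->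
  cond_SO (bfun (cdf1 P X)) g0 m (kn m l) a A rho0 lam0 ->
  cond_MIX P X (cdf1 P X) th0 m l (kn m l) ->
  q < 1 ->
  exists eps c1 c2 : R, [/\ 0 < eps, 0 < c1, 0 < c2 &
    exists E : nat -> set T,
      [/\ (forall n, measurable (E n)),
          (forall n, E n `<=` [set w |
             let am := a (th0 * (m n)%:R) in
             let bm := bfun (cdf1 P X) (th0 * (m n)%:R) in
             let L := fun g mu sg => Ln X (m n) (l n) (kn m l n) am bm g mu sg w in
             (forall g mu sg, in_ball eps g0 g mu sg ->
                (L g mu sg <= L g0 0%R 1%R +
                   (score_lin X (m n) (l n) (kn m l n) am bm g0 g mu sg w
                    - c1 * dist2 g0 g mu sg)%:E)%E) /\
             (forall g mu sg, in_Theta (kn m l n) q g mu sg ->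
                ~ in_ball eps g0 g mu sg ->
                (L g mu sg <= L g0 0%R 1%R + (- c2)%:E)%E)])
        & (fine (P (E n)) : R) @[n --> \oo] --> (1 : R)]].

Proof.
move=> mX stat cF g0_gt _ th01 _ moo _ _ _ koo hSO hMIX q1.
have /andP[ka0 ka1] := kap_bounds g0_gt.
(* [(1 + 2 * dl) * kap g0 = 1] serves both requirements: [(1 + dl) * kap g0 < 1] for the tails and,
   as [kap g0 = max (- g0) 0 + 1/2], the condition [(1 + 2 * dl) * max (- g0) 0 < 1/2] for the
   grid. *)
have [dl dlE] : exists dl : R, dl = ((kap g0)^-1 - 1) / 2 by eexists.
have dl0 : 0 < dl by rewrite dlE divr_gt0// subr_gt0 invf_gt1.
have dl2 : (1 + 2 * dl) * kap g0 = 1 by rewrite dlE; field; rewrite gt_eqF.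
have hdl1 : (1 + dl) * kap g0 < 1.
  have h : 0 < dl * kap g0 by rewrite mulr_gt0.
  by move: dl2 h; clear; move: (kap g0) => u; lra.
have hdl2 : (1 + 2 * dl) * Num.max (- g0) 0 < 2^-1.
  by move: dl2; rewrite /kap; move: dl0; clear; move: (Num.max _ _) => u; lra.
have [al hev] := blk_events mX stat cF th01 moo koo hSO hMIX.
have htrk := blk_tracks mX cF th01 moo koo hSO hev dl0 hdl2.
set ev := blk_ev P X th0 m l in hev htrk.
set v := blk_v P X g0 th0 m l a in htrk.
set k := kn m l in koo hSO hMIX htrk *.
have htr : tracks P ev (lnk m l) k dl v.
  by move=> L L0; apply: wp_S (htrk L L0) => n w h i ik; have [] := h i ik.
have hk : \forall n \near \oo, (k n)%:R = expR (lnk m l n) :> R by exact: knE.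
have FF := sampF_filter P v k.
have Fcdf := samp_gumbel hev hk htr.
have Ftail := samp_tails hev hk htr g0_gt dl0 hdl1.
have Fmin := samp_min hev hk htr q1.
have [eps [c1 [eps0 c10 hloc]]] := local_bound g0_gt Fcdf Ftail.
have [c2 c20 hglob] := global_bound g0_gt Fcdf Ftail Fmin eps0.
(* Any [L] would do: only the support of the true parameter is taken from the tracking here. *)
have [E [mE hE lE]] := wp_and (htrk 1 ltr01) (wp_and hloc hglob).
exists eps, c1, c2; split => //; exists E; split => // n w Enw.
have [hs [hl hg]] := hE n w Enw; rewrite /samp -/k in hl hg.
have hz i : (i < k n)%N -> 0 < 1 + g0 * blk_z P X th0 m l a n i w.
  by move=> ik; have [] := hs i ik.
set s := [seq v n i w | i <- iota 0 (k n)] in hl hg.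
have ks : size s = k n by rewrite size_map size_iota.
pose am := a (th0 * (m n)%:R); pose bm := bfun (cdf1 P X) (th0 * (m n)%:R).
pose L g mu sg := Ln X (m n) (l n) (k n) am bm g mu sg w.
rewrite /= -/am -/bm.
have s0 : {in s, forall u, supp g0 g0 0 1 u}.
  by move=> u _; rewrite /supp subr0 divr1; exact: Dg_supp.
have L0 : L g0 0 1 = (avg s (fun u => ell g0 0 1 (Dg g0 u)))%:E.
  exact: (Ln_supported hz ltr01 s0).
have [hL hU] : (forall g mu sg, 0 < sg -> {in s, forall u, supp g0 g mu sg u} ->
    L g mu sg = (avg s (fun u => ell g mu sg (Dg g0 u)))%:E) /\
  (forall g mu sg, ~ {in s, forall u, supp g0 g mu sg u} -> L g mu sg = -oo%E).
  by split=> g mu sg; [exact: (Ln_supported hz)|exact: (Ln_unsupported hz)].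
split => [g mu sg [gl sg0 hball]|g mu sg [gl [gk sg0]] hball]; rewrite -!/(L _ _ _).
  case: (pselect {in s, forall u, supp g0 g mu sg u}) => hsupp; last by rewrite hU// leNye.
  rewrite hL// L0 -EFinD lee_fin.
  have -> : score_lin X (m n) (l n) (k n) am bm g0 g mu sg w = avg s (score g0 g mu sg).
    exact: (score_linE hz).
  have := hl g mu sg gl hball; rewrite nD_sqr /dist2.
  rewrite /rho avgB avgB; lra.
case: (pselect {in s, forall u, supp g0 g mu sg u}) => hsupp; last by rewrite hU// leNye.
rewrite hL// L0 -EFinD lee_fin.
have hD : eps <= nD g0 g mu sg.
  by rewrite leNgt; apply/negP => h; apply: hball; split.
have := hg g mu sg gl _ sg0 hD hsupp; rewrite ks => /(_ gk).
rewrite /lr avgB; lra.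
Qed.
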